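(* Let $(\Sigma,\mu)$ be a measure space with a ball-basis $\mathscr{B}$. If $T$ is a $\mathbb{B}$-valued multilinear bounded oscillation operator with respect to $\mathscr{B}$ and $r\in[1,\infty)$ such that $T$ is bounded from $L^r(\Sigma,\mu)\times\cdots\times L^r(\Sigma,\mu)$ to $L^{\frac rm,\infty}(\Sigma,\mu)$, then for all $\vec p=(p_1,\ldots,p_m)$ with $r<p_1,\ldots,p_m<\infty$ and for all $\vec w\in A_{\vec p/r,\mathscr{B}}$, $$\|T\|_{L^{p_1}(\Sigma,w_1)\times\cdots\times L^{p_m}(\Sigma,w_m)\to L^p(\Sigma,w)}\lesssim\mathfrak{C}(T)\,\mathcal{N}_1(r,\vec p,\vec w)\,[\vec w]_{A_{\vec p/r,\mathscr{B}}}^{\max_{1\le i\le m}\{p,(p_i/r)'\}},$$ where $\frac1p=\sum_{i=1}^m\frac1{p_i}$, $w=\prod_{i=1}^mw_i^{p/p_i}$, and $\mathfrak{C}(T):=\mathfrak{C}_1(T)+\mathfrak{C}_2(T)+\|T\|_{L^r(\mu)\times\cdots\times L^r(\mu)\to L^{\frac rm,\infty}(\mu)}$. If in addition $A_{\infty,\mathscr{B}}$ satisfies the sharp reverse H\''older property, then for the same exponents $\vec p$ and weights $\vec w$, and for all $\alpha\in\{0,1\}^m$ (with $\mathbf{b}=(b_1,\ldots,b_m)$ a vector of measurable functions), $$\|[T,\mathbf{b}]_\alpha\|_{L^{p_1}(\Sigma,w_1)\times\cdots\times L^{p_m}(\Sigma,w_m)\to L^p(\Sigma,w)}\lesssim\mathfrak{C}(T)\,\mathcal{N}_1(r,\vec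 p,\vec w)\sum_{\tau_2\subset\tau}\mathcal{N}_2^{\tau_2}(r,\vec p,\vec w)\,\|\mathbf{b}\|_\tau\,[\vec w]_{A_{\vec p/r,\mathscr{B}}}^{(|\tau|+1)\max_{1\le i\le m}\{p,(p_i/r)'\}},$$ where $\tau=\{i:\alpha_i\ne0\}$ and $\|\mathbf{b}\|_\tau=\prod_{i\in\tau}\|b_i\|_{\operatorname{osc}_{\exp L}}$.
   Context: Convention. $X\lesssim Y$ means $X\le CY$ with a constant $C>0$ independent of $T$, $\mathbf{b}$ and $\vec w$. Norms $\|T\|_{\cdots\to\cdots}$ are operator norms (best constants); $L^p(\Sigma,w):=L^p(\Sigma,w\,d\mu)$. Ball-basis. A family $\mathscr{B}$ of measurable subsets of a measure space $(\Sigma,\mu)$ is a ball-basis if: (B1) $0<\mu(B)<\infty$ for all $B\in\mathscr{B}$; (B2) for all $x,y\in\Sigma$ some $B\in\mathscr{B}$ contains both; (B3) for every $\varepsilon>0$ and measurable $E$ there is a finite or infinite sequence $\{B_k\}\subset\mathscr{B}$ with $\mu(E\Delta\bigcup_kB_k)<\varepsilon$; (B4) for each $B\in\mathscr{B}$ there is $B^*\in\mathscr{B}$ such that $\mu(B^* )\le\mathfrak{C}_0\mu(B)$, $\bigcup\{B'\in\mathscr{B}:B'\cap B\ne\emptyset,\ \mu(B')\le2\mu(B)\}\subset B^*$, and $A\subset B\Rightarrow A^*\subset B^*$, where $\mathfrak{C}_0\ge1$ is a universal constant. Notation. $\vec f=(f_1,\ldots,f_m)$, $\vec f\mathbf{1}_E=(f_1\mathbf{1}_E,\ldots,f_m\mathbf{1}_E)$,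 $\langle f\rangle_{B,r}:=(\frac1{\mu(B)}\int_B|f|^rd\mu)^{1/r}$, $\lfloor f\rfloor_{B,r}:=\sup_{B'\in\mathscr{B},\,B'\supset B}\langle f\rangle_{B',r}$. An operator $T$ is $m$-sublinear if in each entry $|T(\ldots,\lambda f_i,\ldots)|=|\lambda||T(\ldots,f_i,\ldots)|$ and $|T(\ldots,f_i+g_i,\ldots)|\le|T(\ldots,f_i,\ldots)|+|T(\ldots,g_i,\ldots)|$. Bounded oscillation operators. Let $\mathbb{B}$ be a Banach space. $T$ is a $\mathbb{B}$-valued multilinear bounded oscillation operator with respect to $\mathscr{B}$ and $r\in[1,\infty)$ if there exist constants $\mathfrak{C}_1(T),\mathfrak{C}_2(T)\in(0,\infty)$ and a $\mathbb{B}$-valued $m$-linear operator $\mathcal{T}$ with $T(\vec f)(x)=\|\mathcal{T}(\vec f)(x)\|_{\mathbb{B}}$ for every $x\in\Sigma$ (or, in the case $\mathbb{B}=\mathbb{R}$, $\mathcal{T}=T$ is a real-valued $m$-linear or $m$-sublinear operator) such that for all $\vec f\in L^r(\Sigma,\mu)^m$: (T1) for every $B_0\in\mathscr{B}$ with $B_0^*\subsetneq\Sigma$, there exists $B\in\mathscr{B}$ with $B\supsetneq B_0$ so that $\sup_{x\in B_0}\|\mathcal{T}(\vec f\mathbf{1}_{B^*})(x)-\mathcal{T}(\vec f\mathbf{1}_{B_0^*})(x)\|_{\mathbb{B}}\le\mathfrak{C}_1(T)\prod_{i=1}^m\langle f_i\rangle_{B^*,r}$; (T2) for every $B\in\mathscr{B}$,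 $\sup_{x,x'\in B}\|(\mathcal{T}(\vec f)-\mathcal{T}(\vec f\mathbf{1}_{B^*}))(x)-(\mathcal{T}(\vec f)-\mathcal{T}(\vec f\mathbf{1}_{B^*}))(x')\|_{\mathbb{B}}\le\mathfrak{C}_2(T)\prod_{i=1}^m\lfloor f_i\rfloor_{B,r}$. Commutators. Whenever it makes sense, $[T,\mathbf{b}]_{ke_i}(\vec f)(x):=T(f_1,\ldots,(b_i(x)-b_i)^kf_i,\ldots,f_m)(x)$ and $[T,\mathbf{b}]_\alpha:=[\cdots[[T,\mathbf{b}]_{\alpha_1e_1},\mathbf{b}]_{\alpha_2e_2}\cdots,\mathbf{b}]_{\alpha_me_m}$, i.e. $[T,\mathbf{b}]_\alpha(\vec f)(x)=T\big((b_1(x)-b_1)^{\alpha_1}f_1,\ldots,(b_m(x)-b_m)^{\alpha_m}f_m\big)(x)$. Oscillation spaces. $\|f\|_{\exp L,B}:=\inf\{\lambda>0:\frac1{\mu(B)}\int_B(e^{|f|/\lambda}-1)\,d\mu\le1\}$; $\operatorname{osc}_{\exp L}$ is the collection of $f\in L^1_{\mathrm{loc}}(\Sigma,\mu)$ with $\|f\|_{\operatorname{osc}_{\exp L}}:=\sup_{B\in\mathscr{B}}\|f-f_B\|_{\exp L,B}<\infty$, where $f_B:=\frac1{\mu(B)}\int_Bf\,d\mu$. Weights. A weight is a measurable $w$ with $0<w<\infty$ a.e. For $1<p<\infty$, $[w]_{A_{p,\mathscr{B}}}:=\sup_{B\in\mathscr{B}}(\frac1{\mu(B)}\int_Bw\,d\mu)(\frac1{\mu(B)}\int_Bw^{1-p'}d\mu)^{p-1}$;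 $[w]_{A_{1,\mathscr{B}}}:=\|(M_{\mathscr{B}}w)w^{-1}\|_{L^\infty}$ with $M_{\mathscr{B}}f(x)=\sup_{x\in B\in\mathscr{B}}\frac1{\mu(B)}\int_B|f|d\mu$; $A_{p,\mathscr{B}}$ is the class of weights for which this is finite; $A_{\infty,\mathscr{B}}:=\bigcup_{p\ge1}A_{p,\mathscr{B}}$ with $[w]_{A_{\infty,\mathscr{B}}}:=\inf\{[w]_{A_{p,\mathscr{B}}}:w\in A_{p,\mathscr{B}}\}$. For $\vec q=(q_1,\ldots,q_m)$ with $1<q_i<\infty$, $\frac1q=\sum_i\frac1{q_i}$, a vector of weights $\vec w=(w_1,\ldots,w_m)$ is in $A_{\vec q,\mathscr{B}}$ if $[\vec w]_{A_{\vec q,\mathscr{B}}}:=\sup_{B\in\mathscr{B}}(\frac1{\mu(B)}\int_Bw\,d\mu)^{1/q}\prod_{i=1}^m(\frac1{\mu(B)}\int_Bw_i^{1-q_i'}d\mu)^{1/q_i'}<\infty$, $w=\prod_iw_i^{q/q_i}$. Here $\vec p/r=(p_1/r,\ldots,p_m/r)$. For $1<s<\infty$, $w\in RH_{s,\mathscr{B}}$ means $[w]_{RH_{s,\mathscr{B}}}:=\sup_{B\in\mathscr{B}}(\frac1{\mu(B)}\int_Bw^sd\mu)^{1/s}(\frac1{\mu(B)}\int_Bw\,d\mu)^{-1}<\infty$. $A_{\infty,\mathscr{B}}$ satisfies the sharp reverse H\''older property if there exists a constant $c_0>0$ such that for every $w\in A_{\infty,\mathscr{B}}$ one has $w\in RH_{r_w,\mathscr{B}}$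 with $r_w=1+c_0[w]_{A_{\infty,\mathscr{B}}}^{-1}$. The quantities $\mathcal{N}_1,\mathcal{N}_2$. Put $\sigma_i:=w_i^{\frac r{r-p_i}}$. For a weight $\sigma$ let $M_{\mathscr{B},\sigma}g(x):=\sup_{x\in B\in\mathscr{B}}\frac1{\sigma(B)}\int_B|g|\sigma\,d\mu$, $\sigma(B)=\int_B\sigma\,d\mu$, and let $\|M_{\mathscr{B},\sigma}\|_{L^q(\Sigma,\sigma)}$ be its operator norm on $L^q(\Sigma,\sigma)$. Then $\mathcal{N}_1(r,\vec p,\vec w):=\prod_{i=1}^m\|M_{\mathscr{B},\sigma_i}\|_{L^{p_i/r}(\Sigma,\sigma_i)}^{1/r}$ if $p\le1$, and this product times $\|M_{\mathscr{B},w}\|_{L^{p'}(\Sigma,w)}$ if $p>1$. For $\tau_2\subset\{1,\ldots,m\}$, $\mathcal{N}_2^{\tau_2}(r,\vec p,\vec w):=\prod_{j\in\tau_2}\|M_{\mathscr{B},\sigma_j}\|_{L^{p_j/(rs_j)}(\Sigma,\sigma_j)}^{1/(rs_j)}$ if $p\le1$, and this product times $\|M_{\mathscr{B},w}\|_{L^{p'/s}(\Sigma,w)}^{1/s}$ if $p>1$, where the exponents are required to satisfy $1<s<p'$ and $1<s_j<p_j/r$ (the implicit constants may depend on them). *)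

(* Defs.v *)
From HB Require Import structures.
From mathcomp Require Import all_boot all_order all_algebra.
From mathcomp Require Import all_classical all_reals all_analysis.
From mathcomp Require Import measurable_realfun.

Set Implicit Arguments.
Unset Strict Implicit.
Unset Printing Implicit Defensive.

Import Order.TTheory GRing.Theory Num.Theory.
Import numFieldNormedType.Exports.

Local Open Scope classical_set_scope.
Local Open Scope ring_scope.

Section exponents.
Context {R : realType} {m : nat}.

Definition conj_exp (q : R) : R := q / (q - 1).

(* 1/p = \sum_i 1/p_i *)
Definition hexp (p : 'I_m -> R) : R := (\sum_i (p i)^-1)^-1.

End exponents.

(* The best c >= 0 with |U f|_Y <= c |f|_X for all f in D (+oo if none). *)
Definition opnorm {R : realType} {X Y : Type} (D : set X)
    (nX : X -> \bar R) (nY : Y -> \bar R) (U : X -> Y) : \bar R :=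
  ereal_inf [set c%:E | c in
    [set c : R | 0 <= c /\ forall f, D f -> (nY (U f) <= c%:E * nX f)%E]].

Section ball_bases.
Context {R : realType} {d : measure_display} {S : measurableType d}.
Variable mu : {measure set S -> \bar R}.

(* In ball_dense, a finite (possibly empty) or infinite sequence of balls is
   encoded as a countable set of balls. *)
Record ball_basis (BB : set (set S)) (star : set S -> set S) (C0 : R) : Prop :=
  BallBasis {
    ball_measurable : forall B, BB B -> measurable B ;
    ball_measure : forall B, BB B -> (0 < mu B < +oo)%E ;
    ball_pair : forall x y, exists B, [/\ BB B, B x & B y] ;
    ball_dense : forall (e : R) (E : set S), 0 < e -> measurable E ->
      exists D : set (set S), [/\ countable D, D `<=` BB &
        (mu (E `+` \bigcup_(B in D) B) < e%:E)%E] ;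
    ball_C0 : 1 <= C0 ;
    star_ball : forall B, BB B -> BB (star B) ;
    star_measure : forall B, BB B -> (mu (star B) <= C0%:E * mu B)%E ;
    star_hull : forall B, BB B ->
      \bigcup_(B' in [set B' | [/\ BB B', B' `&` B !=set0 &
                                (mu B' <= 2%:E * mu B)%E]]) B' `<=` star B ;
    star_mono : forall A B, BB A -> BB B -> A `<=` B -> star A `<=` star B
  }.

Definition avg (B : set S) (g : S -> \bar R) : \bar R :=
  ((mu B)^-1 * \int[mu]_(x in B) g x)%E.

Definition avgr (r : R) (B : set S) (f : S -> R) : \bar R :=
  (avg B (fun x => (`|f x| `^ r)%:E) `^ r^-1)%E.

Definition sup_avgr (BB : set (set S)) (r : R) (B : set S) (f : S -> R) :
    \bar R :=
  ereal_sup [set avgr r B' f | B' in [set B' | BB B' /\ B `<=` B']].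

End ball_bases.

Section operators.
Context {R : realType} {d : measure_display} {S : measurableType d}.
Variable mu : {measure set S -> \bar R}.
Context {m : nat}.

Local Notation tuples := ('I_m -> S -> R).

Definition LrT (r : R) : set tuples :=
  [set f | forall i, f i \in Lfun mu r%:E].

Definition restr (f : tuples) (E : set S) : tuples :=
  fun i x => f i x * \1_E x.

Definition subst (f : tuples) (i : 'I_m) (g : S -> R) : tuples := dfwith f i g.

Definition multilinear (r : R) (V : lmodType R) (T : tuples -> S -> V) :=
  forall (f : tuples) (i : 'I_m), LrT r f ->
    (forall (a : R) x,
      T (subst f i (fun y => a * f i y)) x = a *: T f x) /\
    (forall g : S -> R, g \in Lfun mu r%:E -> forall x,
      T (subst f i (fun y => f i y + g y)) x = T f x + T (subst f i g) x).

Definition multisublinear (r : R) (T : tuples -> S -> R) :=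
  forall (f : tuples) (i : 'I_m), LrT r f ->
    (forall (a : R) x,
      `|T (subst f i (fun y => a * f i y)) x| = `|a| * `|T f x|) /\
    (forall g : S -> R, g \in Lfun mu r%:E -> forall x,
      `|T (subst f i (fun y => f i y + g y)) x|
        <= `|T f x| + `|T (subst f i g) x|).

Definition oscT1 (BB : set (set S)) (star : set S -> set S) (r : R)
    (V : normedModType R) (T : tuples -> S -> V) (C1 : R) :=
  forall f, LrT r f -> forall B0, BB B0 -> star B0 `<` setT ->
    exists B, [/\ BB B, B0 `<` B & forall x, B0 x ->
      (`|T (restr f (star B)) x - T (restr f (star B0)) x|%:E
        <= C1%:E * \prod_(i < m) avgr mu r (star B) (f i))%E].

Definition oscT2 (BB : set (set S)) (star : set S -> set S) (r : R)
    (V : normedModType R) (T : tuples -> S -> V) (C2 : R) :=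
  forall f, LrT r f -> forall B, BB B -> forall x x', B x -> B x' ->
    (`|(T f x - T (restr f (star B)) x) - (T f x' - T (restr f (star B)) x')|%:E
      <= C2%:E * \prod_(i < m) sup_avgr mu BB r B (f i))%E.

(* C1 and C2 are the constants C_1(T), C_2(T); the second alternative is the
   case of a real-valued, possibly only sublinear, operator. *)
Definition bounded_oscillation (BB : set (set S)) (star : set S -> set S)
    (r : R) (V : completeNormedModType R) (T : tuples -> S -> R) (C1 C2 : R) :=
  [/\ 0 < C1, 0 < C2 &
   (exists T' : tuples -> S -> V,
      [/\ multilinear r T',
          forall f, LrT r f -> forall x, T f x = `|T' f x|,
          oscT1 BB star r T' C1 & oscT2 BB star r T' C2])
   \/
   [/\ V = R^o :> completeNormedModType R,
       multilinear r (T : tuples -> S -> R^o) \/ multisublinear r T,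
       oscT1 BB star r (T : tuples -> S -> R^o) C1 &
       oscT2 BB star r (T : tuples -> S -> R^o) C2]].

Definition weakLnorm (q : R) (g : S -> R) : \bar R :=
  ereal_sup [set (t%:E * mu [set x | (t < `|g x|)%R] `^ q^-1)%E
            | t in [set t : R | 0 < t]].

(* |T|_{L^r x ... x L^r -> L^(r/m,oo)} *)
Definition weak_opnorm (r : R) (T : tuples -> S -> R) : \bar R :=
  opnorm (LrT r) (fun f => \prod_(i < m) 'N[mu]_(r%:E)[EFin \o f i])%E
    (weakLnorm (r / m%:R)) T.

Definition weak_bounded (r : R) (T : tuples -> S -> R) :=
  (forall f, LrT r f -> measurable_fun setT (T f)) /\
  (weak_opnorm r T < +oo)%E.

(* The argument of T depends on the point x at which the result is evaluated. *)
Definition comm_arg (b : tuples) (alpha : 'I_m -> nat) (f : tuples) (x : S) :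
    tuples :=
  fun i y => (b i x - b i y) ^+ alpha i * f i y.

Definition commutator (T : tuples -> S -> R) (b : tuples)
    (alpha : 'I_m -> nat) (f : tuples) : S -> R :=
  fun x => T (comm_arg b alpha f x) x.

Definition supp (alpha : 'I_m -> nat) : {set 'I_m} :=
  finset (fun i => alpha i != 0%N).

End operators.

Section oscillation.
Context {R : realType} {d : measure_display} {S : measurableType d}.
Variable mu : {measure set S -> \bar R}.

Definition expL_norm (B : set S) (f : S -> R) : \bar R :=
  ereal_inf [set l%:E | l in [set l : R | 0 < l /\
    (avg mu B (fun x => (expR (`|f x| / l) - 1)%:E) <= 1)%E]].

(* This is +oo when f is not integrable on some ball B: there fine gives a
   junk value for f_B, but f minus any constant has infinite exp L norm. *)
Definition osc_expL (BB : set (set S)) (f : S -> R) : \bar R :=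
  ereal_sup [set expL_norm B (fun x => f x - fine (avg mu B (EFin \o f)))
            | B in BB].

End oscillation.

Section weights.
Context {R : realType} {d : measure_display} {S : measurableType d}.
Variable mu : {measure set S -> \bar R}.
Variable BB : set (set S).
Implicit Types w sg : S -> \bar R.

Local Open Scope ereal_scope.

Definition weight w :=
  measurable_fun setT w /\ {ae mu, forall x, 0 < w x < +oo}.

Definition maximal (f : S -> \bar R) (x : S) : \bar R :=
  ereal_sup [set avg mu B (abse \o f) | B in [set B | BB B /\ B x]].

(* Only meant for q >= 1. *)
Definition Ap_const w (q : R) : \bar R :=
  if q == 1%R then 'N[mu]_+oo[(fun x => maximal w x * (w x)^-1)]
  else ereal_sup [set avg mu B w *
    avg mu B (fun x => w x `^ (1 - conj_exp q)) `^ (q - 1) | B in BB].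

Definition Ainfty w :=
  weight w /\ exists q : R, (1 <= q)%R /\ Ap_const w q < +oo.

Definition Ainfty_const w : \bar R :=
  ereal_inf [set Ap_const w q
            | q in [set q : R | (1 <= q)%R /\ Ap_const w q < +oo]].

Definition RH_const w (s : R) : \bar R :=
  ereal_sup [set avg mu B (fun x => w x `^ s) `^ s^-1 * (avg mu B w)^-1
            | B in BB].

Definition sharp_reverse_Holder :=
  exists2 c0 : R, (0 < c0)%R & forall w, Ainfty w ->
    RH_const w (1 + c0 * (fine (Ainfty_const w))^-1) < +oo.

Context {m : nat}.

Definition prod_weight (p : 'I_m -> R) (w : 'I_m -> S -> \bar R) :
    S -> \bar R :=
  fun x => \prod_(i < m) w i x `^ (hexp p / p i).

Definition Avec_const (q : 'I_m -> R) (w : 'I_m -> S -> \bar R) : \bar R :=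
  ereal_sup [set avg mu B (prod_weight q w) `^ (hexp q)^-1 *
    \prod_(i < m) avg mu B (fun x => w i x `^ (1 - conj_exp (q i)))
                    `^ (conj_exp (q i))^-1 | B in BB].

Definition Avec (q : 'I_m -> R) (w : 'I_m -> S -> \bar R) :=
  (forall i, weight (w i)) /\ Avec_const q w < +oo.

Definition wLnorm w (q : R) (g : S -> \bar R) : \bar R :=
  (\int[mu]_x (`|g x| `^ q * w x)) `^ q^-1.

Definition wL w (q : R) : set (S -> R) :=
  [set g | measurable_fun setT g /\ wLnorm w q (EFin \o g) < +oo].

Definition wmaximal sg (g : S -> R) (x : S) : \bar R :=
  ereal_sup [set (\int[mu]_(y in B) sg y)^-1 *
                 \int[mu]_(y in B) (`|g y|%:E * sg y)
            | B in [set B | BB B /\ B x]].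

Definition wmaximal_norm sg (q : R) : \bar R :=
  opnorm (wL sg q) (fun g => wLnorm sg q (EFin \o g)) (wLnorm sg q)
    (wmaximal sg).

Definition sigma (r : R) (p : 'I_m -> R) (w : 'I_m -> S -> \bar R) (i : 'I_m) :
    S -> \bar R :=
  fun x => w i x `^ (r / (r - p i)).

Definition N1 (r : R) (p : 'I_m -> R) (w : 'I_m -> S -> \bar R) : \bar R :=
  (\prod_(i < m) wmaximal_norm (sigma r p w i) (p i / r) `^ r^-1) *
  (if (1 < hexp p)%R
   then wmaximal_norm (prod_weight p w) (conj_exp (hexp p)) else 1).

Definition N2 (t2 : {set 'I_m}) (s : R) (sj : 'I_m -> R) (r : R)
    (p : 'I_m -> R) (w : 'I_m -> S -> \bar R) : \bar R :=
  (\prod_(j in t2)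
     wmaximal_norm (sigma r p w j) (p j / (r * sj j)) `^ (r * sj j)^-1) *
  (if (1 < hexp p)%R
   then wmaximal_norm (prod_weight p w) (conj_exp (hexp p) / s) `^ s^-1
   else 1).

(* |U|_{L^{p_1}(w_1) x ... x L^{p_m}(w_m) -> L^p(w)}, computed on the tuples of
   the source that lie in D. *)
Definition wopnorm (D : set ('I_m -> S -> R)) (p : 'I_m -> R)
    (w : 'I_m -> S -> \bar R) (U : ('I_m -> S -> R) -> S -> R) : \bar R :=
  opnorm [set f | D f /\ forall i, wL (w i) (p i) (f i)]
    (fun f => \prod_(i < m) wLnorm (w i) (p i) (EFin \o f i))
    (fun g => wLnorm (prod_weight p w) (hexp p) (EFin \o g)) U.

(* T is only given on L^r(mu)^m, so its norm is taken on the (dense) tuples of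
   the source that belong to L^r(mu)^m. *)
Definition T_norm (r : R) (p : 'I_m -> R) (w : 'I_m -> S -> \bar R)
    (T : ('I_m -> S -> R) -> S -> R) : \bar R :=
  wopnorm (LrT mu r) p w T.

(* Likewise, the commutator makes sense at f when, for almost every x, T is
   defined on the tuple ((b_i(x) - b_i)^(alpha_i) f_i)_i. *)
Definition comm_norm (r : R) (p : 'I_m -> R) (w : 'I_m -> S -> \bar R)
    (T : ('I_m -> S -> R) -> S -> R) (b : 'I_m -> S -> R)
    (alpha : 'I_m -> nat) : \bar R :=
  wopnorm [set f | {ae mu, forall x, LrT mu r (comm_arg b alpha f x)}] p w
    (commutator T b alpha).

End weights.

(* Main.v *)
Require Import Defs.
From HB Require Import structures.
From mathcomp Require Import all_boot all_order all_algebra.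
From mathcomp Require Import all_classical all_reals all_analysis.
From mathcomp Require Import measurable_realfun.
From mathcomp Require Import zify ring lra.

(** The theorem rests on sparse domination. Fix a ball. To every ball [Q] belongs a bad
    set: the points where the operator, applied to the tuple cut off to [star Q], or the
    maximal function of an entry of this tuple, exceeds a large multiple of the averages
    over [star Q]. The weak type bound and the Vitali covering lemma [vitali] make the
    bad set a small part of [Q]. At a good point the operator is controlled by the
    product of the averages. At a bad point one takes a smaller ball [G] such that the
    balls around the point of more than twice its measure consist of good points at
    least by half: by (T1) the operator for the next ball beyond [G] and for [G] itself
    differ by a product of averages, and by (T2) the part of the tuple outside of that
    next ball contributes almost a constant, whose value is read off at a good point. So
    passing from [Q] to [G] costs one product of averages, and iteration yields a chain
    of balls at almost every point. A ball basis has no nested structure, and the balls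
    of all chains must be chosen from one family with little overlap. The selection
    proceeds by size; removing from each selected ball all balls chosen at least two
    size steps later leaves a core of half its measure, and the cores of all the balls
    whose steps have the same parity are disjoint ([stopping_family],
    [sparse_domination]). Finally the fixed ball exhausts the space ([truncation_error],
    [exhausting_balls]).

    For commutators the argument of the operator depends on the point of evaluation, but
    the selection of balls must not. Everything is therefore done for the tuples with
    entries [beta i x * u i + v i], where [u] and [v] are fixed, and the bad sets are
    defined by the fixed entries [u i] and [c Q i * u i + v i], where [c Q] is a mean of
    the symbol; only [beta i x - c Q i] depends on [x] and appears as a factor. The
    operator itself is the case without symbols.

    The weighted estimate of a sparse sum uses that the target weight and the dual
    weights [sigma i], with suitable powers, have product one, while the same powers of
    their means have product at most the constant [A] of the vector weight. In such a
    dual tuple all weights play the same role. By [ball_testing] the means over a ball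
    are exchanged for the masses of its core at the price of [A ^ max]. Since cores are
    disjoint, the sums that remain are bounded by the weighted maximal operators
    ([sparse_maximal]). For [p <= 1] the power [p] of the sparse sum is subadditive
    ([sparse_bound_le1]); for [p > 1] one argues by duality ([sparse_bound_gt1]).

    For the commutators one also needs the oscillation of the symbols, which is
    exponentially integrable with respect to the measure, to be integrable with respect
    to each weight. This is Hoelder's inequality and a reverse Hoelder inequality for
    the weight, but the reverse Hoelder hypothesis says only that the constant of each
    single weight is finite. The constant is made uniform in two steps. First, balls
    have no gaps in measure: otherwise the product of bumps on a rapidly growing
    sequence of isolated balls would be an [A_2] weight without any reverse Hoelder
    inequality ([regular_balls]). Second, on such a basis a stopping argument shows that
    a reverse Hoelder inequality with some constant improves itself to one with an
    absolute constant ([reverse_holder_improves], [weak_reverse_holder]). It follows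
    that a moment of order [a] costs the power [a] of the Muckenhoupt constant of the
    weight ([moment_bound]), which is at most [A ^ max] for all weights of the dual
    tuple ([dual_A_bound]). So every symbol contributes one more factor [A ^ max], and
    the exponent is [(|tau| + 1) * max].

    The tuples on which a commutator makes sense are described by a dichotomy: a symbol
    is constant almost everywhere, and then the commutator vanishes ([constant_symbol]),
    or the entry and its product with the symbol are both in [L^r] ([symbol_dichotomy]),
    and then the sparse domination applies. *)

Set Implicit Arguments.
Unset Strict Implicit.
Unset Printing Implicit Defensive.

Import Order.TTheory GRing.Theory Num.Theory.
Import numFieldNormedType.Exports.

Local Open Scope classical_set_scope.
Local Open Scope ring_scope.

(** * Countable covers *)

Section integral_covers.
Context {R : realType} {d : measure_display} {S : measurableType d}.
Variable mu : {measure set S -> \bar R}.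
Local Open Scope ereal_scope.

Lemma ge0_integral_bigcup_le (F : (set S)^nat) (f : S -> \bar R) :
  (forall n, measurable (F n)) -> measurable_fun setT f ->
  (forall x, 0 <= f x) ->
  \int[mu]_(x in \bigcup_n F n) f x <= \sum_(n <oo) \int[mu]_(x in F n) f x.
Proof.
move=> mF mf f0; rewrite seqDU_bigcup_eq.
have mD n : measurable (seqDU F n).
  by apply: measurableD => //; exact: bigsetU_measurable.
rewrite ge0_integral_bigcup //; last first.
- exact: measurable_funTS.
apply: lee_nneseries => [n _ _|n _]; first exact: integral_ge0.
apply: ge0_subset_integral => //; first exact: measurable_funTS.
exact: subset_seqDU.
Qed.

Lemma measurable_countable_bigcup (W : set (set S)) (s : set S -> set S) :
  countable W -> (forall A, W A -> measurable (s A)) ->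
  measurable (\bigcup_(A in W) s A).
Proof.
move=> /countable_injP[h hinj] ms.
pose at_ n := \bigcup_(A in [set A | W A /\ h A = n]) s A.
have -> : \bigcup_(A in W) s A = \bigcup_n at_ n.
  apply/seteqP; split=> [x [A WA sAx]|x [n _ [A [WA _] sAx]]]; last by exists A.
  by exists (h A) => //; exists A.
apply: bigcup_measurable => n _.
have [[A [WA hA]]|no] := pselect (exists A, W A /\ h A = n).
  suff -> : at_ n = s A by exact: ms.
  apply/seteqP; split=> [x [B [WB hB] Bx]|x Ax]; last by exists A.
  by rewrite (hinj A B) ?inE // hA hB.
suff -> : at_ n = set0 by [].
by apply/seteqP; split=> // x [A [WA hA] _]; apply: no; exists A.
Qed.

(** The engine of all covering arguments below: local inequalities between the enlarged
    sets [s A] and the disjoint sets [c A] add up. *)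
Lemma countable_cover_integral_le (W : set (set S)) (s c : set S -> set S)
    (H : set S) (f g : S -> \bar R) (K : R) : countable W ->
  (forall A, W A -> measurable (s A)) ->
  (forall A, W A -> measurable (c A) /\ c A `<=` H) -> measurable H ->
  (forall A B, W A -> W B -> c A `&` c B !=set0 -> A = B) ->
  measurable_fun setT f -> measurable_fun setT g ->
  (forall x, 0 <= f x) -> (forall x, 0 <= g x) -> (0 <= K)%R ->
  (forall A, W A -> \int[mu]_(x in s A) f x <= K%:E * \int[mu]_(x in c A) g x) ->
  measurable (\bigcup_(A in W) s A) /\
  \int[mu]_(x in \bigcup_(A in W) s A) f x <= K%:E * \int[mu]_(x in H) g x.
Proof.
move=> /countable_injP[h hinj] ms mc mH cinj mf mg f0 g0 K0 le.
pose at_ (t : set S -> set S) n := \bigcup_(A in [set A | W A /\ h A = n]) t A.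
have atE t n : (exists2 A, W A & at_ t n = t A) \/ at_ t n = set0.
  have [[A [WA hA]]|no] := pselect (exists A, W A /\ h A = n); [left|right].
    exists A => //; apply/seteqP; split=> [x [B [WB hB] Bx]|x Ax].
      by rewrite (hinj A B) ?inE // hA hB.
    by exists A.
  by apply/seteqP; split=> // x [A [WA hA] _]; apply: no; exists A.
have ats : \bigcup_(A in W) s A = \bigcup_n at_ s n.
  apply/seteqP; split=> [x [A WA sAx]|x [n _ [A [WA _] sAx]]]; last by exists A.
  by exists (h A) => //; exists A.
have mats n : measurable (at_ s n).
  by case: (atE s n) => [[A WA ->]|->] //; exact: ms.
have matc n : measurable (at_ c n).
  by case: (atE c n) => [[A WA ->]|->] //; case: (mc _ WA).
split; first by rewrite ats; exact: bigcup_measurable.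
rewrite ats; apply: (le_trans (ge0_integral_bigcup_le mats mf f0)).
have tc : trivIset setT (at_ c).
  move=> i j _ _ [x [[A [WA <-] Ax] [B [WB <-] Bx]]].
  by rewrite (cinj A B WA WB) //; exists x.
apply: (@le_trans _ _ (\sum_(n <oo) K%:E * \int[mu]_(x in at_ c n) g x)).
  apply: lee_nneseries => [n _ _|n _]; first by apply: integral_ge0 => *; exact: f0.
  have [[A [WA hA]]|no] := pselect (exists A, W A /\ h A = n).
    have e t : at_ t n = t A.
      apply/seteqP; split=> [x [B [WB hB] Bx]|x Ax]; last by exists A.
      by rewrite (hinj A B) ?inE // hA hB.
    by rewrite !e; exact: le.
  have e t : at_ t n = set0.
    by apply/seteqP; split=> // x [A [WA hA] _]; apply: no; exists A.
  by rewrite !e !integral_set0 mule0.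
rewrite nneseriesZl//; last by move=> n _; exact: integral_ge0.
rewrite -ge0_integral_bigcup //; last exact: measurable_funTS.
apply: lee_pmul => //; first exact: integral_ge0.
apply: ge0_subset_integral => //.
- exact: bigcup_measurable.
- exact: measurable_funTS.
- by move=> x [n _ [A [WA _] Ax]]; case: (mc _ WA) => _; exact.
Qed.

Lemma countable_cover_measure_le (W : set (set S)) (s c : set S -> set S)
    (H : set S) (K : R) : countable W ->
  (forall A, W A -> measurable (s A)) ->
  (forall A, W A -> measurable (c A) /\ c A `<=` H) -> measurable H ->
  (forall A B, W A -> W B -> c A `&` c B !=set0 -> A = B) -> (0 <= K)%R ->
  (forall A, W A -> mu (s A) <= K%:E * mu (c A)) ->
  measurable (\bigcup_(A in W) s A) /\
  mu (\bigcup_(A in W) s A) <= K%:E * mu H.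
Proof.
move=> cW ms mc mH cinj K0 le.
have [] := @countable_cover_integral_le W s c H (cst 1) (cst 1) K cW ms mc mH cinj.
- exact: measurable_cst.
- exact: measurable_cst.
- by [].
- by [].
- by [].
- move=> A WA; rewrite !integral_cst ?mul1e; first exact: le.
    by case: (mc _ WA).
  exact: ms.
- move=> m; rewrite !integral_cst ?mul1e //.
Qed.

End integral_covers.

(** * Geometry of a ball basis *)

Section balls.
Context {R : realType} {d : measure_display} {S : measurableType d}.
Variable mu : {measure set S -> \bar R}.
Variables (BB : set (set S)) (star : set S -> set S) (C0 : R).
Hypothesis hBB : ball_basis mu BB star C0.

Definition vol (A : set S) : R := fine (mu A).

Lemma volE A : BB A -> mu A = (vol A)%:E.
Proof.
move=> /(ball_measure hBB)/andP[A0 Ay]; rewrite fineK//.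
by rewrite ge0_fin_numE// measure_ge0.
Qed.

Lemma vol_gt0 A : BB A -> 0 < vol A.
Proof. by move=> BA; have /andP[] := ball_measure hBB BA; rewrite volE. Qed.

Lemma le_vol A B : BB A -> BB B -> A `<=` B -> vol A <= vol B.
Proof.
move=> BA BB' AB; rewrite -lee_fin -!volE//.
by apply: le_measure => //; rewrite inE; exact: (ball_measurable hBB).
Qed.

Lemma ball_neq0 A : BB A -> A !=set0.
Proof.
move=> BA; apply/set0P/eqP => A0; have := vol_gt0 BA.
by rewrite /vol A0 measure0 ltxx.
Qed.

Lemma C0_ge1 : 1 <= C0. Proof. exact: ball_C0 hBB. Qed.

Lemma C0_ge0 : 0 <= C0. Proof. exact: le_trans C0_ge1. Qed.

Lemma C0X_ge1 n : 1 <= C0 ^+ n.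
Proof. by apply: exprn_ege1; exact: C0_ge1. Qed.

Lemma C0X_gt0 n : 0 < C0 ^+ n.
Proof. exact: lt_le_trans (C0X_ge1 n). Qed.

Lemma star_absorb A B : BB A -> BB B -> A `&` B !=set0 ->
  vol A <= 2 * vol B -> A `<=` star B.
Proof.
move=> BA BB' AB le; apply: subset_trans (star_hull hBB BB') => x Ax.
by exists A => //; split=> //; rewrite !volE.
Qed.

Lemma sub_star B : BB B -> B `<=` star B.
Proof.
move=> BB'; apply: star_absorb => //; first by rewrite setIid; exact: ball_neq0.
by rewrite ler_peMl ?ler1n // ltW // vol_gt0.
Qed.

Lemma vol_star B : BB B -> vol (star B) <= C0 * vol B.
Proof.
move=> BB'; rewrite -lee_fin EFinM -!volE//; last exact: (star_ball hBB).
exact: (star_measure hBB).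
Qed.

Definition dil n := iter n star.

Lemma dil_ball n B : BB B -> BB (dil n B).
Proof. by move=> ?; elim: n => //= n; exact: (star_ball hBB). Qed.

Lemma vol_dil n B : BB B -> vol (dil n B) <= C0 ^+ n * vol B.
Proof.
move=> BB'; elim: n => [|n IH]; first by rewrite expr0 mul1r.
apply: (le_trans (vol_star (dil_ball n BB'))).
by rewrite exprS -mulrA ler_wpM2l// C0_ge0.
Qed.

Lemma dil_sub n k B : BB B -> (n <= k)%N -> dil n B `<=` dil k B.
Proof.
move=> BB'; elim: k => [|k IH]; first by rewrite leqn0 => /eqP ->.
rewrite leq_eqVlt => /orP[/eqP -> //|/IH nk].
exact: (subset_trans nk (sub_star (dil_ball k BB'))).
Qed.

Lemma sub_dil n B : BB B -> B `<=` dil n B.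
Proof. by move=> BB'; exact: (dil_sub BB' (leq0n n)). Qed.

Lemma dil_mono n A B : BB A -> BB B -> A `<=` B -> dil n A `<=` dil n B.
Proof.
move=> BA BB' AB; elim: n => //= n IH.
by apply: (star_mono hBB) => //; exact: dil_ball.
Qed.

Lemma le_vol_dil n B : BB B -> vol B <= vol (dil n B).
Proof. by move=> BB'; apply: le_vol (sub_dil _ _) => //; exact: dil_ball. Qed.

(** A substitute for a maximum that need not be attained. *)
Lemma near_maximal (T : Type) (P : T -> Prop) (f : T -> R) (M : R) :
  (exists t, P t) -> (forall t, P t -> 0 < f t <= M) ->
  exists t, P t /\ forall u, P u -> f u <= 2 * f t.
Proof.
move=> [t0 Pt0] fM; pose E := [set f t | t in P].
have hE : has_sup E.
  split; first by exists (f t0), t0.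
  by exists M => _ [t Pt <-]; have /andP[] := fM _ Pt.
have s0 : 0 < sup E.
  apply: lt_le_trans (_ : f t0 <= _); first by have /andP[] := fM _ Pt0.
  by apply: sup_upper_bound => //; exists t0.
have [_ [t Pt <-] ht] := sup_adherent (divr_gt0 s0 (ltr0n R 2)) hE.
exists t; split=> // u Pu.
have := sup_upper_bound hE; move=> /(_ (f u)) /(_ (ex_intro2 _ _ u Pu erefl)).
by move: ht; lra.
Qed.

(** Zorn's lemma replaces the greedy selection by decreasing size, since a ball basis
    may be uncountable and have balls of all sizes. It is applied to the disjoint
    subfamilies for which the conclusion holds for all members of [F] that meet them. If
    some member of [F] met no ball of a maximal such subfamily, then one nearly largest
    among these members could be added. *)
Lemma vitali (F : set (set S)) (M : R) :
  F `<=` BB -> (forall A, F A -> vol A <= M) ->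
  exists W, [/\ W `<=` F,
    forall A B, W A -> W B -> A `&` B !=set0 -> A = B &
    forall A, F A -> exists A', [/\ W A', A `&` A' !=set0 & vol A <= 2 * vol A']].
Proof.
move=> FB FM.
pose P W := [/\ W `<=` F,
    forall A B, W A -> W B -> A `&` B !=set0 -> A = B &
    forall A B, F A -> W B -> A `&` B !=set0 ->
      exists A', [/\ W A', A `&` A' !=set0 & vol A <= 2 * vol A']].
have [G GP tot|W [[WF Wd Wm] Wmax]] := @Zorn_bigcup (set S) P.
  split=> [A [W GW WA]|A B [W1 G1 WA] [W2 G2 WB] AB|A B FA [W GW WB] AB].
  - by case: (GP _ GW) => + _ _; exact.
  - case: (tot _ _ G1 G2) => sub.
      by case: (GP _ G2) => _ + _; apply => //; exact: sub.
    by case: (GP _ G1) => _ + _; apply => //; exact: sub.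
  - case: (GP _ GW) => _ _ /(_ _ _ FA WB AB)[A' [WA' AA' le]].
    by exists A'; split=> //; exists W.
exists W; split=> // A FA.
have [[B [WB AB]]|no] := pselect (exists B, W B /\ A `&` B !=set0).
  exact: (Wm A B).
exfalso.
pose Q A := F A /\ ~ (exists B, W B /\ A `&` B !=set0).
have [|t Qt|A0 [[FA0 nA0] mA0]] := @near_maximal _ Q vol M.
- by exists A.
- by case: Qt => Ft _; rewrite vol_gt0 ?FM//; exact: FB.
apply: (Wmax (W `|` [set A0])).
  split; first by move=> x Wx; left.
  move=> sub; apply: nA0; exists A0; split; first by apply: sub; right.
  by rewrite setIid; apply: ball_neq0; exact: FB.
split=> [B [/WF//|->//]|B1 B2 [W1|->] [W2|->]|B1 B2 F1 [W2|->] B12] //.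
- exact: Wd.
- by move=> B12; exfalso; apply: nA0; exists B1; split => //; rewrite setIC.
- by move=> B12; exfalso; apply: nA0; exists B2.
- have [A' [WA' ? ?]] := Wm _ _ F1 W2 B12.
  by exists A'; split => //; left.
- have [[B [WB AB]]|no1] := pselect (exists B, W B /\ B1 `&` B !=set0).
    have [A' [WA' ? ?]] := Wm _ _ F1 WB AB.
    by exists A'; split => //; left.
  by exists A0; split=> //; [right|exact: mA0].
Qed.

Lemma finite_disjoint_charge (V : set (set S)) (H : set S) (e : R) : 0 < e ->
  measurable H -> (mu H < +oo)%E -> (forall A, V A -> measurable A) ->
  (forall A B, V A -> V B -> A `&` B !=set0 -> A = B) ->
  (forall A, V A -> (e%:E <= mu (A `&` H))%E) -> finite_set V.
Proof.
move=> e0 mH Hoo mV Vd Ve; apply: contrapT => /infiniteP/pcard_leP[f].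
have Vf n : V (f n) by exact: funS.
have tf : trivIset setT (fun n => f n `&` H).
  move=> i j _ _ [x [[fi _] [fj _]]]; apply: (@inj _ _ _ f); rewrite ?inE//.
  by apply: Vd; [exact: Vf|exact: Vf|exists x].
have mf n : measurable (f n `&` H) by apply: measurableI => //; exact: mV.
have HN : mu H \is a fin_num by rewrite ge0_fin_numE.
pose N := (Num.truncn (fine (mu H) / e)).+1.
have : (mu (\big[setU/set0]_(i < N) (f i `&` H)) <= mu H)%E.
  apply: le_measure; rewrite ?inE//; first exact: bigsetU_measurable.
  by rewrite -(bigcup_mkord N (fun i => f i `&` H)) => x [i _ []].
rewrite measure_semi_additive_ord//; last 2 first.
- by move=> i j _ _ ij; apply: val_inj; exact: tf ij.
- exact: bigsetU_measurable.
apply/negP; rewrite -ltNge.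
apply: (@lt_le_trans _ _ (\sum_(i < N) e%:E)%E); last first.
  by apply: lee_sum => i _; exact: Ve.
rewrite sumEFin sumr_const card_ord -(fineK HN) lte_fin.
rewrite -mulr_natr mulrC -ltr_pdivrMr//.
by rewrite truncnS_gt.
Qed.

Lemma countable_conull_balls : exists D : set (set S),
  [/\ countable D, D `<=` BB & mu (~` \bigcup_(B in D) B) = 0%E].
Proof.
have /choice[D hD] (n : nat) : exists D : set (set S),
    [/\ countable D, D `<=` BB & (mu (setT `+` \bigcup_(B in D) B) < (n.+1%:R^-1)%:E)%E].
  by apply: (ball_dense hBB).
exists (\bigcup_n D n); split.
- by apply: bigcup_countable => // n _; case: (hD n).
- by move=> B [n _]; case: (hD n) => _ + _; exact.
have mD n : measurable (\bigcup_(B in D n) B).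
  case: (hD n) => cD DB _; apply: measurable_countable_bigcup => //.
  by move=> B /DB; exact: (ball_measurable hBB).
have e : ~` (\bigcup_(B in \bigcup_n D n) B) = \bigcap_n (~` \bigcup_(B in D n) B).
  apply/seteqP; split=> [x nx n _ [B DB Bx]|x nx [B [n _ DB] Bx]].
    by apply: nx; exists B => //; exists n.
  by apply: (nx n) => //; exists B.
rewrite e; apply/eqP; rewrite eq_le measure_ge0 andbT.
apply/lee_addgt0Pr => eps eps0; rewrite add0e.
have [n _ hn] := near_infty_natSinv_lt (PosNum eps0).
have /= {}hn := hn n (leqnn n).
case: (hD n) => cD DB /ltW; rewrite setTYC => le.
apply: le_trans (_ : ((n.+1%:R^-1)%:E <= _)%E); last by rewrite lee_fin ltW.
apply: le_trans le; apply: le_measure; rewrite ?inE.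
- by apply: bigcap_measurable => // k _; exact: measurableC.
- exact: measurableC.
- by move=> x /(_ n I).
Qed.

(** Every ball meets one of countably many balls in a set of positive measure, and only
    finitely many disjoint balls can take a given share of a ball. *)
Lemma countable_disjoint_balls (W : set (set S)) : W `<=` BB ->
  (forall A B, W A -> W B -> A `&` B !=set0 -> A = B) -> countable W.
Proof.
move=> WB Wd; have [D [cD DB D0]] := countable_conull_balls.
pose V B n := [set A | W A /\ ((n.+1%:R^-1)%:E <= mu (A `&` B))%E].
apply: (@sub_countable _ _ _ (\bigcup_(B in D) \bigcup_n V B n)); last first.
  apply: bigcup_countable => // B /DB BB'; apply: bigcup_countable => // n _.
  apply: finite_set_countable; apply: (@finite_disjoint_charge _ B n.+1%:R^-1) => //.
  - exact: (ball_measurable hBB).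
  - by case/andP: (ball_measure hBB BB').
  - by move=> A [/WB BA _]; exact: (ball_measurable hBB).
  - by move=> A1 A2 [? _] [? _]; exact: Wd.
  - by move=> A [].
apply: subset_card_le => A WA; apply: contrapT => nA.
have mA : measurable A by apply: (ball_measurable hBB); exact: WB.
have mD : measurable (\bigcup_(B in D) B).
  apply: measurable_countable_bigcup => // B /DB; exact: (ball_measurable hBB).
have AD0 : mu (\bigcup_(B in D) (A `&` B)) = 0%E.
  apply/eqP; rewrite eq_le measure_ge0 andbT.
  have [|A1 DA1|A1 DA1||A1 B1 _ _ [x []]||A1 DA1|_] :=
    @countable_cover_measure_le _ _ _ mu D (fun B => A `&` B) (fun=> set0) set0 1.
  - by [].
  - by apply: measurableI => //; apply: (ball_measurable hBB); exact: DB.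
  - by split.
  - by [].
  - by [].
  - by [].
  - rewrite measure0 mule0 leNgt; apply/negP => pos; apply: nA; exists A1 => //.
    have mAA : measurable (A `&` A1).
      by apply: measurableI => //; apply: (ball_measurable hBB); exact: DB.
    have fAA : mu (A `&` A1) \is a fin_num.
      rewrite ge0_fin_numE//; apply: (@le_lt_trans _ _ (mu A)).
        by apply: le_measure; rewrite ?inE.
      by case/andP: (ball_measure hBB (WB _ WA)).
    have pos' : 0 < fine (mu (A `&` A1)) by rewrite -lte_fin fineK.
    have [n _ hn] := near_infty_natSinv_lt (PosNum pos').
    have /= {}hn := hn n (leqnn n).
    by exists n => //; split=> //; rewrite -(fineK fAA) lee_fin ltW.
  - by rewrite measure0 mule0.
have := ball_measure hBB (WB _ WA); case/andP => + _; apply/negP; rewrite -leNgt.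
rewrite -(setIT A) -(setUCr (\bigcup_(B in D) B)) setIUr.
apply: (@le_trans _ _ (mu (A `&` \bigcup_(B in D) B) +
                       mu (A `&` ~` \bigcup_(B in D) B))%E).
  by apply: measureU2; apply: measurableI => //; exact: measurableC.
have -> : A `&` \bigcup_(B in D) B = \bigcup_(B in D) (A `&` B).
  exact: setI_bigcupr.
rewrite AD0 add0e -D0; apply: le_measure; rewrite ?inE.
- by apply: measurableI => //; exact: measurableC.
- exact: measurableC.
- by move=> x [].
Qed.

(** For sets that are not known to be measurable. *)
Lemma negligible_small (X : set S) :
  (forall e : R, 0 < e -> exists Y, [/\ measurable Y, X `<=` Y & (mu Y <= e%:E)%E]) ->
  mu.-negligible X.
Proof.
move=> h; have /choice[Y hY] (n : nat) : exists Y,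
  [/\ measurable Y, X `<=` Y & (mu Y <= (n.+1%:R^-1)%:E)%E] by exact: h.
exists (\bigcap_n Y n); split.
- by apply: bigcap_measurable => // n _; case: (hY n).
- apply/eqP; rewrite eq_le measure_ge0 andbT; apply/lee_addgt0Pr => e e0.
  rewrite add0e; have [n _ hn] := near_infty_natSinv_lt (PosNum e0).
  have /= {}hn := hn n (leqnn n).
  apply: (@le_trans _ _ (n.+1%:R^-1)%:E); last by rewrite lee_fin ltW.
  case: (hY n) => mY _; apply: le_trans; apply: le_measure; rewrite ?inE//.
    by apply: bigcap_measurable => // k _; case: (hY k).
  by move=> x /(_ n I).
- by move=> x Xx n _; case: (hY n) => _ + _; exact.
Qed.

Definition dense (H A : set S) := (mu A < 2%:E * mu (A `&` H))%E.

(** A substitute for Lebesgue's differentiation theorem. In a ball that is not dense the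
    complement carries half of the measure, so a covering of those non-dense balls that
    occur in a good approximation of [E] by a union of balls is as small as the error of
    the approximation. *)
Lemma ae_dense_ball (E : set S) : measurable E -> (mu E < +oo)%E ->
  mu.-negligible [set x | E x /\ ~ exists A, [/\ BB A, A x & dense E A]].
Proof.
move=> mE Eoo; apply: negligible_small => e e0.
have K0 : 0 < 1 + 2 * C0 by have := C0_ge1; lra.
have eK : 0 < e / (1 + 2 * C0) by rewrite divr_gt0.
have [D [cD DB lt]] := ball_dense hBB eK mE.
have mD : measurable (\bigcup_(B in D) B).
  by apply: measurable_countable_bigcup => // B /DB; exact: (ball_measurable hBB).
pose H := (\bigcup_(B in D) B) `\` E.
have mH : measurable H by exact: measurableD.
have YE : E `+` \bigcup_(B in D) B = (E `\` \bigcup_(B in D) B) `|` H.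
  by [].
have muH : (mu H <= (e / (1 + 2 * C0))%:E)%E.
  apply: le_trans (ltW lt); apply: le_measure; rewrite ?inE//.
    by rewrite YE; apply: measurableU => //; exact: measurableD.
  by rewrite YE => x; right.
have muE : (mu (E `\` \bigcup_(B in D) B) <= (e / (1 + 2 * C0))%:E)%E.
  apply: le_trans (ltW lt); apply: le_measure; rewrite ?inE//.
  - exact: measurableD.
  - by rewrite YE; apply: measurableU => //; exact: measurableD.
  - by rewrite YE => x; left.
pose F := [set B | D B /\ ~ dense E B].
have FBB : F `<=` BB by move=> B [/DB].
have Fhalf B : F B -> (mu B <= 2%:E * mu (B `\` E))%E.
  move=> [DB' nd]; have BB' := DB _ DB'; have mB := ball_measurable hBB BB'.
  have mI : measurable (B `&` E) by exact: measurableI.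
  have mD' : measurable (B `\` E) by exact: measurableD.
  have fB : (mu B < +oo)%E by case/andP: (ball_measure hBB BB').
  have fI : mu (B `&` E) \is a fin_num.
    rewrite ge0_fin_numE//; apply: le_lt_trans fB.
    by apply: le_measure; rewrite ?inE//; move=> x [].
  have fD : mu (B `\` E) \is a fin_num.
    rewrite ge0_fin_numE//; apply: le_lt_trans fB.
    by apply: le_measure; rewrite ?inE//; move=> x [].
  have eq : (mu B = mu (B `\` E) + mu (B `&` E))%E by rewrite [LHS](measureDI _ mB mE).
  move/negP: nd; rewrite -leNgt eq -(fineK fI) -(fineK fD).
  by rewrite -!EFinM -!EFinD !lee_fin; lra.
have FH B : F B -> B `\` E `<=` H by move=> [DB' _] x [Bx nE]; split=> //; exists B.
have FM B : F B -> vol B <= 2 * (e / (1 + 2 * C0)).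
  move=> FB; rewrite -lee_fin -volE//; last exact: FBB.
  apply: (le_trans (Fhalf _ FB)); rewrite EFinM lee_wpmul2l ?lee_fin//.
  apply: le_trans muH; apply: le_measure; rewrite ?inE//; last exact: FH.
  by apply: measurableD => //; apply: (ball_measurable hBB); exact: FBB.
have [W [WF Wd Wm]] := vitali FBB FM.
have cW : countable W.
  by apply: countable_disjoint_balls => //; exact: subset_trans FBB.
have [] := @countable_cover_measure_le _ _ _ mu W star (fun B => B `\` E) H (2 * C0) cW.
- by move=> A /WF/FBB BA; apply: (ball_measurable hBB); exact: (star_ball hBB).
- move=> A WA; split; last by apply: FH; exact: WF.
  by apply: measurableD => //; apply: (ball_measurable hBB); exact/FBB/WF.
- by [].
- by move=> A B WA WB [x [[Ax _] [Bx _]]]; apply: Wd => //; exists x.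
- by rewrite mulr_ge0// C0_ge0.
- move=> A WA; apply: (le_trans (star_measure hBB (FBB _ (WF _ WA)))).
  rewrite mulrC EFinM -muleA lee_wpmul2l ?lee_fin ?C0_ge0//.
  by apply: Fhalf; exact: WF.
move=> ms le; exists ((E `\` \bigcup_(B in D) B) `|` \bigcup_(A in W) star A); split.
- by apply: measurableU => //; exact: measurableD.
- move=> x [Ex nd]; have [[B DB' Bx]|nx] := pselect ((\bigcup_(B in D) B) x); last by left.
  right; have FB : F B.
    by split=> // dB; apply: nd; exists B; split => //; exact: DB.
  have [A' [WA' AA' leA]] := Wm _ FB.
  exists A' => //; apply: star_absorb AA' leA _ Bx; first exact: FBB.
  exact/FBB/WF.
- apply: (le_trans (measureU2 _ _ _)) => //; first exact: measurableD.
  apply: (le_trans (leeD muE le)).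
  apply: (@le_trans _ _ ((e / (1 + 2 * C0))%:E + (2 * C0)%:E * (e / (1 + 2 * C0))%:E)%E).
    by rewrite leeD2l// lee_wpmul2l// lee_fin mulr_ge0// C0_ge0.
  rewrite -EFinM -EFinD lee_fin -[X in X + _]mul1r -mulrDl mulrC.
  by rewrite divfK// gt_eqF.
Qed.

(** A ball that meets [G] and is larger than half of all the others has a double
    enlargement that swallows them. *)
Lemma ball_hull (G : set S) (K : R) : BB G -> 1 <= K ->
  exists Z, [/\ BB Z, vol Z <= C0 ^+ 2 * (K * vol G) &
    forall A, BB A -> A `&` G !=set0 -> vol A <= K * vol G -> A `<=` Z].
Proof.
move=> BG K1.
pose P A := [/\ BB A, A `&` G !=set0 & vol A <= K * vol G].
have PG : P G.
  split=> //; first by rewrite setIid; exact: ball_neq0.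
  by rewrite ler_peMl// ltW// vol_gt0.
have [|A [BA _ le]|Z [[BZ ZG leZ] mZ]] := @near_maximal _ P vol (K * vol G).
- by exists G.
- by rewrite vol_gt0.
exists (star (star Z)); split.
- by do 2 apply: (star_ball hBB).
- apply: (le_trans (@vol_dil 2 _ BZ)).
  by rewrite ler_wpM2l// exprn_ge0// C0_ge0.
- move=> A BA AG leA; have GZ : G `<=` star Z.
    by apply: star_absorb => //; [rewrite setIC|exact: mZ].
  apply: star_absorb => //; first exact: (star_ball hBB).
    by case: AG => x [Ax Gx]; exists x; split=> //; exact: GZ.
  apply: (@le_trans _ _ (2 * vol Z)); first exact: mZ.
  by rewrite ler_wpM2l//; exact: (@le_vol_dil 1 Z).
Qed.

(** If the measures of the balls through [x0] are bounded, then the enlargement of a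
    nearly largest one absorbs all of them, and they cover the space because any two
    points lie in a ball. *)
Lemma exhausting_balls (x0 : S) :
  (exists B, BB B /\ star B = setT) \/
  exists B : nat -> set S, (forall n, BB (B n) /\ n%:R < vol (B n)) /\
    forall x, exists N, forall n, (N <= n)%N -> star (B n) x.
Proof.
have [[M hM]|nM] := pselect (exists M : R, forall B, BB B -> B x0 -> vol B <= M).
  left; pose P B := BB B /\ B x0.
  have [|A [BA Ax]|Z [[BZ Zx] mZ]] := @near_maximal _ P vol M.
  - by have [B [BB' Bx _]] := ball_pair hBB x0 x0; exists B.
  - by rewrite vol_gt0//=; exact: hM.
  exists Z; split=> //; rewrite -subTset => x _.
  have [B [BB' Bx0 Bx]] := ball_pair hBB x0 x.
  apply: (@star_absorb B) => //; last by apply: mZ; split.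
  by exists x0.
right; have /choice[B hB] (n : nat) : exists B, [/\ BB B, B x0 & n%:R < vol B].
  apply: contrapT => no; apply: nM; exists n%:R => B BB' Bx.
  by rewrite leNgt; apply/negP => lt; apply: no; exists B.
exists B; split=> [n|x]; first by case: (hB n).
have [A [BA Ax0 Ax]] := ball_pair hBB x0 x.
exists (Num.truncn (vol A)).+1 => n Nn; case: (hB n) => BBn Bnx lt.
apply: (@star_absorb A) => //; first by exists x0.
have : (Num.truncn (vol A)).+1%:R <= n%:R :> R by rewrite ler_nat.
have := truncnS_gt (vol A); have := vol_gt0 BBn.
by lra.
Qed.

End balls.

(** * Stopping chains and sparse families *)

Section stopping_chain.
Context {R : realType} {d : measure_display} {S : measurableType d}.
Variable mu : {measure set S -> \bar R}.
Variables (BB : set (set S)) (star : set S -> set S) (C0 : R).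
Hypothesis hBB : ball_basis mu BB star C0.

Local Notation vol := (vol mu).
Local Notation dil := (dil star).
Local Notation dense := (dense mu).

(** Stopping balls are sorted by size into steps of this ratio: six enlargements of a
    ball still have at most half the measure of a ball that is one step larger. *)
Definition ratio : R := (2 * C0 ^+ 6)^-1.
(** So small that a ball dense in the bad set of an enlarged ball is at least three
    steps smaller than that ball. *)
Definition bad_share : R := ratio ^+ 3 / (24 * C0 ^+ 13).

Lemma ratio_gt0 : 0 < ratio.
Proof. by rewrite invr_gt0 mulr_gt0// (C0X_gt0 hBB). Qed.

Lemma ratioE : C0 ^+ 6 * ratio = 2^-1.
Proof.
rewrite /ratio invfM mulrCA divff ?mulr1// gt_eqF//; exact: (C0X_gt0 hBB).
Qed.

Lemma ratio_le : ratio <= 2^-1.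
Proof.
rewrite -ratioE ler_peMl//; [exact: ltW ratio_gt0|exact: (C0X_ge1 hBB)].
Qed.

Lemma bad_share_gt0 : 0 < bad_share.
Proof. by rewrite divr_gt0 ?exprn_gt0 ?ratio_gt0// mulr_gt0// (C0X_gt0 hBB). Qed.

Local Notation kap := (2 * bad_share * C0 ^+ 5).

Lemma kapE : kap * (12 * C0 ^+ 8) = ratio ^+ 3.
Proof.
rewrite /bad_share; have h : C0 ^+ 13 = C0 ^+ 5 * C0 ^+ 8 by rewrite -exprD.
have n5 : C0 ^+ 5 != 0 by rewrite gt_eqF// (C0X_gt0 hBB).
have n8 : C0 ^+ 8 != 0 by rewrite gt_eqF// (C0X_gt0 hBB).
have c0 : C0 != 0 by rewrite gt_eqF// (lt_le_trans ltr01 (C0_ge1 hBB)).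
by rewrite h; field; rewrite ?n5 ?n8 ?c0.
Qed.

Lemma kap_gt0 : 0 < kap.
Proof. by apply: mulr_gt0; [apply: mulr_gt0 => //; exact: bad_share_gt0|exact: (C0X_gt0 hBB)]. Qed.

Lemma kap_le : kap <= ratio ^+ 3.
Proof.
rewrite -kapE ler_peMr//; first exact: ltW kap_gt0.
by have := C0X_ge1 hBB 8; lra.
Qed.

Lemma ratioX_le n : ratio ^+ n.+1 <= 2^-1.
Proof.
elim: n => [|n IH]; first exact: ratio_le.
rewrite exprS; have := ratio_le; have := ratio_gt0.
have : 0 <= ratio ^+ n.+1 by rewrite exprn_ge0// ltW// ratio_gt0.
by nra.
Qed.

Variable H : set S -> set S.
Hypothesis mH : forall Q, BB Q -> measurable (H Q).
Hypothesis leH : forall Q, BB Q -> (mu (H Q) <= (bad_share * vol Q)%:E)%E.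

Lemma le_H_dil c : BB c -> (2%:E * mu (H (dil 5 c)) <= (kap * vol c)%:E)%E.
Proof.
move=> Bc; have Bd := dil_ball hBB 5 Bc.
apply: (@le_trans _ _ (2%:E * (bad_share * vol (dil 5 c))%:E)%E).
  by rewrite lee_wpmul2l ?lee_fin//; exact: leH.
rewrite -EFinM lee_fin; have := vol_dil hBB 5 Bc; have := bad_share_gt0; nra.
Qed.

Lemma vol_dense c A : BB c -> BB A -> dense (H (dil 5 c)) A ->
  vol A < ratio ^+ 3 * vol c.
Proof.
move=> Bc BA; rewrite /dense => lt; rewrite -lte_fin -(volE hBB)//.
apply: (lt_le_trans lt); have Bd := dil_ball hBB 5 Bc.
apply: (@le_trans _ _ (kap * vol c)%:E).
  apply: le_trans (le_H_dil Bc); rewrite lee_wpmul2l// ?lee_fin//.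
  have mA := ball_measurable hBB BA.
  by apply: le_measure; rewrite ?inE; [apply: measurableI => //| |]; try exact: mH; move=> x [].
by rewrite lee_fin ler_wpM2r ?kap_le// ltW// (vol_gt0 hBB).
Qed.

Variable B0 : set S.
Hypothesis BB0 : BB B0.
Local Notation Om := (dil 5 B0).

Let sz j := ratio ^+ j * vol B0.

Let v0 : 0 < vol B0. Proof. exact: (vol_gt0 hBB). Qed.

Let sz0 : sz 0 = vol B0. Proof. by rewrite /sz expr0 mul1r. Qed.

Let szS j : sz j.+1 = ratio * sz j. Proof. by rewrite /sz exprS mulrA. Qed.

Let sz_gt0 j : 0 < sz j.
Proof. by rewrite mulr_gt0// exprn_gt0// ratio_gt0. Qed.

Let szS_lt j : sz j.+1 < sz j.
Proof. by rewrite szS; have := ratio_le; have := ratio_gt0; have := sz_gt0 j; nra. Qed.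

Let le_sz i j : (i <= j)%N -> sz j <= sz i.
Proof.
elim: j => [|j IH]; first by rewrite leqn0 => /eqP ->.
rewrite leq_eqVlt => /orP[/eqP -> //|/IH]; have := szS_lt j; lra.
Qed.

Let sz_inj_le i j : sz i < sz j -> (j < i)%N.
Proof. by move=> lt; rewrite ltnNge; apply/negP => /le_sz; rewrite leNgt lt. Qed.

Implicit Type cur : S -> set S.

(** What would be selected at time [j] because of the point [x]: a nearly largest ball
    around [x] that is dense in the bad set of the ball in charge. The bad set is that
    of the fifth enlargement, which is the ball used for the estimate at [x]. *)
Definition cand cur j x A := [/\ BB A, A x, dense (H (dil 5 (cur x))) A,
  sz j.+1 < vol A & forall A', BB A' -> A' x ->
    dense (H (dil 5 (cur x))) A' -> vol A' <= 2 * vol A].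

(** At time [j] all dense balls larger than the current size have been dealt with. *)
Definition inv j cur := forall x, Om x -> [/\ BB (cur x), dil 5 (cur x) x,
  sz j < vol (cur x), vol (cur x) <= vol B0 &
  forall A, BB A -> A x -> dense (H (dil 5 (cur x))) A -> vol A <= sz j].

(** The ball [c] takes over the point [x]. The last condition is what the step from a
    ball to the next one needs: around [x], balls larger than [dil 4 c] are mostly good. *)
Definition switch cur j x c := [/\ dil 5 c x, sz j.-1 < vol (cur x) &
  forall B, BB B -> B x -> 2 * vol (dil 4 c) < vol B ->
    ~ dense (H (dil 5 (cur x))) B].

(** A point also changes to a selected ball nearby if it has no candidate itself; so
    near the balls selected now no ball in charge remains that is much larger, and later
    descendants of large balls stay away from them. *)
Definition step j cur (W : set (set S)) cur' :=
  [/\ forall A, W A -> BB A /\ exists2 x, Om x & cand cur j x A,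
      forall A B, W A -> W B -> A `&` B !=set0 -> A = B &
      forall x, Om x -> (W (cur' x) /\ switch cur j x (cur' x)) \/
        (cur' x = cur x /\ forall A, W A -> dil 5 A x -> vol (cur x) <= sz j.-1)].

Lemma exists_cand cur j x A : inv j cur -> Om x -> BB A -> A x ->
  dense (H (dil 5 (cur x))) A -> sz j.+1 < vol A -> exists A', cand cur j x A'.
Proof.
move=> iv Ox BA Ax dA lt; have [Bc cx ltc _ _] := iv _ Ox.
pose P A := [/\ BB A, A x, dense (H (dil 5 (cur x))) A & sz j.+1 < vol A].
have [|B [BB' Bx dB _]|A' [[BA' A'x dA' lt'] mx]] :=
  @near_maximal _ _ P vol (ratio ^+ 3 * vol (cur x)).
- by exists A.
- by rewrite (vol_gt0 hBB)//= ltW// vol_dense.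
exists A'; split=> // B BB' Bx dB; have [ltB|leB] := ltP (sz j.+1) (vol B).
  by apply: mx; split.
by have := vol_gt0 hBB BA'; lra.
Qed.

Lemma cand_cur cur j x A : (0 < j)%N -> inv j cur -> Om x -> cand cur j x A ->
  sz j.-1 < vol (cur x).
Proof.
case: j => // j _ iv Ox [BA Ax dA lt _]; have [Bc _ _ _ _] := iv _ Ox.
have := vol_dense Bc BA dA; rewrite /= => lt2.
have : sz j.+2 < ratio ^+ 3 * vol (cur x) by exact: lt_trans lt2.
rewrite !szS !exprS expr0 mulr1 -!mulrA !ltr_pM2l ?ratio_gt0// => lt3.
have := ratio_le; have := ratio_gt0; have := vol_gt0 hBB Bc; nra.
Qed.

(** The Vitali lemma thins the candidates out. A candidate that is discarded meets a
    selected ball of comparable size, whose enlargement contains it and takes over its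
    point. *)
Lemma exists_step j cur : (0 < j)%N -> inv j cur ->
  exists W cur', step j cur W cur' /\ inv j.+1 cur'.
Proof.
move=> j0 iv; pose F A := exists2 x, Om x & cand cur j x A.
have FB A : F A -> BB A by move=> [x _ []].
have FM A : F A -> vol A <= sz j.
  by move=> [x Ox [BA Ax dA _ _]]; have [_ _ _ _] := iv _ Ox; apply.
have [W [WF Wd Wm]] := vitali hBB FB FM; exists W.
have sw x : exists c, Om x -> (W c /\ switch cur j x c) \/
    (c = cur x /\ (forall A, W A -> dil 5 A x -> vol (cur x) <= sz j.-1) /\
     forall A, BB A -> A x -> dense (H (dil 5 (cur x))) A -> vol A <= sz j.+1).
  have [Ox|] := pselect (Om x); last by exists set0.
  have [Bc cx ltc _ dc] := iv _ Ox.
  have [[A cA]|nneed] := pselect (exists A, cand cur j x A).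
    have [BA Ax dA ltA mA] := cA.
    have [|A' [WA' AA' leA]] := Wm A; first by exists x.
    have BA' := FB _ (WF _ WA').
    have sA : A `<=` star A' by exact: (star_absorb hBB).
    exists A' => _; left; split=> //; split.
    - by apply: (@dil_sub _ _ _ _ _ _ _ hBB 1 5) => //; exact: sA.
    - exact: cand_cur cA.
    - move=> B BB' Bx lt dB; have := mA _ BB' Bx dB.
      have : vol A <= vol (dil 4 A').
        apply: (le_vol hBB BA (dil_ball hBB 4 BA')).
        by apply: subset_trans sA _; exact: (@dil_sub _ _ _ _ _ _ _ hBB 1 4).
      by lra.
  have small A : BB A -> A x -> dense (H (dil 5 (cur x))) A -> vol A <= sz j.+1.
    move=> BA Ax dA; rewrite leNgt; apply/negP => lt; apply: nneed.
    exact: exists_cand lt.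
  have [[A' [WA' A'x lt]]|no] :=
    pselect (exists A', [/\ W A', dil 5 A' x & sz j.-1 < vol (cur x)]).
    exists A' => _; left; split=> //; split=> // B BB' Bx ltB dB.
    have [BA' [y _ [_ _ _ ltA' _]]] : BB A' /\ F A' by split; [apply: FB|]; exact: WF.
    have := small _ BB' Bx dB; have := le_vol_dil hBB 4 BA'.
    have := vol_gt0 hBB BA'; lra.
  exists (cur x) => _; right; split=> //; split=> // A WA Ax.
  by rewrite leNgt; apply/negP => lt; apply: no; exists A.
have /choice[cur' hc] := sw; exists cur'; split.
  split=> // [A WA|x Ox]; first by split; [exact/FB/WF|exact: WF].
  have [|[-> [? ?]]] := hc _ Ox; first by left.
  by right.
move=> x Ox; have [Bc cx ltc lec dc] := iv _ Ox.
have [[Wc [c5 _ _]]|[-> [_ sm]]] := hc _ Ox; last first.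
  by split=> //; exact: lt_trans (szS_lt j) ltc.
have Bc' := FB _ (WF _ Wc); have [y Oy [_ _ _ lt _]] := WF _ Wc.
have le := FM _ (WF _ Wc).
split=> //; first by apply: (le_trans le); have := le_sz (leq0n j); rewrite /sz expr0 mul1r.
move=> A BA Ax dA; have := vol_dense Bc' BA dA.
rewrite szS => lt2; apply: ltW; apply: (lt_le_trans lt2).
apply: (@le_trans _ _ (ratio ^+ 3 * sz j)).
  by rewrite ler_pM2l// exprn_gt0// ratio_gt0.
rewrite ler_pM2r// exprS ler_piMr//; first exact: ltW ratio_gt0.
by have := ratioX_le 1; lra.
Qed.

Lemma inv_root : inv 1 (fun=> B0).
Proof.
move=> x Ox; split=> //.
  by rewrite /sz expr1 gtr_pMl//; have := ratio_le; lra.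
move=> A BA Ax dA; apply: ltW; apply: (lt_le_trans (vol_dense BB0 BA dA)).
rewrite /sz expr1 ler_pM2r// exprS ler_piMr//; first exact: ltW ratio_gt0.
by have := ratioX_le 1; lra.
Qed.

(** Here [W j] are the stopping balls selected at time [j], and [c j x] is the stopping
    ball in charge of [x] at that time. *)
Lemma exists_history : exists (W : nat -> set (set S)) (c : nat -> S -> set S),
  [/\ W 0%N = [set B0], c 1%N = (fun=> B0),
      forall j, (0 < j)%N -> inv j (c j) &
      forall j, (0 < j)%N -> step j (c j) (W j) (c j.+1)].
Proof.
have /choice[f hf] (p : nat * (S -> set S)) : exists q : set (set S) * (S -> set S),
    (0 < p.1)%N -> inv p.1 p.2 -> step p.1 p.2 q.1 q.2 /\ inv p.1.+1 q.2.
  have [[j0 iv]|no] := pselect ((0 < p.1)%N /\ inv p.1 p.2).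
    by have [W [c' ?]] := exists_step j0 iv; exists (W, c').
  by exists (set0, p.2) => ? ?; exfalso; exact: no.
pose cc := fix cc n := if n is n'.+1 then (f (n'.+1, cc n')).2 else (fun=> B0) : S -> set S.
have iv n : inv n.+1 (cc n).
  elim: n => [|n IH]; first exact: inv_root.
  by have [] := hf (n.+1, cc n) isT IH.
exists (fun j => if j is j'.+1 then (f (j'.+1, cc j')).1 else [set B0]), (fun j => cc j.-1).
split=> // [[//|j] _|[//|j] _]; first exact: iv.
by have [] := hf (j.+1, cc j) isT (iv j).
Qed.

Section history.
Variables (W : nat -> set (set S)) (c : nat -> S -> set S).
Hypothesis W0 : W 0%N = [set B0].
Hypothesis c1 : c 1%N = (fun=> B0).
Hypothesis c_inv : forall j, (0 < j)%N -> inv j (c j).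
Hypothesis c_step : forall j, (0 < j)%N -> step j (c j) (W j) (c j.+1).

Lemma W_ball j A : W j A -> BB A.
Proof.
case: j => [|j]; first by rewrite W0 => ->.
by have [h _ _] := c_step (ltn0Sn j) => /h[].
Qed.

Lemma W_window j A : W j A -> sz j.+1 < vol A <= sz j.
Proof.
case: j => [|j].
  by rewrite W0 => ->; rewrite -[X in _ < X <= _]mul1r -[X in X * _](expr0 ratio) szS_lt lexx.
have [h _ _] := c_step (ltn0Sn j) => /h[BA [x Ox [_ Ax dA lt _]]].
by rewrite lt/=; have [_ _ _ _] := c_inv (ltn0Sn j) Ox; apply.
Qed.

Lemma W_le j A k : W j A -> sz k.+1 < vol A -> (j <= k)%N.
Proof.
by move=> /W_window/andP[_ le] lt; have := sz_inj_le (lt_le_trans lt le); rewrite ltnS.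
Qed.

Lemma W_ge j A k : W j A -> vol A <= sz k -> (k <= j)%N.
Proof.
by move=> /W_window/andP[lt _] le; have := sz_inj_le (lt_le_trans lt le); rewrite ltnS.
Qed.

Lemma W_inj i j A : W i A -> W j A -> i = j.
Proof.
move=> Wi Wj; have /andP[li ui] := W_window Wi; have /andP[lj uj] := W_window Wj.
by apply/eqP; rewrite eqn_leq (W_le Wi lj) (W_le Wj li).
Qed.

Lemma W_disj j A B : W j A -> W j B -> A `&` B !=set0 -> A = B.
Proof.
case: j => [|j]; first by rewrite W0 => -> ->.
by have [_ + _] := c_step (ltn0Sn j); apply.
Qed.

Lemma c_persist x i j : Om x -> (0 < i)%N -> (i <= j)%N ->
  c j x = c i x \/ vol (c j x) <= sz i.
Proof.
move=> Ox i0; elim: j => [|j IH]; first by rewrite leqNgt i0.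
rewrite leq_eqVlt => /orP[/eqP ->|]; first by left.
rewrite ltnS => ij; have j0 := leq_trans i0 ij.
have [_ _ /(_ _ Ox)[[Wc _]|[-> _]]] := c_step j0; last exact: IH.
by right; have /andP[_ le] := W_window Wc; apply: (le_trans le); exact: le_sz.
Qed.

Lemma c_vol_mono x i j : Om x -> (0 < i)%N -> (i <= j)%N ->
  vol (c j x) <= vol (c i x).
Proof.
move=> Ox i0 ij; have [->//|le] := c_persist Ox i0 ij.
by apply: (le_trans le); have [_ _ /ltW] := c_inv i0 Ox.
Qed.

Lemma c_origin x j : Om x -> (0 < j)%N ->
  c j x = B0 \/ exists2 i, (0 < i < j)%N & W i (c j x).
Proof.
move=> Ox; case: j => // j _; elim: j => [|j IH]; first by rewrite c1; left.
have [_ _ /(_ _ Ox)[[Wc _]|[-> _]]] := c_step (ltn0Sn j).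
  by right; exists j.+1 => //=.
have [|[i /andP[i0 ij] Wi]] := IH; first by left.
by right; exists i => //; rewrite i0 /= (leq_trans ij).
Qed.

Definition later A := exists2 j, (0 < j)%N & W j A.

(** The parent is the ball in whose bad set [A] is dense. *)
Definition parent_of (A p : set S) := exists j x, [/\ (0 < j)%N, W j A, Om x,
  cand (c j) j x A & p = c j x].

(** Two children of the same time are disjoint by the Vitali lemma. If the larger one
    came first, then it would have taken over the point to which the smaller one
    belongs, and the latter would have another parent. *)
Lemma siblings_disjoint A A' p : parent_of A p -> parent_of A' p ->
  A `&` A' !=set0 -> A = A'.
Proof.
wlog: A A' / vol A' <= vol A.
  move=> wl PA PA' AA'; have [le|/ltW le] := leP (vol A') (vol A); first exact: wl.
  by apply/esym/wl => //; rewrite setIC.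
move=> leA [i [x [i0 Wi Ox cx ->]]] [j [y [j0 Wj Oy cy ceq]]] AA'.
have [BA Ax dA ltA mA] := cx; have [BA' Ay dA' _ _] := cy.
have ij : (i <= j)%N.
  by apply: (W_ge Wj); apply: (le_trans leA); have /andP[] := W_window Wi.
move: ij; rewrite leq_eqVlt => /orP[/eqP eij|ij].
  by move: Wj; rewrite -eij => Wj; exact: W_disj Wi Wj AA'.
exfalso; have big := cand_cur i0 (c_inv i0) Ox cx.
have ci : c i y = c j y.
  have [//|le] := c_persist Oy i0 (ltnW ij).
  have [_ _ lt _ _] := c_inv i0 Ox.
  by move: le; rewrite -ceq leNgt lt.
have Ay5 : dil 5 A y.
  apply: (@dil_sub _ _ _ _ _ _ _ hBB 1 5) => //.
  apply: (star_absorb hBB BA' BA) => //; first by rewrite setIC.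
  by have := vol_gt0 hBB BA; lra.
have [_ _ /(_ _ Oy)[[Wc _]|[_ /(_ _ Wi Ay5)]]] := c_step i0; last first.
  by rewrite ci -ceq leNgt big.
have le1 : vol (c i.+1 y) <= sz i by have /andP[] := W_window Wc.
have := c_vol_mono Oy (ltn0Sn i) ij; rewrite -ceq.
have [_ _ lt _ _] := c_inv i0 Ox; lra.
Qed.

(** The first [n] generations of descendants. *)
Fixpoint desc n (p : set S) : set (set S) := if n is n'.+1 then
  [set A | later A /\ (parent_of A p \/ exists2 B, later B /\ parent_of B p & desc n' B A)]
  else set0.

Lemma desc_child n p A A' : later A' -> desc n p A -> parent_of A' A -> desc n.+1 p A'.
Proof.
move=> lA'; elim: n p => //= n IH p [lA [pA|[B [lB pB] dB]]] pA'.
  by split=> //; right; exists A => //; split=> //; left.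
by split=> //; right; exists B => //; exact: IH.
Qed.

Definition kids p := [set A | later A /\ parent_of A p].

Lemma later_ball A : later A -> BB A. Proof. by move=> [j _ /W_ball]. Qed.

Lemma countable_kids p : countable (kids p).
Proof.
apply: (countable_disjoint_balls hBB) => [A [/later_ball//]|A B [_ pA] [_ pB]].
exact: siblings_disjoint pA pB.
Qed.

(** Disjoint children are dense in the bad set of their parent, so all of them together
    have a small part of its measure, and further generations form a geometric series.
    The induction goes from the parent downwards, because the bound is then the same for
    all [n]. *)
Lemma desc_measure n p : BB p -> measurable (\bigcup_(A in desc n p) A) /\
  (mu (\bigcup_(A in desc n p) A) <= (2 * kap * vol p)%:E)%E.
Proof.
elim: n p => [|n IH] p Bp /=.
  rewrite bigcup_set0 measure0; split=> //; rewrite lee_fin.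
  apply: mulr_ge0; last exact/ltW/(vol_gt0 hBB).
  by rewrite mulr_ge0// ltW// kap_gt0.
have -> : \bigcup_(A in desc n.+1 p) A =
    \bigcup_(A in kids p) (A `|` \bigcup_(B in desc n A) B).
  apply/seteqP; split=> [x [A /= [lA [pA|[B [lB pB] dB]]] Ax]|x [A [lA pA]]].
  - by exists A => //; left.
  - by exists B => //; right; exists A.
  - move=> [Ax|[B dB Bx]]; first by exists A => //; split=> //; left.
    exists B => //; split; last by right; exists A.
    by case: n dB {IH} => // n [].
have [] := @countable_cover_measure_le _ _ _ mu (kids p)
    (fun A => A `|` \bigcup_(B in desc n A) B) (fun A => A `&` H (dil 5 p))
    (H (dil 5 p)) 4 (countable_kids p).
- move=> A [lA _]; apply: measurableU; first exact: (ball_measurable hBB (later_ball lA)).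
  by have [] := IH _ (later_ball lA).
- move=> A [lA _]; split; last by move=> x [].
  apply: measurableI; first exact: (ball_measurable hBB (later_ball lA)).
  by apply: mH; exact: (dil_ball hBB).
- by apply: mH; exact: (dil_ball hBB).
- move=> A B [_ pA] [_ pB] [x [[Ax _] [Bx _]]].
  by apply: siblings_disjoint pA pB _; exists x.
- by [].
- move=> A [lA pA]; have BA := later_ball lA; have [mD lD] := IH _ BA.
  apply: (@le_trans _ _ (mu A + mu (\bigcup_(B in desc n A) B))%E).
    by apply: measureU2 => //; exact: (ball_measurable hBB).
  apply: (@le_trans _ _ ((vol A)%:E + (2 * kap * vol A)%:E)%E).
    by rewrite (volE hBB BA) leeD2l.
  apply: (@le_trans _ _ (2%:E * (vol A)%:E)%E).
    rewrite -EFinD -EFinM lee_fin; have := vol_gt0 hBB BA.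
    by have := kap_le; have := ratioX_le 2; nra.
  have [j [x [_ _ _ [_ _ /ltW dA _ _] ->]]] := pA.
  rewrite -(volE hBB BA).
  have -> : (4%:E = 2%:E * 2%:E :> \bar R)%E by rewrite -EFinM; congr EFin; lra.
  by rewrite -muleA lee_wpmul2l// lee_fin.
move=> m le; split => //; apply: (le_trans le).
have -> : (4%:E = 2%:E * 2%:E :> \bar R)%E by rewrite -EFinM; congr EFin; lra.
rewrite -muleA; apply: (@le_trans _ _ (2%:E * (kap * vol p)%:E)%E).
  by rewrite lee_wpmul2l ?lee_fin//; exact: le_H_dil.
by rewrite -EFinM lee_fin !mulrA.
Qed.

Definition family p := \bigcup_n \bigcup_(A in desc n p) A.

Lemma desc_mono n p : desc n p `<=` desc n.+1 p.
Proof.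
elim: n p => [|n IH] p A //= [lA [pA|[B [lB pB] dB]]]; split=> //; first by left.
by right; exists B => //; apply: IH.
Qed.

Lemma family_measure p : BB p -> measurable (family p) /\
  (mu (family p) <= (2 * kap * vol p)%:E)%E.
Proof.
move=> Bp; pose F n := \bigcup_(A in desc n p) A.
have mF n : measurable (F n) by have [] := desc_measure n Bp.
split; first by apply: bigcup_measurable => k _; exact: mF.
have nd : nondecreasing_seq F.
  apply/nondecreasing_seqP => n; apply/subsetPset => x [A dA Ax].
  by exists A => //; exact: desc_mono.
have cv := @nondecreasing_cvg_mu _ _ _ mu F mF (bigcup_measurable (fun k _ => mF k)) nd.
have := @cvg_lim _ _ _ _ _ _ _ cv => /(_ _) <-//.
apply: lime_le; first by apply/cvg_ex; exists (mu (\bigcup_n F n)).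
by apply: nearW => n /=; have [] := desc_measure n Bp.
Qed.

(** Ascending from parent to parent one passes from the late balls to the first one that
    is not late. Each parent is so much larger than its child that its sixth enlargement
    absorbs that of the child. *)
Lemma late_ancestor i A j : W i A -> (j.+1 < i)%N -> exists a p n,
  [/\ later a, vol a <= sz j.+2 & dil 6 A `<=` dil 6 a] /\
  [/\ parent_of a p, sz j.+2 < vol p & desc n p A].
Proof.
elim/ltn_ind: i A => i IH A WA ji; have i0 : (0 < i)%N by exact: leq_trans ji.
have lA : later A by exists i.
have [h _ _] := c_step i0; have [BA [x Ox cA]] := h _ WA.
have [_ Ax dA _ _] := cA.
have pA : parent_of A (c i x) by exists i, x.
have [Bq qx ltq leq dq] := c_inv i0 Ox.
have leA : vol A <= sz j.+2.
  by have /andP[_ le] := W_window WA; apply: (le_trans le); exact: le_sz.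
have [lt|le] := ltP (sz j.+2) (vol (c i x)).
  by exists A, (c i x), 1%N; split; split=> //; split=> //; left.
have [e|[k /andP[k0 ki] Wk]] := c_origin Ox i0.
  exfalso; move: le; rewrite e -sz0; have := szS_lt 0.
  by have := le_sz (isT : 1 <= j.+2)%N; lra.
have jk := W_ge Wk le.
have [a [p [n [[la ua sa] [pa lp da]]]]] := IH k ki _ Wk jk.
exists a, p, n.+1; split; split=> //; last exact: desc_child da pA.
apply: subset_trans sa.
apply: (star_absorb hBB (dil_ball hBB 6 BA) (dil_ball hBB 5 Bq)).
  by exists x; split=> //; exact: (sub_dil hBB).
apply: (le_trans (vol_dil hBB 6 BA)); have := vol_dense Bq BA dA.
have := le_vol_dil hBB 5 Bq; have := vol_gt0 hBB Bq => vq lev lt.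
have : C0 ^+ 6 * vol A <= C0 ^+ 6 * (ratio ^+ 3 * vol (c i x)).
  by rewrite ler_wpM2l ?(ltW lt)// ltW// (C0X_gt0 hBB).
have -> : C0 ^+ 6 * (ratio ^+ 3 * vol (c i x)) =
  C0 ^+ 6 * ratio * (ratio ^+ 2 * vol (c i x)) by ring.
rewrite ratioE => le2; apply: (le_trans le2).
by have := ratioX_le 1; have := exprn_gt0 2 ratio_gt0; nra.
Qed.

Definition late j A := exists2 i, (j.+1 < i)%N & W i A.

(** The balls selected late descend from balls [p] of three consecutive sizes near that
    of [A]; these lie in a bounded enlargement of [A], are disjoint for each of the
    sizes, and their families are small. *)
Lemma late_measure j A : W j A ->
  measurable (\bigcup_(A' in [set A' | late j A' /\ A' `&` A !=set0]) A') /\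
  (2%:E * mu (\bigcup_(A' in [set A' | late j A' /\ A' `&` A !=set0]) A') <= mu A)%E.
Proof.
move=> WA; have BA := W_ball WA; have BsA := star_ball hBB BA.
have /andP[ltA leA] := W_window WA.
pose K := C0 ^+ 5 / ratio ^+ 2.
have K1 : 1 <= K.
  rewrite ler_pdivlMr ?exprn_gt0 ?ratio_gt0// mul1r.
  by apply: le_trans (C0X_ge1 hBB 5); have := ratioX_le 1; lra.
have [Z [BZ leZ hZ]] := ball_hull hBB BsA K1.
pose Q k := [set q | W (j + k).-1 q /\ q `<=` Z].
have Qb k q : Q k q -> BB q by move=> [/W_ball].
have cQ k : countable (Q k).
  apply: (countable_disjoint_balls hBB); first exact: Qb.
  by move=> B B' [WB _] [WB' _]; exact: W_disj WB WB'.
have mQ k : measurable (\bigcup_(q in Q k) family q) /\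
    (mu (\bigcup_(q in Q k) family q) <= (2 * kap)%:E * mu Z)%E.
  apply: (@countable_cover_measure_le _ _ _ mu (Q k) family id Z) => //.
  - by move=> q /Qb Bq; have [] := family_measure Bq.
  - by move=> q [Wq qZ]; split=> //; exact: (ball_measurable hBB (W_ball Wq)).
  - exact: (ball_measurable hBB).
  - by move=> B B' [WB _] [WB' _]; exact: W_disj WB WB'.
  - by rewrite mulr_ge0// ltW// kap_gt0.
  - by move=> q /Qb Bq; rewrite (volE hBB Bq) -EFinM; have [] := family_measure Bq.
have mL : measurable (\bigcup_(A' in [set A' | late j A' /\ A' `&` A !=set0]) A').
  apply: measurable_countable_bigcup; last first.
    by move=> B [[i _ WB] _]; exact: (ball_measurable hBB (W_ball WB)).
  apply: (@sub_countable _ _ _ (\bigcup_i W i)).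
    by apply: subset_card_le => B [[i _ WB] _]; exists i.
  apply: bigcup_countable => // i _; apply: (countable_disjoint_balls hBB).
    by move=> B; exact: W_ball.
  by move=> B B' WB WB'; exact: W_disj WB WB'.
split=> //.
have sub : \bigcup_(A' in [set A' | late j A' /\ A' `&` A !=set0]) A' `<=`
    \bigcup_(q in Q 0%N) family q `|` (\bigcup_(q in Q 1%N) family q `|`
     \bigcup_(q in Q 2%N) family q).
  move=> z [A' [[i ji WA'] A'A] A'z].
  have [a [p [n [[la ua sa] [pa lp da]]]]] := late_ancestor WA' ji.
  have Ba := later_ball la.
  have sa' : dil 6 a `<=` star A.
    apply: (star_absorb hBB (dil_ball hBB 6 Ba) BA).
      have [t [t1 t2]] := A'A; exists t; split=> //; apply: sa.
      exact: (sub_dil hBB 6 (W_ball WA')).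
    apply: (le_trans (vol_dil hBB 6 Ba)).
    have : C0 ^+ 6 * vol a <= C0 ^+ 6 * sz j.+2 by rewrite ler_wpM2l// ltW// (C0X_gt0 hBB).
    by rewrite szS mulrA ratioE; have := sz_gt0 j.+1; lra.
  have [k [x [k0 Wk Ox [_ ax _ _ _] pE]]] := pa.
  have jk : (j.+1 < k)%N by exact: W_ge Wk ua.
  have [Bp px _ pB0 _] := c_inv k0 Ox; rewrite -pE in Bp px pB0.
  have sAx : star A x by apply: sa'; exact: (sub_dil hBB 6 Ba).
  have lep : vol p <= sz j.-1.
    case: j => [|j'] in WA jk ltA leA lp ji ua Q Qb cQ mQ mL *.
      by rewrite /= /sz expr0 mul1r.
    have Ax5 : dil 5 A x by exact: (@dil_sub _ _ _ _ _ _ _ hBB 1 5).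
    have le1 : vol (c j'.+2 x) <= sz j'.
      have [_ _ /(_ _ Ox)[[Wc _]|[-> /(_ _ WA Ax5)//]]] := c_step (ltn0Sn j').
      by have /andP[_ le] := W_window Wc; apply: (le_trans le); exact: ltW (szS_lt j').
    by rewrite pE; apply: le_trans le1; apply: c_vol_mono => //; exact: ltnW.
  have lep' : vol p <= sz j / ratio.
    case: j => [|j'] in lep {WA jk ltA leA lp ji ua Q Qb cQ mQ mL} *.
      apply: (le_trans lep); rewrite ler_pdivlMr ?ratio_gt0//= ler_piMr//.
      - exact/ltW/sz_gt0.
      - by have := ratio_le; lra.
    by rewrite szS mulrC mulKf// gt_eqF// ratio_gt0.
  have pZ : p `<=` Z.
    apply: subset_trans (sub_dil hBB 5 Bp) _; apply: hZ.
    - exact: (dil_ball hBB).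
    - by exists x.
    apply: (le_trans (vol_dil hBB 5 Bp)).
    apply: (@le_trans _ _ (K * vol A)); last first.
      rewrite ler_wpM2l//; first exact: le_trans K1.
      exact: (le_vol_dil hBB 1 BA).
    rewrite /K -mulrA ler_wpM2l//; first exact/ltW/(C0X_gt0 hBB).
    apply: (le_trans lep'); rewrite expr2 invfM mulrC -mulrA ler_wpM2l//.
      by rewrite invr_ge0; exact/ltW/ratio_gt0.
    by rewrite mulrC ler_pdivlMr ?ratio_gt0// mulrC -szS ltW.
  have [t Wt] : exists t, W t p.
    have [e|[t _ Wt]] := c_origin Ox k0; last by exists t; rewrite pE.
    by exists 0%N; rewrite W0 pE e.
  have jt : (j.-1 <= t)%N by exact: W_ge Wt lep.
  have tj : (t <= j.+1)%N by exact: W_le Wt lp.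
  have Fz : family p z by exists n => //; exists A'.
  have [e|[e|e]] : t = (j + 0).-1 \/ t = (j + 1).-1 \/ t = (j + 2).-1.
    by move: jt tj; clear; lia.
  - by left; exists p => //; split=> //; rewrite -e.
  - by right; left; exists p => //; split=> //; rewrite -e.
  - by right; right; exists p => //; split=> //; rewrite -e.
have le : (mu (\bigcup_(A' in [set A' | late j A' /\ A' `&` A !=set0]) A') <=
    (2 * kap)%:E * mu Z + ((2 * kap)%:E * mu Z + (2 * kap)%:E * mu Z))%E.
  apply: (@le_trans _ _ (mu (\bigcup_(q in Q 0%N) family q `|`
     (\bigcup_(q in Q 1%N) family q `|` \bigcup_(q in Q 2%N) family q)))).
    apply: le_measure sub; rewrite inE//.
    by apply: measurableU; [case: (mQ 0%N)|apply: measurableU; [case: (mQ 1%N)|case: (mQ 2%N)]].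
  apply: (le_trans (measureU2 _ _ _)).
  - by case: (mQ 0%N).
  - by apply: measurableU; [case: (mQ 1%N)|case: (mQ 2%N)].
  apply: leeD; first by case: (mQ 0%N).
  apply: (le_trans (measureU2 _ _ _)); first by case: (mQ 1%N).
    by case: (mQ 2%N).
  by apply: leeD; [case: (mQ 1%N)|case: (mQ 2%N)].
apply: (le_trans (lee_wpmul2l _ le)) => //.
have -> : ((2 * kap)%:E * mu Z = (2 * kap * vol Z)%:E)%E.
  by rewrite (volE hBB BZ) EFinM.
rewrite (volE hBB BA) -!EFinD -EFinM lee_fin.
have leZ' : vol Z <= C0 ^+ 8 / ratio ^+ 2 * vol A.
  apply: (le_trans leZ); rewrite /K.
  have h : C0 ^+ 8 = C0 ^+ 2 * C0 ^+ 5 * C0 ^+ 1 by rewrite -!exprD.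
  have -> : C0 ^+ 8 / ratio ^+ 2 * vol A =
    C0 ^+ 2 * (C0 ^+ 5 / ratio ^+ 2 * (C0 ^+ 1 * vol A)) by rewrite h; ring.
  rewrite ler_wpM2l ?(ltW (C0X_gt0 hBB _))// ler_wpM2l//; first exact: le_trans K1.
  exact: (vol_dil hBB 1 BA).
apply: (@le_trans _ _ (12 * kap * (C0 ^+ 8 / ratio ^+ 2 * vol A))).
  have := kap_gt0; nra.
have -> : 12 * kap * (C0 ^+ 8 / ratio ^+ 2 * vol A) =
  (kap * (12 * C0 ^+ 8)) / ratio ^+ 2 * vol A by ring.
rewrite kapE exprS mulfK ?gt_eqF ?exprn_gt0 ?ratio_gt0//.
by rewrite ler_piMl//; [exact/ltW/(vol_gt0 hBB)|have := ratio_le; lra].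
Qed.

Definition stock := [set A | exists j, W j A].

Lemma countable_stock : countable stock.
Proof.
apply: (@sub_countable _ _ _ (\bigcup_i W i)).
  by apply: subset_card_le => A [i Wi]; exists i.
apply: bigcup_countable => // i _; apply: (countable_disjoint_balls hBB).
  by move=> A; exact: W_ball.
by move=> A B WA WB; exact: W_disj WA WB.
Qed.

(** Balls of the next time may overlap with [A], hence the two parity classes. *)
Definition core A := A `\` \bigcup_(A' in [set A' | exists i j,
  [/\ W j A, W i A' & (j.+1 < i)%N]]) A'.

Lemma core_measure j A : W j A -> measurable (core A) /\ (mu A <= 2%:E * mu (core A))%E.
Proof.
move=> WA; have BA := W_ball WA; have mA := ball_measurable hBB BA.
have [mL leL] := late_measure WA.
set L := \bigcup_(A' in _) A' in mL leL.
have eL : core A = A `\` L.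
  apply/seteqP; split=> x [Ax nx]; split=> //.
    move=> [A' [[i ji Wi] _] A'x].
    by apply: nx; exists A' => //; exists i, j.
  move=> [A' [i [k [WA' Wk ki]]] A'x]; apply: nx; exists A' => //.
  by split; [exists i => //; rewrite (W_inj WA WA')|exists x].
rewrite eL; split; first exact: measurableD.
have fA : mu A \is a fin_num by rewrite (volE hBB BA).
have fL : mu (A `&` L) \is a fin_num.
  rewrite ge0_fin_numE//; apply: (@le_lt_trans _ _ (mu A)); last by rewrite ltey_eq fA.
  by apply: le_measure; rewrite ?inE; [exact: measurableI| |move=> x []].
have fD : mu (A `\` L) \is a fin_num.
  rewrite ge0_fin_numE//; apply: (@le_lt_trans _ _ (mu A)); last by rewrite ltey_eq fA.
  by apply: le_measure; rewrite ?inE; [exact: measurableD| |move=> x []].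
have eq : (mu A = mu (A `\` L) + mu (A `&` L))%E by rewrite [LHS](measureDI _ mA mL).
have le2 : (2%:E * mu (A `&` L) <= mu A)%E.
  apply: le_trans leL; rewrite lee_wpmul2l ?lee_fin//.
  by apply: le_measure; rewrite ?inE; [exact: measurableI| |move=> x []].
move: le2; rewrite eq -(fineK fL) -(fineK fD) -EFinD -!EFinM !lee_fin; lra.
Qed.

Lemma core_disjoint i j A B : W i A -> W j B -> odd i = odd j ->
  core A `&` core B !=set0 -> A = B.
Proof.
wlog: i j A B / (i <= j)%N.
  move=> wl WA WB o AB; case/orP: (leq_total i j) => ij; first exact: (wl i j).
  by apply/esym; apply: (wl j i) => //; rewrite setIC.
rewrite leq_eqVlt => /orP[/eqP <- WA WB _ [x [[Ax _] [Bx _]]]|ij WA WB o].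
  by apply: (W_disj WA WB); exists x.
move=> [x [[Ax nx] [Bx _]]]; exfalso; apply: nx; exists B => //; exists j, i.
split=> //; rewrite ltn_neqAle ij andbT; apply/eqP => e.
by move: o; rewrite -e /=; case: (odd i).
Qed.

Lemma W_sub_Om2 j A : W j A -> A `<=` dil 6 B0.
Proof.
case: j => [|j]; first by rewrite W0 => ->; exact: (sub_dil hBB).
have [h _ _] := c_step (ltn0Sn j) => WA.
have [BA [x Ox [_ Ax _ _ _]]] := h _ WA.
apply: (star_absorb hBB BA (dil_ball hBB 5 BB0)); first by exists x.
have [_ _ _ _ h2] := c_inv (ltn0Sn j) Ox.
have /andP[_ le] := W_window WA; have := le_sz (leq0n j.+1); rewrite sz0.
by have := le_vol_dil hBB 5 BB0; have := v0; lra.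
Qed.

(** The sets with even and with odd index are two disjoint families. *)
Lemma sum_measure_almost_disjoint (Z : nat -> set S) (Y : set S) :
  (forall n, measurable (Z n)) -> measurable Y -> (forall n, Z n `<=` Y) ->
  (forall i j, (i.+1 < j)%N -> Z i `&` Z j = set0) ->
  (\sum_(n <oo) mu (Z n) <= mu Y + mu Y)%E.
Proof.
move=> mZ mY ZY Zd; pose a n := mu (\big[setU/set0]_(k < n) Z k).
have mb n : measurable (\big[setU/set0]_(k < n) Z k).
  by apply: bigsetU_measurable.
have aS n : (a n + mu (Z n.+1) <= a n.+2)%E.
  rewrite /a -measureU//; last first.
    rewrite -subset0 => x [+ Znx]; rewrite -(bigcup_mkord n Z) => -[k kn Zkx].
    by rewrite -(Zd k n.+1) ?ltnS//; split.
  apply: le_measure; rewrite ?inE//; first exact: measurableU.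
  move=> x; rewrite -!bigcup_mkord => -[[k kn Zk]|Zn]; last by exists n.+1 => /=.
  by exists k => //=; rewrite (ltn_trans kn)// ltnS.
have sa n : (\sum_(0 <= k < n.+1) mu (Z k) <= a n.+1 + a n)%E.
  elim: n => [|n IH]; first by rewrite big_nat1 /a big_ord1 leeDl.
  rewrite big_nat_recr//=; apply: (le_trans (leeD2r _ IH)).
  by rewrite -addeA addeC; apply: leeD2r; exact: aS.
have aY n : (a n <= mu Y)%E.
  apply: le_measure; rewrite ?inE//.
  by rewrite -bigcup_mkord => x [k _]; exact: ZY.
apply: lime_le; first exact: is_cvg_nneseries.
apply: nearW => n; apply: (@le_trans _ _ (\sum_(0 <= k < n.+1) mu (Z k))%E).
  by rewrite big_nat_recr//= leeDl.
by apply: (le_trans (sa n)); exact: leeD.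
Qed.

(** The lemma of Borel and Cantelli: up to a constant, the measures of the enlarged
    stopping balls are dominated by those of their cores, which have a finite sum. *)
Lemma negligible_infinite_switch :
  mu.-negligible [set x | forall n, exists2 j, (n <= j)%N &
    (\bigcup_(A in W j) dil 5 A) x].
Proof.
pose U j := \bigcup_(A in W j) dil 5 A; pose Z j := \bigcup_(A in W j) core A.
have cW j : countable (W j).
  by apply: sub_countable countable_stock; apply: subset_card_le => A WA; exists j.
have mU j : measurable (U j).
  apply: measurable_countable_bigcup => // A WA; apply: (ball_measurable hBB).
  by apply: (dil_ball hBB); exact: W_ball WA.
have mZ j : measurable (Z j).
  by apply: measurable_countable_bigcup => // A WA; have [] := core_measure WA.
have ZY j : Z j `<=` dil 6 B0 by move=> x [A WA [Ax _]]; exact: W_sub_Om2 WA _ Ax.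
have mY : measurable (dil 6 B0) by apply: (ball_measurable hBB); exact: (dil_ball hBB).
have Zd i j : (i.+1 < j)%N -> Z i `&` Z j = set0.
  move=> ij; rewrite -subset0 => x [[A WA [Ax nx]] [B WB [Bx _]]].
  by apply: nx; exists B => //; exists j, i.
have UZ j : (mu (U j) <= (C0 ^+ 5 * 2)%:E * mu (Z j))%E.
  have [] := @countable_cover_measure_le _ _ _ mu (W j) (dil 5) core (Z j) (C0 ^+ 5 * 2).
  - exact: cW.
  - by move=> A WA; apply: (ball_measurable hBB); apply: (dil_ball hBB); exact: W_ball WA.
  - by move=> A WA; split; [have [] := core_measure WA|move=> x cx; exists A].
  - exact: mZ.
  - by move=> A B WA WB; exact: core_disjoint WA WB _.
  - by rewrite mulr_ge0// ltW// (C0X_gt0 hBB).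
  - move=> A WA; have BA := W_ball WA; have [_ le] := core_measure WA.
    apply: (@le_trans _ _ ((C0 ^+ 5)%:E * mu A)%E).
      rewrite (volE hBB BA) (volE hBB (dil_ball hBB 5 BA)) -EFinM lee_fin.
      exact: (vol_dil hBB).
    by rewrite (EFinM (C0 ^+ 5) 2) -muleA lee_wpmul2l// lee_fin ltW// (C0X_gt0 hBB).
  - by [].
have fin : (\sum_(n <oo) mu (U n) < +oo)%E.
  apply: (@le_lt_trans _ _ (\sum_(n <oo) (C0 ^+ 5 * 2)%:E * mu (Z n))%E).
    by apply: lee_nneseries.
  rewrite nneseriesZl//.
  apply: (@le_lt_trans _ _ ((C0 ^+ 5 * 2)%:E * (mu (dil 6 B0) + mu (dil 6 B0)))%E).
    rewrite lee_wpmul2l//; first by rewrite lee_fin mulr_ge0// ltW// (C0X_gt0 hBB).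
    exact: sum_measure_almost_disjoint.
  by rewrite (volE hBB (dil_ball hBB 6 BB0)) -EFinD -EFinM ltry.
exists (lim_sup_set U); split.
- by apply: bigcap_measurable => // n _; apply: bigcup_measurable.
- exact: lim_sup_set_cvg0.
- by move=> x hx n _; have [j nj Ux] := hx n; exists j.
Qed.

Lemma sz_small (e : R) : 0 < e -> exists n, sz n < e.
Proof.
move=> e0; have : ratio ^+ n @[n --> \oo] --> (0 : R).
  apply: cvg_expr; rewrite ger0_norm ?(ltW ratio_gt0)//.
  by have := ratio_le; lra.
move=> /cvgrPdist_lt /(_ (e / vol B0)) []; first by rewrite divr_gt0.
move=> N _ /(_ N (leqnn N)); rewrite sub0r normrN ger0_norm ?exprn_ge0 ?(ltW ratio_gt0)//.
by rewrite ltr_pdivlMr// => ?; exists N.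
Qed.

(** After the last change of the ball in charge no ball through [x] is dense in its bad
    set, because dense balls would have to be smaller than all sizes. Hence almost every
    such point is good. *)
Lemma ae_terminates :
  mu.-negligible [set x | Om x /\ ~ exists2 n, (0 < n)%N & ~ H (dil 5 (c n x)) x].
Proof.
pose D A := [set x | H (dil 5 A) x /\
  ~ exists B, [/\ BB B, B x & dense (H (dil 5 A)) B]].
have nD : mu.-negligible (\bigcup_(A in stock) D A).
  have /countable_injP[h hinj] := countable_stock.
  pose F n := \bigcup_(A in [set A | stock A /\ h A = n]) D A.
  apply: (@negligibleS _ _ _ _ (\bigcup_n F n)).
    by move=> x [A sA Dx]; exists (h A) => //; exists A.
  apply: negligible_bigcup => n.
  have [[A [sA hA]]|no] := pselect (exists A, stock A /\ h A = n); last first.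
    suff -> : F n = set0 by exact: negligible_set0.
    by rewrite -subset0 => x [A [? ?] _]; apply: no; exists A.
  apply: (@negligibleS _ _ _ _ (D A)).
    by move=> x [B [sB hB]]; rewrite (hinj A B) ?inE// hA hB.
  have [j WA] := sA; have BA := dil_ball hBB 5 (W_ball WA).
  apply: (ae_dense_ball hBB); first exact: mH.
  by apply: (le_lt_trans (leH BA)); exact: ltry.
apply: negligibleS (negligibleU negligible_infinite_switch nD) => x [Ox nx].
apply: contrapT => /not_orP[ninf nDx].
have [n hn] : exists n, forall j, (n <= j)%N -> ~ (\bigcup_(A in W j) dil 5 A) x.
  apply: contrapT => no; apply: ninf => n; apply: contrapT => no2.
  by apply: no; exists n => j nj Ux; apply: no2; exists j.
have cst j : (n.+1 <= j)%N -> c j x = c n.+1 x.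
  elim: j => // j IH; rewrite leq_eqVlt => /orP[/eqP <- //|nj].
  rewrite -IH//; have [_ _ /(_ _ Ox)[[Wc [cx _ _]]|[-> //]]] := c_step (leq_trans (ltn0Sn n) nj).
  by exfalso; apply: (hn j); [exact: ltnW|exists (c j.+1 x)].
have Hx : H (dil 5 (c n.+1 x)) x.
  by apply: contrapT => nH; apply: nx; exists n.+1.
apply: nDx; exists (c n.+1 x).
  have [->|[i _ Wi]] := c_origin Ox (ltn0Sn n); last by exists i.
  by exists 0%N; rewrite W0.
split=> // [[B [BB' Bx dB]]].
have [k hk] := sz_small (vol_gt0 hBB BB').
have [_ _ _ _ /(_ _ BB' Bx)] := c_inv (ltn0Sn (n + k)) Ox.
rewrite cst ?ltnS ?leq_addr// => /(_ dB).
have := le_sz (leq_trans (leq_addl n k) (leqnSn _)); lra.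
Qed.

Variables (Phi Lam : S -> set S -> R).
Hypothesis good_point : forall x Q, BB Q -> Q x -> ~ H Q x -> Phi x Q <= Lam x Q.
Hypothesis next_ball : forall x Q G, BB Q -> BB G -> Q x -> star G x ->
  (forall B, BB B -> B x -> 2 * vol G < vol B -> ~ dense (H Q) B) ->
  vol (star (star G)) < vol Q -> Phi x Q <= Lam x Q + Phi x (star G).

(** The chain has no repetition since every new ball in charge is smaller. *)
Lemma chain_bound x n : Om x -> (0 < n)%N -> exists l : seq (set S),
  [/\ uniq l, forall A, A \in l -> stock A /\ dil 5 A x,
      forall A, A \in l -> vol (c n x) < vol A &
      Phi x (dil 5 B0) <= \sum_(A <- l) Lam x (dil 5 A) + Phi x (dil 5 (c n x))].
Proof.
move=> Ox; case: n => // n _; elim: n => [|n [l [ul sl vl le]]].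
  by exists [::]; split=> //; rewrite big_nil add0r c1.
have [Bc cx ltc lec dc] := c_inv (ltn0Sn n) Ox.
have [_ _ /(_ _ Ox)[[Wc [c5 big nd]]|[-> _]]] := c_step (ltn0Sn n); last by exists l.
have BW := W_ball Wc; have /andP[_ leW] := W_window Wc.
have ltW' : vol (c n.+2 x) < vol (c n.+1 x) by exact: le_lt_trans leW ltc.
exists (c n.+1 x :: l); split.
- by rewrite /= ul andbT; apply/negP => /vl; rewrite ltxx.
- move=> A; rewrite inE => /orP[/eqP ->|/sl//]; split=> //.
  have [->|[i _ Wi]] := c_origin Ox (ltn0Sn n); last by exists i.
  by exists 0%N; rewrite W0.
- by move=> A; rewrite inE => /orP[/eqP ->//|/vl]; exact: lt_trans.
rewrite big_cons; apply: (le_trans le).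
rewrite -addrA addrCA lerD2l.
apply: (@next_ball x (dil 5 (c n.+1 x)) (dil 4 (c n.+2 x))) => //;
  try exact: (dil_ball hBB).
apply: (le_lt_trans (vol_dil hBB 6 BW)).
apply: (@le_lt_trans _ _ (C0 ^+ 6 * sz n.+1)); first by rewrite ler_wpM2l// ltW// (C0X_gt0 hBB).
rewrite szS mulrA ratioE; have := le_vol_dil hBB 5 Bc.
by have := vol_gt0 hBB Bc; move: big; rewrite /=; lra.
Qed.

Lemma ae_chain_bound : mu.-negligible [set x | Om x /\ ~ exists l : seq (set S),
  [/\ uniq l, forall A, A \in l -> stock A /\ dil 5 A x &
      Phi x (dil 5 B0) <= \sum_(A <- l) Lam x (dil 5 A)]].
Proof.
apply: negligibleS ae_terminates => x [Ox nl]; split=> // -[n n0 nH]; apply: nl.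
have [l [ul sl vl le]] := chain_bound Ox n0.
have [Bc cx _ _ _] := c_inv n0 Ox.
exists (c n x :: l); split.
- by rewrite /= ul andbT; apply/negP => /vl; rewrite ltxx.
- move=> A; rewrite inE => /orP[/eqP ->|/sl//]; split=> //.
  have [->|[i _ Wi]] := c_origin Ox n0; last by exists i.
  by exists 0%N; rewrite W0.
rewrite big_cons addrC; apply: (le_trans le); rewrite lerD2l.
by apply: good_point => //; exact: (dil_ball hBB).
Qed.

End history.

(** The abstract form of the selection. Here [Phi x Q] stands for the size of the
    operator on the ball [Q] at the point [x], and [Lam x Q] for the product of
    averages. *)
Theorem stopping_family (Phi Lam : S -> set S -> R) :
  (forall x Q, BB Q -> Q x -> ~ H Q x -> Phi x Q <= Lam x Q) ->
  (forall x Q G, BB Q -> BB G -> Q x -> star G x ->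
    (forall B, BB B -> B x -> 2 * vol G < vol B -> ~ dense (H Q) B) ->
    vol (star (star G)) < vol Q -> Phi x Q <= Lam x Q + Phi x (star G)) ->
  exists (T : set (set S)) (E : set S -> set S) (parity : set S -> bool),
    [/\ countable T, T `<=` BB,
      forall A, T A -> [/\ measurable (E A), E A `<=` A & (mu A <= 2%:E * mu (E A))%E],
      forall A B, T A -> T B -> parity A = parity B -> E A `&` E B !=set0 -> A = B &
      mu.-negligible [set x | dil 5 B0 x /\ ~ exists l : seq (set S),
        [/\ uniq l, forall A, A \in l -> T A /\ dil 5 A x &
            Phi x (dil 5 B0) <= \sum_(A <- l) Lam x (dil 5 A)]]].
Proof.
move=> good next; have [W [c [W0 c1 ci cs]]] := exists_history.
have /choice[sc hsc] (A : set S) : exists j, stock W A -> W j A.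
  by have [[j WA]|no] := pselect (stock W A); [exists j|exists 0%N].
exists (stock W), (core W), (fun A => odd (sc A)); split.
- exact: countable_stock W0 cs.
- by move=> A [j /(W_ball W0 cs)].
- move=> A [j WA]; have [? ?] := core_measure W0 c1 ci cs WA.
  by split=> // x [].
- move=> A B sA sB; exact: (core_disjoint W0 cs (hsc _ sA) (hsc _ sB)).
- exact: (ae_chain_bound W0 c1 ci cs good next).
Qed.

End stopping_chain.

(** * Averages and the maximal function *)

Section Lr_averages.
Context {R : realType} {d : measure_display} {S : measurableType d}.
Variable mu : {measure set S -> \bar R}.
Variable r : R.
Hypothesis r1 : 1 <= r.
Implicit Types f g : S -> R.

Let r0 : 0 < r. Proof. exact: lt_le_trans ltr01 r1. Qed.

Definition nrm f : R := fine ('N[mu]_(r%:E)[EFin \o f])%E.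

Lemma LfunE f : f \in Lfun mu r%:E <->
  measurable_fun setT f /\ ('N[mu]_(r%:E)[EFin \o f] < +oo)%E.
Proof.
split.
  by rewrite !inE => /andP[]; rewrite !inE.
by move=> [mf lf]; rewrite inE; apply/andP; split; rewrite inE.
Qed.

Lemma nrmK f : f \in Lfun mu r%:E -> (nrm f)%:E = 'N[mu]_(r%:E)[EFin \o f]%E.
Proof.
by move=> /LfunE[_ lf]; rewrite fineK// ge0_fin_numE// Lnorm_ge0.
Qed.

Lemma nrm_ge0 f : 0 <= nrm f.
Proof. by rewrite fine_ge0// Lnorm_ge0. Qed.

Lemma nrmX f : f \in Lfun mu r%:E ->
  (\int[mu]_x (`|f x| `^ r)%:E = (nrm f `^ r)%:E)%E.
Proof.
move=> Lf; by rewrite -poweR_EFin nrmK// poweR_Lnorm ?gt_eqF//.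
Qed.

Lemma le_nrm f g : g \in Lfun mu r%:E -> measurable_fun setT f ->
  (forall x, `|f x| <= `|g x|) -> f \in Lfun mu r%:E /\ nrm f <= nrm g.
Proof.
move=> Lg mf fg; have [mg lg] := (LfunE g).1 Lg.
have ig (h : S -> R) : (0 <= \int[mu]_x `|(EFin \o h) x| `^ r)%E.
  by apply: integral_ge0 => x _; exact: poweR_ge0.
have le : ('N[mu]_(r%:E)[EFin \o f] <= 'N[mu]_(r%:E)[EFin \o g])%E.
  rewrite unlock; apply: gt0_ler_poweR.
  - by rewrite invr_ge0 ltW.
  - by rewrite in_itv/= leey andbT; exact: ig.
  - by rewrite in_itv/= leey andbT; exact: ig.
  apply: ge0_le_integral => //.
  - by move=> x _; exact: poweR_ge0.
  - by apply: (measurableT_comp (measurable_poweR r)); apply: measurableT_comp => //;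
      exact/measurable_EFinP.
  - by apply: (measurableT_comp (measurable_poweR r)); apply: measurableT_comp => //;
      exact/measurable_EFinP.
  - move=> x _ /=; rewrite lee_fin ge0_ler_powR ?nnegrE//; exact: ltW.
have Lf : f \in Lfun mu r%:E by apply/LfunE; split=> //; exact: le_lt_trans lg.
by split=> //; rewrite -lee_fin !nrmK.
Qed.

Lemma Lfun_scaleD (a : R) f g : f \in Lfun mu r%:E -> g \in Lfun mu r%:E ->
  (fun x => a * f x + g x) \in Lfun mu r%:E /\
  nrm (fun x => a * f x + g x) <= `|a| * nrm f + nrm g.
Proof.
move=> Lf Lg; have [mf lf] := (LfunE f).1 Lf; have [mg lg] := (LfunE g).1 Lg.
have maf : measurable_fun setT (fun x => a * f x) by exact: measurable_funM.
have naf : ('N[mu]_(r%:E)[EFin \o (fun x => a * f x)%R] = (`|a| * nrm f)%:E)%E.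
  rewrite unlock/=; under eq_integral do rewrite normrM powRM// EFinM.
  rewrite ge0_integralZl//; try by move=> *; rewrite lee_fin powR_ge0.
  - rewrite nrmX// -EFinM poweR_EFin powRM ?powR_ge0// -!powRrM divff ?gt_eqF//.
    by rewrite !powRr1 ?nrm_ge0.
  - apply/measurable_EFinP; apply: (measurableT_comp (measurable_powR r)).
    exact: measurableT_comp.
have le : ('N[mu]_(r%:E)[EFin \o (fun x => a * f x + g x)%R] <= (`|a| * nrm f + nrm g)%:E)%E.
  by rewrite EFinD -naf (nrmK Lg); exact: (minkowski_EFin mu maf mg r1).
have L : (fun x => a * f x + g x) \in Lfun mu r%:E.
  apply/LfunE; split; first exact: measurable_funD.
  by apply: le_lt_trans le _; exact: ltry.
by split=> //; rewrite -lee_fin nrmK.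
Qed.

Lemma Lfun_scale1 (a : R) f : f \in Lfun mu r%:E -> (fun x => a * f x) \in Lfun mu r%:E.
Proof.
move=> Lf; have L0 : (fun x => 0 * f x) \in Lfun mu r%:E.
  have [] // := @le_nrm (fun x => 0 * f x) f Lf.
    by apply: measurable_funM => //; have [] := (LfunE f).1 Lf.
  by move=> x; rewrite mul0r normr0.
have -> : (fun x => a * f x) = (fun x => a * f x + 0 * f x).
  by apply/funext => x; rewrite mul0r addr0.
by have [] := Lfun_scaleD a Lf L0.
Qed.

Definition cut (E : set S) f := fun x => f x * \1_E x.

Lemma cut_Lfun E f : measurable E -> f \in Lfun mu r%:E ->
  cut E f \in Lfun mu r%:E /\ nrm (cut E f) <= nrm f.
Proof.
move=> mE Lf; have [mf _] := (LfunE f).1 Lf; apply: le_nrm => //.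
  by apply: measurable_funM => //; exact: measurable_indic.
move=> x; rewrite /cut normrM indicE; case: (x \in E).
  by rewrite normr1 mulr1.
by rewrite normr0 mulr0.
Qed.

Lemma cut_cut E F f : E `<=` F -> cut E (cut F f) = cut E f.
Proof.
move=> EF; apply/funext => x; rewrite /cut !indicE.
have [Ex|nEx] := boolP (x \in E); last by rewrite !mulr0.
by rewrite (_ : x \in F) ?mulr1// inE; apply: EF; rewrite inE in Ex.
Qed.

Lemma nrm_cutX E f : measurable E -> f \in Lfun mu r%:E ->
  (\int[mu]_(x in E) (`|f x| `^ r)%:E = (nrm (cut E f) `^ r)%:E)%E.
Proof.
move=> mE Lf; rewrite -nrmX; last by have [] := cut_Lfun mE Lf.
rewrite integral_mkcond; apply: eq_integral => x _; rewrite patchE /cut indicE.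
by case: (x \in E); rewrite ?mulr1// mulr0 normr0 powR0// gt_eqF.
Qed.

Variables (BB : set (set S)) (star : set S -> set S) (C0 : R).
Hypothesis hBB : ball_basis mu BB star C0.
Local Notation vol := (vol mu).

Definition ravg (B : set S) f : R := nrm (cut B f) / vol B `^ r^-1.

Lemma ravg_ge0 B f : 0 <= ravg B f.
Proof. by rewrite divr_ge0// ?nrm_ge0// powR_ge0. Qed.

Lemma ravgX B f : BB B -> f \in Lfun mu r%:E ->
  (\int[mu]_(x in B) (`|f x| `^ r)%:E = (ravg B f `^ r * vol B)%:E)%E.
Proof.
move=> bB Lf; rewrite nrm_cutX//; last exact: (ball_measurable hBB).
have v0 := vol_gt0 hBB bB.
rewrite /ravg powRM ?nrm_ge0//; last by rewrite invr_ge0 powR_ge0.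
rewrite -powRN -powRrM mulNr mulVf ?gt_eqF// powR_inv1 ?ltW// -mulrA mulVf ?mulr1//.
by rewrite gt_eqF.
Qed.

Lemma avgrE B f : BB B -> f \in Lfun mu r%:E -> avgr mu r B f = (ravg B f)%:E.
Proof.
move=> bB Lf; rewrite /avgr /avg ravgX// (volE hBB bB) inver gt_eqF ?(vol_gt0 hBB)//.
rewrite -EFinM poweR_EFin mulrC mulfK ?gt_eqF ?(vol_gt0 hBB)//.
by rewrite -powRrM divff ?gt_eqF// powRr1// ravg_ge0.
Qed.

Lemma sup_avgr_le B f a : f \in Lfun mu r%:E ->
  (forall B', BB B' -> B `<=` B' -> ravg B' f <= a) ->
  (sup_avgr mu BB r B f <= a%:E)%E.
Proof.
move=> Lf h; apply: ub_ereal_sup => _ [B' [bB' sB'] <-].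
by rewrite avgrE// lee_fin; exact: h.
Qed.

Lemma ravg_scaleD B (a : R) f g : BB B -> f \in Lfun mu r%:E -> g \in Lfun mu r%:E ->
  ravg B (fun x => a * f x + g x) <= `|a| * ravg B f + ravg B g.
Proof.
move=> bB Lf Lg; have mB := ball_measurable hBB bB.
rewrite /ravg mulrA -mulrDl ler_wpM2r ?invr_ge0 ?powR_ge0//.
have [Lf' _] := cut_Lfun mB Lf; have [Lg' _] := cut_Lfun mB Lg.
have [_] := Lfun_scaleD a Lf' Lg'; apply: le_trans; rewrite le_eqVlt; apply/orP; left.
by apply/eqP; congr nrm; apply/funext => x; rewrite /cut mulrDl mulrA.
Qed.

Lemma ravg_le_nrm B f : BB B -> f \in Lfun mu r%:E -> ravg B f <= nrm f / vol B `^ r^-1.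
Proof.
move=> bB Lf; rewrite ler_wpM2r ?invr_ge0 ?powR_ge0//.
by have [] := cut_Lfun (ball_measurable hBB bB) Lf.
Qed.

(** The level set of the maximal function need not be measurable, but the Vitali
    covering provides a measurable set of the same size that contains it. *)
Lemma maximal_level_cover P f (K : R) : BB P -> f \in Lfun mu r%:E -> 1 <= K ->
  exists M, [/\ measurable M, (mu M <= (C0 / K * vol P)%:E)%E &
    forall B x, BB B -> B x -> ~ M x -> ravg B (cut P f) <= K * ravg P f].
Proof.
move=> bP Lf K1; have mP := ball_measurable hBB bP; have K0 := lt_le_trans ltr01 K1.
have [Lc _] := cut_Lfun mP Lf; have [mc _] := (LfunE _).1 Lc.
pose a := K * ravg P f; have a0 : 0 <= a by rewrite mulr_ge0 ?ravg_ge0// ltW.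
pose F := [set B | BB B /\ a < ravg B (cut P f)].
have FB : F `<=` BB by move=> B [].
have intP : (\int[mu]_x (`|cut P f x| `^ r)%:E = (ravg P f `^ r * vol P)%:E)%E.
  rewrite nrmX//; have := ravgX bP Lf; rewrite (nrm_cutX mP Lf) => <-.
  by [].
have Fpos B : F B -> 0 < ravg P f.
  move=> [bB lt]; rewrite lt_neqAle ravg_ge0 andbT eq_sym; apply/eqP => e.
  have : (\int[mu]_(x in B) (`|cut P f x| `^ r)%:E <= 0)%E.
    have -> : (0 = \int[mu]_x (`|cut P f x| `^ r)%:E)%E.
      by rewrite intP e powR0 ?gt_eqF// mul0r.
    apply: ge0_subset_integral => //; first exact: (ball_measurable hBB).
      apply/measurable_EFinP; apply: (measurableT_comp (measurable_powR r)).
      exact: measurableT_comp.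
  rewrite (ravgX bB Lc) lee_fin leNgt mulr_gt0 ?(vol_gt0 hBB)// powR_gt0//.
  exact: le_lt_trans lt.
have Fle B : F B -> (mu B <= ((a `^ r)^-1)%:E * \int[mu]_(x in B) (`|cut P f x| `^ r)%:E)%E.
  move=> FB'; have [bB lt] := FB'; have ap : 0 < a by rewrite mulr_gt0// (Fpos _ FB').
  rewrite (ravgX bB Lc) (volE hBB bB) -EFinM lee_fin mulrA ler_peMl//.
    exact/ltW/(vol_gt0 hBB).
  rewrite mulrC ler_pdivlMr ?powR_gt0// mul1r ge0_ler_powR ?nnegrE ?ltW//.
  exact: lt_trans lt.
have FM B : F B -> vol B <= (a `^ r)^-1 * (ravg P f `^ r * vol P).
  move=> FB'; rewrite -lee_fin -(volE hBB)//; last exact: FB.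
  apply: (le_trans (Fle _ FB')); rewrite EFinM lee_wpmul2l ?lee_fin ?invr_ge0 ?powR_ge0//.
  rewrite -intP; apply: ge0_subset_integral => //.
  - by apply: (ball_measurable hBB); exact: FB.
  - apply/measurable_EFinP; apply: (measurableT_comp (measurable_powR r)).
    exact: measurableT_comp.
have [W [WF Wd Wm]] := vitali hBB FB FM.
have [[B FBB]|no] := pselect (exists B, F B); last first.
    exists set0; split=> //; first by rewrite measure0 lee_fin mulr_ge0// ?divr_ge0// ?(C0_ge0 hBB)// ltW// (vol_gt0 hBB).
    move=> B x bB Bx _; rewrite leNgt; apply/negP => lt; apply: no; exists B; split => //.
  have pP := Fpos _ FBB; have ap : 0 < a by rewrite mulr_gt0.
  have cW : countable W.
    by apply: (countable_disjoint_balls hBB) => //; exact: subset_trans FB.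
  have [] := @countable_cover_integral_le _ _ _ mu W star id setT (cst 1%E)
    (fun x => (`|cut P f x| `^ r)%:E) (C0 * (a `^ r)^-1) cW.
  + by move=> A /WF/FB bA; apply: (ball_measurable hBB); exact: (star_ball hBB).
  + by move=> A /WF/FB bA; split=> //; exact: (ball_measurable hBB).
  + by [].
  + exact: Wd.
  + exact: measurable_cst.
  + apply/measurable_EFinP; apply: (measurableT_comp (measurable_powR r)).
    exact: measurableT_comp.
  + by [].
  + by move=> x; rewrite lee_fin powR_ge0.
  + by rewrite mulr_ge0 ?(C0_ge0 hBB)// invr_ge0 powR_ge0.
  + move=> A WA; have bA := FB _ (WF _ WA).
    rewrite integral_cst ?mul1e; last exact: (ball_measurable hBB (star_ball hBB bA)).
    apply: (le_trans (star_measure hBB bA)); rewrite (EFinM C0) -muleA.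
    by rewrite lee_wpmul2l ?lee_fin ?(C0_ge0 hBB)//; exact/Fle/WF.
  move=> mM le; exists (\bigcup_(A in W) star A); split=> //.
    move: le; rewrite integral_cst// mul1e => le; apply: (le_trans le).
    rewrite intP -EFinM lee_fin /a powRM ?ravg_ge0 ?(ltW K0)// invfM.
    have rp : ravg P f `^ r != 0 by rewrite gt_eqF// powR_gt0.
    have -> : C0 * ((K `^ r)^-1 / ravg P f `^ r) * (ravg P f `^ r * vol P) =
      C0 / K `^ r * vol P by field; rewrite rp gt_eqF// powR_gt0.
    rewrite ler_wpM2r ?(ltW (vol_gt0 hBB bP))// ler_wpM2l ?(C0_ge0 hBB)//.
    rewrite lef_pV2 ?posrE ?powR_gt0//; exact: le1r_powR.
  move=> B' x bB' B'x nM; rewrite leNgt; apply/negP => lt; apply: nM.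
  have FB' : F B' by [].
  have [A [WA BA leA]] := Wm _ FB'; exists A => //.
  by apply: (star_absorb hBB) B'x => //; exact/FB/WF.
Qed.

End Lr_averages.

(** * Expansion of a sublinear operator *)

Lemma le_prode {R : realType} (I : Type) (s : seq I) (f g : I -> \bar R) :
  (forall i, 0 <= f i)%E -> (forall i, f i <= g i)%E ->
  (\prod_(i <- s) f i <= \prod_(i <- s) g i)%E.
Proof.
move=> f0 fg; elim: s => [|i s IH]; first by rewrite !big_nil.
by rewrite !big_cons lee_pmul// prode_ge0.
Qed.

(** The value [a] is compared with [a'] at another point through the differences that
    (T2) controls. *)
Lemma norm_le_increment {R : realType} (V : normedModType R) (a b a' b' : V) :
  `|a| <= `|(a - b) - (a' - b')| + `|a'| + `|b'| + `|b|.
Proof.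
have e : a = (a - b) - (a' - b') + a' - b' + b.
  by rewrite -(addrA _ a' (- b')) subrK subrK.
rewrite [X in `|X| <= _]e.
apply: (le_trans (ler_normD _ _)) (lerD _ (lexx _)).
apply: (le_trans (ler_normB _ _)) (lerD _ (lexx _)).
exact: ler_normD.
Qed.

Section sublinear_expansion.
Context {R : realType} {d : measure_display} {S : measurableType d}.
Variable mu : {measure set S -> \bar R}.
Context {m : nat}.
Variables (r : R) (V : normedModType R) (T : ('I_m -> S -> R) -> S -> V).
Hypothesis r1 : 1 <= r.
Local Notation tuples := ('I_m -> S -> R).

(** Common to linear operators with values in a normed space and to real sublinear
    operators. *)
Definition normsub := forall (f : tuples) (i : 'I_m), LrT mu r f ->
  (forall (a : R) x, `|T (subst f i (fun y => a * f i y)) x| = `|a| * `|T f x|) /\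
  (forall g, g \in Lfun mu r%:E -> forall x,
    `|T (subst f i (fun y => f i y + g y)) x| <= `|T f x| + `|T (subst f i g) x|).

Hypothesis subT : normsub.

Lemma subst_same (f : tuples) i g : subst f i g i = g.
Proof. exact: dfwithin. Qed.

Lemma subst_other (f : tuples) i j g : i != j -> subst f i g j = f j.
Proof. by move=> ij; rewrite /subst dfwithout. Qed.

(** Expanding one entry at a time turns bounds for the tuples with entries among the [u
    i] and the [v i] into a bound of product form. *)
Lemma sublinear_product (u v : tuples) (a : 'I_m -> R) (U W : 'I_m -> R) (K : R) x :
  LrT mu r u -> LrT mu r v -> (forall i, 0 <= U i) -> (forall i, 0 <= W i) ->
  (forall e : {ffun 'I_m -> bool}, `|T (fun i => if e i then u i else v i) x| <=
     K * \prod_i (if e i then U i else W i)) ->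
  `|T (fun i y => a i * u i y + v i y) x| <= K * \prod_i (`|a i| * U i + W i).
Proof.
move=> Lu Lv U0 W0 hK.
pose tup (c : 'I_m -> option bool) : tuples := fun i => match c i with
  | Some true => u i | Some false => v i | None => fun y => a i * u i y + v i y end.
pose X (c : 'I_m -> option bool) i := match c i with
  | Some true => U i | Some false => W i | None => `|a i| * U i + W i end.
have Lt c : LrT mu r (tup c).
  move=> i; rewrite /tup; case: (c i) => [[]|]; [exact: Lu|exact: Lv|].
  by have [] := Lfun_scaleD r1 (a i) (Lu i) (Lv i).
have H k : forall c, (forall i : 'I_m, (k <= i)%N -> c i != None) ->
    `|T (tup c) x| <= K * \prod_i X c i.
  elim: k => [|k IH] c hc.
    pose e := [ffun i => c i == Some true].
    have -> : tup c = fun i => if e i then u i else v i.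
      apply/funext => i; rewrite /tup ffunE.
      by have := hc i (leq0n _); case: (c i) => [[]|].
    apply: (le_trans (hK e)); rewrite le_eqVlt; apply/orP; left; apply/eqP.
    congr (_ * _); apply: eq_bigr => i _; rewrite /X ffunE.
    by have := hc i (leq0n _); case: (c i) => [[]|].
  have [mk|km] := leqP m k.
    by apply: IH => i ki; have := ltn_ord i; rewrite ltnNge (leq_trans mk ki).
  pose i0 := Ordinal km.
  case ci0 : (c i0) => [b|]; last first.
    pose cb b i := if i == i0 then Some b else c i.
    have hcb b (i : 'I_m) : (k <= i)%N -> cb b i != None.
      rewrite /cb; case: (i =P i0) => //= ne; rewrite leq_eqVlt => /orP[/eqP e|/hc//].
      by exfalso; apply: ne; apply: val_inj; rewrite /= -e.
    have eqt b : tup (cb b) i0 = if b then u i0 else v i0.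
      by rewrite /tup /cb eqxx; case: b.
    have eqt' b (i : 'I_m) : i != i0 -> tup (cb b) i = tup c i.
      by move=> ne; rewrite /tup /cb (negbTE ne).
    have [_ hadd] := subT i0 (Lt (cb false)).
    have [hmul _] := subT i0 (Lt (cb true)).
    have Lau : (fun y => a i0 * u i0 y) \in Lfun mu r%:E by exact: Lfun_scale1.
    have -> : tup c = subst (tup (cb false)) i0
        (fun y => tup (cb false) i0 y + (fun y => a i0 * u i0 y) y).
      apply/funext => i; have [<-|ne] := eqVneq i0 i.
        rewrite subst_same eqt; apply/funext => y.
        by rewrite /tup ci0 addrC.
      by rewrite subst_other// eqt'// eq_sym.
    apply: (le_trans (hadd _ Lau x)).
    have -> : subst (tup (cb false)) i0 (fun y => a i0 * u i0 y) =
        subst (tup (cb true)) i0 (fun y => a i0 * tup (cb true) i0 y).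
      apply/funext => i; have [<-|ne] := eqVneq i0 i.
        by rewrite !subst_same eqt.
      by rewrite !subst_other// !eqt' 1?eq_sym// eq_sym.
    rewrite hmul.
    have XE b : \prod_i X (cb b) i =
        (if b then U i0 else W i0) * \prod_(i | i != i0) X c i.
      rewrite (bigD1 i0)//=; congr (_ * _); first by rewrite /X /cb eqxx; case: b.
      by apply: eq_bigr => i ne; rewrite /X /cb (negbTE ne).
    have := IH _ (hcb false); have := IH _ (hcb true); rewrite !XE.
    have Xi0 : X c i0 = `|a i0| * U i0 + W i0 by rewrite /X ci0.
    rewrite [\prod_i X c i](bigD1 i0)//= Xi0.
    set P := \prod_(i | _) _ => h1 h2; have := ler_wpM2l (normr_ge0 (a i0)) h1.
    by move: h2; nra.
  apply: IH => i; rewrite leq_eqVlt => /orP[/eqP e|]; last exact: hc.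
  have -> : i = i0 by apply: val_inj; rewrite /= -e.
  by rewrite ci0.
have := H m (fun=> None) _; apply.
by move=> i; rewrite leqNgt ltn_ord.
Qed.

End sublinear_expansion.

(** * Sparse domination *)

Section local_oscillation.
Context {R : realType} {d : measure_display} {S : measurableType d}.
Variable mu : {measure set S -> \bar R}.
Variables (BB : set (set S)) (star : set S -> set S) (C0 : R).
Hypothesis hBB : ball_basis mu BB star C0.
Context {m : nat}.
Variable r : R.
Hypothesis (m0 : (0 < m)%N) (r1 : 1 <= r).
Local Notation tuples := ('I_m -> S -> R).
Local Notation vol := (vol mu).
Local Notation dense := (dense mu).
Local Notation ravg := (ravg mu r).
Local Notation nrm := (nrm mu r).
Local Notation dil := (dil star).

Let r0 : 0 < r. Proof. exact: lt_le_trans ltr01 r1. Qed.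
Let mR : 0 < m%:R :> R. Proof. by rewrite ltr0n. Qed.

Variables (V : normedModType R) (T : tuples -> S -> V) (C1 C2 Wk : R).
Hypothesis (C1_ge0 : 0 <= C1) (C2_ge0 : 0 <= C2) (Wk0 : 0 < Wk).
Hypothesis subT : normsub mu r T.
Hypothesis mesT : forall f, LrT mu r f -> measurable_fun setT (fun x => `|T f x|).
Hypothesis wkT : forall f t, LrT mu r f -> 0 < t ->
  (t%:E * mu [set x | t < `|T f x|]%R `^ (r / m%:R)^-1 <= (Wk * \prod_i nrm (f i))%:E)%E.
Hypothesis T1 : oscT1 mu BB star r T C1.
Hypothesis T2 : oscT2 mu BB star r T C2.

Lemma mes_level f t : LrT mu r f -> measurable [set x | t < `|T f x|].
Proof.
move=> Lf; have := mesT Lf => /(_ measurableT `]t, +oo[%classic).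
rewrite setTI => h.
suff -> : [set x | t < `|T f x|] = (fun x => `|T f x|) @^-1` `]t, +oo[%classic by exact: h.
by apply/seteqP; split => x /=; rewrite in_itv/= andbT.
Qed.

(** The weak type bound for a tuple with norms in terms of averages. If one of the
    averages is zero the level is zero, and the measure is obtained as a limit. *)
Lemma weak_level f (a : 'I_m -> R) (v L : R) : LrT mu r f -> 0 < v -> 1 <= L ->
  (forall i, 0 <= a i) -> (forall i, nrm (f i) <= a i * v `^ r^-1) ->
  (mu [set x | (L `^ (m%:R / r)) * Wk * \prod_i a i < `|T f x|]%R <= (v / L)%:E)%E.
Proof.
move=> Lf v0 L1 a0 ha; have L0 := lt_le_trans ltr01 L1.
have pn : \prod_i nrm (f i) <= \prod_i a i * v `^ (m%:R / r).
  apply: (@le_trans _ _ (\prod_i (a i * v `^ r^-1))).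
    by apply: ler_prod => i _; rewrite nrm_ge0/=.
  rewrite big_split/= prodr_const card_ord -powR_mulrn ?powR_ge0// -powRrM.
  by rewrite [X in v `^ X]mulrC.
have P0 : 0 <= \prod_i a i by exact: prodr_ge0.
have gen t : 0 < t -> (t%:E * mu [set x | t < `|T f x|]%R `^ (m%:R / r) <=
    (Wk * (\prod_i a i * v `^ (m%:R / r)))%:E)%E.
  move=> t0; have := wkT Lf t0; rewrite invf_div => h; apply: (le_trans h).
  by rewrite lee_fin ler_wpM2l// ltW.
have mr0 : 0 < m%:R / r by rewrite divr_gt0.
move: P0; rewrite le_eqVlt => /orP[/eqP e|P0].
  rewrite -e mulr0; suff -> : mu [set x | 0 < `|T f x|]%R = 0%E.
    by rewrite lee_fin divr_ge0// ltW.
  apply/eqP; rewrite eq_le measure_ge0 andbT.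
  have -> : [set x | 0 < `|T f x|] = \bigcup_n [set x | n.+1%:R^-1 < `|T f x|].
    apply/seteqP; split=> [x /= h|x [n _ /=]]; last by apply: le_lt_trans.
    by have [n _ hn] := near_infty_natSinv_lt (PosNum h); exists n => //; exact: (hn n (leqnn n)).
  have nz n : mu [set x | n.+1%:R^-1 < `|T f x|]%R = 0%E.
    have := gen n.+1%:R^-1; rewrite -e mul0r mulr0 invr_gt0 ltr0n => /(_ isT).
    rewrite pmule_rle0 ?lte_fin ?invr_gt0 ?ltr0n// => h.
    have : (mu [set x | n.+1%:R^-1 < `|T f x|]%R `^ (m%:R / r) = 0)%E.
      by apply/eqP; rewrite eq_le h poweR_ge0.
    by move/poweR_eq0_eq0; apply.
  have := @measure_sigma_subadditive _ _ _ mu (\bigcup_n [set x | n.+1%:R^-1 < `|T f x|])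
    (fun n => [set x | n.+1%:R^-1 < `|T f x|]).
  move=> /(_ _ _ (@subset_refl _ _)) h; apply: (le_trans (h _ _)).
  - by move=> n; exact: mes_level.
  - by apply: bigcup_measurable => n _; exact: mes_level.
  - by rewrite eseries0// => n _ _; rewrite nz.
set t := L `^ _ * _ * _.
have t0 : 0 < t by rewrite /t !mulr_gt0// powR_gt0.
have h := gen t t0; set M := mu _ in h *.
have h2 : (M `^ (m%:R / r) <= ((v / L) `^ (m%:R / r))%:E)%E.
  rewrite -(@lee_pmul2l _ t%:E)// ?lte_fin//; apply: (le_trans h).
  rewrite -EFinM lee_fin /t powRM ?invr_ge0 ?(ltW v0) ?(ltW L0)// -(powR_inv1 (ltW L0)) -powRrM.
  rewrite mulN1r powRN le_eqVlt; apply/orP; left; apply/eqP; field.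
  by rewrite gt_eqF// powR_gt0.
have M0 : (0 <= M)%E by exact: measure_ge0.
have mr' : m%:R / r != 0 by rewrite gt_eqF.
have e1 z : (0 <= z)%E -> ((z `^ (m%:R / r)) `^ (m%:R / r)^-1 = z)%E.
  by move=> z0; rewrite -poweRrM divff// poweRe1.
rewrite -(e1 M)// -(e1 (v / L)%:E); last by rewrite lee_fin divr_ge0// ltW.
apply: gt0_ler_poweR.
- by rewrite invr_ge0 ltW.
- by rewrite in_itv/= leey andbT poweR_ge0.
- by rewrite in_itv/= lee_fin powR_ge0 leey.
- by rewrite poweR_EFin.
Qed.

(** With these multiples of the averages the exceptional sets of the [2 ^ m] tuples and
    of the [2 * m] entries, all of them living on [star Q], add up to the admitted share
    of [Q]: [lev] belongs to the weak type bound, [big] to the maximal function. *)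
Definition lev : R := 4 * (2 ^ m)%:R * C0 / bad_share C0.
Definition big : R := 4 * m%:R * C0 ^+ 2 / bad_share C0.

Lemma bad_share_le : bad_share C0 <= 24^-1.
Proof.
rewrite /bad_share ler_pdivrMr; last by rewrite mulr_gt0// (C0X_gt0 hBB).
have := ratioX_le hBB 2; have := C0X_ge1 hBB 13; lra.
Qed.

Lemma lev_ge : 4 * C0 <= lev.
Proof.
rewrite /lev -!mulrA ler_wpM2l//.
have b0 := bad_share_gt0 hBB; have b1 := bad_share_le.
have : 1 <= (2 ^ m)%:R :> R by rewrite ler1n expn_gt0.
have c1 := C0_ge1 hBB => h; rewrite mulrA ler_pdivlMr//.
have : C0 * bad_share C0 <= C0 * 1 by rewrite ler_wpM2l ?(C0_ge0 hBB)//; lra.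
by nra.
Qed.

Lemma lev_ge1 : 1 <= lev.
Proof. by have := lev_ge; have := C0_ge1 hBB; lra. Qed.

Lemma big_ge1 : 1 <= big.
Proof.
rewrite /big ler_pdivlMr ?(bad_share_gt0 hBB)// mul1r.
have b1 := bad_share_le; have c1 := C0X_ge1 hBB 2.
have : 1 <= m%:R :> R by rewrite ler1n.
by nra.
Qed.

Lemma restr_LrT (f : tuples) (E : set S) : LrT mu r f -> measurable E -> LrT mu r (restr f E).
Proof. by move=> Lf mE i; have [] := cut_Lfun r1 mE (Lf i). Qed.

Lemma nrm_restr (P : set S) (f : tuples) i : BB P -> LrT mu r f ->
  nrm (restr f P i) <= ravg P (f i) * vol P `^ r^-1.
Proof.
move=> bP Lf; rewrite /ravg divfK// gt_eqF// powR_gt0// (vol_gt0 hBB)//.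
Qed.

Section decomposition.
Variables (beta : S -> 'I_m -> R) (u v : tuples) (c : set S -> 'I_m -> R).
Hypothesis (Lu : LrT mu r u) (Lv : LrT mu r v).

(** The tuple at which the operator is evaluated depends on [x] through the coefficients
    only. On the ball [Q] it is rewritten with the coefficients [beta x i - c Q i],
    which are small in the mean, and the entries [recentred Q]. *)
Definition arg (x : S) : tuples := fun i y => beta x i * u i y + v i y.
Definition recentred (Q : set S) : tuples := fun i y => c Q i * u i y + v i y.

Definition osc_size (x : S) (Q : set S) (i : 'I_m) : R :=
  `|beta x i - c Q i| * ravg (star Q) (u i) + ravg (star Q) (recentred Q i).

Definition local_const : R :=
  big ^+ m + lev `^ (m%:R / r) * (1 + big ^+ m).

Definition size_bound (x : S) (Q : set S) : R :=
  local_const * (C1 + C2 + Wk) * \prod_i osc_size x Q i.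

Lemma arg_LrT x : LrT mu r (arg x).
Proof. by move=> i; have [] := Lfun_scaleD r1 (beta x i) (Lu i) (Lv i). Qed.

Lemma recentred_LrT Q : LrT mu r (recentred Q).
Proof. by move=> i; have [] := Lfun_scaleD r1 (c Q i) (Lu i) (Lv i). Qed.

Lemma osc_size_ge0 x Q i : 0 <= osc_size x Q i.
Proof. by apply: addr_ge0; [apply: mulr_ge0|]; rewrite ?normr_ge0 ?ravg_ge0. Qed.

Lemma argE x Q i y :
  arg x i y = (beta x i - c Q i) * u i y + recentred Q i y.
Proof. by rewrite /arg /recentred; ring. Qed.

(** The bad set must not depend on [x], so the bounds are for the fixed entries [u i]
    and [recentred Q i]. *)
Lemma exists_bad_set Q : BB Q -> exists H, [/\ measurable H,
  (mu H <= (bad_share C0 * vol Q)%:E)%E,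
  forall x, ~ H x -> forall e : {ffun 'I_m -> bool},
    `|T (fun i => if e i then cut (star Q) (u i) else cut (star Q) (recentred Q i)) x|
      <= lev `^ (m%:R / r) * Wk * \prod_i (if e i then ravg (star Q) (u i)
           else ravg (star Q) (recentred Q i)) &
  forall x, ~ H x -> forall B i, BB B -> B x ->
    ravg B (cut (star Q) (u i)) <= big * ravg (star Q) (u i) /\
    ravg B (cut (star Q) (recentred Q i)) <= big * ravg (star Q) (recentred Q i)].
Proof.
move=> bQ; have bP := star_ball hBB bQ; have mP := ball_measurable hBB bP.
have vP := vol_gt0 hBB bP; have Lw := recentred_LrT Q.
(* All tuples that occur in the expansion into products. *)
pose tup (e : {ffun 'I_m -> bool}) : tuples :=
  fun i => if e i then cut (star Q) (u i) else cut (star Q) (recentred Q i).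
pose av (e : {ffun 'I_m -> bool}) i :=
  if e i then ravg (star Q) (u i) else ravg (star Q) (recentred Q i).
have Lt e : LrT mu r (tup e).
  by move=> i; rewrite /tup; case: (e i); [have [] := cut_Lfun r1 mP (Lu i)|have [] := cut_Lfun r1 mP (Lw i)].
have /choice[Mu hMu] i := maximal_level_cover r1 hBB bP (Lu i) big_ge1.
have /choice[Mw hMw] i := maximal_level_cover r1 hBB bP (Lw i) big_ge1.
pose He e := [set x | (lev `^ (m%:R / r)) * Wk * \prod_i av e i < `|T (tup e) x|].
have mHe e : measurable (He e) by exact: mes_level.
have lHe e : (mu (He e) <= (vol (star Q) / lev)%:E)%E.
  apply: (weak_level (Lt e) vP lev_ge1).
  - by move=> i; rewrite /av; case: (e i); rewrite ravg_ge0.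
  - move=> i; rewrite /tup /av; case: (e i).
      exact: (@nrm_restr _ u).
    exact: (@nrm_restr _ (recentred Q)).
pose H1 := \big[setU/set0]_(e : {ffun 'I_m -> bool}) He e.
pose H2 := \big[setU/set0]_(i < m) (Mu i `|` Mw i).
have mH1 : measurable H1 by apply: bigsetU_measurable => e _; exact: mHe.
have mM i : measurable (Mu i `|` Mw i).
  by apply: measurableU; [case: (hMu i)|case: (hMw i)].
have mH2 : measurable H2 by apply: bigsetU_measurable.
have union_le (I : finType) (F : I -> set S) (a : R) : (forall i, measurable (F i)) ->
    (forall i, (mu (F i) <= a%:E)%E) ->
    (mu (\big[setU/set0]_i F i) <= (#|I|%:R * a)%:E)%E.
  move=> mF lF; apply: (@le_trans _ _ (\sum_(i : I) a%:E)%E); last first.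
    by rewrite sumEFin sumr_const mulr_natl.
  elim: (index_enum I) => [|i s IH]; first by rewrite !big_nil measure0.
  rewrite !big_cons; apply: (le_trans (measureU2 _ _ _)) => //.
    by apply: bigsetU_measurable.
  by apply: leeD; [exact: lF|exact: IH].
exists (H1 `|` H2); split.
- exact: measurableU.
- apply: (le_trans (measureU2 _ _ _)) => //.
  have l1 := union_le _ He (vol (star Q) / lev) mHe lHe.
  have l2 : (mu H2 <= (m%:R * (2 * (C0 / big * vol (star Q))))%:E)%E.
    have -> : m%:R = #|'I_m|%:R :> R by rewrite card_ord.
    apply: union_le => // i.
    apply: (le_trans (measureU2 _ _ _)); [by case: (hMu i)|by case: (hMw i)|].
    have -> : ((2 * (C0 / big * vol (star Q)))%:E = (C0 / big * vol (star Q))%:E +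
      (C0 / big * vol (star Q))%:E)%E by rewrite -EFinD; congr EFin; ring.
    by apply: leeD; [case: (hMu i)|case: (hMw i)].
  apply: (le_trans (leeD l1 l2)); rewrite -EFinD lee_fin card_ffun card_bool card_ord.
  have leP : vol (star Q) <= C0 * vol Q by exact: (vol_star hBB).
  have b0 := bad_share_gt0 hBB; have c0 := C0X_gt0 hBB 1; rewrite expr1 in c0.
  have n0 : 0 < (2 ^ m)%:R :> R by rewrite ltr0n expn_gt0.
  have -> : (2 ^ m)%:R * (vol (star Q) / lev) =
      bad_share C0 / (4 * C0) * vol (star Q).
    by rewrite /lev; field; rewrite !gt_eqF.
  have -> : m%:R * (2 * (C0 / big * vol (star Q))) =
      bad_share C0 / (2 * C0) * vol (star Q).
    by rewrite /big; field; rewrite !gt_eqF.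
  have : bad_share C0 / (4 * C0) * vol (star Q) <= bad_share C0 / 4 * vol Q.
    have -> : bad_share C0 / 4 * vol Q = bad_share C0 / (4 * C0) * (C0 * vol Q).
      by field; rewrite gt_eqF.
    by rewrite ler_wpM2l// divr_ge0 ?ltW// mulr_gt0.
  have : bad_share C0 / (2 * C0) * vol (star Q) <= bad_share C0 / 2 * vol Q.
    have -> : bad_share C0 / 2 * vol Q = bad_share C0 / (2 * C0) * (C0 * vol Q).
      by field; rewrite gt_eqF.
    by rewrite ler_wpM2l// divr_ge0 ?ltW// mulr_gt0.
  have : 0 < bad_share C0 * vol Q by rewrite mulr_gt0// (vol_gt0 hBB).
  lra.
- move=> x nH e; rewrite leNgt; apply/negP => lt; apply: nH; left.
  by rewrite /H1 (bigD1 e)//=; left.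
- move=> x nH B i bB Bx.
  have nM : ~ (Mu i `|` Mw i) x.
    by move=> h; apply: nH; right; rewrite /H2 (bigD1 i)//=; left.
  case: (hMu i) => _ _ hu; case: (hMw i) => _ _ hw; split.
    by apply: hu Bx _ => //; move=> h; apply: nM; left.
  by apply: hw Bx _ => //; move=> h; apply: nM; right.
Qed.

Definition sizes (F : tuples) x Q := `|T (restr F (star Q)) x|.

Lemma lev_term_ge0 : 0 <= lev `^ (m%:R / r) * Wk.
Proof. by rewrite mulr_ge0 ?powR_ge0// ltW. Qed.

Lemma arg_restr x Q : restr (arg x) (star Q) = fun i y =>
  (beta x i - c Q i) * cut (star Q) (u i) y + cut (star Q) (recentred Q i) y.
Proof.
apply/funext => i; apply/funext => y.
by rewrite /restr (argE x Q) /cut mulrDl mulrA.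
Qed.

Lemma prod_osc_ge0 x Q : 0 <= \prod_i osc_size x Q i.
Proof. by apply: prodr_ge0 => i _; exact: osc_size_ge0. Qed.

Section bad_sets.
Variable H : set S -> set S.
Hypothesis Hgood : forall Q, BB Q -> forall x, ~ H Q x -> forall e : {ffun 'I_m -> bool},
    `|T (fun i => if e i then cut (star Q) (u i) else cut (star Q) (recentred Q i)) x|
      <= lev `^ (m%:R / r) * Wk * \prod_i (if e i then ravg (star Q) (u i)
           else ravg (star Q) (recentred Q i)).
Hypothesis Hmax : forall Q, BB Q -> forall x, ~ H Q x -> forall B i, BB B -> B x ->
    ravg B (cut (star Q) (u i)) <= big * ravg (star Q) (u i) /\
    ravg B (cut (star Q) (recentred Q i)) <= big * ravg (star Q) (recentred Q i).

Lemma good_value x x' Q : BB Q -> ~ H Q x' ->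
  `|T (restr (arg x) (star Q)) x'| <=
    lev `^ (m%:R / r) * Wk * \prod_i osc_size x Q i.
Proof.
move=> bQ nH; have mP := ball_measurable hBB (star_ball hBB bQ).
rewrite arg_restr; apply: (sublinear_product r1 subT) => //.
- by move=> i; have [] := cut_Lfun r1 mP (Lu i).
- by move=> i; have [] := cut_Lfun r1 mP (recentred_LrT Q i).
- by move=> i; exact: ravg_ge0.
- by move=> i; exact: ravg_ge0.
- move=> e; apply: le_trans (Hgood bQ nH e) _.
  exact: lexx.
Qed.

Lemma good_average x x' Q B i : BB Q -> ~ H Q x' -> BB B -> B x' ->
  ravg B (restr (arg x) (star Q) i) <= big * osc_size x Q i.
Proof.
move=> bQ nH bB Bx; have mP := ball_measurable hBB (star_ball hBB bQ).
rewrite arg_restr; have [h1 h2] := Hmax bQ nH i bB Bx.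
apply: (le_trans (@ravg_scaleD _ _ _ mu r r1 _ _ _ hBB B _ _ _ bB _ _)).
- by have [] := cut_Lfun r1 mP (Lu i).
- by have [] := cut_Lfun r1 mP (recentred_LrT Q i).
rewrite /osc_size mulrDr; apply: lerD => //.
by rewrite [leRHS]mulrCA ler_wpM2l.
Qed.

Lemma local_const_ge : lev `^ (m%:R / r) <= local_const /\ big ^+ m <= local_const.
Proof.
have b0 : 0 <= big ^+ m by rewrite exprn_ge0// (le_trans ler01 big_ge1).
have l0 : 0 <= lev `^ (m%:R / r) by exact: powR_ge0.
by rewrite /local_const; split; nra.
Qed.

Lemma size_good x Q : BB Q -> Q x -> ~ H Q x -> sizes (arg x) x Q <= size_bound x Q.
Proof.
move=> bQ Qx nH; apply: (le_trans (good_value x bQ nH)).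
rewrite /size_bound ler_wpM2r ?prod_osc_ge0//; have [c1 _] := local_const_ge.
apply: ler_pM => //; [exact: powR_ge0|exact: ltW|].
by rewrite lerDr addr_ge0.
Qed.

(** The exceptional set of the weak type bound takes at most a quarter of [B], and [E]
    at most half. *)
Lemma exists_good_point (B E : set S) (g : tuples) (a : 'I_m -> R) : BB B ->
  measurable E -> LrT mu r g -> (forall i, 0 <= a i) ->
  (2%:E * mu (B `&` E) <= mu B)%E ->
  (forall i, nrm (g i) <= a i * vol (star B) `^ r^-1) ->
  exists x', [/\ B x', ~ E x' & `|T g x'| <= lev `^ (m%:R / r) * Wk * \prod_i a i].
Proof.
move=> bB mE Lg a0 half ha; have bs := star_ball hBB bB.
have hw := weak_level Lg (vol_gt0 hBB bs) lev_ge1 a0 ha.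
set L := [set x | _] in hw; have mL : measurable L by exact: mes_level.
apply: contrapT => no; have sub : B `<=` (B `&` E) `|` L.
  move=> x Bx; have [Ex|nE] := pselect (E x); first by left.
  by right; rewrite /L/= ltNge; apply/negP => le; apply: no; exists x.
have mB := ball_measurable hBB bB.
have : (mu B <= mu (B `&` E) + mu L)%E.
  apply: (@le_trans _ _ (mu ((B `&` E) `|` L))).
    by apply: le_measure sub; rewrite inE//; apply: measurableU => //; exact: measurableI.
  by apply: measureU2 => //; exact: measurableI.
have fI : mu (B `&` E) \is a fin_num.
  rewrite ge0_fin_numE//; apply: (@le_lt_trans _ _ (mu B)).
    by apply: le_measure; rewrite ?inE//; first [exact: measurableI|move=> x []].
  by rewrite (volE hBB bB) ltry.
move: half; rewrite -(fineK fI) (volE hBB bB) -EFinM lee_fin => half h.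
have : (mu L <= (vol B / 4)%:E)%E.
  apply: (le_trans hw); rewrite lee_fin ler_pdivrMr ?(lt_le_trans ltr01 lev_ge1)//.
  apply: (le_trans (vol_star hBB bB)); have := lev_ge; have := vol_gt0 hBB bB.
  by have := C0_ge1 hBB; nra.
move=> h4; have := le_trans h (leeD2l _ h4); rewrite -EFinD lee_fin.
by have := vol_gt0 hBB bB; lra.
Qed.

(** With [B] the ball that (T1) provides beyond [star G], the value at [x] for [Q] is
    compared with the value at a point [x'] of [B] by (T2), and the values for [star B]
    and for [star (star G)] at [x] by (T1). The point [x'] is good both for [Q], which
    also bounds all averages that occur, and for the tuple cut off to [star B]. *)
Lemma size_next x Q G : (forall Q, BB Q -> measurable (H Q)) ->
  BB Q -> BB G -> Q x -> star G x ->
  (forall B, BB B -> B x -> 2 * vol G < vol B -> ~ dense (H Q) B) ->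
  vol (star (star G)) < vol Q ->
  sizes (arg x) x Q <= size_bound x Q + sizes (arg x) x (star G).
Proof.
move=> mH bQ bG Qx Gx nd ltv; have bs := star_ball hBB bG; have bss := star_ball hBB bs.
have bP := star_ball hBB bQ; have mP := ball_measurable hBB bP.
pose g := restr (arg x) (star Q).
have Lg : LrT mu r g by apply: restr_LrT => //; exact: arg_LrT.
have prop : star (star G) `<` setT.
  split=> // sub; have := le_vol hBB bQ bss; move: ltv; rewrite ltNge => /negP h h2.
  by apply: h; apply: h2; apply: subset_trans sub.
have [B [bB [GB nBG] hT1]] := T1 Lg bs prop.
have big_B : 2 * vol G < vol B.
  rewrite ltNge; apply/negP => le; apply: nBG; apply: (star_absorb hBB) => //.
  have [z Gz] := ball_neq0 hBB bG; exists z; split=> //.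
  by apply: GB; exact: (sub_star hBB).
have Bx : B x by exact: GB.
have ndB := nd B bB Bx big_B.
have bsB := star_ball hBB bB; have msB := ball_measurable hBB bsB.
have gS : restr g (star (star G)) = restr (arg x) (star (star G)).
  apply/funext => i.
  change (cut (star (star G)) (cut (star Q) (arg x i)) = cut (star (star G)) (arg x i)).
  apply: cut_cut.
  apply: (star_absorb hBB) => //; first by exists x; split=> //; exact: (sub_star hBB).
  by have := vol_gt0 hBB bQ; lra.
have [x' [Bx' nHx' lex']] : exists x', [/\ B x', ~ H Q x' &
    `|T (restr g (star B)) x'| <= lev `^ (m%:R / r) * Wk *
       \prod_i ravg (star B) (g i)].
  apply: exists_good_point => //.
  - exact: mH.
  - exact: restr_LrT.
  - by move=> i; exact: ravg_ge0.
  - by rewrite leNgt; apply/negP.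
  - by move=> i; exact: nrm_restr.
have sBx' : star B x' by exact: (sub_star hBB).
set Y := \prod_i osc_size x Q i; have Y0 : 0 <= Y by exact: prod_osc_ge0.
have big0 : 0 <= big by exact: le_trans ler01 big_ge1.
have avB : \prod_i ravg (star B) (g i) <= big ^+ m * Y.
  have -> : big ^+ m * Y = \prod_i (big * osc_size x Q i).
    by rewrite big_split/= prodr_const card_ord.
  apply: ler_prod => i _; rewrite ravg_ge0/=.
  exact: (good_average x i bQ nHx' bsB sBx').
have h1 : `|T (restr g (star B)) x - T (restr g (star (star G))) x| <= C1 * (big ^+ m * Y).
  rewrite -lee_fin; apply: (le_trans (hT1 x Gx)).
  rewrite EFinM lee_wpmul2l ?lee_fin//.
  under eq_bigr do rewrite (avgrE r1 hBB bsB (Lg _)).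
  by rewrite prodEFin lee_fin.
have h2 : `|(T g x - T (restr g (star B)) x) - (T g x' - T (restr g (star B)) x')|
    <= C2 * (big ^+ m * Y).
  rewrite -lee_fin; apply: (le_trans (T2 Lg bB Bx Bx')).
  rewrite EFinM lee_wpmul2l ?lee_fin//.
  have -> : big ^+ m * Y = \prod_i (big * osc_size x Q i).
    by rewrite big_split/= prodr_const card_ord.
  rewrite -prodEFin; apply: le_prode => i.
    apply: (@le_trans _ _ (avgr mu r B (g i))).
      by rewrite (avgrE r1 hBB bB (Lg _)) lee_fin ravg_ge0.
    by apply: ereal_sup_ubound; exists B => //; split.
  apply: (sup_avgr_le r1 hBB (Lg i)) => B' bB' BB''.
  by apply: (good_average x i bQ nHx' bB'); exact: BB''.
have h3 : `|T g x'| <= lev `^ (m%:R / r) * Wk * Y by exact: good_value.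
have h4 : `|T (restr g (star B)) x'| <= lev `^ (m%:R / r) * Wk * (big ^+ m * Y).
  apply: (le_trans lex'); rewrite ler_wpM2l//; exact: lev_term_ge0.
have tri : `|T g x| <= `|(T g x - T (restr g (star B)) x) - (T g x' - T (restr g (star B)) x')|
   + `|T g x'| + `|T (restr g (star B)) x'|
   + `|T (restr g (star B)) x - T (restr g (star (star G))) x|
   + `|T (restr g (star (star G))) x|.
  apply: (le_trans (norm_le_increment _ (T (restr g (star B)) x) (T g x')
    (T (restr g (star B)) x'))).
  rewrite -[leRHS]addrA; apply: lerD => //.
  by have := ler_normD (T (restr g (star B)) x - T (restr g (star (star G))) x)
    (T (restr g (star (star G))) x); rewrite subrK.
rewrite /sizes -/g -gS; apply: (le_trans tri).
rewrite lerD2r /size_bound -/Y.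
have [c1 c2] := local_const_ge.
set l := lev `^ _ in c1 h3 h4 *; set bg := big ^+ m in c2 h1 h2 h4 *.
have l0 : 0 <= l by exact: powR_ge0.
have bg0 : 0 <= bg by exact: exprn_ge0.
apply: (@le_trans _ _ (C2 * (bg * Y) + l * Wk * Y + l * Wk * (bg * Y) + C1 * (bg * Y))).
  by rewrite !lerD.
have -> : C2 * (bg * Y) + l * Wk * Y + l * Wk * (bg * Y) + C1 * (bg * Y) =
   ((C1 + C2) * bg + Wk * (l * (1 + bg))) * Y by ring.
rewrite ler_wpM2r// /local_const -/l -/bg.
have := mulr_ge0 (addr_ge0 C1_ge0 C2_ge0) (mulr_ge0 l0 (addr_ge0 ler01 bg0)).
have := mulr_ge0 (ltW Wk0) bg0; lra.
Qed.

End bad_sets.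

(** The sum is over fifth enlargements because a point is assigned to a stopping ball if
    it lies in the fifth enlargement. *)
Theorem sparse_domination B0 : BB B0 ->
  exists (A : set (set S)) (E : set S -> set S) (parity : set S -> bool),
    [/\ countable A, A `<=` BB,
      forall Q, A Q -> [/\ measurable (E Q), E Q `<=` Q & (mu Q <= 2%:E * mu (E Q))%E],
      forall Q Q', A Q -> A Q' -> parity Q = parity Q' -> E Q `&` E Q' !=set0 -> Q = Q' &
      mu.-negligible [set x | dil 5 B0 x /\ ~ exists l : seq (set S),
        [/\ uniq l, forall Q, Q \in l -> A Q /\ dil 5 Q x &
            `|T (restr (arg x) (dil 6 B0)) x| <= \sum_(Q <- l) size_bound x (dil 5 Q)]]].
Proof.
move=> bB0; have /choice[H hH] Q : exists H, BB Q -> [/\ measurable H,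
  (mu H <= (bad_share C0 * vol Q)%:E)%E,
  forall x, ~ H x -> forall e : {ffun 'I_m -> bool},
    `|T (fun i => if e i then cut (star Q) (u i) else cut (star Q) (recentred Q i)) x|
      <= lev `^ (m%:R / r) * Wk * \prod_i (if e i then ravg (star Q) (u i)
           else ravg (star Q) (recentred Q i)) &
  forall x, ~ H x -> forall B i, BB B -> B x ->
    ravg B (cut (star Q) (u i)) <= big * ravg (star Q) (u i) /\
    ravg B (cut (star Q) (recentred Q i)) <= big * ravg (star Q) (recentred Q i)].
  have [/exists_bad_set[H hH]|nQ] := pselect (BB Q); first by exists H.
  by exists set0.
have mH Q : BB Q -> measurable (H Q) by case/hH.
have h3 Q : BB Q -> _ := fun bQ => let: And4 _ _ h _ := hH Q bQ in h.
have h4 Q : BB Q -> _ := fun bQ => let: And4 _ _ _ h := hH Q bQ in h.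
have lH Q : BB Q -> (mu (H Q) <= (bad_share C0 * vol Q)%:E)%E by case/hH.
apply: (stopping_family hBB mH lH bB0
  (Phi := fun x Q => sizes (arg x) x Q) (Lam := size_bound)).
- by move=> x Q bQ Qx nH; exact: (size_good (H := H)).
- by move=> x Q G bQ bG Qx Gx nd lt; exact: (size_next (H := H)).
Qed.

(** By (T2) the outer part of the tuple contributes almost a constant on the ball; by
    the weak type bound there are points in the ball at which it is small. *)
Lemma truncation_error (f : tuples) B0 x : LrT mu r f -> BB B0 -> B0 x ->
  `|T f x| <= `|T (restr f (star B0)) x| +
    (C2 + 2 * (lev `^ (m%:R / r) * Wk)) * \prod_i (nrm (f i) / vol B0 `^ r^-1).
Proof.
move=> Lf bB Bx; have bs := star_ball hBB bB; have ms := ball_measurable hBB bs.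
have v0 := vol_gt0 hBB bB; have vs := vol_gt0 hBB bs.
have vp : 0 < vol B0 `^ r^-1 by rewrite powR_gt0.
have Lg := restr_LrT Lf ms.
pose a i := nrm (f i) / vol B0 `^ r^-1.
have a0 i : 0 <= a i by rewrite divr_ge0 ?nrm_ge0// ltW.
have na i : nrm (f i) <= a i * vol (star B0) `^ r^-1.
  rewrite /a -mulrA ler_peMr ?nrm_ge0// mulrC ler_pdivlMr// mul1r.
  rewrite ge0_ler_powR ?nnegrE ?invr_ge0 ?(ltW v0) ?(ltW vs) ?(ltW r0)//.
  exact: (le_vol_dil hBB 1 bB).
have ng i : nrm (restr f (star B0) i) <= a i * vol (star B0) `^ r^-1.
  by apply: le_trans (na i); have [] := cut_Lfun r1 ms (Lf i).
pose E := [set y | (lev `^ (m%:R / r)) * Wk * \prod_i a i < `|T f y|].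
have mE : measurable E by exact: mes_level.
have lE : (mu E <= (vol B0 / 4)%:E)%E.
  apply: (le_trans (weak_level Lf vs lev_ge1 a0 na)).
  rewrite lee_fin ler_pdivrMr ?(lt_le_trans ltr01 lev_ge1)//.
  apply: (le_trans (vol_star hBB bB)); have := lev_ge.
  by have := C0_ge1 hBB; nra.
have [x' [Bx' nE le']] : exists x', [/\ B0 x', ~ E x' &
    `|T (restr f (star B0)) x'| <= lev `^ (m%:R / r) * Wk * \prod_i a i].
  apply: exists_good_point => //.
  apply: (@le_trans _ _ (2%:E * (vol B0 / 4)%:E)%E).
    rewrite lee_wpmul2l// ?lee_fin//; apply: le_trans lE.
    apply: le_measure; rewrite ?inE//.
    by apply: measurableI => //; exact: (ball_measurable hBB).
  by rewrite -EFinM (volE hBB bB) lee_fin; lra.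
have lex' : `|T f x'| <= lev `^ (m%:R / r) * Wk * \prod_i a i.
  by rewrite leNgt; apply/negP.
have hT : `|(T f x - T (restr f (star B0)) x) - (T f x' - T (restr f (star B0)) x')|
   <= C2 * \prod_i a i.
  rewrite -lee_fin; apply: (le_trans (T2 Lf bB Bx Bx')).
  rewrite EFinM lee_wpmul2l ?lee_fin//.
  rewrite -prodEFin; apply: le_prode => i.
    apply: (@le_trans _ _ (avgr mu r B0 (f i))).
      by rewrite (avgrE r1 hBB bB (Lf _)) lee_fin ravg_ge0.
    by apply: ereal_sup_ubound; exists B0 => //; split.
  apply: (sup_avgr_le r1 hBB (Lf i)) => B' bB' BB''.
  apply: (le_trans (ravg_le_nrm r1 hBB bB' (Lf i))).
  rewrite /a ler_wpM2l ?nrm_ge0// lef_pV2 ?posrE ?powR_gt0 ?(vol_gt0 hBB)//.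
  have vB' := vol_gt0 hBB bB'.
  rewrite ge0_ler_powR ?nnegrE ?invr_ge0 ?(ltW v0) ?(ltW vB') ?(ltW r0)//.
  exact: (le_vol hBB).
set b := T f x in hT *; set b1 := T (restr f (star B0)) x in hT *.
set b' := T f x' in lex' hT; set b1' := T (restr f (star B0)) x' in le' hT.
apply: (le_trans (norm_le_increment b b1 b' b1')); rewrite addrC lerD2l.
apply: (le_trans (lerD (lerD hT lex') le')).
by rewrite le_eqVlt; apply/orP; left; apply/eqP; rewrite /a; ring.
Qed.

End decomposition.
End local_oscillation.

(** * Hoelder inequalities and integrals of nonmeasurable functions *)

Section holder.
Context {R : realType}.

Lemma powR_prod (I : Type) (s : seq I) (f : I -> R) (a : R) : (forall i, 0 <= f i) ->
  (\prod_(i <- s) f i) `^ a = \prod_(i <- s) f i `^ a.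
Proof.
move=> f0; elim: s => [|i s IH]; first by rewrite !big_nil powR1.
by rewrite !big_cons powRM ?prodr_ge0// IH.
Qed.

(** The exponential lies above its tangent at zero; this is applied to the quotients of
    the [x i] by the right-hand side. *)
Lemma weighted_amgm (I : finType) (t x : I -> R) : (forall i, 0 < t i) ->
  \sum_i t i = 1 -> (forall i, 0 <= x i) ->
  \prod_i x i `^ t i <= \sum_i t i * x i.
Proof.
move=> t0 t1 x0; set T := \sum_i t i * x i.
have : 0 <= T by apply: sumr_ge0 => i _; rewrite mulr_ge0// ltW.
rewrite le_eqVlt => /orP[/eqP T0|T0].
  have z i : x i = 0.
    move/esym/eqP : T0; rewrite psumr_eq0; last by move=> j _; rewrite mulr_ge0// ltW.
    by move=> /allP/(_ i (mem_index_enum _)); rewrite mulf_eq0 gt_eqF//= => /eqP.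
  have [i _] : exists i : I, true.
    apply: contrapT => no; move/eqP: t1; rewrite big1 ?(eq_sym 0) ?oner_eq0// => i _.
    by exfalso; apply: no; exists i.
  by rewrite (bigD1 i)//= z powR0 ?gt_eqF// mul0r -T0.
have -> : \prod_i x i `^ t i = T * \prod_i (x i / T) `^ t i.
  have e : \prod_(j : I) T `^ t j = T.
    have -> : \prod_(j : I) T `^ t j = T `^ (\sum_j t j).
      elim: (index_enum I) => [|j s IH]; first by rewrite !big_nil powRr0.
      by rewrite !big_cons IH powRD// (gt_eqF T0) implybT.
    by rewrite t1 powRr1// ltW.
  rewrite -[X in X * _]e -big_split/=; apply: eq_bigr => i _.
  rewrite -powRM ?divr_ge0 ?(ltW T0)//.
  by rewrite mulrC divfK// gt_eqF.
rewrite ler_piMr ?(ltW T0)//.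
apply: (@le_trans _ _ (\prod_i expR (t i * (x i / T - 1)))).
  apply: ler_prod => i _; rewrite powR_ge0/=.
  rewrite [t i * _]mulrC expRM ge0_ler_powR ?nnegrE ?expR_ge0 ?divr_ge0 ?(ltW T0) ?(ltW (t0 i))//.
  by have := expR_ge1Dx (x i / T - 1); rewrite addrC subrK.
have -> : \prod_i expR (t i * (x i / T - 1)) = expR (\sum_i t i * (x i / T - 1)).
  by elim: (index_enum I) => [|i s IH]; rewrite ?big_nil ?expR0// !big_cons IH expRD.
rewrite (_ : \sum_i _ = 0) ?expR0//.
under eq_bigr do rewrite mulrBr mulr1 mulrA.
by rewrite sumrB -mulr_suml -/T divff ?gt_eqF// t1 subrr.
Qed.

(** Homogeneity: with [B i] the integrals of the factors, both sides of Hoelder's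
    inequality appear after integration. *)
Lemma weighted_amgm_scaled (I : finType) (t x B : I -> R) : (forall i, 0 < t i) ->
  \sum_i t i = 1 -> (forall i, 0 <= x i) -> (forall i, 0 < B i) ->
  \prod_i x i `^ t i <= \prod_i B i `^ t i * \sum_i t i / B i * x i.
Proof.
move=> t0 t1 x0 B0.
have -> : \prod_i x i `^ t i = \prod_i B i `^ t i * \prod_i (x i / B i) `^ t i.
  rewrite -big_split/=; apply: eq_bigr => i _.
  rewrite -powRM ?divr_ge0 ?(ltW (B0 _))//.
  by rewrite mulrC divfK// gt_eqF.
rewrite ler_wpM2l//; first by apply: prodr_ge0 => i _; rewrite powR_ge0.
apply: (le_trans (weighted_amgm t0 t1 _)); first by move=> i; rewrite divr_ge0// ltW.
by apply: ler_sum => i _; rewrite mulrAC mulrA.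
Qed.

Lemma holder_sum (I : finType) (J : Type) (s : seq J) (t B : I -> R) (x : J -> I -> R) :
  (forall i, 0 < t i) -> \sum_i t i = 1 -> (forall k i, 0 <= x k i) ->
  (forall i, 0 <= B i) -> (forall i, \sum_(k <- s) x k i <= B i) ->
  \sum_(k <- s) \prod_i x k i `^ t i <= \prod_i B i `^ t i.
Proof.
move=> t0 t1 x0 B0 xB.
have [Bp|/existsNP[i /negP]] := pselect (forall i, 0 < B i); last first.
  rewrite -leNgt => Bi0.
  have : \sum_(k <- s) x k i = 0.
    apply/eqP; rewrite eq_le (le_trans (xB i))//= sumr_ge0//.
  have -> : \sum_(k <- s) \prod_i x k i `^ t i = \sum_(k <- s) (x k i `^ t i) *
      \prod_(j | j != i) x k j `^ t j.
    by apply: eq_bigr => k _; rewrite (bigD1 i).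
  move=> e; apply: (@le_trans _ _ 0); last by apply: prodr_ge0 => j _; rewrite powR_ge0.
  elim: s e {xB} => [|k s IH]; first by rewrite !big_nil.
  rewrite !big_cons => e.
  have s0 : 0 <= \sum_(j <- s) x j i by exact: sumr_ge0.
  have := x0 k i => xk; have e1 : x k i = 0 by lra.
  by rewrite e1 powR0 ?gt_eqF// mul0r add0r IH//; lra.
apply: (@le_trans _ _ (\sum_(k <- s) \prod_i B i `^ t i * \sum_i t i / B i * x k i)).
  by apply: ler_sum => k _; exact: weighted_amgm_scaled.
rewrite -mulr_sumr ler_piMr//; first by apply: prodr_ge0 => i _; rewrite powR_ge0.
rewrite exchange_big/= -t1; apply: ler_sum => i _.
rewrite -mulr_sumr mulrAC ler_pdivrMr//.
by apply: ler_wpM2l => //; exact: ltW.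
Qed.

Lemma holder2_sum (J : Type) (s : seq J) (t a b : R) (x y : J -> R) :
  0 < t < 1 -> (forall k, 0 <= x k) -> (forall k, 0 <= y k) ->
  0 <= a -> 0 <= b -> \sum_(k <- s) x k <= a -> \sum_(k <- s) y k <= b ->
  \sum_(k <- s) x k `^ t * y k `^ (1 - t) <= a `^ t * b `^ (1 - t).
Proof.
move=> /andP[t0 t1] x0 y0 a0 b0 xa yb.
have := @holder_sum bool J s (fun c => if c then t else 1 - t)
  (fun c => if c then a else b) (fun k c => if c then x k else y k).
rewrite !big_bool/= => H; have {}H := H _ _ _ _ _.
have e k : \prod_i (if i then x k else y k) `^ (if i then t else 1 - t) =
  x k `^ t * y k `^ (1 - t) by rewrite big_bool.
rewrite (eq_bigr _ (fun k _ => e k)) in H; apply: H.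
- by case=> //; rewrite subr_gt0.
- by rewrite addrC subrK.
- by move=> k; case.
- by case.
- by case.
Qed.

Context {d : measure_display} {S : measurableType d}.
Variable mu : {measure set S -> \bar R}.

Lemma holder_integral (I : finType) (D : set S) (t B : I -> R) (u : I -> S -> R) :
  measurable D -> (forall i, 0 < t i) -> \sum_i t i = 1 ->
  (forall i, measurable_fun setT (u i)) -> (forall i x, 0 <= u i x) ->
  (forall i, 0 <= B i) -> (forall i, \int[mu]_(x in D) (u i x)%:E <= (B i)%:E)%E ->
  (\int[mu]_(x in D) (\prod_i u i x `^ t i)%:E <= (\prod_i B i `^ t i)%:E)%E.
Proof.
move=> mD t0 t1 mu_ u0 B0 uB.
have mp i : measurable_fun setT (fun x => u i x `^ t i).
  exact: (measurableT_comp (measurable_powR _)).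
have mprod : measurable_fun D (fun x => (\prod_i u i x `^ t i)%:E).
  by apply/measurable_EFinP; apply: measurable_funTS; apply: measurable_prod.
have p0 x : 0 <= \prod_i u i x `^ t i by apply: prodr_ge0 => i _; rewrite powR_ge0.
have [Bp|/existsNP[i /negP]] := pselect (forall i, 0 < B i); last first.
  rewrite -leNgt => Bi0.
  have e : (\int[mu]_(x in D) `|(u i x)%:E| = 0)%E.
    apply/eqP; rewrite eq_le; apply/andP; split; last by exact: integral_ge0.
    under eq_integral do rewrite gee0_abs ?lee_fin//.
    by apply: (le_trans (uB i)); rewrite lee_fin.
  have mui : measurable_fun D (fun x => (u i x)%:E).
    by apply/measurable_EFinP; exact: measurable_funTS.
  have ae := (ae_eq_integral_abs mu mD mui).1 e.
  rewrite (@ae_eq_integral _ _ _ mu D (cst 0%E) _ mD mprod).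
  - by rewrite integral0 lee_fin; apply: prodr_ge0 => j _; rewrite powR_ge0.
  - exact: measurable_cst.
  - apply: filterS ae => x ux Dx; have /= := ux Dx => -[uix].
    by rewrite (bigD1 i)//= uix powR0 ?gt_eqF// mul0r.
apply: (@le_trans _ _ (\int[mu]_(x in D) (\prod_i B i `^ t i *
    \sum_i t i / B i * u i x)%:E)%E).
  apply: ge0_le_integral => //.
  - by move=> x _; rewrite lee_fin.
  - apply/measurable_EFinP; apply: measurable_funTS.
    apply: measurable_funM => //; apply: measurable_sum => i.
    exact: measurable_funM.
  - by move=> x _; rewrite lee_fin; exact: weighted_amgm_scaled.
have c0 i : 0 <= t i / B i by rewrite divr_ge0// ltW.
under eq_integral do rewrite EFinM -sumEFin.
rewrite ge0_integralZl//; last 3 first.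
- apply: emeasurable_sum => i; apply/measurable_EFinP; apply: measurable_funTS.
  exact: measurable_funM.
- by move=> x _; apply: sume_ge0 => i _; rewrite lee_fin mulr_ge0.
- by rewrite lee_fin; apply: prodr_ge0 => i _; rewrite powR_ge0.
rewrite ge0_integral_sum//; last 2 first.
- by move=> i; apply/measurable_EFinP; apply: measurable_funTS; exact: measurable_funM.
- by move=> i x _; rewrite lee_fin mulr_ge0.
rewrite -[leRHS]mule1 lee_wpmul2l//.
  by rewrite lee_fin; apply: prodr_ge0 => i _; rewrite powR_ge0.
rewrite -t1 -sumEFin; apply: lee_sum => i _.
under eq_integral do rewrite EFinM.
rewrite ge0_integralZl//; last 3 first.
- by apply/measurable_EFinP; apply: measurable_funTS.
- by move=> x _; rewrite lee_fin.
- by rewrite lee_fin.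
apply: (@le_trans _ _ ((t i / B i)%:E * (B i)%:E)%E).
  by rewrite lee_wpmul2l// lee_fin.
by rewrite -EFinM divfK// gt_eqF.
Qed.

Lemma holder2_integral (D : set S) (t a b : R) (u v : S -> R) :
  measurable D -> 0 < t < 1 -> measurable_fun setT u -> measurable_fun setT v ->
  (forall x, 0 <= u x) -> (forall x, 0 <= v x) -> 0 <= a -> 0 <= b ->
  (\int[mu]_(x in D) (u x)%:E <= a%:E)%E -> (\int[mu]_(x in D) (v x)%:E <= b%:E)%E ->
  (\int[mu]_(x in D) (u x `^ t * v x `^ (1 - t))%:E <= (a `^ t * b `^ (1 - t))%:E)%E.
Proof.
move=> mD /andP[t0 t1] mu_ mv u0 v0 a0 b0 ua vb.
have := @holder_integral bool D (fun c => if c then t else 1 - t)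
  (fun c => if c then a else b) (fun c => if c then u else v) mD.
rewrite big_bool/= => H; have {H} := H _ _ _ _ _ _.
rewrite big_bool/=; under eq_integral do rewrite big_bool/=.
apply.
- by case=> //; rewrite subr_gt0.
- by rewrite addrC subrK.
- by case.
- by case.
- by case.
- by case.
Qed.

Import HBNNSimple.

(** For an integrand that need not be measurable the integral is still monotone almost
    everywhere when the larger function is measurable, because simple functions below it
    are. *)
Lemma integral_le_ae (f h : S -> \bar R) : measurable_fun setT h ->
  (forall x, 0 <= h x)%E -> {ae mu, forall x, (f x <= h x)%E} ->
  (\int[mu]_x f x <= \int[mu]_x h x)%E.
Proof.
move=> mh h0 fh; rewrite [leLHS]/integral patch_setT.
set a := ereal_sup _; set b := ereal_sup _.
have b0 : (0 <= b)%E.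
  apply: ereal_sup_ubound; exists (@nnsfun0 _ _ R); last exact: sintegral0.
  by move=> x /=; rewrite funeneg_ge0.
suff : (a <= \int[mu]_x h x)%E.
  move=> ah; by apply: le_trans ah; rewrite -[leRHS]adde0 leeD2l// oppe_le0.
apply: ub_ereal_sup => _ [s sf <-]; rewrite -integralT_nnsfun.
apply: ae_ge0_le_integral => //.
- by move=> x _; rewrite lee_fin fun_ge0.
- by apply/measurable_EFinP.
- apply: filterS fh => x fx _; apply: (le_trans (sf x)) => /=.
  by rewrite funeposE ge_max fx h0.
Qed.

Lemma integral_ge_ae (f h : S -> \bar R) : measurable_fun setT h ->
  (forall x, 0 <= h x)%E -> {ae mu, forall x, (h x <= f x)%E} ->
  (\int[mu]_x h x <= \int[mu]_x f x)%E.
Proof.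
move=> mh h0 [N [mN N0 hN]].
have e : (\int[mu]_x h x = \int[mu]_x (h \_ (~` N)) x)%E.
  apply: ae_eq_integral => //.
    by apply/(measurable_restrictT _ (measurableC mN)); exact: measurable_funTS.
  exists N; split=> // x /= nx; apply: contrapT => nNx; apply: nx => _.
  by rewrite patchE ifT// inE.
have k0 x : (0 <= (h \_ (~` N)) x)%E by rewrite patchE; case: ifP.
have kf x : ((h \_ (~` N)) x <= (f^\+)%E x)%E.
  rewrite patchE; case: ifPn => [|_]; last exact: funepos_ge0.
  rewrite inE => nN; rewrite funeposE le_max; apply/orP; left.
  by apply: contrapT => nle; apply: nN; exact: (hN x).
rewrite e [leRHS]/integral patch_setT.
set a := ereal_sup _; set b := ereal_sup _.
have -> : b = 0%E.
  apply/eqP; rewrite eq_le; apply/andP; split; last first.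
    apply: ereal_sup_ubound; exists (@nnsfun0 _ _ R); last exact: sintegral0.
    by move=> x /=; rewrite funeneg_ge0.
  apply: ub_ereal_sup => _ [s sf <-]; rewrite -integralT_nnsfun.
  have -> : (0 = \int[mu]_x (cst 0%E : S -> \bar R) x)%E by rewrite integral0.
  apply: ae_ge0_le_integral => //.
  - by move=> x _; rewrite lee_fin fun_ge0.
  - exact/measurable_EFinP.
  - exists N; split=> // x /= nx; apply: (hN x) => hf; apply: nx => _.
    apply: (le_trans (sf x)); rewrite funenegE ge_max lexx andbT leeNl oppe0.
    exact: le_trans hf.
rewrite sube0 ge0_integralTE//; apply: le_ereal_sup => _ [s sk <-].
by exists s => // x; exact: le_trans (kf x).
Qed.

Lemma limn_einfE (u : nat -> \bar R) : limn_einf u = ereal_sup (range (einfs u)).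
Proof. by rewrite limn_einf_lim; apply/cvg_lim => //; exact: cvg_einfs_sup. Qed.

Lemma limn_einf_ge (u : nat -> \bar R) (a : \bar R) :
  (\forall n \near \oo, (a <= u n)%E) -> (a <= limn_einf u)%E.
Proof.
move=> [N _ aN]; rewrite limn_einfE; apply: (@le_trans _ _ (einfs u N)).
  by apply: le_ereal_inf_tmp => _ [n /= Nn <-]; exact: aN.
by apply: ereal_sup_ubound; exists N.
Qed.

Lemma limn_einf_le (u : nat -> \bar R) (a : \bar R) :
  (forall n, (u n <= a)%E) -> (limn_einf u <= a)%E.
Proof.
move=> ua; rewrite limn_einfE; apply: ub_ereal_sup => _ [n _ <-].
by apply: le_trans (ua n); apply: ereal_inf_lbound; exists n => /=.
Qed.

Lemma measurable_limn_einf (g : nat -> S -> \bar R) :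
  (forall n, measurable_fun setT (g n)) -> measurable_fun setT (fun x => limn_einf (g^~ x)).
Proof.
move=> mg.
have -> : (fun x => limn_einf (g^~ x)) = (fun x => (- limn_esup (fun n => - g n x))%E).
  apply/funext => x; rewrite -(limn_einfN (fun n => (- g n x)%E)); congr limn_einf.
  by apply/funext => n /=; rewrite oppeK.
apply: measurableT_comp => //.
apply: (measurable_fun_limn_esup (f := fun n x => (- g n x)%E)) => n.
exact: measurableT_comp.
Qed.

(** Fatou's lemma in the form in which limits are taken below: the limit function need
    not be measurable. *)
Lemma integral_le_liminf (f : S -> \bar R) (g : nat -> S -> \bar R) (K : \bar R) :
  (forall n, measurable_fun setT (g n)) -> (forall n x, 0 <= g n x)%E ->
  {ae mu, forall x, (f x <= limn_einf (g^~ x))%E} ->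
  (forall n, \int[mu]_x g n x <= K)%E -> (\int[mu]_x f x <= K)%E.
Proof.
move=> mg g0 fg gK.
have l0 x : (0 <= limn_einf (g^~ x))%E.
  by apply: limn_einf_ge; apply: nearW.
apply: (@le_trans _ _ (\int[mu]_x limn_einf (g^~ x))%E).
  by apply: integral_le_ae => //; exact: measurable_limn_einf.
apply: (le_trans (fatou mu measurableT mg (fun n x _ => g0 n x))).
exact: limn_einf_le.
Qed.

End holder.

(** * Dual tuples of weights *)

Lemma prod_expR {R : realType} (I : Type) (s : seq I) (f : I -> R) :
  \prod_(i <- s) expR (f i) = expR (\sum_(i <- s) f i).
Proof. by elim: s => [|i s IH]; rewrite ?big_nil ?expR0// !big_cons IH expRD. Qed.

Lemma prod_option {R : comPzSemiRingType} (I : finType) (F : option I -> R) :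
  \prod_j F j = F None * \prod_i F (Some i).
Proof.
rewrite (bigD1 None)//=; congr (_ * _).
rewrite (reindex_omap Some id)/=; last by case.
by apply: eq_bigl => i; rewrite eqxx.
Qed.

Lemma sum_option {R : pzSemiRingType} (I : finType) (F : option I -> R) :
  \sum_j F j = F None + \sum_i F (Some i).
Proof.
rewrite (bigD1 None)//=; congr (_ + _).
rewrite (reindex_omap Some id)/=; last by case.
by apply: eq_bigl => i; rewrite eqxx.
Qed.

Lemma positive_integral_gt0 {R : realType} {d : measure_display} {S : measurableType d}
    (mu : {measure set S -> \bar R}) (phi : S -> R) (D : set S) :
  measurable_fun setT phi -> (forall x, 0 < phi x) -> measurable D -> (0 < mu D)%E ->
  (0 < \int[mu]_(x in D) (phi x)%:E)%E.
Proof.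
move=> mp p0 mD D0; rewrite lt0e integral_ge0 ?andbT; last first.
  by move=> x _; rewrite lee_fin ltW.
apply/eqP => e; have h : (\int[mu]_(x in D) `|(phi x)%:E| = 0)%E.
  by under eq_integral do rewrite gee0_abs ?lee_fin ?(ltW (p0 _))//.
have mpD : measurable_fun D (fun x => (phi x)%:E).
  by apply: measurable_funTS; exact/measurable_EFinP.
have [N [mN N0 hN]] := (ae_eq_integral_abs mu mD mpD).1 h.
suff : (mu D <= 0)%E by rewrite leNgt D0.
rewrite -N0; apply: le_measure; rewrite ?inE// => x Dx; apply: hN => /= hx.
by have [e0] := hx Dx; have := p0 x; rewrite e0 ltxx.
Qed.

Section masses.
Context {R : realType} {d : measure_display} {S : measurableType d}.
Variable mu : {measure set S -> \bar R}.
Variables (BB : set (set S)) (star : set S -> set S) (C0 : R).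
Hypothesis hBB : ball_basis mu BB star C0.
Local Notation vol := (vol mu).
Implicit Types (phi : S -> R) (B D : set S).

(** Weights are finite and positive almost everywhere; on a suitable representative both
    hold everywhere, and all powers are real numbers. *)
Definition pos_weight phi := [/\ measurable_fun setT phi, forall x, 0 < phi x &
  forall B, BB B -> (\int[mu]_(x in B) (phi x)%:E < +oo)%E].

Definition mass phi D : R := fine (\int[mu]_(x in D) (phi x)%:E)%E.

Lemma integral_subset phi D D' : measurable_fun setT phi -> (forall x, 0 <= phi x) ->
  measurable D -> measurable D' -> D `<=` D' ->
  (\int[mu]_(x in D) (phi x)%:E <= \int[mu]_(x in D') (phi x)%:E)%E.
Proof.
move=> mp p0 mD mD' DD'; apply: ge0_subset_integral => //.
  by apply: measurable_funTS; exact/measurable_EFinP.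
by move=> x _; rewrite lee_fin.
Qed.

Lemma massE phi B D : pos_weight phi -> BB B -> measurable D -> D `<=` B ->
  (\int[mu]_(x in D) (phi x)%:E = (mass phi D)%:E)%E.
Proof.
move=> [mp p0 fp] bB mD DB; rewrite fineK// ge0_fin_numE; last first.
  by apply: integral_ge0 => x _; rewrite lee_fin ltW.
apply: le_lt_trans (fp B bB); apply: integral_subset => //; first by move=> x; exact: ltW.
exact: (ball_measurable hBB).
Qed.

Lemma mass_ballE phi B : pos_weight phi -> BB B ->
  (\int[mu]_(x in B) (phi x)%:E = (mass phi B)%:E)%E.
Proof. by move=> wp bB; apply: (massE wp bB) => //; exact: (ball_measurable hBB). Qed.

Lemma mass_ge0 phi D : (forall x, 0 <= phi x) -> 0 <= mass phi D.
Proof. by move=> p0; apply/fine_ge0/integral_ge0 => x _; rewrite lee_fin. Qed.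

Lemma le_mass phi B D D' : pos_weight phi -> BB B -> measurable D -> measurable D' ->
  D `<=` D' -> D' `<=` B -> mass phi D <= mass phi D'.
Proof.
move=> wp bB mD mD' DD' D'B; have [mp p0 _] := wp.
rewrite -lee_fin -(massE wp bB mD (subset_trans DD' D'B)) -(massE wp bB mD' D'B).
by apply: integral_subset => // x; exact: ltW.
Qed.

Lemma mass_gt0 phi B D : pos_weight phi -> BB B -> measurable D -> D `<=` B ->
  (0 < mu D)%E -> 0 < mass phi D.
Proof.
move=> wp bB mD DB D0; have [mp p0 _] := wp.
by rewrite -lte_fin -(massE wp bB mD DB); exact: positive_integral_gt0.
Qed.

Lemma mass_ball_gt0 phi B : pos_weight phi -> BB B -> 0 < mass phi B.
Proof.
move=> wp bB; apply: (mass_gt0 wp bB) => //; first exact: (ball_measurable hBB).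
by have /andP[] := ball_measure hBB bB.
Qed.

Definition mean phi B : R := mass phi B / vol B.

Lemma mean_gt0 phi B : pos_weight phi -> BB B -> 0 < mean phi B.
Proof. by move=> wp bB; rewrite divr_gt0 ?(vol_gt0 hBB)// mass_ball_gt0. Qed.

Section dual_tuples.
Variables (I : finType) (phi : I -> S -> R) (k : I -> R) (A : R).
Hypothesis (wphi : forall i, pos_weight (phi i)) (k0 : forall i, 0 < k i).
Hypothesis kphi : forall x, \prod_i phi i x `^ k i = 1.
Hypothesis phiA : forall B, BB B -> \prod_i mean (phi i) B `^ k i <= A.

Let K := \sum_i k i.

(** Hoelder's inequality for the function one. *)
Lemma holder_dual_tuple (J : finType) (h : J -> S -> R) (l : J -> R) B D :
  (0 < \sum_j l j) -> (forall j, 0 < l j) -> (forall j, pos_weight (h j)) ->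
  BB B -> measurable D -> D `<=` B -> (forall x, \prod_j h j x `^ l j = 1) ->
  fine (mu D) `^ (\sum_j l j) <= \prod_j mass (h j) D `^ l j.
Proof.
move=> L0 l0 wh bB mD DB hl; set L := \sum_j l j.
have fD : mu D \is a fin_num.
  rewrite ge0_fin_numE//; apply: (@le_lt_trans _ _ (mu B)).
    by apply: le_measure; rewrite ?inE//; exact: (ball_measurable hBB).
  by rewrite (volE hBB bB) ltry.
have h0 j x : 0 < h j x by have [] := wh j.
have := @holder_integral _ _ _ mu J D (fun j => l j / L) (fun j => mass (h j) D) h mD.
have e x : \prod_i h i x `^ (l i / L) = 1.
  transitivity ((\prod_i h i x `^ l i) `^ L^-1); last by rewrite hl powR1.
  rewrite powR_prod; last by move=> i; exact: powR_ge0.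
  by apply: eq_bigr => i _; rewrite powRrM.
under eq_integral do rewrite e.
rewrite integral_cst// mul1e -(fineK fD) lee_fin => H.
have {}H : fine (mu D) <= \prod_i mass (h i) D `^ (l i / L).
  apply: H.
  - by move=> j; rewrite divr_gt0.
  - by rewrite -mulr_suml divff// gt_eqF.
  - by move=> j; have [] := wh j.
  - by move=> j x; exact: ltW.
  - by move=> j; apply: mass_ge0 => x; exact: ltW.
  - by move=> j; rewrite (massE (wh j) bB).
apply: (@le_trans _ _ ((\prod_i mass (h i) D `^ (l i / L)) `^ L)).
  rewrite ge0_ler_powR ?nnegrE ?fine_ge0 ?(ltW L0)//.
  by apply: prodr_ge0 => i _; exact: powR_ge0.
rewrite powR_prod; last by move=> i; exact: powR_ge0.
rewrite le_eqVlt; apply/orP; left; apply/eqP; apply: eq_bigr => i _.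
by rewrite -powRrM divfK// gt_eqF.
Qed.

Lemma mean_product_ge1 B : BB B -> 0 < K -> 1 <= \prod_i mean (phi i) B `^ k i.
Proof.
move=> bB K0.
have mB := ball_measurable hBB bB; have v0 := vol_gt0 hBB bB.
have := holder_dual_tuple K0 k0 wphi bB mB (@subset_refl _ _) kphi.
rewrite -/(vol B) => h.
have -> : \prod_i mean (phi i) B `^ k i = (\prod_i mass (phi i) B `^ k i) / vol B `^ K.
  under eq_bigr => i _.
    rewrite powRM ?invr_ge0 ?(ltW v0) ?(ltW (mass_ball_gt0 (wphi i) bB))//.
    rewrite -powR_inv1 ?(ltW v0)// -powRrM mulN1r powRN; over.
  rewrite big_split/= prodfV; congr (_ / _).
  rewrite /K; elim: (index_enum I) => [|i s IH]; first by rewrite !big_nil powRr0.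
  by rewrite !big_cons IH powRD// (gt_eqF v0) implybT.
by rewrite ler_pdivlMr ?powR_gt0// mul1r.
Qed.

Lemma dual_tuple_ge1 B : BB B -> 0 < K -> 1 <= A.
Proof. by move=> bB K0; exact: le_trans (mean_product_ge1 bB K0) (phiA bB). Qed.

End dual_tuples.

Section sparse_sums.
Variables (s : seq (set S)) (E : set S -> set S) (parity : set S -> bool).
Hypothesis us : uniq s.
Hypothesis mE : forall A, A \in s -> measurable (E A).
Hypothesis dE : forall A B, A \in s -> B \in s -> parity A = parity B ->
  E A `&` E B !=set0 -> A = B.

(** Two families of disjoint sets. *)
Lemma sparse_integral_sum (h : S -> R) : measurable_fun setT h -> (forall x, 0 <= h x) ->
  (\sum_(A <- s) \int[mu]_(x in E A) (h x)%:E <= 2%:E * \int[mu]_x (h x)%:E)%E.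
Proof.
move=> mh h0; have hE0 A : (0 <= \int[mu]_(x in A) (h x)%:E)%E.
  by apply: integral_ge0 => x _; rewrite lee_fin.
have half (b : bool) : (\sum_(A <- s | parity A == b) \int[mu]_(x in E A) (h x)%:E <=
    \int[mu]_x (h x)%:E)%E.
  pose F A := if A \in s then E A else set0.
  have mF A : measurable (F A) by rewrite /F; case: ifP => // As; exact: mE.
  rewrite -big_filter; pose s' := [seq A <- s | parity A == b].
  have -> : (\sum_(A <- s') \int[mu]_(x in E A) (h x)%:E =
      \sum_(A <- s') \int[mu]_(x in F A) (h x)%:E)%E.
    apply: eq_big_seq => A; rewrite mem_filter => /andP[_ As].
    by rewrite /F As.
  rewrite -ge0_integral_bigsetU//.
  - apply: integral_subset => //; exact: bigsetU_measurable.
  - exact: filter_uniq.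
  - move=> A B /=; rewrite !mem_filter => /andP[/eqP pA As] /andP[/eqP pB Bs] AB.
    by apply: dE => //; [rewrite pA pB|move: AB; rewrite /F As Bs].
  - by apply: measurable_funTS; exact/measurable_EFinP.
  - by move=> x _; rewrite lee_fin.
rewrite (bigID (fun A => parity A == true))/=.
have -> : (2%:E * \int[mu]_x (h x)%:E = \int[mu]_x (h x)%:E + \int[mu]_x (h x)%:E)%E.
  by rewrite -{1}[2]/(1 + 1 :> R) EFinD ge0_muleDl ?lee_fin// mul1e.
apply: leeD; first exact: half.
apply: le_trans (half false); rewrite le_eqVlt; apply/orP; left; apply/eqP.
by apply: eq_bigl => A; case: (parity A).
Qed.

End sparse_sums.
End masses.

(** * Weighted maximal operators *)

Lemma opnorm_ge0 {R : realType} (X Y : Type) (D : set X) (nX : X -> \bar R)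
    (nY : Y -> \bar R) (U : X -> Y) : (0 <= opnorm D nX nY U)%E.
Proof. by apply: le_ereal_inf_tmp => _ [c [c0 _] <-]; rewrite lee_fin. Qed.

Section weighted_maximal_operator.
Context {R : realType} {d : measure_display} {S : measurableType d}.
Variable mu : {measure set S -> \bar R}.
Variables (BB : set (set S)) (star : set S -> set S) (C0 : R).
Hypothesis hBB : ball_basis mu BB star C0.
Local Notation mass := (mass mu).
Local Notation pos_weight := (pos_weight mu BB).

(** The infimum that defines an operator norm is itself a bound. *)
Lemma opnorm_attained {X Y : Type} (D : set X) (nX : X -> \bar R) (nY : Y -> \bar R)
    (U : X -> Y) f : D f -> (0 <= nX f < +oo)%E -> (opnorm D nX nY U < +oo)%E ->
  (nY (U f) <= (fine (opnorm D nX nY U))%:E * nX f)%E.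
Proof.
move=> Df /andP[f0 fy] Ny; set N := opnorm _ _ _ _ in Ny *.
have N0 : (0 <= N)%E by apply: le_ereal_inf_tmp => _ [c [c0 _] <-]; rewrite lee_fin.
have fN : N \is a fin_num by rewrite ge0_fin_numE.
have ff : nX f \is a fin_num by rewrite ge0_fin_numE.
rewrite -(fineK ff); set a := fine (nX f); have a0 : 0 <= a by exact: fine_ge0.
apply/lee_addgt0Pr => eps eps0.
have [_ [c [c0 hc] <-] lt] := @lb_ereal_inf_adherent R _ (eps / (a + 1)) (divr_gt0 eps0
  (ltr_wpDl a0 ltr01)) fN.
have {}lt : (c%:E < N + (eps / (a + 1))%:E)%E by exact: lt.
rewrite -(fineK fN) -EFinD lte_fin in lt.
apply: (le_trans (hc f Df)); rewrite -(fineK ff) -/a -!EFinM -EFinD lee_fin.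
apply: (le_trans (ler_wpM2r a0 (ltW lt))); rewrite mulrDl lerD2l.
rewrite -mulrA ler_piMr ?(ltW eps0)//.
by rewrite mulrC ler_pdivrMr ?mul1r ?lerDl// ltr_wpDl.
Qed.

Variables (sg : S -> \bar R) (v : S -> R) (q : R).
Hypothesis (q1 : 0 < q) (wv : pos_weight v) (msg : measurable_fun setT sg).
Hypothesis sgv : {ae mu, forall x, sg x = (v x)%:E}.

Lemma wLnorm_real (g : S -> R) : measurable_fun setT g -> (forall x, 0 <= g x) ->
  (wLnorm mu sg q (EFin \o g) = (\int[mu]_x (g x `^ q * v x)%:E) `^ q^-1)%E.
Proof.
have [mv v0 _] := wv => mg g0; rewrite /wLnorm; congr (_ `^ _)%E.
have mgq : measurable_fun setT (fun x => g x `^ q).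
  exact: (measurableT_comp (measurable_powR q)).
apply: ae_eq_integral => //.
- apply: emeasurable_funM => //; apply: (measurableT_comp (measurable_poweR q)).
  by apply: measurableT_comp => //; exact/measurable_EFinP.
- by apply/measurable_EFinP; exact: measurable_funM.
- apply: filterS sgv => x e _ /=.
  by rewrite e ger0_norm// EFinM.
Qed.

(** The maximal function is a supremum of uncountably many averages and may fail to be
    measurable. Measurable minorants [k] suffice. *)
Lemma wmaximal_bound (g k : S -> R) (G : R) :
  measurable_fun setT g -> (forall x, 0 <= g x) -> 0 <= G ->
  (\int[mu]_x (g x `^ q * v x)%:E <= G%:E)%E ->
  measurable_fun setT k -> (forall x, 0 <= k x) ->
  (forall x, 0 < k x -> exists B, [/\ BB B, B x &
     ((k x * mass v B)%:E <= \int[mu]_(y in B) (g y * v y)%:E)%E]) ->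
  (wmaximal_norm mu BB sg q < +oo)%E ->
  (\int[mu]_x (k x `^ q * v x)%:E <=
    (fine (wmaximal_norm mu BB sg q) `^ q * G)%:E)%E.
Proof.
have [mv v0 _] := wv => mg g0 G0 gG mk k0 hk Ny.
have gn : (wLnorm mu sg q (EFin \o g) <= (G `^ q^-1)%:E)%E.
  rewrite wLnorm_real// -poweR_EFin; apply: gt0_ler_poweR => //.
  - by rewrite invr_ge0 ltW.
  - rewrite in_itv/= leey andbT; apply: integral_ge0 => x _.
    by rewrite lee_fin mulr_ge0 ?powR_ge0// ltW.
  - by rewrite in_itv/= leey andbT lee_fin.
have gy : (wLnorm mu sg q (EFin \o g) < +oo)%E by apply: le_lt_trans gn _; rewrite ltry.
have gn0 : (0 <= wLnorm mu sg q (EFin \o g))%E by exact: poweR_ge0.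
have := @opnorm_attained _ _ _ _ _ (wmaximal mu BB sg) g (conj mg gy) _ Ny.
rewrite gn0 gy => /(_ isT) H.
rewrite -/(wmaximal_norm mu BB sg q) in H; set N := fine _ in H *.
have N0 : 0 <= N.
  by apply: fine_ge0; exact: opnorm_ge0.
have mkq : measurable_fun setT (fun x => k x `^ q).
  exact: (measurableT_comp (measurable_powR q)).
have kM : (\int[mu]_x (k x `^ q * v x)%:E <=
    \int[mu]_x (`|wmaximal mu BB sg g x| `^ q * sg x))%E.
  apply: integral_ge_ae.
  - by apply/measurable_EFinP; exact: measurable_funM.
  - by move=> x; rewrite lee_fin mulr_ge0 ?powR_ge0// ltW.
  - apply: filterS sgv => x e; rewrite e EFinM lee_wpmul2r ?lee_fin ?(ltW (v0 x))//.
    have := k0 x; rewrite le_eqVlt => /orP[/eqP <-|kx].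
      by rewrite powR0 ?gt_eqF// poweR_ge0.
    have [B [bB Bx hB]] := hk x kx; have mB := ball_measurable hBB bB.
    rewrite -poweR_EFin; apply: gt0_ler_poweR; rewrite ?(ltW q1)//.
    - by rewrite in_itv/= leey andbT lee_fin.
    - by rewrite in_itv/= leey andbT.
    - apply: le_trans (lee_abs _).
      apply: (@le_trans _ _ ((\int[mu]_(y in B) sg y)^-1 *
        \int[mu]_(y in B) (`|g y|%:E * sg y))%E); last first.
        by apply: ereal_sup_ubound; exists B.
      have -> : (\int[mu]_(y in B) sg y = (mass v B)%:E)%E.
        rewrite -(mass_ballE hBB wv bB); apply: ae_eq_integral => //.
        - exact: measurable_funTS.
        - by apply/measurable_EFinP; exact: measurable_funTS.
        - by apply: filterS sgv => y ey _.
      have -> : (\int[mu]_(y in B) (`|g y|%:E * sg y) =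
          \int[mu]_(y in B) (g y * v y)%:E)%E.
        apply: ae_eq_integral => //.
        - apply: measurable_funTS; apply: emeasurable_funM => //.
          by apply/measurable_EFinP; exact: measurableT_comp.
        - by apply/measurable_EFinP; apply: measurable_funTS; exact: measurable_funM.
        - by apply: filterS sgv => y ey _; rewrite ey ger0_norm// EFinM.
      have mB0 := mass_ball_gt0 hBB wv bB.
      rewrite inver gt_eqF//; apply: (@le_trans _ _ ((mass v B)^-1%:E * (k x * mass v B)%:E)%E).
        by rewrite -EFinM lee_fin mulrCA mulVf ?mulr1// gt_eqF.
      by rewrite lee_wpmul2l// lee_fin invr_ge0 ltW.
have i0 : (0 <= \int[mu]_x (k x `^ q * v x)%:E)%E.
  by apply: integral_ge0 => x _; rewrite lee_fin mulr_ge0 ?powR_ge0// ltW.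
have h2 : ((\int[mu]_x (k x `^ q * v x)%:E) `^ q^-1 <= (N * G `^ q^-1)%:E)%E.
  apply: (@le_trans _ _ (wLnorm mu sg q (wmaximal mu BB sg g))).
    apply: (gt0_ler_poweR _ _ _ kM); rewrite ?invr_ge0 ?(ltW q1)//.
    - by rewrite in_itv/= leey andbT.
    - by rewrite in_itv/= leey andbT; exact: le_trans i0 kM.
  apply: (le_trans H); rewrite EFinM lee_wpmul2l// lee_fin.
have e1 (z : \bar R) : (0 <= z)%E -> ((z `^ q^-1) `^ q = z)%E.
  by move=> z0; rewrite -poweRrM mulVf ?gt_eqF// poweRe1.
rewrite -(e1 _ i0); have -> : N `^ q * G = (N * G `^ q^-1) `^ q.
  by rewrite powRM ?powR_ge0// -powRrM mulVf ?gt_eqF// powRr1.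
rewrite -poweR_EFin; apply: (gt0_ler_poweR _ _ _ h2); rewrite ?(ltW q1)//.
- by rewrite in_itv/= leey andbT poweR_ge0.
- by rewrite in_itv/= leey andbT lee_fin mulr_ge0// powR_ge0.
Qed.

(** The indicator of a ball is a minorant of its own maximal function. *)
Lemma wmaximal_norm_ge1 B : BB B -> (1 <= wmaximal_norm mu BB sg q)%E.
Proof.
have [mv v0 _] := wv => bB; have mB := ball_measurable hBB bB.
have [Ny|] := boolP (wmaximal_norm mu BB sg q < +oo)%E; last first.
  by rewrite -leNgt; apply: le_trans; rewrite leey.
have fN : wmaximal_norm mu BB sg q \is a fin_num.
  by rewrite ge0_fin_numE// opnorm_ge0.
have mB0 := mass_ball_gt0 hBB wv bB.
have ind (f : S -> R) D : measurable D ->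
    (\int[mu]_(x in D) (\1_B x * f x)%:E = \int[mu]_(x in D `&` B) (f x)%:E)%E.
  move=> mD; rewrite [RHS]integral_mkcondr; apply: eq_integral => x _.
  by rewrite patchE indicE; case: (x \in B); rewrite ?mul1r ?mul0r.
have iB x : (\1_B x : R) `^ q = \1_B x.
  by rewrite indicE; case: (x \in B); rewrite ?powR1 ?powR0 ?gt_eqF.
have := @wmaximal_bound (\1_B) (\1_B) (mass v B).
under eq_integral do rewrite iB.
rewrite ind// setTI (mass_ballE hBB wv bB) => H.
have {}H : ((mass v B)%:E <= (fine (wmaximal_norm mu BB sg q) `^ q * mass v B)%:E)%E.
  apply: H => //; first exact: ltW.
  move=> x; rewrite {1}indicE; case: (boolP (x \in B)) => [xB _|_]; last by rewrite ltxx.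
  exists B; split=> //; first by rewrite inE in xB.
  by rewrite ind// setIid indicE xB mul1r (mass_ballE hBB wv bB).
rewrite -(fineK fN) lee_fin leNgt; apply/negP => lt.
move: H; rewrite lee_fin leNgt => /negP; apply.
rewrite gtr_pMl// (_ : 1 = 1 `^ q); last by rewrite powR1.
rewrite gt0_ltr_powR ?nnegrE ?fine_ge0 ?opnorm_ge0//.
Qed.

(** On the set [E A] the maximal function is at least the average over [dl A]; the
    largest of finitely many averages is a measurable minorant of it. *)
Lemma sparse_maximal (s : seq (set S)) (E : set S -> set S) (parity : set S -> bool)
    (dl : set S -> set S) (H : set S -> R) (g : S -> R) (G : R) :
  uniq s -> (forall A, A \in s -> [/\ BB (dl A), measurable (E A) & E A `<=` dl A]) ->
  (forall A B, A \in s -> B \in s -> parity A = parity B ->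
    E A `&` E B !=set0 -> A = B) ->
  measurable_fun setT g -> (forall x, 0 <= g x) -> 0 <= G ->
  (\int[mu]_x (g x `^ q * v x)%:E <= G%:E)%E ->
  (forall A, 0 <= H A) ->
  (forall A, A \in s -> ((H A * mass v (dl A))%:E <= \int[mu]_(y in dl A) (g y * v y)%:E)%E) ->
  (wmaximal_norm mu BB sg q < +oo)%E ->
  \sum_(A <- s) H A `^ q * mass v (E A) <= 2 * (fine (wmaximal_norm mu BB sg q) `^ q * G).
Proof.
have [mv v0 _] := wv => us hs dE mg g0 G0 gG H0 hH Ny.
pose k x := \big[Num.max/0]_(A <- s) (H A * \1_(dl A) x).
have mk : measurable_fun setT k.
  rewrite /k; elim: s hs {us dE hH k} => [|A l IH] hs.
    rewrite (_ : (fun=> _) = cst 0); first exact: measurable_cst.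
    by apply/funext => x; rewrite big_nil.
  rewrite (_ : (fun=> _) = (fun x => H A * \1_(dl A) x) \max
    (fun x => \big[Num.max/0]_(A <- l) (H A * \1_(dl A) x))); last first.
    by apply/funext => x; rewrite big_cons.
  apply: measurable_maxr.
    apply: measurable_funM => //; apply: measurable_indic.
    by have [bA _ _] := hs A (mem_head _ _); exact: (ball_measurable hBB).
  by apply: IH => B Bl; apply: hs; rewrite inE Bl orbT.
have kge A x : A \in s -> dl A x -> H A <= k x.
  rewrite /k; elim: (s) => // B l IH; rewrite inE big_cons le_max => /orP[/eqP -> Bx|Al Ax].
    by rewrite indicE mem_set// mulr1 lexx.
  by rewrite IH// orbT.
have katt x : k x = 0 \/ exists A, [/\ A \in s, dl A x & k x = H A].
  rewrite /k; elim: (s) => [|A l IH]; first by left; rewrite big_nil.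
  rewrite big_cons; case: leP => _.
    case: IH => [->|[B [Bl Bx ->]]]; first by left.
    by right; exists B; rewrite inE Bl orbT.
  rewrite indicE; case: (boolP (x \in dl A)) => [xA|_]; last by left; rewrite mulr0.
  by right; exists A; rewrite mulr1 mem_head; split=> //; rewrite inE in xA.
have k0 x : 0 <= k x by case: (katt x) => [->|[A [_ _ ->]]].
have mkq : measurable_fun setT (fun x => k x `^ q * v x).
  by apply: measurable_funM => //; exact: (measurableT_comp (measurable_powR q)).
have kq0 x : 0 <= k x `^ q * v x by rewrite mulr_ge0 ?powR_ge0// ltW.
rewrite -lee_fin -sumEFin.
apply: (@le_trans _ _ (\sum_(A <- s) \int[mu]_(x in E A) (k x `^ q * v x)%:E)%E).
  rewrite big_seq [leRHS]big_seq; apply: lee_sum => A As; have [bA mA EA] := hs A As.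
  have -> : ((H A `^ q * mass v (E A))%:E =
      \int[mu]_(x in E A) ((H A `^ q)%:E * (v x)%:E))%E.
    rewrite ge0_integralZl//; last 3 first.
    - by apply/measurable_EFinP; exact: measurable_funTS.
    - by move=> x _; rewrite lee_fin ltW.
    - by rewrite lee_fin powR_ge0.
    by rewrite (massE hBB wv bA mA EA).
  apply: ge0_le_integral => //.
  - by move=> x _; rewrite -EFinM lee_fin mulr_ge0 ?powR_ge0// ltW.
  - by apply/measurable_EFinP; apply: measurable_funTS; exact: measurable_funM.
  - by apply/measurable_EFinP; exact: measurable_funTS.
  - move=> x Ex; rewrite -EFinM lee_fin ler_wpM2r ?(ltW (v0 x))//.
    rewrite ge0_ler_powR ?nnegrE ?(ltW q1)//.
    by apply: kge => //; exact: EA.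
apply: (le_trans (@sparse_integral_sum _ _ _ mu s E parity us _ dE _ mkq kq0)).
  by move=> A /hs[].
rewrite EFinM lee_wpmul2l ?lee_fin//; apply: (wmaximal_bound (g := g)) => //.
move=> x kx; case: (katt x) => [e|[A [As Ax e]]]; first by rewrite e ltxx in kx.
exists (dl A); split=> //; first by have [] := hs A As.
by rewrite e; exact: hH.
Qed.

End weighted_maximal_operator.

(** * Weighted bounds for sparse sums *)

Section exponents.
Context {R : realType} {m : nat}.
Variables (r P e : R) (p : 'I_m -> R).
Hypothesis (r0 : 0 < r) (P0 : 0 < P) (rp : forall i, r < p i).

(** The next lemma after taking logarithms, where it is a linear combination: [1 / r]
    times the upper bound, [k] times the difference of the upper and the lower bound,
    and the monotonicity in each variable. *)
Lemma log_sparse_exponents (x x' a c k : R) (y y' : 'I_m -> R) :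
  x' <= x -> (forall i, y' i <= y i) -> 0 <= k ->
  r / P * x + \sum_i (1 - r / p i) * y i <= a ->
  - c <= r / P * x' + \sum_i (1 - r / p i) * y' i ->
  (forall i, (p i)^-1 <= k * (1 - r / p i)) -> e <= k * (r / P) ->
  \sum_i y i / r + (P^-1 + e) * x <=
    (r^-1 + k) * a + k * c + e * x' + \sum_i y' i / p i.
Proof.
move=> xx yy k0 ha hc hk he.
have pi0 i : 0 < p i by exact: lt_trans (rp i).
pose U := \sum_i (1 - r / p i) * y i; pose U' := \sum_i (1 - r / p i) * y' i.
pose Z := \sum_i y i / p i; pose Z' := \sum_i y' i / p i.
have -> : \sum_i y i / r = r^-1 * U + Z.
  rewrite /U /Z mulr_sumr -big_split/=; apply: eq_bigr => i _.
  by field; rewrite !gt_eqF.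
have ZU : Z - Z' <= k * (U - U').
  rewrite /Z /Z' /U /U' -!sumrB mulr_sumr; apply: ler_sum => i _.
  rewrite -mulrBl -mulrBr mulrA mulrC ler_wpM2r ?subr_ge0//.
have exx : e * (x - x') <= k * (r / P) * (x - x') by rewrite ler_wpM2r// subr_ge0.
have h1 := ler_wpM2l k0 ha; have h2 := ler_wpM2l k0 hc.
have r1 : 0 <= r^-1 by rewrite invr_ge0 ltW.
have h3 := ler_wpM2l r1 ha.
rewrite -/U in h1 h3; rewrite -/U' in h2; rewrite -/Z'.
have e1 : r^-1 * (r / P * x + U) = P^-1 * x + r^-1 * U by field; rewrite !gt_eqF.
rewrite e1 in h3; nra.
Qed.

(** For [e = 1 - 1 / P] the conditions on [k] say that [1 + k * r] is at least [P] and
    all the exponents conjugate to [p i / r], which is how their maximum enters the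
    theorem. In the application [X] and [Y i] are means over a ball, and [X'], [Y' i]
    masses of its core divided by the measure of the ball. *)
Lemma sparse_exponents (X X' A D k : R) (Y Y' : 'I_m -> R) :
  0 < X' -> X' <= X -> (forall i, 0 < Y' i) -> (forall i, Y' i <= Y i) ->
  0 < A -> 0 < D -> 0 <= k ->
  X `^ (r / P) * \prod_i Y i `^ (1 - r / p i) <= A ->
  D^-1 <= X' `^ (r / P) * \prod_i Y' i `^ (1 - r / p i) ->
  (forall i, (p i)^-1 <= k * (1 - r / p i)) -> e <= k * (r / P) ->
  X `^ (P^-1 + e) * \prod_i Y i `^ r^-1 <=
    D `^ k * A `^ (r^-1 + k) * (X' `^ e * \prod_i Y' i `^ (p i)^-1).
Proof.
move=> X'0 XX Y'0 YY A0 D0 k0 hA hD hk he.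
have X0 := lt_le_trans X'0 XX; have Y0 i : 0 < Y i := lt_le_trans (Y'0 i) (YY i).
have E (x : R) : 0 < x -> x = expR (ln x) by move=> x0; rewrite lnK.
have ep (z : 'I_m -> R) (t : 'I_m -> R) : (forall i, 0 < z i) ->
    \prod_i z i `^ t i = expR (\sum_i t i * ln (z i)).
  move=> z0; rewrite -prod_expR; apply: eq_bigr => i _.
  by rewrite {1}(E _ (z0 i)) -expRM mulrC.
have ep1 (z t : R) : 0 < z -> z `^ t = expR (t * ln z).
  by move=> z0; rewrite {1}(E _ z0) -expRM mulrC.
move: hA hD; rewrite !(ep _ _ Y0) !(ep _ _ Y'0) !ep1// -!expRD.
rewrite {1}(E _ A0) ler_expR => hA.
rewrite [D^-1]E ?invr_gt0// ler_expR lnV ?posrE// => hD.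
rewrite ler_expR.
have := log_sparse_exponents _ _ k0 hA hD hk he.
have -> : \sum_i ln (Y i) / r = \sum_i r^-1 * ln (Y i) by apply: eq_bigr => i _; rewrite mulrC.
have -> : \sum_i ln (Y' i) / p i = \sum_i (p i)^-1 * ln (Y' i).
  by apply: eq_bigr => i _; rewrite mulrC.
rewrite !ler_ln ?posrE// => /(_ XX) H.
have {}H := H (fun i => _).
have := H _; rewrite addrC => h; apply: le_trans (h _) _.
  by move=> i; rewrite ler_ln ?posrE.
by rewrite le_eqVlt; apply/orP; left; apply/eqP; ring.
Qed.

End exponents.

Lemma powR_subadd {R : realType} (x y a : R) : 0 <= x -> 0 <= y -> 0 < a <= 1 ->
  (x + y) `^ a <= x `^ a + y `^ a.
Proof.
move=> x0 y0 /andP[a0 a1].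
have := addr_ge0 x0 y0; rewrite le_eqVlt => /orP[/eqP e|s0].
  by rewrite -e powR0 ?gt_eqF// addr_ge0// powR_ge0.
have h z : 0 <= z -> z <= x + y -> z / (x + y) * (x + y) `^ a <= z `^ a.
  rewrite le_eqVlt => /orP[/eqP <- _|z0 zs]; first by rewrite !mul0r powR_ge0.
  have -> : z `^ a = (z / (x + y)) `^ a * (x + y) `^ a.
    by rewrite -powRM ?divr_ge0 ?ltW// divfK// gt_eqF.
  rewrite ler_wpM2r ?powR_ge0//; apply: ger1_powR => //.
  by rewrite divr_gt0//= ler_pdivrMr// mul1r.
have := lerD (h x x0 _) (h y y0 _); rewrite lerDl lerDr => /(_ y0 x0).
by rewrite -mulrDl -mulrDl divff ?gt_eqF// mul1r.
Qed.

Lemma powR_sum_le {R : realType} (J : Type) (s : seq J) (x : J -> R) (a : R) :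
  (forall j, 0 <= x j) -> 0 < a <= 1 ->
  (\sum_(j <- s) x j) `^ a <= \sum_(j <- s) x j `^ a.
Proof.
move=> x0 /andP[a0 a1]; elim: s => [|j s IH]; first by rewrite !big_nil powR0 ?gt_eqF.
rewrite !big_cons; apply: le_trans (powR_subadd _ _ _) _ => //.
- exact: sumr_ge0.
- by rewrite a0.
- by rewrite lerD2l.
Qed.

Section weighted_sparse_bounds.
Context {R : realType} {d : measure_display} {S : measurableType d}.
Variable mu : {measure set S -> \bar R}.
Variables (BB : set (set S)) (star : set S -> set S) (C0 : R).
Hypothesis hBB : ball_basis mu BB star C0.
Local Notation vol := (vol mu).
Local Notation mass := (mass mu).
Local Notation mean := (mean mu).
Local Notation pos_weight := (pos_weight mu BB).
Context {m : nat}.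
Variables (r P A D0 k e : R) (p : 'I_m -> R) (w : S -> R) (sg : 'I_m -> S -> R).
Hypothesis (r1 : 1 <= r) (m0 : (0 < m)%N) (rp : forall i, r < p i).
Hypothesis hP : P^-1 = \sum_i (p i)^-1.
Hypothesis (ww : pos_weight w) (wsg : forall i, pos_weight (sg i)).
Hypothesis dual : forall x, w x `^ (r / P) * \prod_i sg i x `^ (1 - r / p i) = 1.
Hypothesis hA : forall B, BB B ->
  mean w B `^ (r / P) * \prod_i mean (sg i) B `^ (1 - r / p i) <= A.
Hypothesis (D01 : 1 <= D0) (k0 : 0 <= k).
Hypothesis hk : forall i, (p i)^-1 <= k * (1 - r / p i).
Hypothesis he : e <= k * (r / P).

Let r0 : 0 < r. Proof. exact: lt_le_trans ltr01 r1. Qed.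
Let p0 i : 0 < p i. Proof. exact: lt_trans (rp i). Qed.
Let P0 : 0 < P.
Proof.
rewrite -invr_gt0 hP (bigD1 (Ordinal m0))//=.
by apply: ltr_wpDr; [apply: sumr_ge0 => i _|]; rewrite ?invr_ge0 ?invr_gt0 ?ltW.
Qed.
Let gam0 i : 0 < 1 - r / p i.
Proof. by rewrite subr_gt0 ltr_pdivrMr// mul1r. Qed.
Let rP0 : 0 < r / P. Proof. by rewrite divr_gt0. Qed.

(** The target weight and the dual weights form one family, in which the target has the
    index [None]. *)
Definition dual_exp (j : option 'I_m) : R := if j is Some i then 1 - r / p i else r / P.
Definition dual_fun (j : option 'I_m) : S -> R := if j is Some i then sg i else w.

Lemma dual_exp_gt0 j : 0 < dual_exp j. Proof. by case: j. Qed.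
Lemma dual_fun_pos j : pos_weight (dual_fun j). Proof. by case: j. Qed.
Lemma dual_funE x : \prod_j dual_fun j x `^ dual_exp j = 1.
Proof. by rewrite prod_option. Qed.
Lemma dual_meanE B : BB B -> \prod_j mean (dual_fun j) B `^ dual_exp j <= A.
Proof. by move=> bB; rewrite prod_option; exact: hA. Qed.
Lemma dual_exp_sum_gt0 : 0 < \sum_j dual_exp j.
Proof.
rewrite (bigD1 None)//=; apply: ltr_wpDr => //.
by apply: sumr_ge0 => j _; exact/ltW/dual_exp_gt0.
Qed.

Lemma A_ge1 B : BB B -> 1 <= A.
Proof.
move=> bB; apply: (dual_tuple_ge1 hBB dual_fun_pos dual_exp_gt0 dual_funE _ bB).
  exact: dual_meanE.
exact: dual_exp_sum_gt0.
Qed.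

Definition testing_const : R :=
  (D0 `^ (\sum_j dual_exp j)) `^ k * A `^ (r^-1 + k).

(** The lower bound for the masses of [E] is Hoelder's inequality on [E], which has a
    fixed share of the measure of [B]. *)
Lemma ball_testing B E : BB B -> measurable E -> E `<=` B -> vol B <= D0 * fine (mu E) ->
  mass w B `^ (P^-1 + e) * \prod_i mean (sg i) B `^ r^-1 <=
    testing_const * (mass w E `^ e * \prod_i mass (sg i) E `^ (p i)^-1).
Proof.
move=> bB mE EB hE; have v0 := vol_gt0 hBB bB; have mB := ball_measurable hBB bB.
have D0p : 0 < D0 by exact: lt_le_trans D01.
have E0 : 0 < fine (mu E) by rewrite -(pmulr_rgt0 _ D0p); exact: lt_le_trans hE.
have E0' : (0 < mu E)%E.
  rewrite lt_neqAle measure_ge0 andbT; apply/eqP => e0.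
  by move: E0; rewrite -e0 ltxx.
have L0 := dual_exp_sum_gt0.
have A0 := lt_le_trans ltr01 (A_ge1 bB).
have mE0 v : pos_weight v -> 0 < mass v E by move=> wv; exact: (mass_gt0 hBB wv bB).
have mle v : pos_weight v -> mass v E <= mass v B.
  by move=> wv; apply: (le_mass hBB wv bB).
have split_vol (v : S -> R) a : pos_weight v -> mass v E `^ a = (mass v E / vol B) `^ a * vol B `^ a.
  by move=> wv; rewrite -powRM ?divr_ge0 ?(ltW v0) ?(ltW (mE0 _ wv))// divfK// gt_eqF.
have := @sparse_exponents R m r P e p r0 P0 rp (mean w B) (mass w E / vol B) A
   (D0 `^ (\sum_j dual_exp j)) k (fun i => mean (sg i) B) (fun i => mass (sg i) E / vol B).
move=> H; have {}H := H _ _ _ _ _ _ _ _ _ _ _.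
have e1 : mass w B `^ (P^-1 + e) = mean w B `^ (P^-1 + e) * vol B `^ (P^-1 + e).
  by rewrite -powRM ?(ltW v0) ?(ltW (mean_gt0 hBB ww bB))// /mean divfK// gt_eqF.
have e2 : mass w E `^ e * \prod_i mass (sg i) E `^ (p i)^-1 =
   (mass w E / vol B) `^ e * \prod_i (mass (sg i) E / vol B) `^ (p i)^-1 * vol B `^ (P^-1 + e).
  rewrite split_vol//.
  under eq_bigr do rewrite split_vol//.
  rewrite big_split/=.
  have -> : \prod_i vol B `^ (p i)^-1 = vol B `^ P^-1.
    rewrite hP; elim: (index_enum _) => [|i s IH]; first by rewrite !big_nil powRr0.
    by rewrite !big_cons IH powRD// (gt_eqF v0) implybT.
  by rewrite powRD ?(gt_eqF v0) ?implybT//; ring.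
rewrite e1 e2 mulrAC [leRHS]mulrA ler_wpM2r ?powR_ge0//; apply: H.
- by rewrite divr_gt0// mE0.
- by rewrite ler_wpM2r ?invr_ge0 ?(ltW v0)//; exact: mle.
- by move=> i; rewrite divr_gt0// mE0.
- by move=> i; rewrite ler_wpM2r ?invr_ge0 ?(ltW v0)//; exact: mle.
- by [].
- by rewrite powR_gt0.
- by [].
- exact: hA.
- have := holder_dual_tuple hBB dual_exp_sum_gt0 dual_exp_gt0 dual_fun_pos bB mE EB dual_funE.
  rewrite prod_option/= => h.
  have -> : (mass w E / vol B) `^ (r / P) * \prod_i (mass (sg i) E / vol B) `^ (1 - r / p i) =
     (mass w E `^ (r / P) * \prod_i mass (sg i) E `^ (1 - r / p i)) / vol B `^ (\sum_j dual_exp j).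
    rewrite sum_option/= split_vol//.
    under [in RHS]eq_bigr do rewrite split_vol//.
    rewrite big_split/=.
    have -> : \prod_i vol B `^ (1 - r / p i) = vol B `^ (\sum_i (1 - r / p i)).
      elim: (index_enum _) => [|i s IH]; first by rewrite !big_nil powRr0.
      by rewrite !big_cons IH [RHS]powRD// (gt_eqF v0) implybT.
    rewrite powRD ?(gt_eqF v0) ?implybT//; field.
    by rewrite !gt_eqF// powR_gt0.
  rewrite ler_pdivlMr ?powR_gt0//; apply: le_trans h.
  rewrite -powR_inv1 ?powR_ge0// -powRrM mulrN1 powRN.
  rewrite mulrC ler_pdivrMr ?powR_gt0// -powRM ?(ltW E0) ?(ltW D0p)//.
  by rewrite ge0_ler_powR ?nnegrE ?(ltW L0) ?(ltW v0) ?mulr_ge0 ?(ltW E0) ?(ltW D0p)// mulrC.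
- exact: hk.
- exact: he.
Qed.

Section sparse_family.
Variables (s : seq (set S)) (E : set S -> set S) (dl : set S -> set S).
Variables (psi : set S -> S -> R) (a : set S -> R) (H : set S -> 'I_m -> R) (F : 'I_m -> R).
Hypothesis hs : forall Q, Q \in s ->
  [/\ BB (dl Q), measurable (E Q), E Q `<=` dl Q & vol (dl Q) <= D0 * fine (mu (E Q))].
Hypothesis mpsi : forall Q, measurable_fun setT (psi Q).
Hypothesis (psi0 : forall Q x, 0 <= psi Q x) (a0 : forall Q, 0 <= a Q).
Hypothesis (H0 : forall Q i, 0 <= H Q i) (F0 : forall i, 0 <= F i).
Hypothesis ha : forall Q, Q \in s ->
  a Q <= \prod_i (mean (sg i) (dl Q) `^ r^-1 * H Q i).
Hypothesis hF : forall i, \sum_(Q <- s) H Q i `^ p i * mass (sg i) (E Q) <= F i `^ p i.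

Let w0 x : 0 < w x. Proof. by case: ww. Qed.
Let sg0 i x : 0 < sg i x. Proof. by case: (wsg i). Qed.
Let mass0 v D : pos_weight v -> 0 <= mass v D.
Proof. by move=> [_ v0 _]; apply: mass_ge0 => x; exact: ltW. Qed.

Let z Q := \prod_i (H Q i * mass (sg i) (E Q) `^ (p i)^-1).

Let z0 Q : 0 <= z Q.
Proof. by apply: prodr_ge0 => i _; rewrite mulr_ge0 ?powR_ge0. Qed.

(** Hoelder's inequality for sums, with exponents [p i / P]. *)
Lemma sum_sparse_products : \sum_(Q <- s) z Q `^ P <= (\prod_i F i) `^ P.
Proof.
have e1 Q : z Q `^ P = \prod_i (H Q i `^ p i * mass (sg i) (E Q)) `^ (P / p i).
  rewrite /z powR_prod; last by move=> i; rewrite mulr_ge0 ?powR_ge0.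
  apply: eq_bigr => i _; rewrite !powRM ?powR_ge0// ?mass0//.
  rewrite -!powRrM; congr (_ `^ _ * _ `^ _); last by rewrite mulrC.
  by rewrite mulrC divfK// gt_eqF.
have e2 : (\prod_i F i) `^ P = \prod_i (F i `^ p i) `^ (P / p i).
  rewrite powR_prod//; apply: eq_bigr => i _; rewrite -powRrM.
  by rewrite mulrC divfK// gt_eqF.
rewrite (eq_bigr _ (fun Q _ => e1 Q)) e2; apply: holder_sum => //.
- by move=> i; rewrite divr_gt0.
- by rewrite -mulr_sumr -hP divff// gt_eqF.
- by move=> Q i; rewrite mulr_ge0 ?powR_ge0// mass0.
- by move=> i; rewrite powR_ge0.
Qed.

Lemma coefficient_le Q : Q \in s -> mass w (dl Q) `^ (P^-1 + e) * a Q <=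
  testing_const * (mass w (E Q) `^ e * z Q).
Proof.
move=> Qs; have [bQ mE EQ vQ] := hs Qs.
apply: (@le_trans _ _ (mass w (dl Q) `^ (P^-1 + e) *
    \prod_i mean (sg i) (dl Q) `^ r^-1 * \prod_i H Q i)).
  by rewrite -mulrA ler_wpM2l ?powR_ge0// -big_split/= ha.
have := ball_testing bQ mE EQ vQ => h.
apply: (le_trans (ler_wpM2r _ h)); first exact: prodr_ge0.
rewrite le_eqVlt; apply/orP; left; apply/eqP.
rewrite /z big_split/=; ring.
Qed.

Let tc0 : 0 <= testing_const.
Proof. by rewrite mulr_ge0 ?powR_ge0. Qed.

Definition sparse_fun x := \sum_(Q <- s) psi Q x * a Q.

Lemma measurable_sparse_fun : measurable_fun setT sparse_fun.
Proof. by apply: measurable_sum => Q; exact: measurable_funM. Qed.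

Let mG := measurable_sparse_fun.

Let G0 x : 0 <= sparse_fun x.
Proof. by apply: sumr_ge0 => Q _; rewrite mulr_ge0. Qed.

Let mw : measurable_fun setT w. Proof. by case: ww. Qed.

Let mpow (f : S -> R) b : measurable_fun setT f -> measurable_fun setT (fun x => f x `^ b).
Proof. by move=> mf; exact: (measurableT_comp (measurable_powR b)). Qed.

(** For [P <= 1] the power [P] of a sum is at most the sum of the powers, and each term
    can be integrated separately. *)
Lemma sparse_bound_le1 (K : R) : P <= 1 -> e = 0 -> 0 <= K ->
  (forall Q, Q \in s -> (\int[mu]_x (psi Q x `^ P * w x)%:E <=
     (K `^ P * mass w (dl Q))%:E)%E) ->
  (\int[mu]_x (sparse_fun x `^ P * w x)%:E <=
     ((K * testing_const * \prod_i F i) `^ P)%:E)%E.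
Proof.
move=> P1 e0 K0 hK.
have mterm Q : measurable_fun setT (fun x => (psi Q x `^ P * w x)%:E).
  by apply/measurable_EFinP; apply: measurable_funM => //; exact: mpow.
have t0 Q x : 0 <= psi Q x `^ P * w x by rewrite mulr_ge0 ?powR_ge0// ltW.
apply: (@le_trans _ _ (\int[mu]_x \sum_(Q <- s) ((a Q `^ P)%:E * (psi Q x `^ P * w x)%:E))%E).
  apply: ge0_le_integral => //.
  - by move=> x _; rewrite lee_fin mulr_ge0 ?powR_ge0// ltW.
  - by apply/measurable_EFinP; apply: measurable_funM => //; exact: mpow.
  - by apply: emeasurable_sum => Q; exact: emeasurable_funM.
  - move=> x _; under eq_bigr do rewrite -EFinM.
    rewrite sumEFin lee_fin; under eq_bigr do rewrite mulrA.
    rewrite -mulr_suml ler_wpM2r ?(ltW (w0 x))//.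
    apply: (le_trans (@powR_sum_le R _ s _ P _ _)).
    - by move=> Q; rewrite mulr_ge0.
    - by rewrite P0.
    - by apply: ler_sum => Q _; rewrite powRM// mulrC.
rewrite ge0_integral_sum//; last 2 first.
- by move=> Q; exact: emeasurable_funM.
- by move=> Q x _; rewrite -EFinM lee_fin mulr_ge0// powR_ge0.
apply: (@le_trans _ _ (\sum_(Q <- s) ((K * testing_const) `^ P * z Q `^ P)%:E)%E).
  rewrite big_seq [leRHS]big_seq; apply: lee_sum => Q Qs.
  rewrite ge0_integralZl//; last 2 first.
  - by move=> x _; rewrite lee_fin.
  - by rewrite lee_fin powR_ge0.
  apply: (@le_trans _ _ ((a Q `^ P)%:E * (K `^ P * mass w (dl Q))%:E)%E).
    by rewrite lee_wpmul2l ?lee_fin ?powR_ge0//; exact: hK.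
  rewrite -EFinM lee_fin.
  have -> : a Q `^ P * (K `^ P * mass w (dl Q)) =
      K `^ P * (mass w (dl Q) `^ (P^-1 + e) * a Q) `^ P.
    rewrite e0 addr0 [in RHS]powRM ?powR_ge0// -[in RHS]powRrM mulVf ?gt_eqF//.
    by rewrite powRr1 ?mass0//; ring.
  have -> : (K * testing_const) `^ P * z Q `^ P = K `^ P * (testing_const * z Q) `^ P.
    by rewrite powRM// [in RHS]powRM// mulrA.
  rewrite ler_wpM2l ?powR_ge0//.
  have c0 : 0 <= mass w (dl Q) `^ (P^-1 + e) * a Q by rewrite mulr_ge0 ?powR_ge0.
  have := coefficient_le Qs; rewrite {2}e0 powRr0 mul1r => h.
  by rewrite ge0_ler_powR ?nnegrE ?(ltW P0)// mulr_ge0.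
rewrite sumEFin lee_fin -mulr_sumr [leRHS]powRM; last exact: prodr_ge0.
  2: exact: mulr_ge0.
by rewrite ler_wpM2l ?powR_ge0//; exact: sum_sparse_products.
Qed.

Hypothesis supp_psi : forall Q x, Q \in s -> ~ dl Q x -> psi Q x = 0.

(** Duality against the power [P - 1] of the function itself. The function is truncated
    first, since the integral has to be finite to be cancelled on both sides. *)
Lemma sparse_bound_gt1 (K N : R) : 1 < P -> e = 1 - P^-1 -> 0 <= K -> 0 <= N ->
  (forall (g : S -> R) (G : R), measurable_fun setT g -> (forall x, 0 <= g x) -> 0 <= G ->
    (\int[mu]_x (g x `^ conj_exp P * w x)%:E <= G%:E)%E ->
    exists h : set S -> R, [/\ forall Q, 0 <= h Q,
      forall Q, Q \in s -> (\int[mu]_x (psi Q x * (g x * w x))%:E <=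
        (K * mass w (dl Q) * h Q)%:E)%E &
      \sum_(Q <- s) h Q `^ conj_exp P * mass w (E Q) <= N `^ conj_exp P * G]) ->
  (\int[mu]_x (sparse_fun x `^ P * w x)%:E <=
     ((K * N * testing_const * \prod_i F i) `^ P)%:E)%E.
Proof.
move=> P1 eE K0 N0 test.
set B := K * N * _ * _; have B0 : 0 <= B.
  by apply: mulr_ge0; [apply: mulr_ge0 => //; exact: mulr_ge0|exact: prodr_ge0].
have Pne : P != 0 by rewrite gt_eqF.
have P1' : 0 < P - 1 by rewrite subr_gt0.
pose P' := conj_exp P; have P'0 : 0 < P' by rewrite divr_gt0.
have e0 : 0 < e by rewrite eE subr_gt0 invf_lt1.
have eP' : e = P'^-1 by rewrite eE /P' /conj_exp; field; rewrite Pne gt_eqF.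
pose tr n x := Num.min (sparse_fun x) n%:R.
have tr0 n x : 0 <= tr n x by rewrite le_min G0 ler0n.
have mtr n : measurable_fun setT (tr n) by exact: measurable_minr.
have mterm (f : S -> R) : measurable_fun setT f ->
    measurable_fun setT (fun x => (f x * w x)%:E).
  by move=> mf; apply/measurable_EFinP; exact: measurable_funM.
(* The truncation is bounded and supported in finitely many balls. *)
have trB n : (\int[mu]_x (tr n x `^ P * w x)%:E <= (B `^ P)%:E)%E.
  have fin : (\int[mu]_x (tr n x `^ P * w x)%:E <=
      \sum_(Q <- s) (n%:R `^ P * mass w (dl Q))%:E)%E.
    have ew Q : Q \in s -> (\int[mu]_x ((n%:R `^ P)%:E * (\1_(dl Q) x * w x)%:E) =
        (n%:R `^ P * mass w (dl Q))%:E)%E.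
      move=> Qs; have [bQ _ _ _] := hs Qs; have mQ := ball_measurable hBB bQ.
      rewrite ge0_integralZl//; last 2 first.
      - by apply: mterm; exact: measurable_indic.
      - by move=> x _; rewrite lee_fin mulr_ge0// ?(ltW (w0 x))// indicE.
      rewrite EFinM; congr (_ * _)%E.
      rewrite -(mass_ballE hBB ww bQ) [RHS]integral_mkcond; apply: eq_integral => x _.
      by rewrite patchE indicE; case: (x \in dl Q); rewrite ?mul1r ?mul0r.
    rewrite [leRHS]big_seq -(eq_bigr _ ew) -big_seq.
    pose ind Q : S -> R := if `[< measurable (dl Q) >] then \1_(dl Q) else cst 0.
    have mind Q : measurable_fun setT (ind Q).
      by rewrite /ind; case: asboolP => // h; exact: measurable_indic.
    have ind0 Q x : 0 <= ind Q x by rewrite /ind; case: ifP => // _; rewrite indicE.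
    have indE Q : Q \in s -> ind Q = \1_(dl Q).
      move=> /hs[bQ _ _ _]; rewrite /ind asboolT//; exact: (ball_measurable hBB).
    have -> : (\sum_(Q <- s) \int[mu]_x ((n%:R `^ P)%:E * (\1_(dl Q) x * w x)%:E) =
       \sum_(Q <- s) \int[mu]_x ((n%:R `^ P)%:E * (ind Q x * w x)%:E))%E.
      by apply: eq_big_seq => Q Qs; rewrite indE.
    rewrite -ge0_integral_sum//; last 2 first.
    - by move=> Q; apply: emeasurable_funM => //; exact: mterm.
    - by move=> Q x _; rewrite -EFinM lee_fin !mulr_ge0 ?powR_ge0// ltW.
    apply: ge0_le_integral => //.
    - by move=> x _; rewrite lee_fin mulr_ge0 ?powR_ge0// ltW.
    - by apply: mterm; exact: mpow.
    - apply: emeasurable_sum => Q; apply: emeasurable_funM => //; exact: mterm.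
    - move=> x _; under eq_bigr do rewrite -EFinM.
      rewrite sumEFin lee_fin.
      have [[Q [Qs Qx]]|no] := pselect (exists Q, Q \in s /\ dl Q x).
        rewrite (big_rem Q)//= indE// indicE mem_set// mul1r.
        rewrite -[leLHS]addr0 lerD//.
          by rewrite ler_wpM2r ?(ltW (w0 x))// ge0_ler_powR ?nnegrE ?(ltW P0)// ge_min lexx orbT.
        by apply: sumr_ge0 => Q' _; rewrite !mulr_ge0 ?powR_ge0// ltW.
      rewrite (_ : tr n x = 0) ?powR0// ?mul0r.
        by apply: sumr_ge0 => Q' _; rewrite !mulr_ge0 ?powR_ge0// ltW.
      rewrite /tr (_ : sparse_fun x = 0) ?min_l//.
      rewrite /sparse_fun big_seq big1// => Q Qs.
      by rewrite supp_psi ?mul0r// => Qx; apply: no; exists Q.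
  set I := (\int[mu]_x _)%E in fin *.
  have I0 : (0 <= I)%E.
    by apply: integral_ge0 => x _; rewrite lee_fin mulr_ge0 ?powR_ge0// ltW.
  have fI : I \is a fin_num.
    by rewrite ge0_fin_numE//; apply: (le_lt_trans fin); rewrite sumEFin ltry.
  pose g x := tr n x `^ (P - 1).
  have g0 x : 0 <= g x by exact: powR_ge0.
  have mg : measurable_fun setT g by exact: mpow.
  have gE x : g x `^ P' = tr n x `^ P.
    by rewrite /g -powRrM /P' /conj_exp mulrC divfK// gt_eqF.
  have [|h [h0 hh hs']] := test g (fine I) mg g0 (fine_ge0 I0).
    by under eq_integral do rewrite gE; rewrite fineK.
  have step1 : (I <= \int[mu]_x (sparse_fun x * (g x * w x))%:E)%E.
    apply: ge0_le_integral => //.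
    - by move=> x _; rewrite lee_fin mulr_ge0 ?powR_ge0// ltW.
    - by apply: mterm; exact: mpow.
    - by apply/measurable_EFinP; do 2!apply: measurable_funM => //.
    - move=> x _; rewrite lee_fin mulrA ler_wpM2r ?(ltW (w0 x))//.
      have -> : tr n x `^ P = tr n x * g x.
        rewrite /g -{2}(powRr1 (tr0 n x)) -powRD ?subrKC//.
        by rewrite (negbTE Pne).
      by rewrite ler_wpM2r// ge_min lexx.
  have step2 : (\int[mu]_x (sparse_fun x * (g x * w x))%:E <=
      \sum_(Q <- s) (a Q * (K * mass w (dl Q) * h Q))%:E)%E.
    have -> : (\int[mu]_x (sparse_fun x * (g x * w x))%:E =
        \int[mu]_x \sum_(Q <- s) ((a Q)%:E * (psi Q x * (g x * w x))%:E))%E.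
      apply: eq_integral => x _; rewrite /sparse_fun mulr_suml -sumEFin.
      by apply: eq_bigr => Q _; rewrite -EFinM; congr EFin; ring.
    have mq Q : measurable_fun setT (fun x => (psi Q x * (g x * w x))%:E).
      by apply/measurable_EFinP; do 2!apply: measurable_funM => //.
    have q0 Q x : 0 <= psi Q x * (g x * w x) by rewrite !mulr_ge0// ltW.
    rewrite ge0_integral_sum//; last 2 first.
    - by move=> Q; exact: emeasurable_funM.
    - by move=> Q x _; rewrite -EFinM lee_fin mulr_ge0.
    rewrite big_seq [leRHS]big_seq; apply: lee_sum => Q Qs.
    rewrite ge0_integralZl// ?lee_fin//; last by move=> x _; rewrite lee_fin.
    by rewrite EFinM lee_wpmul2l ?lee_fin//; exact: hh.
  have step3 : \sum_(Q <- s) (a Q * (K * mass w (dl Q) * h Q)) <=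
      K * testing_const * (\sum_(Q <- s) z Q * (h Q * mass w (E Q) `^ e)).
    rewrite big_distrr/= big_seq [leRHS]big_seq; apply: ler_sum => Q Qs.
    have := coefficient_le Qs.
    rewrite eE addrC subrK powRr1 ?mass0// -eE => h1.
    have := ler_wpM2l (mulr_ge0 K0 (h0 Q)) h1 => h2.
    apply: le_trans (le_trans _ h2) _; last first.
      by rewrite le_eqVlt; apply/orP; left; apply/eqP; ring.
    by rewrite le_eqVlt; apply/orP; left; apply/eqP; ring.
  have step4 : \sum_(Q <- s) z Q * (h Q * mass w (E Q) `^ e) <=
      \prod_i F i * (N * fine I `^ e).
    have := @holder2_sum R _ s P^-1 ((\prod_i F i) `^ P) (N `^ P' * fine I)
      (fun Q => z Q `^ P) (fun Q => h Q `^ P' * mass w (E Q)).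
    rewrite -eE => H'; apply: le_trans (le_trans _ (H' _ _ _ _ _ _ _)) _.
    - rewrite le_eqVlt; apply/orP; left; apply/eqP; apply: eq_bigr => Q _.
      rewrite -powRrM divff// powRr1//; congr (_ * _).
      by rewrite powRM ?powR_ge0 ?mass0// -powRrM eP' divff ?gt_eqF// powRr1.
    - by rewrite invr_gt0 P0 invf_lt1.
    - by move=> Q; exact: powR_ge0.
    - by move=> Q; rewrite mulr_ge0 ?powR_ge0 ?mass0.
    - exact: powR_ge0.
    - by rewrite mulr_ge0 ?powR_ge0 ?fine_ge0.
    - exact: sum_sparse_products.
    - exact: hs'.
    rewrite -powRrM divff// powRr1 ?prodr_ge0//.
    by rewrite powRM ?powR_ge0 ?fine_ge0// -powRrM eP' divff ?gt_eqF// powRr1.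
  have : fine I <= B * fine I `^ e.
    rewrite -lee_fin fineK//; apply: (le_trans step1); apply: (le_trans step2).
    rewrite sumEFin lee_fin; apply: (le_trans step3).
    apply: (le_trans (ler_wpM2l (mulr_ge0 K0 tc0) step4)).
    by rewrite le_eqVlt; apply/orP; left; apply/eqP; rewrite /B; ring.
  have := fine_ge0 I0; rewrite le_eqVlt => /orP[/eqP i0 _|i0 le].
    by rewrite -(fineK fI) -i0 lee_fin powR_ge0.
  have iP : fine I `^ P^-1 <= B.
    have -> : fine I `^ P^-1 = fine I / fine I `^ e.
      have -> : P^-1 = 1 - e by rewrite eE; ring.
      by rewrite powRB ?(gt_eqF i0) ?implybT// powRr1// ltW.
    by rewrite ler_pdivrMr ?powR_gt0.
  rewrite -(fineK fI) lee_fin -(powRr1 (ltW i0)) -{1}(mulVf Pne) powRrM.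
  by rewrite ge0_ler_powR ?nnegrE ?powR_ge0 ?(ltW P0).
apply: (integral_le_liminf (g := fun n x => (tr n x `^ P * w x)%:E)) => //.
- by move=> n; apply: mterm; exact: mpow.
- by move=> n x; rewrite lee_fin mulr_ge0 ?powR_ge0// ltW.
- apply: aeW => x; apply: limn_einf_ge.
  exists (Num.truncn (sparse_fun x)).+1 => // n /= hn.
  rewrite /tr min_l//; apply: ltW; apply: lt_le_trans (truncnS_gt _) _.
  by rewrite ler_nat.
Qed.

End sparse_family.
End weighted_sparse_bounds.

(** * Muckenhoupt constants *)

Section muckenhoupt_constants.
Context {R : realType} {d : measure_display} {S : measurableType d}.
Variable mu : {measure set S -> \bar R}.
Variables (BB : set (set S)) (star : set S -> set S) (C0 : R).
Hypothesis hBB : ball_basis mu BB star C0.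
Local Notation vol := (vol mu).
Local Notation mass := (mass mu).
Local Notation mean := (mean mu).
Local Notation pos_weight := (pos_weight mu BB).

Lemma avg_mean v B : pos_weight v -> BB B -> avg mu B (EFin \o v) = (mean v B)%:E.
Proof.
move=> wv bB; rewrite /avg (mass_ballE hBB wv bB) (volE hBB bB) inver.
by rewrite gt_eqF ?(vol_gt0 hBB)// -EFinM mulrC.
Qed.

(** The quantity that defines [A_q], for a real valued weight. *)
Definition A_bound (v : S -> R) (q M : R) :=
  pos_weight (fun x => v x `^ (1 - conj_exp q)) /\
  forall B, BB B ->
    mean v B * mean (fun x => v x `^ (1 - conj_exp q)) B `^ (q - 1) <= M.

Lemma Ap_const_real v q : 1 < q -> pos_weight v ->
  Ap_const mu BB (EFin \o v) q = ereal_sup [set avg mu B (EFin \o v) *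
    avg mu B (EFin \o (fun x => v x `^ (1 - conj_exp q)))%R `^ (q - 1) | B in BB]%E.
Proof. by move=> q1 wv; rewrite /Ap_const gt_eqF. Qed.

Lemma Ap_const_le v q M : 1 < q -> pos_weight v -> A_bound v q M ->
  (Ap_const mu BB (EFin \o v) q <= M%:E)%E.
Proof.
move=> q1 wv [wd hM]; rewrite Ap_const_real//; apply: ub_ereal_sup => _ [B bB <-].
by rewrite !avg_mean// poweR_EFin -EFinM lee_fin; exact: hM.
Qed.

Lemma weight_real v : pos_weight v -> weight mu (EFin \o v).
Proof.
move=> [mv v0 _]; split; first exact/measurable_EFinP.
by apply: aeW => x; rewrite lte_fin v0 ltry.
Qed.

Lemma dual_pow_measurable v b : pos_weight v ->
  measurable_fun setT (fun x => v x `^ b) /\ forall x, 0 < v x `^ b.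
Proof.
move=> [mv v0 _]; split; last by move=> x; exact: powR_gt0.
exact: (measurableT_comp (measurable_powR b)).
Qed.

(** For [q > 1] the weight and its dual weight form a dual tuple. For [q = 1] the
    maximal function of the weight on a ball is at least its mean. *)
Lemma Ap_const_ge1 v q B0 : BB B0 -> 1 <= q -> pos_weight v ->
  (1 <= Ap_const mu BB (EFin \o v) q)%E.
Proof.
move=> bB0 q1 wv; have [mv v0 fv] := wv.
have [Ny|] := boolP (Ap_const mu BB (EFin \o v) q < +oo)%E; last first.
  by rewrite -leNgt; apply: le_trans; rewrite leey.
have v0' := vol_gt0 hBB bB0; have m0 := mass_ball_gt0 hBB wv bB0.
have mB := ball_measurable hBB bB0.
move: q1; rewrite le_eqVlt => /orP[/eqP qe|q1].
  move: Ny; rewrite /Ap_const -qe eqxx unlock => Ny.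
  set N := (X in (1 <= X)%E) in Ny *.
  have muT : (0 < mu setT)%E.
    apply: (@lt_le_trans _ _ (mu B0)); first by have /andP[] := ball_measure hBB bB0.
    by apply: le_measure; rewrite ?inE.
  have Nge : {ae mu, forall x, (`|maximal mu BB (EFin \o v) x * ((v x)%:E)^-1| <= N)%E}.
    rewrite /N muT; exact: ess_sup_inf.ess_sup_ge.
  have N0 : (0 <= N)%E.
    by rewrite /N muT; apply: ess_sup_inf.ess_sup_gee => //; apply: aeW => x; exact: abse_ge0.
  have fN : N \is a fin_num by rewrite ge0_fin_numE.
  have : ((mean v B0)%:E * mu B0 <= N * (mass v B0)%:E)%E.
    rewrite -(mass_ballE hBB wv bB0) -integral_cst//.
    have N0' : 0 <= fine N by exact: fine_ge0.
    rewrite -(fineK fN) -ge0_integralZl//; last 2 first.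
    - by apply/measurable_EFinP; exact: measurable_funTS.
    - by move=> x _; rewrite lee_fin ltW.
    apply: ae_ge0_le_integral => //.
    - by move=> x _; rewrite lee_fin ltW// (mean_gt0 hBB).
    - by move=> x _; rewrite -EFinM lee_fin mulr_ge0// ltW.
    - by apply/measurable_EFinP; apply: measurable_funTS; exact: measurable_funM.
    - apply: filterS Nge => x hx Bx; rewrite fineK//.
      have : (`|(mean v B0)%:E| <= `|maximal mu BB (EFin \o v) x|)%E.
        rewrite gee0_abs ?lee_fin ?(ltW (mean_gt0 hBB wv bB0))//.
        apply: le_trans (lee_abs _); apply: ereal_sup_ubound; exists B0 => //=.
        rewrite -(avg_mean wv bB0); congr avg; apply/funext => y /=.
        by rewrite ger0_norm// ltW.
      rewrite gee0_abs ?lee_fin ?(ltW (mean_gt0 hBB wv bB0))// => h.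
      have vx := v0 x; move: hx; rewrite abseM inver gt_eqF//.
      rewrite (@gee0_abs _ ((v x)^-1)%:E) ?lee_fin ?invr_ge0 ?(ltW vx)// => hx.
      apply: (le_trans h); rewrite -(@lee_pmul2r _ ((v x)^-1)%:E) ?lte_fin ?invr_gt0//.
      by rewrite -muleA -EFinM divff ?mule1// gt_eqF.
  rewrite (volE hBB bB0) -EFinM divfK ?gt_eqF// -(fineK fN) -EFinM !lee_fin.
  by rewrite -[X in X <= _ -> _]mul1r ler_pM2r.
have q1' : 0 < q - 1 by rewrite subr_gt0.
have qe : conj_exp q = 1 + (q - 1)^-1.
  by rewrite /conj_exp; field; rewrite gt_eqF.
have [md d0] := dual_pow_measurable (1 - conj_exp q) wv.
rewrite Ap_const_real// in Ny *.
have wd : pos_weight (fun x => v x `^ (1 - conj_exp q)).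
  split=> // B bB; rewrite ltey; apply/eqP => e.
  have : (avg mu B (EFin \o v) * avg mu B (EFin \o (fun x => v x `^ (1 - conj_exp q)))%R
    `^ (q - 1) = +oo)%E.
    rewrite (avg_mean wv bB) /avg e (volE hBB bB) inver gt_eqF ?(vol_gt0 hBB)//.
    rewrite gt0_muley ?lte_fin ?invr_gt0 ?(vol_gt0 hBB)//.
    by rewrite poweRyr ?gt_eqF// gt0_muley// lte_fin (mean_gt0 hBB).
  move=> e'; move: Ny; rewrite ltNge => /negP; apply; rewrite -e'.
  by apply: ereal_sup_ubound; exists B.
set N := ereal_sup _ in Ny *.
pose h (c : bool) := if c then v else (fun x => v x `^ (1 - conj_exp q)).
pose l (c : bool) : R := if c then 1 else q - 1.
have N0 : (0 <= N)%E.
  apply: (@le_trans _ _ (avg mu B0 (EFin \o v) * avg mu B0 (EFin \o (fun x => v x `^ (1 - conj_exp q)))%R `^ (q - 1))%E).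
    by rewrite !avg_mean// poweR_EFin -EFinM lee_fin mulr_ge0 ?powR_ge0// ltW// (mean_gt0 hBB).
  by apply: ereal_sup_ubound; exists B0.
have fN : N \is a fin_num by rewrite ge0_fin_numE.
rewrite -(fineK fN) lee_fin.
apply: (@dual_tuple_ge1 _ _ _ mu BB star C0 hBB _ h l (fine N) _ _ _ _ B0 bB0).
- by case.
- by case=> //=.
- move=> x; rewrite big_bool/= powRr1 ?ltW// -powRrM qe.
  have -> : (1 - (1 + (q - 1)^-1)) * (q - 1) = -1 by field; rewrite gt_eqF.
  by rewrite powR_inv1 ?ltW// divff// gt_eqF.
- move=> B bB; rewrite big_bool/= powRr1 ?(ltW (mean_gt0 hBB wv bB))// -lee_fin fineK//.
  apply: ereal_sup_ubound; exists B => //.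
  by rewrite !avg_mean// poweR_EFin -EFinM.
- by rewrite big_bool/= addr_gt0.
Qed.

(** The exponent in the hypothesis involves the constant of the weight; since this
    constant lies between one and [M], the exponent is controlled from both sides. The
    constant [K] of the inequality is not controlled. *)
Lemma reverse_holder_exponent c0 v q M B0 : BB B0 -> 0 < c0 ->
  (forall w, Ainfty mu BB w ->
    (RH_const mu BB w (1 + c0 * (fine (Ainfty_const mu BB w))^-1) < +oo)%E) ->
  1 < q -> pos_weight v -> A_bound v q M ->
  exists e, [/\ c0 / M <= e, e <= c0 & exists K, 0 <= K /\ forall B, BB B ->
    (\int[mu]_(x in B) (v x `^ (1 + e))%:E <=
      (K * vol B * mean v B `^ (1 + e))%:E)%E].
Proof.
move=> bB0 c00 RH q1 wv hM; have hA := Ap_const_le q1 wv hM.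
have Ai : Ainfty mu BB (EFin \o v).
  split; first exact: weight_real.
  by exists q; split; [exact: ltW|apply: le_lt_trans hA _; rewrite ltry].
set a := Ainfty_const mu BB (EFin \o v).
have a1 : (1 <= a)%E.
  by apply: le_ereal_inf_tmp => _ [t [t1 _] <-]; exact: (Ap_const_ge1 bB0).
have aM : (a <= M%:E)%E.
  apply: (le_trans _ hA); apply: ereal_inf_lbound; exists q => //; split; first exact: ltW.
  by apply: le_lt_trans hA _; rewrite ltry.
have fa : a \is a fin_num.
  by rewrite ge0_fin_numE ?(le_trans _ a1)//; apply: le_lt_trans aM _; rewrite ltry.
have := RH _ Ai; rewrite -/a; move: a1 aM; rewrite -(fineK fa) !lee_fin /=.
set f := fine a => f1 fM Ky.
have f0 : 0 < f by exact: lt_le_trans f1.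
exists (c0 / f); split.
- by rewrite ler_wpM2l ?(ltW c00)// lef_pV2 ?posrE// (lt_le_trans f0).
- by rewrite ler_piMr ?(ltW c00)// invf_le1.
have e0 : 0 < c0 / f by rewrite divr_gt0.
set s := 1 + c0 / f in Ky *; have s0 : 0 < s by rewrite /s addr_gt0.
set N := RH_const _ _ _ _ in Ky.
have [md d0] := dual_pow_measurable s wv.
have N0 B : BB B -> (avg mu B (fun x => (v x)%:E `^ s) `^ s^-1 * (avg mu B (EFin \o v))^-1 <= N)%E.
  by move=> bB; apply: ereal_sup_ubound; exists B.
have fN : N \is a fin_num.
  rewrite ge0_fin_numE//; apply: le_trans (N0 _ bB0); rewrite mule_ge0 ?poweR_ge0//.
  by rewrite avg_mean// inver gt_eqF ?(mean_gt0 hBB)// lee_fin invr_ge0 ltW// (mean_gt0 hBB).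
exists (fine N `^ s); split; first exact: powR_ge0.
move=> B bB; have m0 := mean_gt0 hBB wv bB; have vB := vol_gt0 hBB bB.
have := N0 B bB; rewrite avg_mean// inver gt_eqF// => h.
set I := (\int[mu]_(x in B) _)%E.
have I0 : (0 <= I)%E by apply: integral_ge0 => x _; rewrite lee_fin powR_ge0.
have aI : avg mu B (fun x => (v x)%:E `^ s)%E = ((vol B)^-1%:E * I)%E.
  by rewrite /avg (volE hBB bB) inver gt_eqF.
have h2 : (((vol B)^-1%:E * I) `^ s^-1 <= (fine N * mean v B)%:E)%E.
  rewrite EFinM fineK//; rewrite -aI.
  apply: (@le_trans _ _ ((avg mu B (fun x => (v x)%:E `^ s) `^ s^-1 *
     ((mean v B)^-1)%:E) * (mean v B)%:E)%E).
    by rewrite -muleA -EFinM mulVf ?mule1// gt_eqF.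
  by rewrite lee_wpmul2r// lee_fin ltW.
have N0' : 0 <= fine N.
  have := le_trans (poweR_ge0 _ _) h2; rewrite lee_fin.
  by rewrite pmulr_lge0.
have i0 : (0 <= (vol B)^-1%:E * I)%E by rewrite mule_ge0// lee_fin invr_ge0 ltW.
have h3 : ((vol B)^-1%:E * I <= ((fine N * mean v B) `^ s)%:E)%E.
  have -> : ((vol B)^-1%:E * I = (((vol B)^-1%:E * I) `^ s^-1) `^ s)%E.
    by rewrite -poweRrM mulVf ?gt_eqF// poweRe1.
  rewrite -poweR_EFin; apply: (gt0_ler_poweR _ _ _ h2); rewrite ?(ltW s0)//.
  - by rewrite in_itv/= leey andbT poweR_ge0.
  - by rewrite in_itv/= leey andbT lee_fin mulr_ge0// ltW.
have -> : I = ((vol B)%:E * ((vol B)^-1%:E * I))%E.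
  by rewrite muleA -EFinM divff ?mul1e// gt_eqF.
apply: (@le_trans _ _ ((vol B)%:E * ((fine N * mean v B) `^ s)%:E)%E).
  by rewrite lee_wpmul2l// lee_fin ltW.
by rewrite -EFinM lee_fin powRM// ?(ltW m0)// le_eqVlt; apply/orP; left; apply/eqP; ring.
Qed.

End muckenhoupt_constants.

(** * The reverse Hoelder property excludes gaps between balls *)

Section regularity.
Context {R : realType} {d : measure_display} {S : measurableType d}.
Variable mu : {measure set S -> \bar R}.
Variables (BB : set (set S)) (star : set S -> set S) (C0 : R).
Hypothesis hBB : ball_basis mu BB star C0.
Local Notation vol := (vol mu).
Local Notation mass := (mass mu).
Local Notation mean := (mean mu).
Local Notation pos_weight := (pos_weight mu BB).

Definition escapes (G B : set S) := [/\ BB B, B `&` G !=set0 & ~ B `<=` G].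

Lemma joint_ball A B : BB A -> BB B -> A `&` B !=set0 ->
  exists D, [/\ BB D, A `<=` D & B `<=` D].
Proof.
move=> bA bB AB; have vA := vol_gt0 hBB bA; have vB := vol_gt0 hBB bB.
have [le|lt] := leP (vol A) (vol B).
  exists (star B); split; first exact: (star_ball hBB).
    by apply: (star_absorb hBB) => //; lra.
  exact: (sub_star hBB).
exists (star A); split; [exact: (star_ball hBB)|exact: (sub_star hBB)|].
by apply: (star_absorb hBB) => //; [rewrite setIC|lra].
Qed.

Lemma common_ball A B : BB A -> BB B -> exists D, [/\ BB D, A `<=` D & B `<=` D].
Proof.
move=> bA bB; have [x Ax] := ball_neq0 hBB bA; have [y By] := ball_neq0 hBB bB.
have [P [bP Px Py]] := ball_pair hBB x y.
have [|D [bD AD PD]] := @joint_ball A P bA bP; first by exists x.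
have [|E [bE DE BE]] := @joint_ball D B bD bB; first by exists y; split=> //; exact: PD.
by exists E; split=> //; exact: subset_trans DE.
Qed.

Section isolated.
Hypothesis gap : forall l : R, exists A, [/\ BB A, star A <> setT &
  forall B, BB B -> B `&` A !=set0 -> ~ B `<=` star A -> l * vol A < vol B].

(** If the next larger ball can be arbitrarily much larger, then there are balls [G]
    such that all balls meeting but not contained in [G] are huge; [B] is one of the
    smallest of them. *)
Lemma isolated_ball (L : R) : 1 <= L -> exists G B l, [/\ BB G, escapes G B,
  vol B = 2 * l * vol G, forall u, escapes G u -> l * vol G <= vol u & L <= l].
Proof.
move=> L1; have L0 := lt_le_trans ltr01 L1; have c1 := C0_ge1 hBB.
have [A [bA nA hA]] := gap (C0 ^+ 2 * (2 * L)).
pose G := star A; have bG : BB G := star_ball hBB bA.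
have vA := vol_gt0 hBB bA; have vG := vol_gt0 hBB bG.
have vGA : vol G <= C0 * vol A by exact: (vol_star hBB).
have AG : A `<=` G by exact: (sub_star hBB).
have A0 := ball_neq0 hBB bA.
have esc u : escapes G u -> 2 * L * vol G <= vol u.
  move=> [bu uG nuG]; have [le|lt] := leP (vol u) (2 * vol G).
    have bGs := star_ball hBB bG; have us := star_absorb hBB bu bG uG le.
    exfalso; have : C0 ^+ 2 * (2 * L) * vol A < vol (star G).
      apply: hA => //.
        case: A0 => x Ax; exists x; split=> //.
        by apply: (sub_star hBB) => //; exact: AG.
      by move=> sub; apply: nuG; exact: subset_trans sub.
    apply/negP; rewrite -leNgt; apply: (le_trans (vol_star hBB bG)).
    apply: (le_trans (ler_wpM2l (C0_ge0 hBB) vGA)).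
    have -> : C0 * (C0 * vol A) = C0 ^+ 2 * 1 * vol A by ring.
    rewrite ler_wpM2r ?(ltW vA)// ler_wpM2l ?exprn_ge0 ?(C0_ge0 hBB)//.
    by lra.
  have bus := star_ball hBB bu.
  have Gu : G `<=` star u by apply: (star_absorb hBB) => //; [rewrite setIC|lra].
  have : C0 ^+ 2 * (2 * L) * vol A < vol (star u).
    apply: hA => //.
      by case: A0 => x Ax; exists x; split=> //; apply: Gu; exact: AG.
    move=> sub; have := le_vol hBB bus bG sub; have := le_vol_dil hBB 1 bu => /= h1 h2.
    by lra.
  have hus := vol_star hBB bu => h.
  have c0p : 0 < C0 by exact: lt_le_trans c1.
  rewrite -(ler_pM2l c0p); apply: (le_trans _ hus); apply: (le_trans _ (ltW h)).
  have -> : C0 ^+ 2 * (2 * L) * vol A = C0 * (2 * L) * (C0 * vol A) by ring.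
  have -> : C0 * (2 * L * vol G) = C0 * (2 * L) * vol G by ring.
  by rewrite ler_wpM2l// mulr_ge0 ?(C0_ge0 hBB)//; lra.
have [y ny] : exists y, ~ G y.
  apply: contrapT => no; apply: nA; rewrite -subTset => y _.
  by apply: contrapT => ny; apply: no; exists y.
have [x Gx] := ball_neq0 hBB bG; have [B0 [bB0 Bx By]] := ball_pair hBB x y.
have eB0 : escapes G B0 by split=> //; [exists x|move=> /(_ y By)].
have [|u eu|B [eB mB]] := @near_maximal R _ (escapes G) (fun B => (vol B)^-1)
    (2 * L * vol G)^-1.
- by exists B0.
- have [bu _ _] := eu; rewrite invr_gt0 (vol_gt0 hBB)//= lef_pV2 ?posrE ?(vol_gt0 hBB)//.
    exact: esc.
  by rewrite mulr_gt0//; lra.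
exists G, B, (vol B / (2 * vol G)); split=> //.
- by field; rewrite gt_eqF.
- move=> u eu; have [bu _ _] := eu; have [bB _ _] := eB.
  have vu := vol_gt0 hBB bu; have vB := vol_gt0 hBB bB.
  have -> : vol B / (2 * vol G) * vol G = vol B / 2 by field; rewrite gt_eqF.
  have := mB u eu; rewrite -(ler_pM2r vB) -(ler_pM2r vu).
  have -> : (vol u)^-1 * vol B * vol u = vol B by field; rewrite gt_eqF.
  have -> : 2 * (vol B)^-1 * vol B * vol u = 2 * vol u by field; rewrite gt_eqF.
  by lra.
- have vB := esc B eB; rewrite ler_pdivlMr; last by lra.
  by apply: le_trans vB; rewrite mulrCA mulrA.
Qed.

(** The ratios grow so fast that all series below converge, while no power of them is
    bounded by an exponential. *)
Lemma isolated_sequence : exists (G B : nat -> set S) (l : nat -> R), forall k,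
  [/\ BB (G k), escapes (G k) (B k), vol (B k) = 2 * l k * vol (G k),
    forall u, escapes (G k) u -> l k * vol (G k) <= vol u &
    2 ^+ k.+1 * 4 ^+ (k * k) <= l k /\ forall j, (j < k)%N -> 2 * l j < l k].
Proof.
have /choice[t ht] (L : R) : exists t : set S * set S * R, 1 <= L ->
    [/\ BB t.1.1, escapes t.1.1 t.1.2, vol t.1.2 = 2 * t.2 * vol t.1.1,
       forall u, escapes t.1.1 u -> t.2 * vol t.1.1 <= vol u & L <= t.2].
  have [/isolated_ball[G [B [l h]]]|_] := leP 1 L; first by exists (G, B, l).
  by exists (set0, set0, 0) => //.
pose gr k : R := 2 ^+ k.+1 * 4 ^+ (k * k).
have gr1 k : 1 <= gr k by rewrite /gr mulr_ege1// exprn_ege1// ler1n.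
pose fix T k := if k is k'.+1 then t (gr k + 2 * `|(T k').2| + 1) else t (gr 0%N).
have hT k : [/\ BB (T k).1.1, escapes (T k).1.1 (T k).1.2,
    vol (T k).1.2 = 2 * (T k).2 * vol (T k).1.1,
    forall u, escapes (T k).1.1 u -> (T k).2 * vol (T k).1.1 <= vol u & gr k <= (T k).2].
  case: k => [|k] /=; first exact: ht.
  have n0 := normr_ge0 (T k).2; have := gr1 k.+1 => g1.
  have [] := ht (gr k.+1 + 2 * `|(T k).2| + 1) _; first by lra.
  by move=> *; split=> //; lra.
have inc k : 2 * (T k).2 < (T k.+1).2.
  have n0 := normr_ge0 (T k).2; have := gr1 k.+1 => g1; have := ler_norm (T k).2.
  by have /= [] := ht (gr k.+1 + 2 * `|(T k).2| + 1) _; lra.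
have mono k : forall j, (j < k)%N -> 2 * (T j).2 < (T k).2.
  elim: k => [//|k IH] j; rewrite ltnS leq_eqVlt => /orP[/eqP -> //|jk].
  apply: lt_trans (inc k); apply: (lt_trans (IH _ jk)).
  by have [_ _ _ _] := hT k; have := gr1 k; lra.
exists (fun k => (T k).1.1), (fun k => (T k).1.2), (fun k => (T k).2) => k.
by have [? ? ? ? ?] := hT k; split=> //; split=> // j; exact: mono.
Qed.

End isolated.

Section gliding_weight.
Variables (G B : nat -> set S) (l : nat -> R).
Hypothesis (bG : forall k, BB (G k)) (eB : forall k, escapes (G k) (B k)).
Hypothesis vB : forall k, vol (B k) = 2 * l k * vol (G k).
Hypothesis hl : forall k u, escapes (G k) u -> l k * vol (G k) <= vol u.
Hypothesis lbig : forall k, 2 ^+ k.+1 * 4 ^+ (k * k) <= l k.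
Hypothesis lgrow : forall k j, (j < k)%N -> 2 * l j < l k.

Let h k : R := 2^-1 ^+ k.
Let c k : R := h k * l k.
Let h0 k : 0 < h k. Proof. by rewrite exprn_gt0// invr_gt0. Qed.
Let l2 k : 2 <= l k.
Proof.
apply: le_trans (lbig k); rewrite exprS -mulrA ler_peMr// mulr_ege1//.
  by rewrite exprn_ege1// ler1n.
by rewrite exprn_ege1// ler1n.
Qed.
Let c_big k : 4 ^+ (k * k) <= c k.
Proof.
rewrite /c; have := ler_wpM2l (ltW (h0 k)) (lbig k); apply: le_trans.
have -> : h k * (2 ^+ k.+1 * 4 ^+ (k * k)) = 2 * 4 ^+ (k * k) :> R.
  by rewrite /h exprS exprVn; field; rewrite expf_neq0.
by rewrite ler_peMl ?exprn_ge0// ler1n.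
Qed.
Let c0 k : 0 < c k. Proof. by apply: lt_le_trans (c_big k); rewrite exprn_gt0. Qed.

Lemma distinct_isolated j k : G j = G k -> j = k.
Proof.
have lt j' k' : (j' < k')%N -> G j' <> G k'.
  move=> jk e; have := hl (k := k') (u := B j'); rewrite -e vB => H.
  have vG := vol_gt0 hBB (bG j'); have := lgrow jk.
  by have := H (eB j'); rewrite ler_pM2r// leNgt => /negP.
by move=> e; case: (ltngtP j k) => // /lt; rewrite e.
Qed.

(** Since balls leaving [G k] are at least [l k] times larger, the bump of height [c k],
    which is [l k / 2 ^ k], adds at most the relative amount [2 ^ - k] to their mean. *)
Definition bump k x : R := 1 + c k * \1_(G k) x.

Lemma bump_ge1 k x : 1 <= bump k x.
Proof. by rewrite /bump lerDl mulr_ge0// ?(ltW (c0 _))// indicE. Qed.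

Lemma bump_gt0 k x : 0 < bump k x. Proof. exact: lt_le_trans (bump_ge1 k x). Qed.

Lemma measurable_bump k : measurable_fun setT (bump k).
Proof.
apply: measurable_funD => //; apply: measurable_funM => //; apply: measurable_indic.
exact: (ball_measurable hBB).
Qed.

Lemma bumps_gt0 F x : 0 < \prod_(k <- F) bump k x.
Proof. by apply: prodr_gt0 => k _; exact: bump_gt0. Qed.

Lemma measurable_bumps (F : seq nat) : measurable_fun setT (fun x => \prod_(k <- F) bump k x).
Proof. by apply: measurable_prod => k _; exact: measurable_bump. Qed.

Lemma exists_largest (F : seq nat) : F != [::] ->
  exists2 k, k \in F & forall j, j \in F -> vol (G j) <= vol (G k).
Proof.
elim: F => // i F IH _; case: (eqVneq F [::]) => [->|/IH[k kF hk]].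
  by exists i; rewrite ?mem_head// => j; rewrite inE => /eqP ->.
have [le|lt] := leP (vol (G k)) (vol (G i)).
  exists i; first exact: mem_head.
  by move=> j; rewrite inE => /orP[/eqP ->//|/hk] /le_trans; apply.
exists k; first by rewrite inE kF orbT.
by move=> j; rewrite inE => /orP[/eqP ->|/hk//]; exact: ltW.
Qed.

(** Intersecting isolated balls are strongly nested, so that expanding the product of
    the bumps one ball at a time, the largest first, costs a convergent product. *)
Lemma integral_bumps (n : nat) : forall (F : seq nat) (U : set S) (V : R), (size F <= n)%N ->
  uniq F -> measurable U -> (mu U <= V%:E)%E ->
  (forall k, k \in F -> l k * vol (G k) <= V) ->
  (\int[mu]_(x in U) (\prod_(k <- F) bump k x)%:E <= (V * \prod_(k <- F) (1 + h k))%:E)%E.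
Proof.
elim: n => [|n IH] F U V.
  rewrite leqn0 size_eq0 => /eqP -> _ mU UV _; rewrite big_nil mulr1.
  by under eq_integral do rewrite big_nil; rewrite integral_cst// mul1e.
case: (eqVneq F [::]) => [-> _ _ mU UV _|F0 sF uF mU UV hF].
  by rewrite big_nil mulr1; under eq_integral do rewrite big_nil; rewrite integral_cst// mul1e.
have [k kF kmax] := exists_largest F0; pose F' := rem k F.
have sF' : (size F' <= n)%N by rewrite size_rem// -ltnS prednK//; case: (F) F0.
have uF' : uniq F' by exact: rem_uniq.
have F'F j : j \in F' -> j \in F by exact: mem_rem.
have kF' : k \notin F' by rewrite mem_rem_uniqF.
have V0 : 0 <= V by rewrite -lee_fin; apply: le_trans UV.
have mG := ball_measurable hBB (bG k); have vG := vol_gt0 hBB (bG k).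
pose p x := \prod_(j <- F') bump j x.
have p0 x : 0 <= p x by exact/ltW/bumps_gt0.
have mp : measurable_fun setT p by exact: measurable_bumps.
have mpE D : measurable_fun D (fun x => (p x)%:E).
  by apply: measurable_funTS; exact/measurable_EFinP.
have i1 : (\int[mu]_(x in U) (p x)%:E <= (V * \prod_(j <- F') (1 + h j))%:E)%E.
  by apply: IH => // j /F'F; exact: hF.
have hp0 (s : seq nat) : 0 <= \prod_(j <- s) (1 + h j).
  by apply: prodr_ge0 => j _; rewrite addr_ge0// ltW.
have i2 : (\int[mu]_(x in G k) (p x)%:E <= (vol (G k) * \prod_(j <- F') (1 + h j))%:E)%E.
  pose F2 := [seq j <- F' | `[< G j `&` G k !=set0 >]].
  have -> : (\int[mu]_(x in G k) (p x)%:E = \int[mu]_(x in G k) (\prod_(j <- F2) bump j x)%:E)%E.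
    apply: eq_integral => x; rewrite inE => Gx; congr EFin.
    rewrite /F2 big_filter [RHS]big_mkcond; apply: eq_bigr => j _.
    case: asboolP => // no; rewrite /bump indicE memNset ?mulr0 ?addr0// => Gj.
    by apply: no; exists x.
  apply: (@le_trans _ _ (vol (G k) * \prod_(j <- F2) (1 + h j))%:E).
    apply: IH => //.
    - by apply: leq_trans sF'; rewrite size_filter count_size.
    - exact: filter_uniq.
    - by rewrite (volE hBB (bG k)).
    - move=> j; rewrite mem_filter => /andP[/asboolP GG jF'].
      have ne : G j <> G k by move=> /distinct_isolated e; rewrite -e jF' in kF'.
      apply: hl; split=> //; first by rewrite setIC.
      move=> kj; have lek := kmax _ (F'F _ jF').
      have ej : escapes (G k) (G j).
        by split=> // jk; apply: ne; apply/seteqP; split.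
      by have := hl ej; have := l2 k; nra.
  rewrite lee_fin ler_wpM2l ?(ltW vG)// /F2 big_filter [leLHS]big_mkcond/=.
  apply: ler_prod => j _; case: asboolP => _; rewrite ?ler01 ?lerDl ?(ltW (h0 _))// ?lexx andbT.
  by rewrite addr_ge0// ltW.
have e : (\int[mu]_(x in U) (\prod_(j <- F) bump j x)%:E =
    \int[mu]_(x in U) (p x)%:E + (c k)%:E * \int[mu]_(x in U) (\1_(G k) x * p x)%:E)%E.
  rewrite -ge0_integralZl//; last 3 first.
  - by apply/measurable_EFinP; apply: measurable_funTS; exact: measurable_funM.
  - by move=> x _; rewrite lee_fin mulr_ge0// indicE.
  - by rewrite lee_fin ltW.
  rewrite -ge0_integralD//; last 3 first.
  - by move=> x _; rewrite lee_fin.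
  - move=> x _; rewrite -EFinM lee_fin; apply: mulr_ge0; first exact: ltW.
    by rewrite mulr_ge0// indicE.
  - apply: emeasurable_funM => //.
    by apply/measurable_EFinP; apply: measurable_funTS; exact: measurable_funM.
  apply: eq_integral => x _; rewrite -EFinM -EFinD; congr EFin.
  have -> : \prod_(j <- F) bump j x = bump k x * p x.
    by rewrite (perm_big _ (perm_to_rem kF)) big_cons.
  by rewrite /bump; ring.
rewrite e.
have i3 : (\int[mu]_(x in U) (\1_(G k) x * p x)%:E <= \int[mu]_(x in G k) (p x)%:E)%E.
  have -> : (\int[mu]_(x in U) (\1_(G k) x * p x)%:E = \int[mu]_(x in U `&` G k) (p x)%:E)%E.
    rewrite [RHS]integral_mkcondr; apply: eq_integral => x _.
    by rewrite patchE indicE; case: (x \in G k); rewrite ?mul1r ?mul0r.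
  apply: ge0_subset_integral => //; first exact: measurableI.
  by move=> x _; rewrite lee_fin.
apply: (@le_trans _ _ ((V * \prod_(j <- F') (1 + h j))%:E +
   (c k)%:E * (vol (G k) * \prod_(j <- F') (1 + h j))%:E)%E).
  by apply: leeD => //; rewrite lee_wpmul2l ?lee_fin ?(ltW (c0 _))//; exact: le_trans i2.
rewrite -EFinM -EFinD lee_fin.
have -> : \prod_(j <- F) (1 + h j) = (1 + h k) * \prod_(j <- F') (1 + h j).
  by rewrite (perm_big _ (perm_to_rem kF)) big_cons.
set Pi := \prod_(j <- F') _; have Pi0 : 0 <= Pi by exact: hp0.
have := ler_wpM2l (mulr_ge0 (ltW (h0 k)) Pi0) (hF k kF).
by rewrite /c; lra.
Qed.

Variables (B0 : set S).
Hypothesis bB0 : BB B0.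

(** The value of [bump k] on a ball that it does not separate. *)
Definition level k (D : set S) : R := if `[< D `<=` G k >] then 1 + c k else 1.

Lemma level_gt0 k D : 0 < level k D.
Proof. by rewrite /level; case: asboolP => _ //; rewrite addr_gt0. Qed.

Definition separates k D := `[< escapes (G k) D >].

Lemma bump_level k D x : BB D -> D x ->
  bump k x = level k D * (if separates k D then bump k x else 1).
Proof.
move=> bD Dx; rewrite /level /separates /bump.
case: (asboolP (D `<=` G k)) => sub; case: asboolP => [[_ _ //]|ns].
  by rewrite indicE mem_set ?mulr1//; exact: sub.
  by rewrite mul1r.
rewrite mulr1 indicE memNset ?mulr0 ?addr0// => Gx; apply: ns; split=> //.
by exists x.
Qed.

(** Infinitely many isolated balls may contain a given ball, so the product of all bumps
    can be infinite; it is normalized to be one on [B0] as far as [B0] is not separated. *)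
Definition ratios N D : R := \prod_(k <- iota 0 N) (level k D / level k B0).

Lemma ratios_gt0 N D : 0 < ratios N D.
Proof. by apply: prodr_gt0 => k _; rewrite divr_gt0 ?level_gt0. Qed.

(** An isolated ball that contains just one of two given balls is left by a ball that
    contains both. This bounds [l k]. *)
Lemma ratios_stable D : BB D -> exists N s, 0 < s /\ forall n, (N <= n)%N -> ratios n D = s.
Proof.
move=> bD; have [E [bE DE BE]] := common_ball bD bB0.
have vD := vol_gt0 hBB bD; have v0 := vol_gt0 hBB bB0; have vE := vol_gt0 hBB bE.
pose a := Num.min (vol D) (vol B0); have a0 : 0 < a by rewrite lt_min vD.
have lk k : k%:R <= l k.
  apply: le_trans (lbig k); apply: (@le_trans _ _ (2 ^+ k.+1)).
    rewrite -natrX ler_nat; apply: ltnW; apply: leq_trans (ltn_expl k (isT : (1 < 2)%N)) _.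
    by rewrite leq_exp2l.
  by rewrite ler_peMr ?exprn_ge0// exprn_ege1// ler1n.
have st k : vol E / a < k%:R -> level k D = level k B0.
  move=> ka; rewrite /level; case: asboolP => D1; case: asboolP => D2 //; exfalso.
    have eE : escapes (G k) E.
      split=> //; last by move=> EG; apply: D2; exact: subset_trans EG.
      by have [x Dx] := ball_neq0 hBB bD; exists x; split; [exact: DE|exact: D1].
    have h1 := hl eE; have h2 := le_vol hBB bD (bG k) D1.
    have h3 : a <= vol (G k) by rewrite /a ge_min h2.
    move: ka; rewrite ltr_pdivrMr// ltNge => /negP; apply.
    apply: le_trans h1; apply: ler_pM => //; exact: ltW.
  have eE : escapes (G k) E.
    split=> //; last by move=> EG; apply: D1; exact: subset_trans EG.
    by have [x Dx] := ball_neq0 hBB bB0; exists x; split; [exact: BE|exact: D2].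
  have h1 := hl eE; have h2 := le_vol hBB bB0 (bG k) D2.
  have h3 : a <= vol (G k) by rewrite /a ge_min h2 orbT.
  move: ka; rewrite ltr_pdivrMr// ltNge => /negP; apply.
  apply: le_trans h1; apply: ler_pM => //; exact: ltW.
exists (Num.truncn (vol E / a)).+1, (ratios (Num.truncn (vol E / a)).+1 D).
split; first exact: ratios_gt0.
move=> n Nn; rewrite /ratios -{1}(subnKC Nn) iotaD big_cat/= big_seq [X in _ * X]big_seq.
rewrite [X in _ * X]big1 ?mulr1; first by rewrite -big_seq.
move=> k; rewrite mem_iota add0n => /andP[Nk _].
rewrite st ?divff ?gt_eqF ?level_gt0//; apply: lt_le_trans (truncnS_gt _) _.
by rewrite ler_nat.
Qed.

Definition partial_weight N x : R := \prod_(k <- iota 0 N) (bump k x / level k B0).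

Lemma partial_weightE N D x : BB D -> D x -> partial_weight N x =
  ratios N D * \prod_(k <- [seq k <- iota 0 N | separates k D]) bump k x.
Proof.
move=> bD Dx; rewrite big_filter [X in _ * X]big_mkcond -big_split/=.
by apply: eq_bigr => k _; rewrite {1}(bump_level k bD Dx) mulrAC.
Qed.

(** The lower limit is measurable and obeys Fatou's lemma without any discussion of
    convergence. *)
Definition limit_weight x : \bar R := limn_einf (fun N => (partial_weight N x)%:E).

Lemma measurable_partial N : measurable_fun setT (partial_weight N).
Proof.
apply: measurable_prod => k _; apply: measurable_funM => //; exact: measurable_bump.
Qed.

Lemma partial_gt0 N x : 0 < partial_weight N x.
Proof. by apply: prodr_gt0 => k _; rewrite divr_gt0 ?bump_gt0 ?level_gt0. Qed.

(** On every ball the weight is comparable with a constant [s] in the mean and from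
    below, which makes it an [A_2] weight, and it is at least [s * c k] on the isolated
    balls. *)
Lemma limit_weight_bounds D : BB D -> exists s, [/\ 0 < s,
  forall x, D x -> (s%:E <= limit_weight x)%E,
  forall k x, escapes (G k) D -> D x -> G k x -> ((s * c k)%:E <= limit_weight x)%E &
  (\int[mu]_(x in D) limit_weight x <= (expR 2 * s * vol D)%:E)%E].
Proof.
move=> bD; have [N [s [s0 hs]]] := ratios_stable bD; exists s; split=> //.
- move=> x Dx; apply: limn_einf_ge; exists N => // n /= Nn.
  rewrite lee_fin (partial_weightE _ bD Dx) hs// ler_peMr ?(ltW s0)//.
  elim: [seq _ <- _ | _] => [|k F IH]; first by rewrite big_nil.
  by rewrite big_cons mulr_ege1// bump_ge1.
- move=> k x eD Dx Gx; apply: limn_einf_ge; exists (maxn N k.+1) => // n /=.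
  rewrite geq_max => /andP[Nn kn]; rewrite lee_fin (partial_weightE _ bD Dx) hs//.
  rewrite ler_wpM2l ?(ltW s0)// (perm_big _ (perm_to_rem (x := k) _))/=; last first.
    by rewrite mem_filter mem_iota/= add0n kn andbT; exact/asboolP.
  rewrite big_cons; apply: (@le_trans _ _ (bump k x)).
    by rewrite /bump indicE mem_set// mulr1 lerDr.
  rewrite ler_peMr ?(ltW (bump_gt0 _ _))//.
  elim: (rem _ _) => [|j F IH]; first by rewrite big_nil.
  by rewrite big_cons mulr_ege1// bump_ge1.
have mD := ball_measurable hBB bD.
apply: (@le_trans _ _ (limn_einf (fun n => \int[mu]_(x in D) (partial_weight n x)%:E)%E)).
  apply: (fatou mu mD).
  - by move=> n; apply/measurable_EFinP; apply: measurable_funTS; exact: measurable_partial.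
  - by move=> n x _; rewrite lee_fin ltW// partial_gt0.
have bnd n : (N <= n)%N ->
    (\int[mu]_(x in D) (partial_weight n x)%:E <= (expR 2 * s * vol D)%:E)%E.
  move=> Nn; pose F := [seq k <- iota 0 n | separates k D].
  have -> : (\int[mu]_(x in D) (partial_weight n x)%:E =
      s%:E * \int[mu]_(x in D) (\prod_(k <- F) bump k x)%:E)%E.
    rewrite -ge0_integralZl//; last 3 first.
    - by apply/measurable_EFinP; apply: measurable_funTS; exact: measurable_bumps.
    - by move=> x _; rewrite lee_fin ltW// bumps_gt0.
    - by rewrite lee_fin ltW.
    apply: eq_integral => x; rewrite inE => Dx.
    by rewrite (partial_weightE _ bD Dx) hs// EFinM.
  have : (\int[mu]_(x in D) (\prod_(k <- F) bump k x)%:E <=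
     (vol D * \prod_(k <- F) (1 + h k))%:E)%E.
    apply: (integral_bumps (leqnn _)) => //.
    - by rewrite filter_uniq// iota_uniq.
    - by rewrite (volE hBB bD).
    - by move=> k; rewrite mem_filter => /andP[/asboolP eD _]; exact: hl.
  move=> le; apply: (@le_trans _ _ (s%:E * (vol D * \prod_(k <- F) (1 + h k))%:E)%E).
    by rewrite lee_wpmul2l// lee_fin ltW.
  rewrite -EFinM lee_fin.
  have -> : expR 2 * s * vol D = s * (vol D * expR 2) by ring.
  rewrite ler_wpM2l ?(ltW s0)// ler_wpM2l ?(ltW (vol_gt0 hBB bD))//.
  apply: (@le_trans _ _ (\prod_(k <- F) expR (h k))).
    apply: ler_prod => k _; rewrite expR_ge1Dx andbT addr_ge0// ltW//.
  rewrite prod_expR ler_expR /F big_filter.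
  apply: (@le_trans _ _ (\sum_(k <- iota 0 n) h k)).
    by rewrite big_mkcond; apply: ler_sum => k _; case: ifP => // _; exact: ltW.
  have -> : \sum_(k <- iota 0 n) h k = 2 - 2 * h n.
    elim: n {Nn F le} => [|n IHn]; first by rewrite big_nil /h expr0; ring.
    rewrite -addn1 iotaD big_cat/= IHn big_cons big_nil add0n addr0 /h addn1 exprS.
    by field.
  by rewrite gerBl mulr_ge0// ltW.
rewrite limn_einfE; apply: ub_ereal_sup => _ [n _ <-].
apply: le_trans (bnd (maxn N n) (leq_maxl _ _)).
by apply: ereal_inf_lbound; exists (maxn N n) => //=; exact: leq_maxr.
Qed.

(** The weight is finite almost everywhere; it gets the value one elsewhere. *)
Definition real_weight x : R := fine (limit_weight x) + \1_(limit_weight @^-1` [set +oo%E]) x.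

Lemma measurable_limit : measurable_fun setT limit_weight.
Proof.
apply: measurable_limn_einf => n; apply/measurable_EFinP; exact: measurable_partial.
Qed.

Lemma measurable_real : measurable_fun setT real_weight.
Proof.
apply: measurable_funD.
  exact: (measurableT_comp (fine_measurable measurableT) measurable_limit).
apply: measurable_indic; rewrite -[X in measurable X]setTI.
by apply: measurable_limit => //; exact: measurable_set1.
Qed.

Lemma limit_gt0 x : (0 < limit_weight x)%E.
Proof.
have [D [bD Dx _]] := ball_pair hBB x x.
have [s [s0 hs _ _]] := limit_weight_bounds bD.
by apply: lt_le_trans (hs x Dx); rewrite lte_fin.
Qed.

Lemma real_weight_gt0 x : 0 < real_weight x.
Proof.
rewrite /real_weight indicE; have := limit_gt0 x.
case: (asboolP (limit_weight x = +oo%E)) => [e _|ne].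
  by rewrite mem_set// e /= add0r.
rewrite memNset// addr0; case: (limit_weight x) ne => [y _|//|//] /=.
by rewrite lte_fin.
Qed.

Lemma real_weightE x : limit_weight x != +oo%E -> (real_weight x)%:E = limit_weight x.
Proof.
move=> ne; rewrite /real_weight indicE memNset ?addr0//; last by move=> e; rewrite e eqxx in ne.
by rewrite fineK// ge0_fin_numE ?ltW ?limit_gt0// ltey.
Qed.

Lemma ae_real_weight D : BB D ->
  {ae mu, forall x, D x -> (real_weight x)%:E = limit_weight x}.
Proof.
move=> bD; have mD := ball_measurable hBB bD.
have [s [s0 _ _ up]] := limit_weight_bounds bD.
have : mu.-integrable D limit_weight.
  apply/integrableP; split; first by apply: measurable_funTS; exact: measurable_limit.
  under eq_integral do rewrite gee0_abs ?(ltW (limit_gt0 _))//.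
  by apply: le_lt_trans up _; rewrite ltry.
move=> /(integrable_ae mD); apply: filterS => x fx Dx; apply: real_weightE.
by have := fx Dx; case: (limit_weight x).
Qed.

Lemma integral_real_weight D : BB D ->
  (\int[mu]_(x in D) (real_weight x)%:E = \int[mu]_(x in D) limit_weight x)%E.
Proof.
move=> bD; apply: ae_eq_integral.
- exact: (ball_measurable hBB).
- by apply/measurable_EFinP; apply: measurable_funTS; exact: measurable_real.
- by apply: measurable_funTS; exact: measurable_limit.
- exact: ae_real_weight.
Qed.

Lemma real_weight_pos : pos_weight real_weight.
Proof.
split; [exact: measurable_real|exact: real_weight_gt0|].
move=> D bD; rewrite integral_real_weight//.
by have [s [_ _ _ up]] := limit_weight_bounds bD; apply: le_lt_trans up _; rewrite ltry.
Qed.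

Lemma real_weight_A2 : A_bound mu BB real_weight 2 (expR 2).
Proof.
have e2 : 1 - conj_exp 2 = -1 :> R by rewrite /conj_exp; field.
rewrite /A_bound e2.
have dE x : real_weight x `^ (-1) = (real_weight x)^-1.
  by rewrite powR_inv1// ltW// real_weight_gt0.
have mE : measurable_fun setT (fun x => real_weight x `^ (-1)).
  exact: (measurableT_comp (measurable_powR _) measurable_real).
have up D s : BB D -> 0 < s -> (forall x, D x -> (s%:E <= limit_weight x)%E) ->
    (\int[mu]_(x in D) (real_weight x `^ (-1))%:E <= (s^-1 * vol D)%:E)%E.
  move=> bD s0 hs; have mD := ball_measurable hBB bD.
  rewrite EFinM -(volE hBB bD) -integral_cst//; apply: ae_ge0_le_integral => //.
  - by move=> x _; rewrite lee_fin powR_ge0.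
  - by apply/measurable_EFinP; apply: measurable_funTS.
  - by move=> x _; rewrite lee_fin invr_ge0 ltW.
  - apply: filterS (ae_real_weight bD) => x e Dx; rewrite lee_fin dE.
    rewrite lef_pV2 ?posrE ?real_weight_gt0// -lee_fin e//; exact: hs.
have wd : pos_weight (fun x => real_weight x `^ (-1)).
  split=> // [x|D bD]; first by rewrite powR_gt0// real_weight_gt0.
  have [s [s0 hs _ _]] := limit_weight_bounds bD.
  by apply: le_lt_trans (up D s bD s0 hs) _; rewrite ltry.
split=> // D bD; have [s [s0 hs _ hi]] := limit_weight_bounds bD.
have vD := vol_gt0 hBB bD.
have h1 : mean real_weight D <= expR 2 * s.
  rewrite ler_pdivrMr// -lee_fin -(mass_ballE hBB real_weight_pos bD).
  by rewrite integral_real_weight.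
have h2 : mean (fun x => real_weight x `^ (-1)) D <= s^-1.
  by rewrite ler_pdivrMr// -lee_fin -(mass_ballE hBB wd bD); exact: up.
have -> : 2 - 1 = 1 :> R by ring.
rewrite powRr1; last by rewrite ltW// (mean_gt0 hBB).
apply: (le_trans (ler_pM _ _ h1 h2)).
- by rewrite ltW// (mean_gt0 hBB)//; exact: real_weight_pos.
- by rewrite ltW// (mean_gt0 hBB).
- by rewrite mulfK// gt_eqF.
Qed.

(** On the enlargement of [B k] the ratio of the averages of [w ^ (1 + e)] and [w] is of
    the order [l k ^ e], up to the summable loss. *)
Lemma no_reverse_holder e K : 0 < e -> 0 <= K -> ~ (forall D, BB D ->
  (\int[mu]_(x in D) (real_weight x `^ (1 + e))%:E <=
     (K * vol D * mean real_weight D `^ (1 + e))%:E)%E).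
Proof.
move=> e0 K0 RH; have e10 : 0 < 1 + e by rewrite addr_gt0.
have mwe : measurable_fun setT (fun x => real_weight x `^ (1 + e)).
  exact: (measurableT_comp (measurable_powR _) measurable_real).
pose K' := K * (2 * C0) * expR 2 `^ (1 + e).
have key k : c k `^ e <= 2 ^+ k * K'.
  have [bB nB nsub] := eB k; have vG := vol_gt0 hBB (bG k); have lk := l2 k.
  pose D := star (B k); have bD : BB D by exact: (star_ball hBB).
  have mD := ball_measurable hBB bD; have mG := ball_measurable hBB (bG k).
  have GD : G k `<=` D.
    apply: (star_absorb hBB) => //; first by rewrite setIC.
    by rewrite vB; nra.
  have eD : escapes (G k) D.
    split=> //; last by move=> sub; apply: nsub; apply: subset_trans sub; exact: (sub_star hBB).
    by have [x Gx] := ball_neq0 hBB (bG k); exists x; split=> //; exact: GD.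
  have [s [s0 hs hsc hi]] := limit_weight_bounds bD.
  have vD := vol_gt0 hBB bD.
  have h1 : mean real_weight D <= expR 2 * s.
    rewrite ler_pdivrMr// -lee_fin -(mass_ballE hBB real_weight_pos bD).
    by rewrite integral_real_weight.
  have h2 : (((s * c k) `^ (1 + e) * vol (G k))%:E <=
      \int[mu]_(x in D) (real_weight x `^ (1 + e))%:E)%E.
    rewrite EFinM -(volE hBB (bG k)) -(integral_cst mu mG).
    apply: (@le_trans _ _ (\int[mu]_(x in G k) (real_weight x `^ (1 + e))%:E)%E); last first.
      by apply: integral_subset => // x; rewrite powR_ge0.
    apply: ae_ge0_le_integral => //.
    - by move=> x _; rewrite lee_fin powR_ge0.
    - by move=> x _; rewrite lee_fin powR_ge0.
    - by apply/measurable_EFinP; exact: measurable_funTS.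
    - apply: filterS (ae_real_weight bD) => x ex Gx; rewrite lee_fin.
      have sc : 0 <= s * c k by apply: mulr_ge0; exact: ltW.
      rewrite ge0_ler_powR ?nnegrE ?(ltW e10) ?(ltW (real_weight_gt0 x))//.
      by rewrite -lee_fin ex; [apply: hsc => //; exact: GD|exact: GD].
  have := le_trans h2 (RH D bD); rewrite lee_fin => h3.
  have h4 : K * vol D * mean real_weight D `^ (1 + e) <=
      K * (C0 * (2 * l k * vol (G k))) * (expR 2 * s) `^ (1 + e).
    apply: ler_pM.
    - by rewrite mulr_ge0// ltW.
    - exact: powR_ge0.
    - by rewrite ler_wpM2l// -vB; exact: (vol_star hBB).
    - rewrite ge0_ler_powR ?nnegrE ?(ltW e10) ?mulr_ge0 ?expR_ge0 ?(ltW s0) ?invr_ge0 ?(ltW vD)//.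
      by rewrite ltW// (mass_ball_gt0 hBB real_weight_pos).
  have := le_trans h3 h4.
  rewrite (powRM _ (ltW s0) (ltW (c0 k))) (powRM _ (expR_ge0 2) (ltW s0)).
  have sp : 0 < s `^ (1 + e) by exact: powR_gt0.
  have -> : K * (C0 * (2 * l k * vol (G k))) * (expR 2 `^ (1 + e) * s `^ (1 + e)) =
     (K' * l k) * (s `^ (1 + e) * vol (G k)) by rewrite /K'; ring.
  rewrite mulrAC mulrC ler_pM2r ?mulr_gt0//.
  rewrite powRD ?(gt_eqF (c0 k)) ?implybT// powRr1 ?(ltW (c0 k))//.
  have lp : 0 < l k by lra.
  have -> : K' * l k = c k * (2 ^+ k * K').
    by rewrite /c /h exprVn; field; rewrite expf_neq0.
  by rewrite ler_pM2l// ltW.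
have K'0 : 0 <= K' by rewrite !mulr_ge0 ?powR_ge0 ?(C0_ge0 hBB).
(* The lower bound is [4 ^ k], the upper bound [2 ^ k] times a constant. *)
pose k := (Num.truncn (e^-1) + Num.truncn K').+1.
have k1 : e^-1 <= k%:R.
  by apply: ltW; apply: lt_le_trans (truncnS_gt _) _; rewrite ler_nat /k ltnS leq_addr.
have k2 : K' < k%:R.
  by apply: lt_le_trans (truncnS_gt _) _; rewrite ler_nat /k ltnS leq_addl.
have : 4 ^+ k <= c k `^ e.
  apply: (@le_trans _ _ ((4 ^+ (k * k)) `^ e)); last first.
    by rewrite ge0_ler_powR ?nnegrE ?(ltW e0) ?exprn_ge0 ?(ltW (c0 k))//; exact: c_big.
  rewrite -powR_mulrn// -powRrM -powR_mulrn//; apply: ler_powR; first by rewrite ler1n.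
  by rewrite natrM -mulrA ler_peMr// -ler_pdivrMr// div1r.
move=> h1; have := le_trans h1 (key k).
have -> : 4 ^+ k = 2 ^+ k * 2 ^+ k :> R by rewrite -exprMn; congr (_ ^+ _); ring.
rewrite ler_pM2l ?exprn_gt0// leNgt => /negP; apply; apply: (lt_trans k2).
by rewrite -natrX ltr_nat ltn_expl.
Qed.

End gliding_weight.

(** Otherwise there are isolated balls, and the weight built from them belongs to [A_2]
    and has no reverse Hoelder inequality. *)
Theorem regular_balls c0 : BB !=set0 -> 0 < c0 ->
  (forall w, Ainfty mu BB w ->
    (RH_const mu BB w (1 + c0 * (fine (Ainfty_const mu BB w))^-1) < +oo)%E) ->
  exists l : R, 1 <= l /\ forall A, BB A -> star A <> setT ->
    exists B, [/\ BB B, B `&` A !=set0, ~ B `<=` star A & vol B <= l * vol A].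
Proof.
move=> [B0 bB0] c00 RH; apply: contrapT => no.
have gap (l : R) : exists A, [/\ BB A, star A <> setT &
    forall B, BB B -> B `&` A !=set0 -> ~ B `<=` star A -> l * vol A < vol B].
  apply: contrapT => nA; apply: no; exists (Num.max 1 l); split; first by rewrite le_max lexx.
  move=> A bA sA; apply: contrapT => nB; apply: nA; exists A; split=> // B bB BA nBA.
  rewrite ltNge; apply/negP => le; apply: nB; exists B; split=> //; apply: (le_trans le).
  by rewrite ler_wpM2r ?(ltW (vol_gt0 hBB bA))// le_max lexx orbT.
have [G [B [l hG]]] := isolated_sequence gap.
have bG k : BB (G k) by case: (hG k).
have eB k : escapes (G k) (B k) by case: (hG k).
have vB k : vol (B k) = 2 * l k * vol (G k) by case: (hG k).
have hl k u : escapes (G k) u -> l k * vol (G k) <= vol u by case: (hG k) => _ _ _ + _; exact.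
have lb k : 2 ^+ k.+1 * 4 ^+ (k * k) <= l k by case: (hG k) => _ _ _ _ [].
have lg k j : (j < k)%N -> 2 * l j < l k by case: (hG k) => _ _ _ _ [_]; exact.
pose v := real_weight G l B0.
have wv : pos_weight v by exact: (real_weight_pos bG eB vB hl lb lg bB0).
have [|e [e1 _ [K [K0 hK]]]] := reverse_holder_exponent hBB bB0 c00 RH _ wv
  (real_weight_A2 bG eB vB hl lb lg bB0).
  by rewrite ltr1n.
apply: (no_reverse_holder bG eB vB hl lb lg bB0 _ K0 hK).
by apply: lt_le_trans e1; rewrite divr_gt0// expR_gt0.
Qed.

End regularity.

(** * Self-improvement of the reverse Hoelder inequality *)

Section weak_reverse_holder.
Context {R : realType} {d : measure_display} {S : measurableType d}.
Variable mu : {measure set S -> \bar R}.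
Variables (BB : set (set S)) (star : set S -> set S) (C0 : R).
Hypothesis hBB : ball_basis mu BB star C0.
Local Notation vol := (vol mu).
Local Notation mass := (mass mu).
Local Notation mean := (mean mu).
Local Notation pos_weight := (pos_weight mu BB).
Local Notation dil := (dil star).

Lemma powR2_le (e : R) : 0 < e <= 1 -> 2 `^ e <= 1 + e.
Proof.
move=> /andP[e0]; rewrite le_eqVlt => /orP[/eqP ->|e1]; first by rewrite powRr1//; lra.
have : \prod_(c : bool) (if c then 2 else 1) `^ (if c then e else 1 - e) <=
    \sum_(c : bool) (if c then e else 1 - e) * (if c then 2 else 1).
  apply: weighted_amgm; last by case.
    by case=> //; rewrite subr_gt0.
  by rewrite big_bool/= addrC subrK.
by rewrite !big_bool/= powR1 !mulr1; lra.
Qed.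

(** The last term of the sum dominates; the ratio is at least the square root of two. *)
Lemma geometric_sum_le (lam a y : R) (n : nat) : 0 < lam -> 2^-1 <= a ->
  \sum_(j < n) (if 2 ^+ j * lam < y then (2 ^+ j * lam) `^ a else 0) <= 4 * y `^ a.
Proof.
move=> lam0 a2; have a0 : 0 < a by apply: lt_le_trans a2; rewrite invr_gt0.
have p2 : 4 / 3 <= 2 `^ a.
  apply: (@le_trans _ _ (2 `^ 2^-1)); last by apply: ler_powR => //; rewrite ler1n.
  have -> : 4 / 3 = ((4 / 3) ^+ 2) `^ 2^-1 :> R.
    by rewrite -powR_mulrn// -powRrM divff// powRr1.
  by rewrite ge0_ler_powR ?nnegrE ?invr_ge0 ?exprn_ge0//; lra.
have l0 j : 0 < 2 ^+ j * lam by rewrite mulr_gt0// exprn_gt0.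
have full k : \sum_(j < k.+1) (2 ^+ j * lam) `^ a <= 4 * (2 ^+ k * lam) `^ a.
  elim: k => [|k IH]; first by rewrite big_ord1 ler_peMl ?powR_ge0// ler1n.
  rewrite big_ord_recr/=.
  have -> : (2 ^+ k.+1 * lam) `^ a = 2 `^ a * (2 ^+ k * lam) `^ a.
    by rewrite exprS -mulrA powRM// ltW.
  have := ler_wpM2r (powR_ge0 (2 ^+ k * lam) a) p2; move: IH; lra.
elim: n => [|n IH]; first by rewrite big_ord0 mulr_ge0// powR_ge0.
rewrite big_ord_recr/=; case: ifPn => [lt|_]; last by rewrite addr0.
apply: (@le_trans _ _ (4 * (2 ^+ n * lam) `^ a)); last first.
  rewrite ler_wpM2l// ge0_ler_powR ?nnegrE ?(ltW a0) ?(ltW (l0 _))// ?ltW//.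
  exact: lt_trans lt.
apply: le_trans (full n); rewrite big_ord_recr/= lerD2r; apply: ler_sum => j _.
by case: ifP => // _; exact: powR_ge0.
Qed.

Variables (l0 : R).
Hypothesis l01 : 1 <= l0.
Hypothesis reg : forall A, BB A -> star A <> setT ->
  exists B, [/\ BB B, B `&` A !=set0, ~ B `<=` star A & vol B <= l0 * vol A].

Variable Kc : R.
Hypothesis KcE : Kc = C0 ^+ 4 * l0.
(** For exponents below this rate divided by [M] the series over the levels is absorbed
    into half of the constant. *)
Definition rh_rate : R := (128 * Kc ^+ 4 * expR 4)^-1.

Let Kc1 : 1 <= Kc.
Proof. by rewrite KcE mulr_ege1// (C0X_ge1 hBB). Qed.
Let Kc0 : 0 < Kc. Proof. exact: lt_le_trans ltr01 Kc1. Qed.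

Lemma rh_rate_gt0 : 0 < rh_rate.
Proof. by rewrite /rh_rate invr_gt0 !mulr_gt0 ?exprn_gt0// ?expR_gt0. Qed.

Lemma rh_rate_le1 : rh_rate <= 1.
Proof.
rewrite /rh_rate invf_le1 ?mulr_gt0 ?exprn_gt0 ?expR_gt0//.
rewrite !mulr_ege1 ?exprn_ege1 ?ler1n//.
by apply: (le_trans _ (expR_ge1Dx 4)); rewrite lerDl.
Qed.

Variables (v : S -> R) (M : R).
Hypothesis (wv : pos_weight v) (M1 : 1 <= M).
Hypothesis half : forall B, BB B -> mean v B <= M * mean (fun x => v x `^ 2^-1) B ^+ 2.

Let M0 : 0 < M. Proof. exact: lt_le_trans ltr01 M1. Qed.
Let mv : measurable_fun setT v. Proof. by case: wv. Qed.
Let v0 x : 0 < v x. Proof. by case: wv. Qed.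
Let mpow b : measurable_fun setT (fun x => v x `^ b).
Proof. exact: (measurableT_comp (measurable_powR b)). Qed.

(** If a ball meets [Q], has at most twice its measure and a mean above this level, then
    it is in fact much smaller than [Q]. *)
Definition level_of Q : R := 2 * Kc * (mass v (star Q) / vol Q).

(** Stopping balls: the largest balls of large mean. By regularity there is a larger
    ball of comparable measure; its mean is not large, and this bounds the mass of the
    enlarged stopping balls. *)
Lemma stopping_balls Q t : BB Q -> level_of Q <= t -> exists W : set (set S),
  [/\ countable W, forall A B, W A -> W B -> A `&` B !=set0 -> A = B,
    forall A, W A -> [/\ BB A, A `&` Q !=set0, vol A <= 2 * vol Q, t * vol A < mass v A &
      mass v (dil 3 A) <= Kc * t * vol A] &
    forall B x, BB B -> Q x -> B x -> vol B <= 2 * vol Q -> t * vol B < mass v B ->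
      exists A, [/\ W A, star A x & B `<=` dil 2 A]].
Proof.
move=> bQ ht; have vQ := vol_gt0 hBB bQ; have bs := star_ball hBB bQ.
have lq0 : 0 < level_of Q.
  by apply: mulr_gt0; [rewrite mulr_gt0|rewrite divr_gt0// (mass_ball_gt0 hBB)].
have t0 : 0 < t by exact: lt_le_trans ht.
pose F x A := [/\ BB A, A x, vol A <= 2 * vol Q & t * vol A < mass v A].
have small A x : Q x -> F x A -> 2 * Kc * vol A <= vol Q.
  move=> Qx [bA Ax vA mA]; have pA := vol_gt0 hBB bA.
  have sub : A `<=` star Q by apply: (star_absorb hBB) => //; exists x.
  have : mass v A <= mass v (star Q).
    by apply: (le_mass hBB wv bs) => //; exact: (ball_measurable hBB).
  move: ht; rewrite /level_of mulrA ler_pdivrMr// => h1 h2.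
  have := lt_le_trans mA h2; have := mass_ball_gt0 hBB wv bs => ms h3.
  have h4 : t * (2 * Kc * vol A) <= t * vol Q.
    have -> : t * (2 * Kc * vol A) = 2 * Kc * (t * vol A) by ring.
    apply: le_trans h1; rewrite ler_wpM2l ?mulr_ge0 ?(ltW Kc0)//; exact: ltW.
  by move: h4; rewrite ler_pM2l.
pose top A := exists x, [/\ Q x, F x A & forall A', F x A' -> vol A' <= 2 * vol A].
have exists_top x B : Q x -> F x B -> exists A, [/\ top A, A x & vol B <= 2 * vol A].
  move=> Qx FB; have [|A [bA _ vA _]|A [FA mA]] := @near_maximal R _ (F x) vol (2 * vol Q).
  - by exists B.
  - by rewrite (vol_gt0 hBB bA).
  - by exists A; split; [exists x|case: FA|exact: mA].
have topBB : top `<=` BB by move=> A [x [_ []]].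
have topM A : top A -> vol A <= 2 * vol Q by move=> [x [_ []]].
have [W [WF Wd Wm]] := vitali hBB topBB topM.
exists W; split=> //.
- by apply: (countable_disjoint_balls hBB) => //; exact: subset_trans topBB.
- move=> A /WF[x [Qx FA mA]]; have [bA Ax vA lA] := FA; split=> //; first by exists x.
  have pA := vol_gt0 hBB bA; have sm := small A x Qx FA.
  have c1 := C0_ge1 hBB.
  have nT : star A <> setT.
    move=> sT; have := vol_star hBB bA.
    have : vol Q <= vol (star A) by apply: (le_vol hBB bQ (star_ball hBB bA)); rewrite sT.
    have : C0 <= Kc.
      by rewrite KcE exprS -mulrA ler_peMr ?(C0_ge0 hBB)// mulr_ege1// (C0X_ge1 hBB).
    nra.
  have [B [bB BA nB vB]] := reg bA nT.
  have bigB : 2 * vol A < vol B.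
    by rewrite ltNge; apply/negP => le; apply: nB; exact: (star_absorb hBB).
  have AB : A `<=` star B.
    by apply: (star_absorb hBB) => //; [rewrite setIC|have := vol_gt0 hBB bB; lra].
  pose D := dil 4 B; have bD : BB D := dil_ball hBB 4 bB.
  have bsB := star_ball hBB bB.
  have sD : dil 3 A `<=` D.
    have -> : D = dil 3 (star B) by [].
    exact: (dil_mono hBB).
  have bd3 := dil_ball hBB 3 bA.
  have vD : vol D <= Kc * vol A.
    apply: (le_trans (vol_dil hBB 4 bB)); rewrite KcE -mulrA ler_wpM2l//.
    by rewrite exprn_ge0// (C0_ge0 hBB).
  have Dx : D x by apply: sD; exact: (sub_dil hBB).
  have mD : mass v D <= t * vol D.
    rewrite leNgt; apply/negP => lt.
    have FD : F x D by split=> //; lra.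
    by have := mA D FD; have := le_vol_dil hBB 4 bB; rewrite -/D; lra.
  have := le_mass hBB wv bD (ball_measurable hBB bd3) (ball_measurable hBB bD) sD (@subset_refl _ _).
  have := ler_wpM2l (ltW t0) vD; lra.
- move=> B x bB Qx Bx vB mB; have FB : F x B by [].
  have [Ax [tA Axx lA]] := exists_top x B Qx FB.
  have [A [WA AA vA]] := Wm _ tA; have bAx := topBB _ tA; have bA := topBB _ (WF _ WA).
  have s1 : Ax `<=` star A by exact: (star_absorb hBB).
  exists A; split=> //; first exact: s1.
  apply: (@subset_trans _ (star Ax)); first by apply: (star_absorb hBB) => //; exists x.
  exact: (star_mono hBB bAx (star_ball hBB bA)).
Qed.

Let root x := v x `^ 2^-1.
Let mroot : measurable_fun setT root := mpow _.

Lemma root_pos : pos_weight root.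
Proof.
split; [exact: mpow|by move=> x; exact: powR_gt0|move=> B bB].
have mB := ball_measurable hBB bB.
apply: (@le_lt_trans _ _ (\int[mu]_(x in B) (1 + v x)%:E)%E).
  apply: ge0_le_integral => //.
  - by move=> x _; rewrite lee_fin powR_ge0.
  - by apply/measurable_EFinP; exact: measurable_funTS.
  - by apply/measurable_EFinP; apply: measurable_funTS; exact: measurable_funD.
  - move=> x _; rewrite lee_fin; have [v1|v1] := leP 1 (v x).
      apply: (@le_trans _ _ (v x)); last by rewrite lerDr.
      by rewrite ler1_powR// invf_le1// ler1n.
    apply: (@le_trans _ _ 1); last by rewrite lerDl ltW.
    rewrite (_ : 1 = 1 `^ 2^-1); last by rewrite powR1.
    by rewrite ge0_ler_powR ?nnegrE ?(ltW (v0 x)) ?(ltW v1).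
under eq_integral do rewrite EFinD.
rewrite ge0_integralD//; last 2 first.
- by move=> x _; rewrite lee_fin ltW.
- by apply/measurable_EFinP; exact: measurable_funTS.
rewrite integral_cst// mul1e (volE hBB bB) (mass_ballE hBB wv bB).
by rewrite -EFinD ltry.
Qed.

(** In a ball of large mean the square root of the weight is large on a substantial part
    of the ball, by the comparison of the means of the weight and of its square root. *)
Lemma vol_large_mean A t : BB A -> 0 < t -> t * vol A < mass v A ->
  ((vol A)%:E <= (2 * (M / t) `^ 2^-1)%:E *
    \int[mu]_(x in A) (if (t < 4 * M * v x)%R then root x else 0)%:E)%E.
Proof.
move=> bA t0 lt; have vA := vol_gt0 hBB bA; have mA := ball_measurable hBB bA.
pose g x := if t < 4 * M * v x then root x else 0.
have mg : measurable_fun setT g.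
  by apply: measurable_fun_ifT => //; apply: (@measurable_fun_ltr _ _ _ _ (cst t)) => //; exact: measurable_funM.
have g0 x : 0 <= g x by rewrite /g; case: ifP => // _; exact: powR_ge0.
have tM : 0 < t / M by rewrite divr_gt0.
have h1 : (t / M) `^ 2^-1 < mean root A.
  have m0 : 0 <= mean root A by rewrite ltW// (mean_gt0 hBB root_pos).
  have : t / M < mean root A ^+ 2.
    rewrite ltr_pdivrMr//; apply: (@lt_le_trans _ _ (mean v A)).
      by rewrite ltr_pdivlMr.
    by rewrite mulrC; exact: half.
  move=> h; have -> : mean root A = (mean root A ^+ 2) `^ 2^-1.
    by rewrite -powR_mulrn// -powRrM divff// powRr1.
  by rewrite gt0_ltr_powR ?nnegrE ?invr_gt0 ?(ltW tM) ?exprn_ge0.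
set I := (\int[mu]_(x in A) _)%E; have I0 : (0 <= I)%E.
  by apply: integral_ge0 => x _; rewrite lee_fin; exact: g0.
have fI : I \is a fin_num.
  rewrite ge0_fin_numE//; apply: le_lt_trans (_ : (\int[mu]_(x in A) (root x)%:E < +oo)%E).
    apply: ge0_le_integral => //.
    - by move=> x _; rewrite lee_fin; exact: g0.
    - by apply/measurable_EFinP; exact: measurable_funTS.
    - by apply/measurable_EFinP; apply: measurable_funTS; exact: mpow.
    - by move=> x _; rewrite lee_fin; case: ifP => // _; exact: powR_ge0.
  by have [_ _] := root_pos; exact.
have sq : (t / (4 * M)) `^ 2^-1 = (t / M) `^ 2^-1 / 2.
  have -> : t / (4 * M) = (t / M) * (2^-1) ^+ 2 by field; rewrite gt_eqF.
  rewrite powRM ?(ltW tM) ?exprn_ge0 ?invr_ge0//; congr (_ * _).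
  by rewrite -powR_mulrn ?invr_ge0// -powRrM divff// powRr1// invr_ge0.
have h2 : (mass root A <= (t / M) `^ 2^-1 / 2 * vol A + fine I).
  rewrite -lee_fin -(mass_ballE hBB root_pos bA) EFinD EFinM -(volE hBB bA) fineK//.
  rewrite -integral_cst// /I -ge0_integralD//; last 3 first.
  - by move=> x _; rewrite lee_fin mulr_ge0 ?powR_ge0// invr_ge0.
  - by move=> x _; rewrite lee_fin; exact: g0.
  - by apply/measurable_EFinP; exact: measurable_funTS.
  apply: ge0_le_integral => //.
  - by move=> x _; rewrite lee_fin powR_ge0.
  - by apply/measurable_EFinP; apply: measurable_funTS; exact: mpow.
  - apply: emeasurable_funD => //; apply/measurable_EFinP; exact: measurable_funTS.
  - move=> x _; rewrite /= -EFinD lee_fin; case: ifPn => [_|].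
      by rewrite lerDr divr_ge0// powR_ge0.
    rewrite -leNgt addr0 -sq => le; rewrite ge0_ler_powR ?nnegrE ?invr_ge0 ?(ltW (v0 x))//.
      by rewrite divr_ge0 ?mulr_ge0 ?(ltW t0)// ltW.
    by rewrite ler_pdivlMr ?mulr_gt0// mulrC.
rewrite -(fineK fI) -EFinM lee_fin.
have MT : (M / t) `^ 2^-1 = ((t / M) `^ 2^-1)^-1.
  have -> : M / t = (t / M) `^ (-1) by rewrite powR_inv1 ?(ltW tM)// invf_div.
  by rewrite -powRrM mulN1r powRN.
have s0 : 0 < (t / M) `^ 2^-1 by exact: powR_gt0.
move: h1; rewrite MT ltr_pdivlMr// => h1.
rewrite -(ler_pM2l s0).
have -> : (t / M) `^ 2^-1 * (2 * ((t / M) `^ 2^-1)^-1 * fine I) = 2 * fine I.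
  by field; rewrite gt_eqF.
by move: h1 h2; lra.
Qed.

Let gsup t x := if t < 4 * M * v x then root x else 0.

Let mgsup t : measurable_fun setT (gsup t).
Proof.
by apply: measurable_fun_ifT => //; apply: (@measurable_fun_ltr _ _ _ _ (cst t)) => //;
  exact: measurable_funM.
Qed.

Let gsup0 t x : 0 <= gsup t x.
Proof. by rewrite /gsup; case: ifP => // _; exact: powR_ge0. Qed.

Lemma level_of_gt0 Q : BB Q -> 0 < level_of Q.
Proof.
move=> bQ; apply: mulr_gt0; first by rewrite mulr_gt0.
by rewrite divr_gt0 ?(vol_gt0 hBB)// (mass_ball_gt0 hBB wv)//; exact: (star_ball hBB).
Qed.

(** Almost every point where [v] exceeds [2 * t] lies in a ball half of which has this
    property, hence in a ball of mean larger than [t], and so in an enlarged stopping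
    ball. The mass of that ball is bounded by the integral of the square root of [v]. *)
Lemma level_estimate Q t U : BB Q -> level_of Q <= t -> measurable U ->
  (forall A, BB A -> A `&` Q !=set0 -> vol A <= 2 * vol Q -> t * vol A < mass v A -> A `<=` U) ->
  (\int[mu]_(x in Q `&` [set x | (2 * t < v x)%R]) (v x)%:E <=
    (2 * Kc * (M * t) `^ 2^-1)%:E * \int[mu]_(x in U) (gsup t x)%:E)%E.
Proof.
move=> bQ ht mU hU; have t0 : 0 < t := lt_le_trans (level_of_gt0 bQ) ht.
have mQ := ball_measurable hBB bQ.
have [W [cW Wd hW cov]] := stopping_balls bQ ht.
have ve0 x : (0 <= (v x)%:E)%E by rewrite lee_fin ltW.
have mve : measurable_fun setT (fun x => (v x)%:E) by exact/measurable_EFinP.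
have [||||||||||mS le] := @countable_cover_integral_le _ _ _ mu W star id U
    (fun x => (v x)%:E) (fun x => (gsup t x)%:E) (2 * Kc * (M * t) `^ 2^-1) cW.
- by move=> A /hW[bA _ _ _ _]; apply: (ball_measurable hBB); exact: (star_ball hBB).
- move=> A WA; have [bA AQ vA lA _] := hW A WA.
  by split; [exact: (ball_measurable hBB)|exact: hU].
- by [].
- exact: Wd.
- by [].
- by apply/measurable_EFinP.
- by [].
- by move=> x; rewrite lee_fin.
- by rewrite !mulr_ge0 ?powR_ge0// ltW.
- move=> A WA; have [bA AQ vA lA mA] := hW A WA.
  have bs := star_ball hBB bA; have b3 := dil_ball hBB 3 bA.
  rewrite (mass_ballE hBB wv bs).
  apply: (@le_trans _ _ (Kc * t * vol A)%:E).
    rewrite lee_fin; apply: le_trans mA; apply: (le_mass hBB wv b3) => //.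
    - exact: (ball_measurable hBB).
    - exact: (ball_measurable hBB).
    - exact: (dil_sub hBB bA (isT : (1 <= 3)%N)).
  have h := vol_large_mean bA t0 lA.
  apply: (@le_trans _ _ ((Kc * t)%:E * ((2 * (M / t) `^ 2^-1)%:E *
     \int[mu]_(x in A) (gsup t x)%:E))%E).
    by rewrite EFinM lee_wpmul2l// lee_fin mulr_ge0// ltW.
  rewrite muleA -EFinM; rewrite le_eqVlt; apply/orP; left; apply/eqP; congr (_%:E * _)%E.
  have -> : M * t = (M / t) * t ^+ 2 by field; rewrite gt_eqF.
  have -> : (M / t * t ^+ 2) `^ 2^-1 = (M / t) `^ 2^-1 * t.
    rewrite [LHS]powRM ?divr_ge0 ?exprn_ge0 ?(ltW M0) ?(ltW t0)//; congr (_ * _).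
    by rewrite -powR_mulrn ?(ltW t0)// -powRrM divff// powRr1 ?(ltW t0).
  ring.
apply: le_trans le.
set E := Q `&` _; have mE : measurable E.
  apply: measurableI => //; rewrite -[X in measurable X]setTI.
  have -> : [set x | 2 * t < v x] = v @^-1` `]2 * t, +oo[%classic.
    by apply/seteqP; split=> x /=; rewrite in_itv/= andbT.
  exact: mv.
have fE : (mu E < +oo)%E.
  apply: (@le_lt_trans _ _ (mu Q)); last by rewrite (volE hBB bQ) ltry.
  by apply: le_measure; rewrite ?inE//; move=> x [].
rewrite integral_mkcond [leRHS]integral_mkcond.
have r0 D x : (0 <= ((fun x => (v x)%:E) \_ D) x)%E by rewrite patchE; case: ifP.
apply: ae_ge0_le_integral => //.
- by apply/(measurable_restrictT _ mE); exact: measurable_funTS.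
- by apply/(measurable_restrictT _ mS); exact: measurable_funTS.
apply: (@negligibleS _ _ _ mu _ _ _ (ae_dense_ball hBB mE fE)) => x /=.
move=> nle; rewrite not_implyE in nle; have {nle}[_ nle] := nle.
have [Ex|nEx] := pselect (E x); last first.
  by exfalso; apply: nle; rewrite {1}patchE memNset.
split=> // -[A [bA Ax dA]]; apply: nle.
have mA := ball_measurable hBB bA; have mAE : measurable (A `&` E) by exact: measurableI.
have fAE : mu (A `&` E) \is a fin_num.
  rewrite ge0_fin_numE//; apply: le_lt_trans fE.
  by apply: le_measure; rewrite ?inE//; move=> y [].
move: dA; rewrite /dense (volE hBB bA) -(fineK fAE) -EFinM lte_fin => dA.
have lQ : fine (mu (A `&` E)) <= vol Q.
  rewrite -lee_fin fineK// -(volE hBB bQ); apply: le_measure; rewrite ?inE//.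
  by move=> y [_ []].
have mAE2 : t * vol A < mass v A.
  have : 2 * t * fine (mu (A `&` E)) <= mass v A.
    rewrite -lee_fin -(mass_ballE hBB wv bA) EFinM fineK// -integral_cst//.
    apply: (@le_trans _ _ (\int[mu]_(y in A `&` E) (v y)%:E)%E); last first.
      by apply: integral_subset.
    apply: ge0_le_integral => //.
    - by move=> y _; rewrite lee_fin mulr_ge0// ltW.
    - by apply/measurable_EFinP; exact: measurable_funTS.
    - by move=> y [_ [_ /= h]]; rewrite lee_fin ltW.
  by have := ltr_pM2l t0 (vol A) (2 * fine (mu (A `&` E))); rewrite dA; lra.
have [Qx _] := Ex.
have [|A' [WA' sx _]] := cov A x bA Qx Ax _ mAE2; first by lra.
rewrite !patchE mem_set// mem_set//; by exists A'.
Qed.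

(** If the reverse Hoelder inequality holds with some constant on all balls, then it
    holds with half of this constant, up to a fixed additive error: the levels
    contribute geometric series, and the exponent is so small that their sum is
    absorbed. *)
Lemma reverse_holder_improves Q e F : BB Q -> 0 < e -> e * M <= rh_rate -> 0 <= F ->
  (forall B, BB B -> (\int[mu]_(x in B) (v x `^ (1 + e))%:E <=
     (F * (vol B `^ (- e) * mass v (star B) `^ (1 + e)))%:E)%E) ->
  (\int[mu]_(x in Q) (v x `^ (1 + e))%:E <=
     ((4 * Kc + F / 2) * (vol Q `^ (- e) * mass v (star Q) `^ (1 + e)))%:E)%E.
Proof.
move=> bQ e0 eM F0 hF; have mQ := ball_measurable hBB bQ; have vQ := vol_gt0 hBB bQ.
have bs := star_ball hBB bQ; have rr1 := rh_rate_le1; have rr0 := rh_rate_gt0.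
have e1 : e <= 1 by apply: le_trans rr1; apply: le_trans eM; rewrite ler_peMr// ltW.
have [lam lamQ lam0] : exists2 lam, lam = level_of Q & 0 < lam.
  by exists (level_of Q) => //; exact: level_of_gt0.
pose lev j := 2 ^+ j * lam.
have lev0 j : 0 < lev j by rewrite mulr_gt0// exprn_gt0.
have levS j : lev j.+1 = 2 * lev j by rewrite /lev exprS mulrA.
have levge j : lam <= lev j by rewrite ler_peMl ?(ltW lam0)// exprn_ege1// ler1n.
set m := mass v (star Q); have m0 : 0 < m := mass_ball_gt0 hBB wv bs.
have [|W [cW Wd hW cov]] := @stopping_balls Q lam bQ; first by rewrite lamQ.
have mve : measurable_fun setT (fun x => (v x)%:E) by exact/measurable_EFinP.
have mve1 : measurable_fun setT (fun x => (v x `^ (1 + e))%:E).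
  by apply/measurable_EFinP; exact: mpow.
pose U := \bigcup_(A in W) dil 2 A.
have [||||||||||mU leU] := @countable_cover_integral_le _ _ _ mu W (dil 2) id (star Q)
    (fun x => (v x `^ (1 + e))%:E) (fun x => (v x)%:E) (F * Kc ^+ 2 * lam `^ e) cW.
- by move=> A /hW[bA _ _ _ _]; apply: (ball_measurable hBB); exact: (dil_ball hBB 2 bA).
- move=> A WA; have [bA AQ vA lA _] := hW A WA.
  by split; [exact: (ball_measurable hBB)|exact: (star_absorb hBB)].
- exact: (ball_measurable hBB).
- exact: Wd.
- by [].
- by [].
- by move=> x; rewrite lee_fin powR_ge0.
- by move=> x; rewrite lee_fin ltW.
- by rewrite !mulr_ge0 ?powR_ge0 ?exprn_ge0// ltW.
- move=> A WA; have [bA AQ vA lA mA] := hW A WA; have pA := vol_gt0 hBB bA.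
  have b2 := dil_ball hBB 2 bA; have p2 := vol_gt0 hBB b2.
  apply: (le_trans (hF _ b2)); rewrite (mass_ballE hBB wv bA) -EFinM lee_fin.
  rewrite -!mulrA ler_wpM2l//.
  have h1 : vol (dil 2 A) `^ (- e) <= vol A `^ (- e).
    rewrite !powRN lef_pV2 ?posrE ?powR_gt0//.
    by rewrite ge0_ler_powR ?nnegrE ?(ltW e0) ?(ltW pA) ?(ltW p2)//; exact: (le_vol_dil hBB).
  have h2 : mass v (dil 3 A) `^ (1 + e) <= (Kc * lam * vol A) `^ (1 + e).
    rewrite ge0_ler_powR ?nnegrE ?addr_ge0 ?(ltW e0) ?mass_ge0 ?mulr_ge0 ?(ltW Kc0) ?(ltW lam0) ?(ltW pA)//.
    by move=> x; exact: ltW.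
  apply: (le_trans (ler_pM (powR_ge0 _ _) (powR_ge0 _ _) h1 h2)).
  rewrite powRM ?mulr_ge0 ?(ltW Kc0) ?(ltW lam0) ?(ltW pA)// powRM ?(ltW Kc0) ?(ltW lam0)//.
  have -> : vol A `^ (- e) * (Kc `^ (1 + e) * lam `^ (1 + e) * vol A `^ (1 + e)) =
      Kc `^ (1 + e) * (lam `^ e * (lam * vol A)).
    have pS (y : R) : 0 < y -> y `^ (1 + e) = y * y `^ e.
      by move=> y0; rewrite powRD ?(gt_eqF y0) ?implybT// powRr1// ltW.
    rewrite powRN (pS _ lam0) (pS _ pA).
    by field; rewrite gt_eqF// powR_gt0.
  apply: (@le_trans _ _ (Kc ^+ 2 * (lam `^ e * mass v A))); last by rewrite expr2 -mulrA.
  apply: ler_pM.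
  - exact: powR_ge0.
  - by rewrite !mulr_ge0 ?powR_ge0 ?(ltW lam0) ?(ltW pA).
  - rewrite -powR_mulrn ?(ltW Kc0)//; apply: ler_powR => //; lra.
  - by rewrite ler_wpM2l ?powR_ge0// ltW.
have leU' : (\int[mu]_(x in U) (v x `^ (1 + e))%:E <= (F * Kc ^+ 2 * lam `^ e * m)%:E)%E.
  by apply: (le_trans leU); rewrite (mass_ballE hBB wv bs) -EFinM.
have subU t : lam <= t -> forall A, BB A -> A `&` Q !=set0 -> vol A <= 2 * vol Q ->
    t * vol A < mass v A -> A `<=` U.
  move=> lt A bA [x [Ax Qx]] vA lA; have [|A' [WA' _ sub]] := cov A x bA Qx Ax vA.
    by apply: le_lt_trans lA; rewrite ler_wpM2r ?(ltW (vol_gt0 hBB bA)).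
  by move=> y /sub h; exists A'.
pose tr n x := Num.min (v x) (lev n).
have tr0 n x : 0 <= tr n x by rewrite le_min !ltW.
have mtr n : measurable_fun setT (fun x => v x * tr n x `^ e).
  apply: measurable_funM => //; apply: (measurableT_comp (measurable_powR e)).
  exact: measurable_minr.
have e2 : 2 `^ e - 1 <= e by rewrite lerBlDl; apply: powR2_le; rewrite e0.
(* The power [e] of the truncated weight as a sum over the dyadic levels below it; each
   step contributes a factor [2 ^ e - 1], which is at most [e]. *)
have trS n x : tr n.+1 x `^ e <= (2 * lam) `^ e +
    \sum_(j < n) (if 2 * lev j < v x then e * lev j.+1 `^ e else 0).
  elim: n => [|n IH].
    rewrite big_ord0 addr0 ge0_ler_powR ?nnegrE ?(ltW e0) ?mulr_ge0 ?(ltW lam0)//.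
    by rewrite /tr /lev expr1 ge_min lexx orbT.
  rewrite big_ord_recr/= addrA; case: ifPn => [lt|].
    apply: (@le_trans _ _ (tr n.+1 x `^ e + e * lev n.+1 `^ e)); last by rewrite lerD2r.
    have -> : tr n.+1 x = lev n.+1 by rewrite /tr min_r// levS ltW.
    apply: (@le_trans _ _ (lev n.+2 `^ e)).
      by rewrite ge0_ler_powR ?nnegrE ?(ltW e0) ?(ltW (lev0 _))// /tr ge_min lexx orbT.
    rewrite levS powRM ?(ltW (lev0 _))//.
    have := ler_wpM2r (powR_ge0 (lev n.+1) e) e2; lra.
  rewrite -leNgt addr0 => le; apply: le_trans IH.
  have vl : v x <= lev n.+1 by rewrite levS.
  by rewrite /tr !min_l//; apply: (le_trans vl); rewrite (levS n.+1); have := lev0 n.+1; lra.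
pose g j x := if 2 * lev j < v x then v x else 0.
have mg j : measurable_fun setT (g j).
  by apply: measurable_fun_ifT => //; apply: (@measurable_fun_ltr _ _ _ _ (cst _)).
have g0 j x : 0 <= g j x by rewrite /g; case: ifP => // _; exact: ltW.
have gE j : (\int[mu]_(x in Q) (g j x)%:E =
    \int[mu]_(x in Q `&` [set x | (2 * lev j < v x)%R]) (v x)%:E)%E.
  rewrite [RHS]integral_mkcondr; apply: eq_integral => x _; rewrite patchE /g.
  by case: ifPn => h; [rewrite mem_set|rewrite memNset//; exact/negP].
have gle j : (\int[mu]_(x in Q) (g j x)%:E <=
    (2 * Kc * (M * lev j) `^ 2^-1)%:E * \int[mu]_(x in U) (gsup (lev j) x)%:E)%E.
  by rewrite gE; apply: level_estimate => //; [rewrite -lamQ|exact: subU].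
pose D := 32 * Kc * rh_rate * expR 4.
have D0 : 0 <= D by rewrite !mulr_ge0 ?expR_ge0// ltW.
have tail n : (\sum_(j < n) (e * lev j.+1 `^ e)%:E * \int[mu]_(x in Q) (g j x)%:E <=
    D%:E * \int[mu]_(x in U) (v x `^ (1 + e))%:E)%E.
  pose a j := e * lev j.+1 `^ e * (2 * Kc * (M * lev j) `^ 2^-1).
  have a0 j : 0 <= a j by rewrite !mulr_ge0 ?powR_ge0// ltW.
  apply: (@le_trans _ _ (\sum_(j < n) \int[mu]_(x in U) ((a j)%:E * (gsup (lev j) x)%:E))%E).
    apply: lee_sum => j _; rewrite ge0_integralZl//; last 3 first.
    - by apply/measurable_EFinP; exact: measurable_funTS.
    - by move=> x _; rewrite lee_fin.
    - by rewrite lee_fin.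
    have -> : (a j)%:E = ((e * lev j.+1 `^ e)%:E * (2 * Kc * (M * lev j) `^ 2^-1)%:E)%E.
      by rewrite -EFinM.
    by rewrite -muleA lee_wpmul2l// lee_fin mulr_ge0 ?powR_ge0// ltW.
  rewrite -ge0_integral_sum//; last 2 first.
  - move=> j; apply: emeasurable_funM => //.
    by apply/measurable_EFinP; exact: measurable_funTS.
  - by move=> j x _; rewrite -EFinM lee_fin mulr_ge0.
  rewrite -ge0_integralZl//; last 2 first.
  - exact: measurable_funTS.
  - by move=> x _; rewrite lee_fin powR_ge0.
  apply: ge0_le_integral => //.
  - by move=> x _; apply: sume_ge0 => j _; rewrite -EFinM lee_fin mulr_ge0.
  - apply: emeasurable_sum => j; apply: emeasurable_funM => //.
    by apply/measurable_EFinP; exact: measurable_funTS.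
  - apply: emeasurable_funM => //; exact: measurable_funTS.
  move=> x _; under eq_bigr do rewrite -EFinM.
  rewrite sumEFin -EFinM lee_fin.
  have y0 : 0 < 4 * M * v x by rewrite !mulr_gt0.
  have -> : \sum_(j < n) a j * gsup (lev j) x =
      e * 2 `^ e * (2 * Kc * M `^ 2^-1) * root x *
       \sum_(j < n) (if 2 ^+ j * lam < 4 * M * v x then (2 ^+ j * lam) `^ (2^-1 + e) else 0).
    rewrite mulr_sumr; apply: eq_bigr => j _; rewrite /gsup -/(lev j).
    case: ifP => _; last by rewrite !mulr0.
    rewrite /a levS powRM ?(ltW (lev0 _))// powRM ?(ltW (lev0 _)) ?(ltW M0)//.
    by rewrite [lev j `^ (_ + _)]powRD ?(gt_eqF (lev0 _)) ?implybT//; ring.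
  apply: (@le_trans _ _ (e * 2 `^ e * (2 * Kc * M `^ 2^-1) * root x *
      (4 * (4 * M * v x) `^ (2^-1 + e)))).
    rewrite ler_wpM2l// ?mulr_ge0 ?powR_ge0 ?(ltW e0) ?(ltW Kc0)//.
    by apply: geometric_sum_le => //; rewrite lerDl ltW.
  (* The level sets produce the square root of [v], and the sum over the levels produces
     the missing power. *)
  have half2 : root x * (4 * M * v x) `^ 2^-1 * M `^ 2^-1 = 2 * M * v x.
    rewrite /root -powRM ?(ltW (v0 x)) ?(ltW y0)// -powRM ?mulr_ge0 ?(ltW (v0 x)) ?(ltW y0) ?(ltW M0)//.
    have -> : v x * (4 * M * v x) * M = (2 * M * v x) ^+ 2 by ring.
    have n0 : 0 <= 2 * M * v x by rewrite !mulr_ge0// ltW.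
    by rewrite -powR_mulrn// -powRrM divff// powRr1.
  have fourM : (4 * M) `^ e <= expR 4.
    have M4 : 0 < 4 * M by rewrite mulr_gt0.
    have -> : 4 * M = expR (ln (4 * M)) by rewrite lnK.
    rewrite -expRM ler_expR.
    have : ln (4 * M) <= 4 * M.
      by rewrite -ler_expR lnK//; have := expR_ge1Dx (4 * M); lra.
    move=> l4; have := ler_wpM2l (ltW e0) l4; lra.
  have two : 2 `^ e <= 2 by have := powR2_le (e := e); rewrite e0 e1 => /(_ isT); lra.
  rewrite powRD ?(gt_eqF y0) ?implybT//.
  rewrite [(4 * M * v x) `^ e]powRM ?(ltW (v0 x)) ?mulr_ge0 ?(ltW M0)//.
  rewrite [v x `^ (1 + e)]powRD ?(gt_eqF (v0 x)) ?implybT// powRr1 ?(ltW (v0 x))//.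
  have -> : e * 2 `^ e * (2 * Kc * M `^ 2^-1) * root x *
    (4 * ((4 * M * v x) `^ 2^-1 * ((4 * M) `^ e * v x `^ e))) =
    8 * Kc * e * (root x * (4 * M * v x) `^ 2^-1 * M `^ 2^-1) * (2 `^ e * (4 * M) `^ e) * v x `^ e.
    by ring.
  rewrite half2.
  have -> : 8 * Kc * e * (2 * M * v x) * (2 `^ e * (4 * M) `^ e) * v x `^ e =
    16 * Kc * (e * M) * (2 `^ e * (4 * M) `^ e) * (v x * v x `^ e) by ring.
  rewrite ler_wpM2r ?mulr_ge0 ?powR_ge0 ?(ltW (v0 x))//.
  have -> : D = 16 * Kc * rh_rate * (2 * expR 4) by rewrite /D; ring.
  apply: ler_pM.
  - by rewrite !mulr_ge0// ltW.
  - by rewrite mulr_ge0 ?powR_ge0.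
  - by rewrite ler_wpM2l// mulr_ge0// ltW.
  - by apply: ler_pM => //; exact: powR_ge0.
have main n : (\int[mu]_(x in Q) (v x * tr n.+1 x `^ e)%:E <=
    ((2 * lam) `^ e * m + D * (F * Kc ^+ 2 * lam `^ e * m))%:E)%E.
  apply: (@le_trans _ _ (((2 * lam) `^ e)%:E * \int[mu]_(x in Q) (v x)%:E +
      \sum_(j < n) (e * lev j.+1 `^ e)%:E * \int[mu]_(x in Q) (g j x)%:E)%E).
    have gz j : (0 <= \int[mu]_(x in Q) ((e * lev j.+1 `^ e)%:E * (g j x)%:E))%E.
      by apply: integral_ge0 => x _; rewrite -EFinM lee_fin !mulr_ge0 ?powR_ge0// ltW.
    have -> : (\sum_(j < n) (e * lev j.+1 `^ e)%:E * \int[mu]_(x in Q) (g j x)%:E =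
        \int[mu]_(x in Q) \sum_(j < n) ((e * lev j.+1 `^ e)%:E * (g j x)%:E))%E.
      rewrite ge0_integral_sum//; last 2 first.
      - move=> j; apply: emeasurable_funM => //.
        by apply/measurable_EFinP; exact: measurable_funTS.
      - by move=> j x _; rewrite -EFinM lee_fin !mulr_ge0 ?powR_ge0// ltW.
      apply: eq_bigr => j _; rewrite ge0_integralZl//.
      - by apply/measurable_EFinP; exact: measurable_funTS.
      - by move=> x _; rewrite lee_fin.
      - by rewrite lee_fin mulr_ge0 ?powR_ge0// ltW.
    rewrite -ge0_integralZl//; last 3 first.
    - exact: measurable_funTS.
    - by move=> x _; rewrite lee_fin ltW.
    - by rewrite lee_fin powR_ge0.
    have ms : measurable_fun Q (fun x => \sum_(j < n) ((e * lev j.+1 `^ e)%:E * (g j x)%:E))%E.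
      apply: emeasurable_sum => j; apply: emeasurable_funM => //.
      by apply/measurable_EFinP; exact: measurable_funTS.
    have mv1 : measurable_fun Q (fun x => ((2 * lam) `^ e)%:E * (v x)%:E)%E.
      by apply: emeasurable_funM => //; exact: measurable_funTS.
    rewrite -ge0_integralD//; last 2 first.
    - by move=> x _; rewrite -EFinM lee_fin mulr_ge0 ?powR_ge0// ltW.
    - by move=> x _; apply: sume_ge0 => j _; rewrite -EFinM lee_fin !mulr_ge0 ?powR_ge0// ltW.
    apply: ge0_le_integral => //.
    - by move=> x _; rewrite lee_fin mulr_ge0 ?powR_ge0// ltW.
    - by apply/measurable_EFinP; exact: measurable_funTS.
    - exact: emeasurable_funD.
    - move=> x _; under eq_bigr do rewrite -EFinM.
      rewrite sumEFin -EFinM -EFinD lee_fin.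
      apply: (le_trans (ler_wpM2l (ltW (v0 x)) (trS n x))).
      rewrite mulrDr mulr_sumr mulrC lerD2l le_eqVlt; apply/orP; left; apply/eqP.
      by apply: eq_bigr => j _; rewrite /g; case: ifP => _; rewrite ?mulr0// mulrC.
  rewrite EFinD; apply: leeD.
    rewrite EFinM lee_wpmul2l ?lee_fin ?powR_ge0//.
    rewrite -(mass_ballE hBB wv bs); apply: integral_subset => //.
    - by move=> x; exact: ltW.
    - exact: (ball_measurable hBB).
    - exact: (sub_star hBB).
  by apply: (le_trans (tail n)); rewrite [leRHS]EFinM lee_wpmul2l// lee_fin.
have fin : (2 * lam) `^ e * m + D * (F * Kc ^+ 2 * lam `^ e * m) <=
    (4 * Kc + F / 2) * (vol Q `^ (- e) * m `^ (1 + e)).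
  pose l1 := m / vol Q; have l10 : 0 < l1 by rewrite divr_gt0.
  have lamE : lam = 2 * Kc * l1 by rewrite lamQ.
  have K2 : 0 < 2 * Kc by rewrite mulr_gt0.
  have NE : vol Q `^ (- e) * m `^ (1 + e) = l1 `^ e * m.
    rewrite /l1 powRM ?(ltW m0) ?invr_ge0 ?(ltW vQ)// -(powR_inv1 (ltW vQ)) -powRrM mulN1r.
    by rewrite [m `^ (1 + e)]powRD ?(gt_eqF m0) ?implybT// powRr1 ?(ltW m0)//; ring.
  have le1 : lam `^ e <= 2 * Kc * l1 `^ e.
    rewrite lamE powRM ?(ltW K2) ?(ltW l10)// ler_wpM2r ?powR_ge0//.
    by apply: ler1_powR => //; have := Kc1; lra.
  have two : 2 `^ e <= 2 by have := powR2_le (e := e); rewrite e0 e1 => /(_ isT); lra.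
  have le2 : (2 * lam) `^ e <= 4 * Kc * l1 `^ e.
    rewrite powRM ?(ltW lam0)//; apply: (le_trans (ler_pM (powR_ge0 _ _) (powR_ge0 _ _) two le1)).
    by rewrite le_eqVlt; apply/orP; left; apply/eqP; ring.
  rewrite NE [leRHS]mulrDl; apply: lerD.
    by rewrite mulrA ler_wpM2r ?(ltW m0).
  have -> : D * (F * Kc ^+ 2 * lam `^ e * m) = (D * F * Kc ^+ 2 * m) * lam `^ e by ring.
  apply: (le_trans (ler_wpM2l _ le1)).
    by rewrite !mulr_ge0 ?exprn_ge0// ltW.
  (* The choice of the rate. *)
  have D1 : D * Kc ^+ 3 * 4 = 1.
    rewrite /D /rh_rate; field; rewrite !gt_eqF ?expR_gt0//.
  rewrite le_eqVlt; apply/orP; left; apply/eqP.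
  have -> : D * F * Kc ^+ 2 * m * (2 * Kc * l1 `^ e) = (D * Kc ^+ 3 * 4) * (F / 2 * (l1 `^ e * m)).
    by field.
  by rewrite D1 mul1r.
apply: (@le_trans _ _ ((2 * lam) `^ e * m + D * (F * Kc ^+ 2 * lam `^ e * m))%:E); last first.
  by rewrite lee_fin.
rewrite integral_mkcond; apply: (integral_le_liminf
  (g := fun n => (fun x => (v x * tr n.+1 x `^ e)%:E) \_ Q)).
- move=> n; apply/(measurable_restrictT _ mQ).
  by apply/measurable_EFinP; exact: measurable_funTS.
- by move=> n x; rewrite patchE; case: ifP => // _; rewrite lee_fin mulr_ge0 ?powR_ge0// ltW.
- apply: aeW => x; apply: limn_einf_ge.
  exists (Num.truncn (v x / lam)).+1 => // n /= hn.
  rewrite !patchE; case: ifP => // _; rewrite /tr min_l.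
    by rewrite lee_fin powRD ?(gt_eqF (v0 x)) ?implybT// powRr1// ltW.
  have : v x / lam <= 2 ^+ n.+1.
    apply: ltW; apply: lt_le_trans (truncnS_gt _) _; rewrite -natrX ler_nat.
    by apply: (leq_trans hn); apply: ltnW; apply: leq_trans (ltn_expl n (isT : (1 < 2)%N)) _; rewrite leq_exp2l.
  by rewrite ler_pdivrMr.
- by move=> n; rewrite -integral_mkcond; exact: main.
Qed.

End weak_reverse_holder.

(** * Moments of exponentially integrable functions *)

Lemma powR_le_expR {R : realType} (x y : R) : 0 <= x -> 0 < y -> x `^ y <= y `^ y * expR x.
Proof.
move=> x0 y0; have -> : x `^ y = y `^ y * (x / y) `^ y.
  by rewrite -powRM ?divr_ge0 ?(ltW y0)// mulrC divfK// gt_eqF.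
rewrite ler_wpM2l ?powR_ge0//.
have -> : expR x = expR (x / y) `^ y by rewrite -expRM divfK// gt_eqF.
rewrite ge0_ler_powR ?nnegrE ?divr_ge0 ?expR_ge0 ?(ltW y0)//.
by apply: le_trans (expR_ge1Dx _); rewrite lerDr.
Qed.

Section exponential_moments.
Context {R : realType} {d : measure_display} {S : measurableType d}.
Variable mu : {measure set S -> \bar R}.
Variables (BB : set (set S)) (star : set S -> set S) (C0 : R).
Hypothesis hBB : ball_basis mu BB star C0.
Local Notation vol := (vol mu).
Local Notation mass := (mass mu).
Local Notation mean := (mean mu).
Local Notation pos_weight := (pos_weight mu BB).

Variables (l0 c0 Kc : R).
Hypothesis (l01 : 1 <= l0) (c00 : 0 < c0) (KcE : Kc = C0 ^+ 4 * l0).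
Hypothesis reg : forall A, BB A -> star A <> setT ->
  exists B, [/\ BB B, B `&` A !=set0, ~ B `<=` star A & vol B <= l0 * vol A].
Hypothesis RH : forall w, Ainfty mu BB w ->
  (RH_const mu BB w (1 + c0 * (fine (Ainfty_const mu BB w))^-1) < +oo)%E.

(** The first bound allows the use of the qualitative hypothesis, the second that of the
    iteration. *)
Definition rate : R := Num.min c0 (rh_rate Kc).

Let Kc1 : 1 <= Kc.
Proof. by rewrite KcE mulr_ege1// (C0X_ge1 hBB). Qed.
Let Kc0 : 0 < Kc. Proof. exact: lt_le_trans ltr01 Kc1. Qed.

Lemma rate_gt0 : 0 < rate.
Proof. by rewrite lt_min c00 (rh_rate_gt0 hBB l01 KcE). Qed.

Lemma rate_le1 : rate <= 1.
Proof. by rewrite ge_min (rh_rate_le1 hBB l01 KcE) orbT. Qed.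

Variables (v : S -> R) (q M : R).
Hypothesis (q1 : 1 < q) (wv : pos_weight v) (M1 : 1 <= M) (hM : A_bound mu BB v q M).

Let M0 : 0 < M. Proof. exact: lt_le_trans ltr01 M1. Qed.
Let v0 x : 0 < v x. Proof. by case: wv. Qed.
Let mv : measurable_fun setT v. Proof. by case: wv. Qed.

(** The square root of [v] and the dual weight form a dual tuple, so the product of
    their means has a lower bound. The constant [M] is that of [A_q], whatever [q] is. *)
Lemma half_condition B : BB B -> mean v B <= M * mean (fun x => v x `^ 2^-1) B ^+ 2.
Proof.
move=> bB; have [wd hA] := hM; have q1' : 0 < q - 1 by rewrite subr_gt0.
have wr : pos_weight (fun x => v x `^ 2^-1) := root_pos hBB wv.
pose h (c : bool) := if c then (fun x => v x `^ 2^-1) else (fun x => v x `^ (1 - conj_exp q)).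
pose l (c : bool) : R := if c then 2 else q - 1.
have : 1 <= \prod_c mean (h c) B `^ l c.
  apply: (mean_product_ge1 hBB) => //.
  - by case.
  - by case=> //=.
  - move=> x; rewrite big_bool/= -!powRrM mulVf//.
    have -> : (1 - conj_exp q) * (q - 1) = -1 by rewrite /conj_exp; field; rewrite gt_eqF.
    by rewrite powRr1 ?ltW// powR_inv1 ?ltW// divff// gt_eqF.
  - by rewrite big_bool/= addr_gt0.
rewrite big_bool/=; set D := mean _ B `^ (q - 1); set r := mean _ B => h1.
have m0 := mean_gt0 hBB wv bB; have r0 : 0 < r := mean_gt0 hBB wr bB.
have := hA B bB; rewrite -/D => h2.
rewrite powR_mulrn ?(ltW r0)// in h1.
have D0 : 0 <= D by exact: powR_ge0.
have := ler_wpM2l (ltW m0) h1; have := ler_wpM2r (exprn_ge0 2 (ltW r0)) h2; nra.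
Qed.

Let e := rate / M.

Let e0 : 0 < e. Proof. by rewrite divr_gt0 ?rate_gt0. Qed.

(** The qualitative reverse Hoelder inequality starts the iteration that makes its
    constant uniform. *)
Lemma weak_reverse_holder Q : BB Q ->
  (\int[mu]_(x in Q) (v x `^ (1 + e))%:E <=
     (8 * Kc * (vol Q `^ (- e) * mass v (star Q) `^ (1 + e)))%:E)%E.
Proof.
move=> bQ; have [e' [e'1 _ [K [K0 hK]]]] := reverse_holder_exponent hBB bQ c00 RH q1 wv hM.
have ee : e <= e'.
  by apply: le_trans e'1; rewrite ler_wpM2r ?invr_ge0 ?(ltW M0)// ge_min lexx.
have e10 : 0 < 1 + e by rewrite addr_gt0.
have mp b : measurable_fun setT (fun x => v x `^ b).
  exact: (measurableT_comp (measurable_powR b)).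
(* The exponent is lowered from [e'] to [e] by splitting at the mean of [v]. *)
have start B : BB B -> (\int[mu]_(x in B) (v x `^ (1 + e))%:E <=
     ((8 * Kc + (1 + K) / 2 ^+ 0) * (vol B `^ (- e) * mass v (star B) `^ (1 + e)))%:E)%E.
  move=> bB; have mB := ball_measurable hBB bB; have vB := vol_gt0 hBB bB.
  have bs := star_ball hBB bB; pose a := mean v B; have a0 : 0 < a := mean_gt0 hBB wv bB.
  apply: (@le_trans _ _ (\int[mu]_(x in B) ((a `^ e)%:E * (v x)%:E +
      (a `^ (e - e'))%:E * (v x `^ (1 + e'))%:E))%E).
    apply: ge0_le_integral => //.
    - by move=> x _; rewrite lee_fin powR_ge0.
    - by apply/measurable_EFinP; exact: measurable_funTS.
    - apply: emeasurable_funD; apply: emeasurable_funM => //.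
        by apply/measurable_EFinP; exact: measurable_funTS.
      by apply/measurable_EFinP; apply: measurable_funTS; exact: mp.
    - move=> x _; rewrite -!EFinM -EFinD lee_fin.
      have pS (y b : R) : 0 < y -> y `^ (1 + b) = y * y `^ b.
        by move=> y0; rewrite powRD ?(gt_eqF y0) ?implybT// powRr1// ltW.
      rewrite !pS//; have [va|av] := leP (v x) a.
        apply: (@le_trans _ _ (a `^ e * v x)).
          rewrite mulrC ler_wpM2r ?(ltW (v0 x))//.
          by rewrite ge0_ler_powR ?nnegrE ?(ltW e0) ?(ltW (v0 x)) ?(ltW a0).
        by rewrite lerDl !mulr_ge0 ?powR_ge0// ltW.
      apply: (@le_trans _ _ (a `^ (e - e') * (v x * v x `^ e'))); last first.
        by rewrite lerDr mulr_ge0 ?powR_ge0// ltW.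
      rewrite mulrCA ler_wpM2l ?(ltW (v0 x))//.
      have -> : v x `^ e = v x `^ (e - e') * v x `^ e'.
        by rewrite -powRD ?subrK// (gt_eqF (v0 x)) implybT.
      rewrite ler_wpM2r ?powR_ge0//.
      have -> : e - e' = - (e' - e) by ring.
      rewrite !powRN lef_pV2 ?posrE ?powR_gt0//.
      by rewrite ge0_ler_powR ?nnegrE ?subr_ge0 ?(ltW (v0 x)) ?(ltW a0) ?(ltW av).
  rewrite ge0_integralD//; last 4 first.
  - by move=> x _; rewrite -EFinM lee_fin mulr_ge0 ?powR_ge0// ltW.
  - by apply: emeasurable_funM => //; apply/measurable_EFinP; exact: measurable_funTS.
  - by move=> x _; rewrite -EFinM lee_fin mulr_ge0 ?powR_ge0.
  - by apply: emeasurable_funM => //; apply/measurable_EFinP; apply: measurable_funTS; exact: mp.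
  rewrite ge0_integralZl//; last 3 first.
  - by apply/measurable_EFinP; exact: measurable_funTS.
  - by move=> x _; rewrite lee_fin ltW.
  - by rewrite lee_fin powR_ge0.
  rewrite ge0_integralZl//; last 3 first.
  - by apply/measurable_EFinP; apply: measurable_funTS; exact: mp.
  - by move=> x _; rewrite lee_fin powR_ge0.
  - by rewrite lee_fin powR_ge0.
  apply: (@le_trans _ _ ((a `^ e)%:E * (mass v B)%:E + (a `^ (e - e'))%:E *
     (K * vol B * a `^ (1 + e'))%:E)%E).
    apply: leeD; first by rewrite (mass_ballE hBB wv bB).
    by rewrite lee_wpmul2l ?lee_fin ?powR_ge0//; exact: hK.
  rewrite -!EFinM -EFinD lee_fin expr0 divr1.
  have mE : mass v B = vol B * a by rewrite /a /mean mulrC divfK// gt_eqF.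
  have -> : a `^ e * mass v B + a `^ (e - e') * (K * vol B * a `^ (1 + e')) =
      (1 + K) * (vol B `^ (- e) * mass v B `^ (1 + e)).
    have e1 : a `^ (e - e') * a `^ (1 + e') = a `^ (1 + e).
      rewrite -powRD ?(gt_eqF a0) ?implybT//; congr (_ `^ _); ring.
    have e2 : vol B `^ (- e) * mass v B `^ (1 + e) = vol B * a `^ (1 + e).
      rewrite mE powRM ?(ltW vB) ?(ltW a0)// mulrA -powRD ?(gt_eqF vB) ?implybT//.
      by have -> : - e + (1 + e) = 1 by [ring]; rewrite powRr1 ?(ltW vB).
    have e3 : a `^ (1 + e) = a * a `^ e.
      by rewrite powRD ?(gt_eqF a0) ?implybT// powRr1// ltW.
    have -> : a `^ (e - e') * (K * vol B * a `^ (1 + e')) =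
      K * vol B * (a `^ (e - e') * a `^ (1 + e')) by ring.
    by rewrite e1 e2 mE e3; ring.
  apply: (@le_trans _ _ ((1 + K) * (vol B `^ (- e) * mass v (star B) `^ (1 + e)))).
    apply: ler_wpM2l; first by rewrite addr_ge0.
    apply: ler_wpM2l; first exact: powR_ge0.
    rewrite ge0_ler_powR ?nnegrE ?(ltW e10) ?mass_ge0//; try by move=> x; exact: ltW.
    apply: (le_mass hBB wv bs) => //; first exact: (ball_measurable hBB).
    exact: (sub_star hBB).
  rewrite ler_wpM2r ?mulr_ge0 ?powR_ge0// lerDr mulr_ge0// ltW//.
have iter n : forall B, BB B -> (\int[mu]_(x in B) (v x `^ (1 + e))%:E <=
     ((8 * Kc + (1 + K) / 2 ^+ n) * (vol B `^ (- e) * mass v (star B) `^ (1 + e)))%:E)%E.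
  elim: n => [|n IH] B bB; first exact: start.
  have -> : 8 * Kc + (1 + K) / 2 ^+ n.+1 = 4 * Kc + (8 * Kc + (1 + K) / 2 ^+ n) / 2.
    by rewrite exprS; field; rewrite expf_neq0.
  apply: (reverse_holder_improves hBB l01 reg KcE wv M1 half_condition bB e0 _ _ IH).
    by rewrite /e divfK ?gt_eqF// ge_min lexx orbT.
  by rewrite addr_ge0 ?divr_ge0 ?mulr_ge0 ?exprn_ge0 ?addr_ge0// ltW.
set N := vol Q `^ (- e) * _; have N0 : 0 <= N by rewrite mulr_ge0 ?powR_ge0.
apply/lee_addgt0Pr => eps eps0.
pose n := (Num.truncn (eps^-1 * ((1 + K) * N))).+1.
apply: (le_trans (iter n Q bQ)); rewrite -/N -EFinD lee_fin mulrDl lerD2l.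
rewrite mulrAC ler_pdivrMr ?exprn_gt0// -ler_pdivrMl//.
apply: ltW; apply: lt_le_trans (truncnS_gt _) _.
by rewrite -/n -natrX ler_nat ltnW// ltn_expl.
Qed.

(** Hoelder's inequality with the exponent [1 + e] for the weight. The conjugate
    exponent is of the order [M], and the root of this order of a moment of an
    exponentially integrable function is at most proportional to it; this is where the
    power of [M] comes from. *)
Lemma moment_bound (P : set S) (t : S -> R) (a : R) : BB P -> measurable_fun setT t ->
  (forall x, 0 <= t x) -> 0 < a ->
  (\int[mu]_(x in P) (expR (t x))%:E <= (2 * vol P)%:E)%E ->
  (\int[mu]_(x in P) (t x `^ a * v x)%:E <=
    (16 * Kc * (2 * a / rate) `^ a * M `^ a * mass v (star P))%:E)%E.
Proof.
move=> bP mt t0 a0 ht; have mP := ball_measurable hBB bP; have vP := vol_gt0 hBB bP.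
have bs := star_ball hBB bP; set m := mass v (star P).
have m0 : 0 < m := mass_ball_gt0 hBB wv bs.
have e10 : 0 < 1 + e by rewrite addr_gt0.
(* The exponents [1 / th] and [1 + e] are conjugate. *)
pose th := e / (1 + e); have th0 : 0 < th by rewrite divr_gt0.
have th1 : th < 1 by rewrite ltr_pdivrMr// mul1r ltrDr.
have th' : 1 - th = (1 + e)^-1 by rewrite /th; field; rewrite gt_eqF.
pose b := a / th; have b0 : 0 < b by rewrite divr_gt0.
have i1 : (\int[mu]_(x in P) (t x `^ b)%:E <= (b `^ b * (2 * vol P))%:E)%E.
  apply: (@le_trans _ _ (\int[mu]_(x in P) ((b `^ b)%:E * (expR (t x))%:E))%E).
    apply: ge0_le_integral => //.
    - by move=> x _; rewrite lee_fin powR_ge0.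
    - apply/measurable_EFinP; apply: measurable_funTS.
      exact: (measurableT_comp (measurable_powR b)).
    - apply: emeasurable_funM => //; apply/measurable_EFinP; apply: measurable_funTS.
      exact: measurableT_comp.
    - by move=> x _; rewrite -EFinM lee_fin powR_le_expR.
  rewrite ge0_integralZl//; last 2 first.
  - by apply/measurable_EFinP; apply: measurable_funTS; exact: measurableT_comp.
  - by rewrite lee_fin powR_ge0.
  by rewrite EFinM lee_wpmul2l ?lee_fin ?powR_ge0.
have i2 := weak_reverse_holder bP.
have := holder2_integral mP _ _ _ _ _ _ _ i1 i2 (t := th).
move=> H; have {}H := H _ _ _ _ _ _ _.
have -> : (\int[mu]_(x in P) (t x `^ a * v x)%:E =
    \int[mu]_(x in P) ((t x `^ b) `^ th * (v x `^ (1 + e)) `^ (1 - th))%:E)%E.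
  apply: eq_integral => x _; rewrite -!powRrM /b divfK ?gt_eqF// th' divff ?gt_eqF//.
  by rewrite powRr1// ltW.
apply: (le_trans (H _ _ _ _ _ _ _)).
- by rewrite th0.
- exact: (measurableT_comp (measurable_powR b)).
- exact: (measurableT_comp (measurable_powR _)).
- by move=> x; exact: powR_ge0.
- by move=> x; exact: powR_ge0.
- by rewrite !mulr_ge0 ?powR_ge0// ltW.
- by rewrite !mulr_ge0 ?powR_ge0// ltW.
rewrite lee_fin th'.
rewrite (powRM _ (powR_ge0 _ _)) ?mulr_ge0 ?(ltW vP)// -powRrM /b divfK ?gt_eqF// -/b.
rewrite (powRM _ _ (ltW vP))// -/m.
rewrite [(8 * Kc * _) `^ _]powRM ?mulr_ge0 ?powR_ge0 ?(ltW Kc0)//.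
rewrite [(vol P `^ _ * _) `^ _]powRM ?powR_ge0// -!powRrM divff ?gt_eqF// powRr1 ?(ltW m0)//.
have -> : - e * (1 + e)^-1 = - th by rewrite /th mulNr.
rewrite powRN.
have -> : b `^ a * (2 `^ th * vol P `^ th) * ((8 * Kc) `^ (1 + e)^-1 * ((vol P `^ th)^-1 * m)) =
   2 `^ th * (8 * Kc) `^ (1 + e)^-1 * b `^ a * m.
  by field; rewrite gt_eqF// powR_gt0.
rewrite ler_wpM2r ?(ltW m0)//.
have -> : 16 * Kc * (2 * a / rate) `^ a * M `^ a = 2 * (8 * Kc) * (2 * a / rate * M) `^ a.
  rewrite [(2 * a / rate * M) `^ a]powRM ?divr_ge0 ?mulr_ge0 ?(ltW a0) ?(ltW rate_gt0) ?(ltW M0)//.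
  ring.
apply: ler_pM.
- by rewrite mulr_ge0 ?powR_ge0.
- exact: powR_ge0.
- apply: ler_pM; rewrite ?powR_ge0//.
    by apply: ler1_powR; rewrite ?ler1n// ltW.
  apply: ler1_powR; first by have := Kc1; lra.
  by rewrite invf_le1// lerDl ltW.
rewrite ge0_ler_powR ?nnegrE ?(ltW a0) ?(ltW b0)//.
  by rewrite !mulr_ge0 ?invr_ge0 ?(ltW a0) ?(ltW rate_gt0) ?(ltW M0).
have r0 := rate_gt0.
have -> : 2 * a / rate * M = a * (2 / e) by rewrite /e; field; rewrite !gt_eqF.
rewrite /b ler_wpM2l ?(ltW a0)// /th invf_div ler_wpM2r ?invr_ge0 ?(ltW e0)//.
have : e <= 1 by rewrite /e ler_pdivrMr// mul1r; apply: le_trans rate_le1 M1.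
by lra.
Qed.

End exponential_moments.

(** * Averages with respect to a weight *)

Lemma powR_le_cancel {R : realType} (x y a : R) : 0 < a -> 0 <= x -> 0 <= y ->
  x `^ a <= y `^ a -> x <= y.
Proof.
move=> a0 x0 y0; apply: contraTT; rewrite -!ltNge => lt.
by rewrite gt0_ltr_powR ?nnegrE.
Qed.

Lemma integral_scale_le {R : realType} {d : measure_display} {S : measurableType d}
    (mu : {measure set S -> \bar R}) (D : set S) (F : S -> R) (c K : R) :
  measurable D -> measurable_fun setT F -> (forall x, 0 <= F x) -> 0 <= c ->
  (\int[mu]_(x in D) (F x)%:E <= K%:E)%E -> (\int[mu]_(x in D) (c * F x)%:E <= (c * K)%:E)%E.
Proof.
move=> mD mF F0 c0 hK; under eq_integral do rewrite EFinM.
rewrite ge0_integralZl//; last 2 first.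
- by apply/measurable_EFinP; exact: measurable_funTS.
- by move=> x _; rewrite lee_fin.
by rewrite EFinM lee_wpmul2l.
Qed.

Section weighted_averages.
Context {R : realType} {d : measure_display} {S : measurableType d}.
Variable mu : {measure set S -> \bar R}.
Variables (BB : set (set S)) (star : set S -> set S) (C0 : R).
Hypothesis hBB : ball_basis mu BB star C0.
Local Notation vol := (vol mu).
Local Notation mass := (mass mu).
Local Notation mean := (mean mu).
Local Notation pos_weight := (pos_weight mu BB).
Variable r : R.
Hypothesis r1 : 1 <= r.

Let r0 : 0 < r. Proof. exact: lt_le_trans ltr01 r1. Qed.

Lemma ravg_le_mean P D v g (X : R) : BB P -> BB D -> pos_weight v -> g \in Lfun mu r%:E ->
  0 <= X -> vol D <= C0 * vol P ->
  (\int[mu]_(x in P) (`|g x| `^ r)%:E <= (X `^ r * mass v D)%:E)%E ->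
  ravg mu r P g <= C0 * X * mean v D `^ r^-1.
Proof.
move=> bP bD wv Lg X0 vD; rewrite (ravgX r1 hBB bP Lg) lee_fin => le.
have vP := vol_gt0 hBB bP; have mD := mean_gt0 hBB wv bD.
have c0 := C0_ge0 hBB; have c1 := C0_ge1 hBB.
apply: (powR_le_cancel r0) => //; first by rewrite ravg_ge0.
  by rewrite !mulr_ge0 ?powR_ge0.
rewrite [leRHS]powRM ?mulr_ge0 ?powR_ge0// [(C0 * X) `^ r]powRM//.
rewrite -powRrM mulVf ?gt_eqF// powRr1 ?(ltW mD)//.
rewrite -(ler_pM2r vP); apply: (le_trans le).
have -> : mass v D = mean v D * vol D by rewrite /mean divfK// gt_eqF// (vol_gt0 hBB).
have C0r : C0 <= C0 `^ r by rewrite -{1}(powRr1 c0); exact: ler_powR.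
apply: (@le_trans _ _ (X `^ r * (mean v D * (C0 `^ r * vol P)))).
  rewrite ler_wpM2l ?powR_ge0// ler_wpM2l ?(ltW mD)//; apply: (le_trans vD).
  by rewrite ler_wpM2r ?(ltW vP).
by rewrite le_eqVlt; apply/orP; left; apply/eqP; ring.
Qed.

Definition wmean (v : S -> R) (D : set S) (h : S -> R) (s : R) : R :=
  fine (\int[mu]_(x in D) (h x `^ s * v x)%:E)%E / mass v D.

Variables (v h : S -> R).
Hypothesis (wv : pos_weight v) (mh : measurable_fun setT h) (h0 : forall x, 0 <= h x).

Let v0 x : 0 < v x. Proof. by case: wv. Qed.
Let mv : measurable_fun setT v. Proof. by case: wv. Qed.
Let mhv s : measurable_fun setT (fun x => (h x `^ s * v x)%:E).
Proof.
apply/measurable_EFinP; apply: measurable_funM => //.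
exact: (measurableT_comp (measurable_powR s)).
Qed.
Let hv0 s x : (0 <= (h x `^ s * v x)%:E)%E.
Proof. by rewrite lee_fin mulr_ge0 ?powR_ge0// ltW. Qed.

Lemma wmean_ge0 D s : 0 <= wmean v D h s.
Proof.
apply: divr_ge0; last by apply: mass_ge0 => x; exact: ltW.
by apply: fine_ge0; exact: integral_ge0.
Qed.

Lemma wmean_finite D s a G : BB D -> 0 < s <= a ->
  (\int[mu]_x (h x `^ a * v x)%:E <= G%:E)%E ->
  (\int[mu]_(x in D) (h x `^ s * v x)%:E < +oo)%E.
Proof.
move=> bD /andP[s0 sa] hG; have mD := ball_measurable hBB bD.
have a0 : 0 < a := lt_le_trans s0 sa.
apply: (@le_lt_trans _ _ (\int[mu]_(x in D) ((v x)%:E + (h x `^ a * v x)%:E))%E).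
  apply: ge0_le_integral => //.
  - exact: measurable_funTS.
  - apply: emeasurable_funD; apply: measurable_funTS => //; exact/measurable_EFinP.
  - move=> x _; rewrite -EFinD lee_fin -{2}(mul1r (v x)) -mulrDl ler_wpM2r ?(ltW (v0 x))//.
    have [h1|h1] := leP 1 (h x).
      by apply: (le_trans (ler_powR h1 sa)); rewrite lerDr.
    apply: (@le_trans _ _ (1 `^ s)).
      by rewrite ge0_ler_powR ?nnegrE ?(ltW s0) ?(ltW h1).
    by rewrite powR1 lerDl powR_ge0.
rewrite ge0_integralD//; last 3 first.
- by move=> x _; rewrite lee_fin ltW.
- by apply: measurable_funTS; exact/measurable_EFinP.
- exact: measurable_funTS.
rewrite (mass_ballE hBB wv bD); apply: lte_add_pinfty; first by rewrite ltry.
apply: (@le_lt_trans _ _ (\int[mu]_x (h x `^ a * v x)%:E)%E); last first.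
  by apply: le_lt_trans hG _; rewrite ltry.
exact: ge0_subset_integral.
Qed.

Lemma wmean_mass D s : BB D -> (\int[mu]_(x in D) (h x `^ s * v x)%:E < +oo)%E ->
  (\int[mu]_(x in D) (h x `^ s * v x)%:E = (wmean v D h s * mass v D)%:E)%E.
Proof.
move=> bD fin; rewrite /wmean divfK ?gt_eqF ?(mass_ball_gt0 hBB wv)//.
by rewrite fineK// ge0_fin_numE// integral_ge0.
Qed.

(** The oscillation [y] is integrated with the conjugate exponent, so that [h] enters
    through a mean to which a maximal operator applies. *)
Lemma wmean_holder P D (y : S -> R) (s B : R) : BB P -> BB D -> P `<=` D -> 1 < s -> 0 <= B ->
  measurable_fun setT y -> (forall x, 0 <= y x) ->
  (\int[mu]_(x in D) (h x `^ s * v x)%:E < +oo)%E ->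
  (\int[mu]_(x in P) (y x `^ conj_exp s * v x)%:E <= (B `^ conj_exp s * mass v D)%:E)%E ->
  (\int[mu]_(x in P) (y x * (h x * v x))%:E <=
     (B * wmean v D h s `^ s^-1 * mass v D)%:E)%E.
Proof.
move=> bP bD PD s1 B0 my y0 fin hy; have mP := ball_measurable hBB bP.
have m0 := mass_ball_gt0 hBB wv bD; have mD := ball_measurable hBB bD.
have s0 : 0 < s := lt_trans ltr01 s1; have s1' : 0 < s - 1 by rewrite subr_gt0.
have c0 : 0 < conj_exp s by rewrite divr_gt0.
have cE : 1 - s^-1 = (conj_exp s)^-1 by rewrite /conj_exp; field; rewrite !gt_eqF.
have hh : (\int[mu]_(x in P) (h x `^ s * v x)%:E <= (wmean v D h s * mass v D)%:E)%E.
  by rewrite -wmean_mass//; apply: ge0_subset_integral => //; exact: measurable_funTS.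
have t01 : 0 < s^-1 < 1 by rewrite invr_gt0 s0 invf_lt1.
have pos1 x : 0 <= h x `^ s * v x by rewrite -lee_fin.
have pos2 x : 0 <= y x `^ conj_exp s * v x by rewrite mulr_ge0 ?powR_ge0// ltW.
have A0 : 0 <= wmean v D h s * mass v D by rewrite mulr_ge0 ?wmean_ge0// ltW.
have B0' : 0 <= B `^ conj_exp s * mass v D by rewrite mulr_ge0 ?powR_ge0// ltW.
have my' : measurable_fun setT (fun x => y x `^ conj_exp s * v x).
  by apply: measurable_funM => //; exact: (measurableT_comp (measurable_powR _)).
have mh' : measurable_fun setT (fun x => h x `^ s * v x).
  by apply/measurable_EFinP; exact: mhv.
have := holder2_integral mP t01 mh' my' pos1 pos2 A0 B0' hh hy.
have pE x : (h x `^ s * v x) `^ s^-1 * (y x `^ conj_exp s * v x) `^ (1 - s^-1) =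
    y x * (h x * v x).
  rewrite cE !powRM ?powR_ge0 ?(ltW (v0 x))// -!powRrM !divff ?gt_eqF// !powRr1//.
  have vE : v x `^ s^-1 * v x `^ (conj_exp s)^-1 = v x.
    by rewrite -powRD -cE ?subrKC ?oner_eq0// powRr1// ltW.
  by rewrite -[in RHS]vE; ring.
under eq_integral do rewrite pE; move=> le; apply: (le_trans le).
rewrite lee_fin cE (powRM _ (wmean_ge0 _ _) (ltW m0)) (powRM _ (powR_ge0 _ _) (ltW m0)).
rewrite -powRrM divff ?gt_eqF// powRr1//.
have mE : mass v D `^ s^-1 * mass v D `^ (conj_exp s)^-1 = mass v D.
  by rewrite -powRD -cE ?subrKC ?oner_eq0// powRr1// ltW.
by rewrite -[in leRHS]mE le_eqVlt; apply/orP; left; apply/eqP; ring.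
Qed.

(** Without oscillation the exponent [s] is just a larger mean. *)
Lemma wmean_jensen P D s : BB P -> BB D -> P `<=` D -> 1 <= s ->
  (\int[mu]_(x in D) (h x `^ s * v x)%:E < +oo)%E ->
  (\int[mu]_(x in P) (h x * v x)%:E <= (wmean v D h s `^ s^-1 * mass v D)%:E)%E.
Proof.
move=> bP bD PD; rewrite le_eqVlt => /orP[/eqP s1|s1] fin.
  have hE x : h x `^ s * v x = h x * v x by rewrite -s1 powRr1.
  rewrite -s1 invr1 powRr1 ?wmean_ge0// s1 -wmean_mass//.
  under [leRHS]eq_integral do rewrite hE.
  apply: ge0_subset_integral => //; [exact: (ball_measurable hBB)..| |].
  - apply: measurable_funTS; apply/measurable_EFinP; exact: measurable_funM.
  - by move=> x _; rewrite lee_fin mulr_ge0// ltW.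
have := @wmean_holder P D (cst 1) s 1 bP bD PD s1 ler01 _ _ fin.
rewrite mul1r => H; under eq_integral do rewrite -[h _ * v _]mul1r.
apply: H => //; rewrite powR1 mul1r.
under eq_integral do rewrite mul1r.
rewrite -(mass_ballE hBB wv bD); apply: ge0_subset_integral => //.
- exact: (ball_measurable hBB).
- exact: (ball_measurable hBB).
- by apply: measurable_funTS; apply/measurable_EFinP.
- by move=> x _; rewrite lee_fin ltW.
Qed.

Lemma sparse_wmean (sg : S -> \bar R) (l : seq (set S)) (E : set S -> set S)
    (parity : set S -> bool) (dl : set S -> set S) s q G :
  uniq l -> (forall A, A \in l -> [/\ BB (dl A), measurable (E A) & E A `<=` dl A]) ->
  (forall A B, A \in l -> B \in l -> parity A = parity B ->
    E A `&` E B !=set0 -> A = B) ->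
  0 < q -> measurable_fun setT sg -> {ae mu, forall x, sg x = (v x)%:E} -> 0 <= G ->
  (\int[mu]_x (h x `^ (s * q) * v x)%:E <= G%:E)%E ->
  (wmaximal_norm mu BB sg q < +oo)%E ->
  \sum_(A <- l) wmean v (dl A) h s `^ q * mass v (E A) <=
    2 * (fine (wmaximal_norm mu BB sg q) `^ q * G).
Proof.
move=> ul hl dl' q0 msg sgv G0 hG fin.
have mhs : measurable_fun setT (fun x => h x `^ s).
  exact: (measurableT_comp (measurable_powR s)).
have hG' : (\int[mu]_x ((h x `^ s) `^ q * v x)%:E <= G%:E)%E.
  by under eq_integral do rewrite -powRrM.
refine (@sparse_maximal R d S mu BB star C0 hBB sg v q q0 wv msg sgv l E parity dl
  (fun A => wmean v (dl A) h s) (fun x => h x `^ s) G ul hl dl' mhs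
  (fun x => powR_ge0 _ _) G0 hG' (fun A => wmean_ge0 (dl A) s) _ fin).
- move=> A Al; have [bA _ _] := hl A Al.
  rewrite /wmean divfK ?gt_eqF ?(mass_ball_gt0 hBB wv)//.
  have I0 : (0 <= \int[mu]_(x in dl A) (h x `^ s * v x)%:E)%E by exact: integral_ge0.
  by case: (\int[mu]_(x in _) _)%E I0 => //= _; exact: leey.
Qed.

End weighted_averages.

(** * Sparse sums with oscillation *)

(** The product of different oscillations is replaced by powers of single ones, so that
    each term contains only one function to be integrated. *)
Lemma prod_add_le {R : realType} (I : finType) (A : {set I}) (a : I -> R) (K : R) :
  (forall i, 0 <= a i) -> 0 <= K ->
  \prod_(i in A) (a i + K) <= 2 ^+ #|A| * (K ^+ #|A| + \sum_(i <- enum A) a i ^+ #|A|).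
Proof.
move=> a0 K0; pose Y := \big[Num.max/K]_(i in A) a i.
have KY : K <= Y by exact: bigmax_ge_id.
apply: (@le_trans _ _ (\prod_(i in A) (2 * Y))).
  apply: ler_prod => i iA; rewrite addr_ge0//=.
  by have : a i <= Y by [exact: (le_bigmax_cond _ _ iA)]; lra.
rewrite prodr_const exprMn ler_wpM2l ?exprn_ge0//.
have s0 : 0 <= \sum_(i <- enum A) a i ^+ #|A| by apply: sumr_ge0 => i _; exact: exprn_ge0.
rewrite /Y; apply: (big_ind (fun y => y ^+ #|A| <= K ^+ #|A| + \sum_(i <- enum A) a i ^+ #|A|)).
- by rewrite lerDl.
- by move=> y z; rewrite /Num.max; case: ifP.
- move=> i iA; rewrite big_enum/= (bigD1 i)//=.
  apply: (@le_trans _ _ (a i ^+ #|A| + \sum_(j in A | j != i) a j ^+ #|A|)).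
    by rewrite lerDl; apply: sumr_ge0 => j _; exact: exprn_ge0.
  by rewrite lerDr exprn_ge0.
Qed.

(** The conclusion of the moment bound as a hypothesis: [mc b s] is a constant that does
    not depend on the weight and [M] a bound for its Muckenhoupt constant. *)
Definition moments {R : realType} {d : measure_display} {S : measurableType d}
    (mu : {measure set S -> \bar R}) (BB : set (set S)) (star : set S -> set S)
    (mc : R -> R -> R) (M : R) (v : S -> R) := forall (P : set S) (t : S -> R) (b s : R),
  BB P -> measurable_fun setT t -> (forall x, 0 <= t x) -> 0 < b -> 0 < s ->
  (\int[mu]_(x in P) (expR (t x))%:E <= (2 * vol mu P)%:E)%E ->
  (\int[mu]_(x in P) ((t x `^ b) `^ s * v x)%:E <=
    ((mc b s * M `^ b) `^ s * mass mu v (star P))%:E)%E.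

Section sparse_tuples.
Context {R : realType} {d : measure_display} {S : measurableType d}.
Variable mu : {measure set S -> \bar R}.
Variables (BB : set (set S)) (star : set S -> set S) (C0 : R).
Hypothesis hBB : ball_basis mu BB star C0.
Local Notation vol := (vol mu).
Local Notation mass := (mass mu).
Local Notation mean := (mean mu).
Local Notation pos_weight := (pos_weight mu BB).
Local Notation dil := (dil star).
Context {m : nat}.
Variables (r P A k M Km : R) (p : 'I_m -> R) (w : S -> R) (sg : 'I_m -> S -> R).
Hypothesis (r1 : 1 <= r) (m0 : (0 < m)%N) (rp : forall i, r < p i).
Hypothesis hP : P^-1 = \sum_i (p i)^-1.
Hypothesis (ww : pos_weight w) (wsg : forall i, pos_weight (sg i)).
Hypothesis dual : forall x, w x `^ (r / P) * \prod_i sg i x `^ (1 - r / p i) = 1.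
Hypothesis hA : forall B, BB B ->
  mean w B `^ (r / P) * \prod_i mean (sg i) B `^ (1 - r / p i) <= A.
Hypothesis k0 : 0 <= k.
Hypothesis hk : forall i, (p i)^-1 <= k * (1 - r / p i).
Hypothesis he : 1 - P^-1 <= k * (r / P).

Variables (tau : {set 'I_m}) (sj : 'I_m -> R) (s : R) (mc : R -> R -> R).
Hypothesis (sj1 : forall i, 1 <= sj i <= p i / r).
Hypothesis (s1 : 1 < P -> 1 <= s < conj_exp P).
Hypothesis (tau_sj : forall i, i \in tau -> 1 < sj i) (tau_s : forall i, i \in tau -> 1 < P -> 1 < s).
Hypothesis mc0 : forall a b, 0 <= mc a b.
Hypothesis (M1 : 1 <= M) (Km1 : 1 <= Km).
Hypothesis momw : forall i, i \in tau -> moments mu BB star mc M w.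
Hypothesis momsg : forall i, i \in tau -> moments mu BB star mc M (sg i).
Hypothesis hKm : forall i, i \in tau -> mc r (conj_exp (sj i)) `^ r^-1 <= Km.

Variables (we : S -> \bar R) (se : 'I_m -> S -> \bar R).
Hypothesis (mwe : measurable_fun setT we) (wew : {ae mu, forall x, we x = (w x)%:E}).
Hypothesis (mse : forall i, measurable_fun setT (se i)).
Hypothesis (sesg : forall i, {ae mu, forall x, se i x = (sg i x)%:E}).

Definition entry_norm i := wmaximal_norm mu BB (se i) (p i / (r * sj i)).
Definition target_norm := wmaximal_norm mu BB we (conj_exp P / s).
Definition entry_factor i : R := fine (entry_norm i) `^ (r * sj i)^-1.
Definition target_factor : R := if 1 < P then fine target_norm `^ s^-1 else 1.

Hypothesis finN : forall i, (entry_norm i < +oo)%E.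
Hypothesis finW : 1 < P -> (target_norm < +oo)%E.

Let r0 : 0 < r. Proof. exact: lt_le_trans ltr01 r1. Qed.
Let p0 i : 0 < p i. Proof. exact: lt_trans (rp i). Qed.
Let P0 : 0 < P.
Proof.
rewrite -invr_gt0 hP (bigD1 (Ordinal m0))//=.
by apply: ltr_wpDr; [apply: sumr_ge0 => i _|]; rewrite ?invr_ge0 ?invr_gt0 ?ltW.
Qed.
Let sj0 i : 0 < sj i. Proof. by apply: lt_le_trans ltr01 _; case/andP: (sj1 i). Qed.
Let M0 : 0 < M. Proof. exact: lt_le_trans ltr01 M1. Qed.
Let Km0 : 0 < Km. Proof. exact: lt_le_trans ltr01 Km1. Qed.
Let w0 x : 0 < w x. Proof. by case: ww. Qed.
Let mw : measurable_fun setT w. Proof. by case: ww. Qed.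
Let N := #|tau|.

Variables (h : 'I_m -> S -> R) (G : 'I_m -> R).
Hypothesis (mh : forall i, measurable_fun setT (h i)) (h0 : forall i x, 0 <= h i x).
Hypothesis G0 : forall i, 0 <= G i.
Hypothesis hG : forall i, (\int[mu]_x (h i x `^ (p i / r) * sg i x)%:E <= (G i `^ p i)%:E)%E.

Definition entry_mean Q i : R := wmean mu (sg i) (dil 7 Q) (h i) (sj i) `^ (r * sj i)^-1.
Definition coefficient Q : R := \prod_i (mean (sg i) (dil 7 Q) `^ r^-1 * entry_mean Q i).

Variable t : set S -> 'I_m -> S -> R.
Hypothesis (mt : forall Q i, measurable_fun setT (t Q i)) (t0 : forall Q i x, 0 <= t Q i x).
Hypothesis t_exp : forall Q i, BB Q -> i \in tau ->
  (\int[mu]_(x in Q) (expR (t Q i x))%:E <= (2 * vol Q)%:E)%E.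

(** A bound for the product over the symbols of the sums [t Q i x + Km * M], in which
    [Km * M] is the price of an oscillation inside of an average. *)
Definition oscillation Q x : R :=
  (Km * M) ^+ N + \sum_(i <- enum tau) t Q i x ^+ N.
(** Defined to be zero for sets that are not balls, so as to be measurable without
    conditions. *)
Definition profile Q x : R :=
  if `[< BB Q >] then \1_(dil 6 Q) x * oscillation (dil 6 Q) x else 0.

Lemma oscillation_ge0 Q x : 0 <= oscillation Q x.
Proof.
apply: addr_ge0; first by rewrite exprn_ge0// mulr_ge0// ltW.
by apply: sumr_ge0 => i _; exact: exprn_ge0.
Qed.

Lemma measurable_oscillation Q : measurable_fun setT (oscillation Q).
Proof.
apply: measurable_funD => //; apply: measurable_sum => i; exact: measurable_funX.
Qed.

Lemma profile_ge0 Q x : 0 <= profile Q x.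
Proof.
rewrite /profile; case: ifP => // _; exact: mulr_ge0 (oscillation_ge0 _ _).
Qed.

Lemma measurable_profile Q : measurable_fun setT (profile Q).
Proof.
rewrite /profile; case: asboolP => // bQ; apply: measurable_funM.
  by apply: measurable_indic; apply: (ball_measurable hBB); exact: (dil_ball hBB).
exact: measurable_oscillation.
Qed.

Lemma entry_mean_ge0 Q i : 0 <= entry_mean Q i. Proof. exact: powR_ge0. Qed.

Lemma coefficient_ge0 Q : 0 <= coefficient Q.
Proof. by apply: prodr_ge0 => i _; rewrite mulr_ge0// powR_ge0. Qed.

Let KN0 : 0 <= (Km * M) ^+ N.
Proof. by rewrite exprn_ge0// mulr_ge0// ltW. Qed.

Let MN : M `^ N%:R <= (Km * M) ^+ N.
Proof.
rewrite powR_mulrn ?(ltW M0)// lerXn2r ?nnegrE ?mulr_ge0 ?(ltW M0) ?(ltW Km0)//.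
by rewrite ler_peMl ?(ltW M0).
Qed.

Let tauN i : i \in tau -> 0 < N%:R :> R.
Proof. by move=> it; rewrite ltr0n /N card_gt0; apply/set0Pn; exists i. Qed.

(** For [P <= 1] moments of order [P] of the profile are used, for [P > 1] moments of
    the order conjugate to [s]. *)
Definition osc_const : R :=
  if 1 < P then 2 * (1 + N%:R * mc N%:R (conj_exp s))
  else (1 + N%:R * mc N%:R P `^ P) `^ P^-1.

Let D0 : R := 2 * C0 ^+ 7.
Let D01 : 1 <= D0.
Proof. by rewrite mulr_ege1 ?ler1n// (C0X_ge1 hBB). Qed.

Definition sparse_const : R := osc_const * 2 ^+ m * (D0 `^ (\sum_j dual_exp r P p j)) `^ k.

Section finite_family.
Variables (l : seq (set S)) (E : set S -> set S) (parity : set S -> bool).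
Hypothesis ul : uniq l.
Hypothesis hl : forall Q, Q \in l ->
  [/\ BB Q, measurable (E Q), E Q `<=` Q & (mu Q <= 2%:E * mu (E Q))%E].
Hypothesis El : forall Q Q', Q \in l -> Q' \in l -> parity Q = parity Q' ->
  E Q `&` E Q' !=set0 -> Q = Q'.

Let hs Q : Q \in l ->
  [/\ BB (dil 7 Q), measurable (E Q), E Q `<=` dil 7 Q & vol (dil 7 Q) <= D0 * fine (mu (E Q))].
Proof.
move=> /hl[bQ mE EQ vE]; split=> //; first exact: (dil_ball hBB).
  by apply: subset_trans EQ _; exact: (sub_dil hBB).
apply: (le_trans (vol_dil hBB 7 bQ)).
have -> : D0 * fine (mu (E Q)) = C0 ^+ 7 * (2 * fine (mu (E Q))) by rewrite /D0; ring.
rewrite ler_wpM2l ?(ltW (C0X_gt0 hBB _))//.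
have fE : mu (E Q) \is a fin_num.
  rewrite ge0_fin_numE//; apply: (@le_lt_trans _ _ (mu Q)).
    by apply: le_measure; rewrite ?inE//; exact: (ball_measurable hBB).
  by rewrite (volE hBB bQ) ltry.
by rewrite -lee_fin EFinM (fineK fE) -(volE hBB bQ).
Qed.

(** The exponent [sj i] of the mean is paid for by the exponent of the maximal operator. *)
Lemma sum_entry_mean i : \sum_(Q <- l) entry_mean Q i `^ p i * mass (sg i) (E Q) <=
  (2 * entry_factor i * G i) `^ p i.
Proof.
have q0 : 0 < p i / (r * sj i) by rewrite divr_gt0// mulr_gt0.
have sE : sj i * (p i / (r * sj i)) = p i / r by field; rewrite !gt_eqF.
have hG' : (\int[mu]_x (h i x `^ (sj i * (p i / (r * sj i))) * sg i x)%:E <= (G i `^ p i)%:E)%E.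
  by rewrite sE.
have hl' Q : Q \in l -> [/\ BB (dil 7 Q), measurable (E Q) & E Q `<=` dil 7 Q].
  by move=> /hs[].
have := sparse_wmean hBB (wsg i) (mh i) ul hl' El q0 (mse i) (sesg i)
  (powR_ge0 _ _) hG' (finN i).
have eE Q : entry_mean Q i `^ p i = wmean mu (sg i) (dil 7 Q) (h i) (sj i) `^ (p i / (r * sj i)).
  by rewrite /entry_mean -powRrM mulrC.
under eq_bigr do rewrite -eE.
move=> le; apply: (le_trans le).
rewrite [leRHS]powRM ?G0//; last by rewrite mulr_ge0// powR_ge0.
rewrite [(2 * _) `^ _]powRM ?powR_ge0// /entry_factor -powRrM.
rewrite [(r * sj i)^-1 * p i]mulrC -mulrA ler_wpM2r//.
  by rewrite mulr_ge0 ?powR_ge0.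
rewrite -{1}(powRr1 (ler0n R 2)) ler_powR ?ler1n//.
by apply: ltW; exact: le_lt_trans (rp i).
Qed.

Let big6 Q : Q \in l -> BB (dil 6 Q) /\ measurable (dil 6 Q).
Proof.
by move=> /hl[bQ _ _ _]; split; [|apply: (ball_measurable hBB)]; exact: (dil_ball hBB).
Qed.

Let profileE Q x : Q \in l -> profile Q x = \1_(dil 6 Q) x * oscillation (dil 6 Q) x.
Proof. by move=> /hl[bQ _ _ _]; rewrite /profile asboolT. Qed.

Let mass7 Q : Q \in l -> 0 < mass w (dil 7 Q).
Proof. by move=> /hs[bQ _ _ _]; exact: (mass_ball_gt0 hBB ww). Qed.

Lemma profile_power Q : P <= 1 -> Q \in l ->
  (\int[mu]_x (profile Q x `^ P * w x)%:E <=
     ((osc_const * (Km * M) ^+ N) `^ P * mass w (dil 7 Q))%:E)%E.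
Proof.
move=> P1 Ql; have [b6 m6] := big6 Ql; have [b7 _ _ _] := hs Ql.
have mt6 i : measurable_fun setT (fun x => (t (dil 6 Q) i x `^ N%:R) `^ P * w x).
  apply: measurable_funM => //.
  by do 2!apply: (measurableT_comp (measurable_powR _)) => //.
apply: (@le_trans _ _ (\int[mu]_(x in dil 6 Q) ((((Km * M) ^+ N) `^ P)%:E * (w x)%:E +
    \sum_(i <- enum tau) ((t (dil 6 Q) i x `^ N%:R) `^ P * w x)%:E))%E).
  rewrite [leRHS]integral_mkcond; apply: ge0_le_integral => //.
  - by move=> x _; rewrite lee_fin mulr_ge0 ?powR_ge0// ltW.
  - apply/measurable_EFinP; apply: measurable_funM => //.
    by apply: (measurableT_comp (measurable_powR _)); exact: measurable_profile.
  - apply/(measurable_restrictT _ m6); apply: emeasurable_funD.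
      apply: emeasurable_funM => //; apply/measurable_EFinP; exact: measurable_funTS.
    apply: emeasurable_sum => i; apply/measurable_EFinP; exact: measurable_funTS.
  - move=> x _; rewrite profileE// patchE indicE.
    case: ifPn => xQ; last by rewrite mul0r powR0 ?mul0r// gt_eqF.
    rewrite mul1r -EFinM sumEFin -EFinD lee_fin -mulr_suml -mulrDl ler_wpM2r ?(ltW (w0 x))//.
    have s0 : 0 <= \sum_(i <- enum tau) t (dil 6 Q) i x ^+ N.
      by apply: sumr_ge0 => i _; exact: exprn_ge0.
    apply: (le_trans (powR_subadd KN0 s0 _)); first by rewrite P0.
    rewrite lerD2l; under [leRHS]eq_bigr do rewrite powR_mulrn//.
    apply: powR_sum_le; last by rewrite P0.
    by move=> i; exact: exprn_ge0.
rewrite ge0_integralD//; last 4 first.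
- by move=> x _; rewrite -EFinM lee_fin mulr_ge0 ?powR_ge0// ltW.
- apply: emeasurable_funM => //; apply/measurable_EFinP; exact: measurable_funTS.
- by move=> x _; apply: sume_ge0 => i _; rewrite lee_fin mulr_ge0 ?powR_ge0// ltW.
- apply: emeasurable_sum => i; apply/measurable_EFinP; exact: measurable_funTS.
rewrite ge0_integralZl//; last 3 first.
- by apply/measurable_EFinP; exact: measurable_funTS.
- by move=> x _; rewrite lee_fin ltW.
- by rewrite lee_fin powR_ge0.
rewrite ge0_integral_sum//; last 2 first.
- by move=> i; apply/measurable_EFinP; exact: measurable_funTS.
- by move=> i x _; rewrite lee_fin mulr_ge0 ?powR_ge0// ltW.
have le7 : mass w (dil 6 Q) <= mass w (dil 7 Q).
  apply: (le_mass hBB ww b7) => //; first exact: (ball_measurable hBB).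
  exact: (sub_star hBB).
apply: (@le_trans _ _ ((((Km * M) ^+ N) `^ P)%:E * (mass w (dil 7 Q))%:E +
   \sum_(i <- enum tau) ((mc N%:R P * (Km * M) ^+ N) `^ P * mass w (dil 7 Q))%:E)%E).
  apply: leeD.
    by rewrite lee_wpmul2l ?lee_fin ?powR_ge0// (mass_ballE hBB ww b6) lee_fin.
  rewrite big_seq [leRHS]big_seq; apply: lee_sum => i; rewrite mem_enum => it.
  apply: (le_trans (momw it b6 (mt _ _) (t0 _ _) (tauN it) P0 (t_exp b6 it))).
  rewrite lee_fin ler_wpM2r ?(ltW (mass7 Ql))// ge0_ler_powR ?nnegrE ?(ltW P0)//.
  - by rewrite mulr_ge0 ?powR_ge0.
  - by rewrite mulr_ge0.
  - by rewrite ler_wpM2l.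
rewrite sumEFin -EFinM -EFinD lee_fin big_enum sumr_const -/N -[_ *+ N]mulr_natl.
have mcP : (mc N%:R P * (Km * M) ^+ N) `^ P = mc N%:R P `^ P * ((Km * M) ^+ N) `^ P.
  by rewrite powRM.
rewrite mcP /osc_const ltNge P1/= [leRHS]mulrC [(_ `^ P^-1 * _) `^ P]powRM ?powR_ge0//.
rewrite -[(_ `^ P^-1) `^ P]powRrM mulVf ?gt_eqF// powRr1; last first.
  by rewrite addr_ge0// mulr_ge0// powR_ge0.
by rewrite le_eqVlt; apply/orP; left; apply/eqP; ring.
Qed.

(** The testing hypothesis of the duality argument: the oscillation is moved from the
    dual function [g] to its mean of order [s]. *)
Lemma profile_testing (g : S -> R) (G' : R) : 1 < P ->
  measurable_fun setT g -> (forall x, 0 <= g x) -> 0 <= G' ->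
  (\int[mu]_x (g x `^ conj_exp P * w x)%:E <= G'%:E)%E ->
  exists H : set S -> R, [/\ forall Q, 0 <= H Q,
    forall Q, Q \in l -> (\int[mu]_x (profile Q x * (g x * w x))%:E <=
      ((1 + N%:R * mc N%:R (conj_exp s)) * (Km * M) ^+ N * mass w (dil 7 Q) * H Q)%:E)%E &
    \sum_(Q <- l) H Q `^ conj_exp P * mass w (E Q) <=
      (2 * target_factor) `^ conj_exp P * G'].
Proof.
move=> P1 mg g0 G'0 hg; have /andP[s1' sP] := s1 P1.
have s0 : 0 < s := lt_le_trans ltr01 s1'.
have P1' : 0 < P - 1 by rewrite subr_gt0.
have c1 : 1 <= conj_exp P by rewrite /conj_exp ler_pdivlMr// mul1r; lra.
have c0 : 0 < conj_exp P := lt_le_trans ltr01 c1.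
pose H Q := wmean mu w (dil 7 Q) g s `^ s^-1; exists H; split.
- by move=> Q; exact: powR_ge0.
- move=> Q Ql; have [b6 m6] := big6 Ql; have [b7 _ _ _] := hs Ql.
  have s67 : dil 6 Q `<=` dil 7 Q by exact: (sub_star hBB).
  have fin : (\int[mu]_(x in dil 7 Q) (g x `^ s * w x)%:E < +oo)%E.
    by apply: (wmean_finite hBB ww mg g0 b7 _ hg); rewrite s0 ltW.
  have gw0 x : 0 <= g x * w x by rewrite mulr_ge0// ltW.
  have mgw : measurable_fun setT (fun x => g x * w x) by exact: measurable_funM.
  have mtg i : measurable_fun setT (fun x => t (dil 6 Q) i x ^+ N * (g x * w x)).
    by apply: measurable_funM => //; exact: measurable_funX.
  have -> : (\int[mu]_x (profile Q x * (g x * w x))%:E =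
     \int[mu]_(x in dil 6 Q) (((Km * M) ^+ N)%:E * (g x * w x)%:E +
       \sum_(i <- enum tau) (t (dil 6 Q) i x ^+ N * (g x * w x))%:E))%E.
    rewrite [RHS]integral_mkcond; apply: eq_integral => x _; rewrite patchE profileE// indicE.
    case: ifP => _; last by rewrite !mul0r.
    by rewrite mul1r -EFinM sumEFin -EFinD -mulr_suml -mulrDl.
  rewrite ge0_integralD//; last 4 first.
  - by move=> x _; rewrite -EFinM lee_fin mulr_ge0.
  - apply: emeasurable_funM => //; apply/measurable_EFinP; exact: measurable_funTS.
  - by move=> x _; apply: sume_ge0 => i _; rewrite lee_fin mulr_ge0// exprn_ge0.
  - apply: emeasurable_sum => i; apply/measurable_EFinP; exact: measurable_funTS.
  rewrite ge0_integralZl//; last 2 first.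
  - by apply/measurable_EFinP; exact: measurable_funTS.
  - by move=> x _; rewrite lee_fin.
  rewrite ge0_integral_sum//; last 2 first.
  - by move=> i; apply/measurable_EFinP; exact: measurable_funTS.
  - by move=> i x _; rewrite lee_fin mulr_ge0// exprn_ge0.
  apply: (@le_trans _ _ (((Km * M) ^+ N)%:E * (H Q * mass w (dil 7 Q))%:E +
     \sum_(i <- enum tau) (mc N%:R (conj_exp s) * (Km * M) ^+ N * H Q * mass w (dil 7 Q))%:E)%E).
    apply: leeD.
      by rewrite lee_wpmul2l ?lee_fin//; exact: (wmean_jensen hBB ww mg g0).
    rewrite big_seq [leRHS]big_seq; apply: lee_sum => i; rewrite mem_enum => it; have s1'' := tau_s it P1.
    have cs0 : 0 < conj_exp s by rewrite divr_gt0// subr_gt0.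
    have mom := momw it b6 (mt _ _) (t0 _ _) (tauN it) cs0 (t_exp b6 it).
    have B0 : 0 <= mc N%:R (conj_exp s) * M `^ N%:R by rewrite mulr_ge0 ?powR_ge0.
    under eq_integral do rewrite -powR_mulrn//.
    apply: (le_trans (wmean_holder hBB ww mg g0 b6 b7 s67 s1'' B0 _ _ fin mom)).
    - exact: (measurableT_comp (measurable_powR _)).
    - by move=> x; exact: powR_ge0.
    rewrite lee_fin ler_wpM2r ?(ltW (mass7 Ql))// ler_wpM2r ?powR_ge0//.
    by rewrite ler_wpM2l.
  rewrite sumEFin -EFinM -EFinD lee_fin big_enum sumr_const -/N -[_ *+ N]mulr_natl.
  by rewrite le_eqVlt; apply/orP; left; apply/eqP; ring.
- have q0 : 0 < conj_exp P / s by rewrite divr_gt0.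
  have sE : s * (conj_exp P / s) = conj_exp P by rewrite mulrC divfK// gt_eqF.
  have hg' : (\int[mu]_x (g x `^ (s * (conj_exp P / s)) * w x)%:E <= G'%:E)%E by rewrite sE.
  have hl' Q : Q \in l -> [/\ BB (dil 7 Q), measurable (E Q) & E Q `<=` dil 7 Q].
    by move=> /hs[].
  have := sparse_wmean hBB ww mg ul hl' El q0 mwe wew G'0 hg' (finW P1).
  have eE Q : H Q `^ conj_exp P = wmean mu w (dil 7 Q) g s `^ (conj_exp P / s).
    by rewrite /H -powRrM mulrC.
  under eq_bigr do rewrite -eE.
  move=> le; apply: (le_trans le).
  rewrite /target_factor P1 [(2 * _) `^ _]powRM ?powR_ge0// -powRrM.
  rewrite [s^-1 * _]mulrC mulrA ler_wpM2r// ler_wpM2r ?powR_ge0//.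
  by rewrite -{1}(powRr1 (ler0n R 2)) ler_powR ?ler1n.
Qed.

Lemma sparse_tuple_bound :
  (\int[mu]_x (sparse_fun l profile coefficient x `^ P * w x)%:E <=
    ((sparse_const * A `^ (r^-1 + k) * (Km * M) ^+ N * target_factor *
      \prod_i (entry_factor i * G i)) `^ P)%:E)%E.
Proof.
have F0 i : 0 <= 2 * entry_factor i * G i by rewrite !mulr_ge0 ?powR_ge0.
have e1 : \prod_i (2 * entry_factor i * G i) = 2 ^+ m * \prod_i (entry_factor i * G i).
  under eq_bigr do rewrite -mulrA.
  by rewrite big_split/= prodr_const card_ord.
have cle Q : Q \in l -> coefficient Q <= \prod_i (mean (sg i) (dil 7 Q) `^ r^-1 * entry_mean Q i).
  by [].
have [P1|P1] := leP P 1.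
  have he0 : 0 <= k * (r / P) by rewrite mulr_ge0// divr_ge0 ?ltW.
  have oc0 : 0 <= osc_const * (Km * M) ^+ N.
    by rewrite mulr_ge0// /osc_const ltNge P1/= powR_ge0.
  have := sparse_bound_le1 hBB r1 m0 rp hP ww wsg dual hA D01 k0 hk he0 hs measurable_profile
    profile_ge0 coefficient_ge0 entry_mean_ge0 F0 cle sum_entry_mean P1 erefl oc0
    (fun Q Ql => profile_power P1 Ql).
  move=> le; apply: (le_trans le); rewrite lee_fin e1 /target_factor ltNge P1/= /testing_const.
  rewrite le_eqVlt; apply/orP; left; apply/eqP; congr (_ `^ _); rewrite /sparse_const; ring.
have oc0 : 0 <= (1 + N%:R * mc N%:R (conj_exp s)) * (Km * M) ^+ N.
  by rewrite mulr_ge0// addr_ge0// mulr_ge0.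
have tf0 : 0 <= 2 * target_factor.
  by rewrite mulr_ge0// /target_factor P1 powR_ge0.
have supp Q x : Q \in l -> ~ dil 7 Q x -> profile Q x = 0.
  move=> Ql nx; rewrite profileE// indicE memNset ?mul0r// => x6; apply: nx.
  by have [b6 _] := big6 Ql; exact: (sub_star hBB).
have := sparse_bound_gt1 hBB r1 m0 rp hP ww wsg dual hA D01 k0 hk he hs measurable_profile
  profile_ge0 coefficient_ge0 entry_mean_ge0 F0 cle sum_entry_mean supp P1 erefl oc0 tf0
  (fun g G' => @profile_testing g G' P1).
move=> le; apply: (le_trans le); rewrite lee_fin e1 /testing_const.
rewrite le_eqVlt; apply/orP; left; apply/eqP; congr (_ `^ _).
rewrite /sparse_const /osc_const P1; ring.
Qed.

End finite_family.

Variables (V : normedModType R) (T : ('I_m -> S -> R) -> S -> V) (C1 C2 Wk : R).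
Hypothesis (C1_ge0 : 0 <= C1) (C2_ge0 : 0 <= C2) (Wk0 : 0 < Wk).
Hypothesis subT : normsub mu r T.
Hypothesis mesT : forall f, LrT mu r f -> measurable_fun setT (fun x => `|T f x|).
Hypothesis wkT : forall f (a : R), LrT mu r f -> 0 < a ->
  (a%:E * mu [set x | a < `|T f x|]%R `^ (r / m%:R)^-1 <= (Wk * \prod_i nrm mu r (f i))%:E)%E.
Hypothesis T1 : oscT1 mu BB star r T C1.
Hypothesis T2 : oscT2 mu BB star r T C2.

Variables (f b : 'I_m -> S -> R) (cen : set S -> 'I_m -> R) (lam : 'I_m -> R).
Hypothesis fh : forall i x, `|f i x| `^ r = h i x * sg i x.
Hypothesis lam0 : forall i, 0 <= lam i.
Hypothesis bt : forall Q i x, i \in tau -> `|b i x - cen Q i| = lam i * t Q i x.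

(** The argument of the commutator is affine in the values [b i x]; these are its
    coefficients. *)
Definition slope i : S -> R := if i \in tau then f i else cst 0.
Definition offset i : S -> R := fun x => if i \in tau then - (b i x * f i x) else f i x.

Hypothesis (Lslope : LrT mu r slope) (Loffset : LrT mu r offset).

Let beta x i := b i x.
Let cc Q i := cen (star Q) i.

Let sg0 i x : 0 < sg i x. Proof. by case: (wsg i). Qed.

Let entry_finite Q i : BB Q ->
  (\int[mu]_(x in dil 7 Q) (h i x `^ sj i * sg i x)%:E < +oo)%E.
Proof.
move=> bQ; apply: (wmean_finite hBB (wsg i) (mh i) (h0 i) (dil_ball hBB 7 bQ) _ (hG i)).
by rewrite sj0; case/andP: (sj1 i).
Qed.

Let entryX Q i : entry_mean Q i `^ r = wmean mu (sg i) (dil 7 Q) (h i) (sj i) `^ (sj i)^-1.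
Proof. by rewrite /entry_mean -powRrM; congr (_ `^ _); field; rewrite !gt_eqF. Qed.

(** The function [h i] is [|f i| ^ r] divided by the dual weight, so that averages of [f
    i] become weighted means of [h i]. *)
Lemma entry_average Q i g : BB Q -> g \in Lfun mu r%:E -> (forall x, `|g x| = `|f i x|) ->
  ravg mu r (dil 6 Q) g <= C0 * entry_mean Q i * mean (sg i) (dil 7 Q) `^ r^-1.
Proof.
move=> bQ Lg gf; have b6 := dil_ball hBB 6 bQ; have b7 := dil_ball hBB 7 bQ.
apply: (ravg_le_mean hBB r1 b6 b7 (wsg i) Lg).
- exact: entry_mean_ge0.
- exact: (vol_star hBB b6).
- under eq_integral do rewrite gf fh; rewrite entryX.
  apply: (wmean_jensen hBB (wsg i) (mh i) (h0 i) b6 b7).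
  + exact: (sub_star hBB).
  + by case/andP: (sj1 i).
  + exact: entry_finite.
Qed.

(** The entry of the recentred tuple is the product of [f i] and the deviation of the
    symbol from its mean. By the moments of this deviation it costs [Km * M] compared
    with [f i]. *)
Lemma entry_oscillation Q i g : BB Q -> i \in tau -> g \in Lfun mu r%:E ->
  (forall x, `|g x| = lam i * t (dil 6 Q) i x * `|f i x|) ->
  ravg mu r (dil 6 Q) g <=
    C0 * (lam i * (Km * M) * entry_mean Q i) * mean (sg i) (dil 7 Q) `^ r^-1.
Proof.
move=> bQ it Lg gf; have b6 := dil_ball hBB 6 bQ; have b7 := dil_ball hBB 7 bQ.
have KM0 : 0 <= Km * M by rewrite mulr_ge0// ltW.
have m7 := mass_ball_gt0 hBB (wsg i) b7.
apply: (ravg_le_mean hBB r1 b6 b7 (wsg i) Lg).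
- by apply: mulr_ge0 (entry_mean_ge0 Q i); exact: mulr_ge0.
- exact: (vol_star hBB b6).
- have sj1' := tau_sj it; have c0 : 0 < conj_exp (sj i).
    by rewrite divr_gt0// subr_gt0.
  set c := conj_exp (sj i) in c0 *.
  have B0 : 0 <= mc r c * M `^ r by rewrite mulr_ge0// powR_ge0.
  have mtr : measurable_fun setT (fun x => t (dil 6 Q) i x `^ r).
    exact: (measurableT_comp (measurable_powR _)).
  have mom := momsg it b6 (mt _ _) (t0 _ _) r0 c0 (t_exp b6 it).
  have hold := wmean_holder hBB (wsg i) (mh i) (h0 i) b6 b7 (sub_star hBB b6) sj1' B0
    mtr (fun x => powR_ge0 _ _) (entry_finite i bQ) mom.
  have gE x : `|g x| `^ r = lam i `^ r * (t (dil 6 Q) i x `^ r * (h i x * sg i x)).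
    by rewrite gf (powRM _ (mulr_ge0 (lam0 i) (t0 _ _ _)) (normr_ge0 _))
      (powRM _ (lam0 i) (t0 _ _ _)) fh -mulrA.
  under eq_integral do rewrite gE.
  have m6 := ball_measurable hBB b6.
  have mth : measurable_fun setT (fun x => t (dil 6 Q) i x `^ r * (h i x * sg i x)).
    apply: measurable_funM => //.
    by apply: measurable_funM => //; case: (wsg i).
  have th0 x : 0 <= t (dil 6 Q) i x `^ r * (h i x * sg i x).
    by rewrite !mulr_ge0 ?powR_ge0// ltW.
  apply: (le_trans (integral_scale_le m6 mth th0 (powR_ge0 (lam i) r) hold)).
  rewrite lee_fin mulrA ler_wpM2r ?(ltW m7)//.
  rewrite (powRM _ (mulr_ge0 (lam0 i) KM0) (entry_mean_ge0 Q i)) (powRM _ (lam0 i) KM0).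
  rewrite (powRM _ (ltW Km0) (ltW M0)) entryX.
  have mcK : mc r c <= Km `^ r.
    have := hKm it; rewrite -/c => le.
    have -> : mc r c = (mc r c `^ r^-1) `^ r by rewrite -powRrM mulVf ?gt_eqF// powRr1.
    by rewrite ge0_ler_powR ?nnegrE ?powR_ge0 ?(ltW r0) ?(ltW Km0).
  rewrite -[leRHS]mulrA; apply: ler_wpM2l; first exact: powR_ge0.
  apply: ler_wpM2r; first exact: powR_ge0.
  by apply: ler_wpM2r => //; exact: powR_ge0.
Qed.

Lemma osc_size_le Q i x : BB Q -> dil 6 Q x ->
  osc_size mu star r beta slope offset cc x (dil 5 Q) i <=
  C0 * (if i \in tau then lam i * (t (dil 6 Q) i x + Km * M) else 1) *
    (mean (sg i) (dil 7 Q) `^ r^-1 * entry_mean Q i).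
Proof.
move=> bQ x6; have b6 := dil_ball hBB 6 bQ.
have Lrec := recentred_LrT r1 cc Lslope Loffset (dil 5 Q) i.
have -> : osc_size mu star r beta slope offset cc x (dil 5 Q) i =
    `|b i x - cen (dil 6 Q) i| * ravg mu r (dil 6 Q) (slope i) +
    ravg mu r (dil 6 Q) (recentred slope offset cc (dil 5 Q) i) by [].
have [it|it] := boolP (i \in tau).
  have a1 := @entry_average Q i _ bQ (Lslope i) _.
  have {}a1 : ravg mu r (dil 6 Q) (slope i) <=
      C0 * entry_mean Q i * mean (sg i) (dil 7 Q) `^ r^-1.
    by apply: a1 => y; rewrite /slope it.
  have a2 := @entry_oscillation Q i _ bQ it Lrec.
  have {}a2 : ravg mu r (dil 6 Q) (recentred slope offset cc (dil 5 Q) i) <=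
      C0 * (lam i * (Km * M) * entry_mean Q i) * mean (sg i) (dil 7 Q) `^ r^-1.
    apply: a2 => y; rewrite -bt// -normrM -normrN; congr `|_|.
    by rewrite /recentred /slope /offset it /cc; ring.
  have lt0 : 0 <= lam i * t (dil 6 Q) i x by rewrite mulr_ge0.
  rewrite bt//; apply: (le_trans (lerD (ler_wpM2l lt0 a1) a2)).
  by rewrite le_eqVlt; apply/orP; left; apply/eqP; ring.
have z : ravg mu r (dil 6 Q) (slope i) = 0.
  rewrite /slope (negbTE it) /ravg (_ : nrm mu r _ = 0) ?mul0r//.
  rewrite /nrm (_ : EFin \o _ = cst 0%E) ?Lnorm0//.
    by rewrite lt0r_neq0.
  by apply/funext => y; congr (_%:E); exact: mul0r.
rewrite z mulr0 add0r.
apply: (le_trans (@entry_average Q i _ bQ Lrec _)).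
  by move=> y; rewrite /recentred /slope /offset (negbTE it) mulr0 add0r.
by rewrite le_eqVlt; apply/orP; left; apply/eqP; ring.
Qed.

Definition operator_const : R :=
  @local_const R C0 m r * (C1 + C2 + Wk) * (C0 ^+ m * 2 ^+ N * \prod_(i in tau) lam i).

Lemma operator_const_ge0 : 0 <= operator_const.
Proof.
have [l0 b0] := local_const_ge hBB r m0.
have c0 := C0_ge0 hBB.
have big0 : 0 <= @big R C0 m ^+ m by rewrite exprn_ge0// (le_trans ler01)// (big_ge1 hBB m0).
have h1 := le_trans big0 b0; rewrite !mulr_ge0 ?exprn_ge0// ?addr_ge0 ?(ltW Wk0)//.
by apply: prodr_ge0 => i _.
Qed.

Lemma size_bound_le Q x : BB Q -> dil 5 Q x ->
  size_bound mu star C0 r C1 C2 Wk beta slope offset cc x (dil 5 Q) <=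
  operator_const * (profile Q x * coefficient Q).
Proof.
move=> bQ x5; have b5 := dil_ball hBB 5 bQ.
have x6 : dil 6 Q x by apply: (sub_star hBB b5).
have c0 := C0_ge0 hBB.
have KM0 : 0 <= Km * M by rewrite mulr_ge0// ltW.
have cE : 0 <= @local_const R C0 m r * (C1 + C2 + Wk).
  have [_ b0] := local_const_ge hBB r m0.
  have big0 : 0 <= @big R C0 m ^+ m by rewrite exprn_ge0// (le_trans ler01)// (big_ge1 hBB m0).
  have h1 := le_trans big0 b0.
  by rewrite mulr_ge0// ?addr_ge0 ?(ltW Wk0).
rewrite /size_bound /operator_const -[leRHS]mulrA; apply: ler_wpM2l => //.
have p1 : \prod_i osc_size mu star r beta slope offset cc x (dil 5 Q) i <=
    \prod_i (C0 * (if i \in tau then lam i * (t (dil 6 Q) i x + Km * M) else 1) *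
      (mean (sg i) (dil 7 Q) `^ r^-1 * entry_mean Q i)).
  by apply: ler_prod => i _; rewrite osc_size_ge0 osc_size_le.
apply: (le_trans p1); rewrite big_split/= big_split/= prodr_const card_ord -big_mkcond/=.
have pE : profile Q x = oscillation (dil 6 Q) x.
  by rewrite /profile asboolT// indicE mem_set// mul1r.
rewrite big_split/= pE -/(coefficient Q) [leRHS]mulrA.
apply: ler_wpM2r; first exact: coefficient_ge0.
have := prod_add_le tau (fun i => t0 (dil 6 Q) i x) KM0; rewrite -/N -/(oscillation (dil 6 Q) x).
move=> h1; rewrite -mulrA -[leRHS]mulrA ler_wpM2l ?exprn_ge0//.
have l0 : 0 <= \prod_(i in tau) lam i by apply: prodr_ge0 => i _.
apply: (le_trans (ler_wpM2l l0 h1)).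
by rewrite le_eqVlt; apply/orP; left; apply/eqP; rewrite /oscillation; ring.
Qed.

Let beta_arg := arg beta slope offset.

Definition weighted_const : R := operator_const *
  (sparse_const * A `^ (r^-1 + k) * (Km * M) ^+ N * target_factor *
      \prod_i (entry_factor i * G i)).

(** The sum at a point is over a finite part of the sparse family. In an enumeration of
    the family this part is contained in an initial segment, to which the bound for
    finite families applies. *)
Lemma local_bound B0 : BB B0 -> exists g : S -> \bar R,
  [/\ measurable_fun setT g, forall x, (0 <= g x)%E,
    (\int[mu]_x g x <= (weighted_const `^ P)%:E)%E &
    {ae mu, forall x, dil 5 B0 x ->
      ((`|T (restr (beta_arg x) (dil 6 B0)) x| `^ P * w x)%:E <= g x)%E}].
Proof.
move=> bB0.
have [Ac [E [parity [cA AB hE dE neg]]]] := sparse_domination hBB m0 r1 C1_ge0 C2_ge0 Wk0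
  subT mesT wkT T1 T2 beta cc Lslope Loffset bB0.
have /countable_injP[code inj] := cA.
pose dec n : option (set S) :=
  if pselect (exists Q, Ac Q /\ code Q = n) is left e then Some (sval (cid e)) else None.
have decP n Q : dec n = Some Q -> Ac Q /\ code Q = n.
  by rewrite /dec; case: pselect => // e [<-]; case: (cid e).
have decK Q : Ac Q -> dec (code Q) = Some Q.
  move=> AQ; rewrite /dec; case: pselect => [e|]; last by case; exists Q.
  case: (cid e) => Q' /= [AQ' cQ]; congr Some.
  by apply: inj; rewrite ?inE.
pose l n := pmap dec (iota 0 n).
have lP n Q : Q \in l n -> Ac Q.
  by rewrite mem_pmap => /mapP[j _ /esym/decP[]].
have ul n : uniq (l n).
  apply: (@pmap_uniq _ _ dec code); last exact: iota_uniq.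
  by move=> j; case e : (dec j) => [Q|] //=; have [] := decP _ _ e.
have bl n Q : Q \in l n -> [/\ BB Q, measurable (E Q), E Q `<=` Q & (mu Q <= 2%:E * mu (E Q))%E].
  by move=> /lP AQ; have [? ? ?] := hE Q AQ; split=> //; exact: AB.
have dl n Q Q' : Q \in l n -> Q' \in l n -> parity Q = parity Q' ->
    E Q `&` E Q' !=set0 -> Q = Q'.
  by move=> /lP AQ /lP AQ'; exact: dE.
pose F n x := sparse_fun (l n) profile coefficient x.
have F0 n x : 0 <= F n x.
  by apply: sumr_ge0 => Q _; rewrite mulr_ge0 ?profile_ge0 ?coefficient_ge0.
have mF n : measurable_fun setT (F n).
  by apply: measurable_sum => Q; apply: measurable_funM => //; exact: measurable_profile.
have oc0 := operator_const_ge0.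
pose g n x := ((operator_const * F n x) `^ P * w x)%:E.
have mg n : measurable_fun setT (g n).
  apply/measurable_EFinP; apply: measurable_funM => //.
  by apply: (measurableT_comp (measurable_powR _)); exact: measurable_funM.
have g0 n x : (0 <= g n x)%E by rewrite lee_fin mulr_ge0 ?powR_ge0// ltW.
have gB n : (\int[mu]_x g n x <= (weighted_const `^ P)%:E)%E.
  have gE x : g n x = ((operator_const `^ P)%:E * (F n x `^ P * w x)%:E)%E.
    by rewrite /g powRM// -EFinM mulrA.
  under eq_integral do rewrite gE.
  rewrite ge0_integralZl//; last 3 first.
  - apply/measurable_EFinP; apply: measurable_funM => //.
    exact: (measurableT_comp (measurable_powR _)).
  - by move=> x _; rewrite lee_fin mulr_ge0 ?powR_ge0// ltW.
  - by rewrite lee_fin powR_ge0.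
  have := sparse_tuple_bound (ul n) (bl n) (dl n).
  move=> /(lee_wpmul2l (_ : (0 <= (operator_const `^ P)%:E)%E)) h1.
  apply: (le_trans (h1 _)); first by rewrite lee_fin powR_ge0.
  rewrite -EFinM -powRM// !mulr_ge0 ?powR_ge0 ?exprn_ge0//.
  - by rewrite /osc_const; case: ifP => _; rewrite ?powR_ge0// mulr_ge0// addr_ge0// mulr_ge0.
  - by rewrite mulr_ge0 ?(ltW M0) ?(ltW Km0).
  - by rewrite /target_factor; case: ifP => _; rewrite ?powR_ge0.
  - by apply: prodr_ge0 => i _; rewrite mulr_ge0// powR_ge0.
exists (fun x => limn_einf (g ^~ x)); split.
- exact: measurable_limn_einf.
- by move=> x; apply: limn_einf_ge; exists 0%N.
- by apply: (integral_le_liminf mg g0) => //; exact: aeW.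
- case: neg => Z [mZ Z0 sub]; exists Z; split=> // x /= nx; apply: sub => /=.
  move/not_implyP: nx => [x5 h1]; split=> // -[s' [us' hs' hle]].
  apply: h1; apply: limn_einf_ge.
  exists (\max_(Q <- s') (code Q).+1)%N => // n /= hn.
  rewrite lee_fin ler_wpM2r ?(ltW (w0 x))// ge0_ler_powR ?nnegrE ?(ltW P0)//.
    exact: mulr_ge0.
  apply: (le_trans hle).
  apply: (@le_trans _ _ (\sum_(Q <- s') operator_const * (profile Q x * coefficient Q))).
    rewrite big_seq [leRHS]big_seq; apply: ler_sum => Q Qs; have [AQ xQ] := hs' Q Qs.
    by apply: size_bound_le => //; exact: AB.
  rewrite -mulr_sumr ler_wpM2l// /F /sparse_fun.
  have pe : perm_eq s' [seq Q <- l n | Q \in s'].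
    apply: uniq_perm => //; first by rewrite filter_uniq.
    move=> Q; rewrite mem_filter; case Qs : (Q \in s') => //=.
    have [AQ _] := hs' Q Qs; rewrite /l mem_pmap; apply/esym/mapP; exists (code Q).
      rewrite mem_iota/= add0n; apply: leq_trans hn.
      by rewrite (big_rem Q)//= leq_maxl.
    by rewrite decK.
  rewrite (perm_big _ pe)/= big_filter big_mkcond/=; apply: ler_sum => Q _.
  by case: ifP => // _; rewrite mulr_ge0 ?profile_ge0 ?coefficient_ge0.
Qed.

(** Since the argument of the operator varies with the point, its value may be a
    nonmeasurable function of the point, hence the measurable majorant [g]. The
    truncation error tends to zero along the exhausting balls, so a number below the
    value of the operator is eventually below that of the truncated operator. *)
Theorem weighted_bound : exists g : S -> \bar R,
  [/\ measurable_fun setT g, forall x, (0 <= g x)%E,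
    (\int[mu]_x g x <= (weighted_const `^ P)%:E)%E &
    {ae mu, forall x, ((`|T (beta_arg x) x| `^ P * w x)%:E <= g x)%E}].
Proof.
have [[x0 _]|S0] := pselect (exists x0 : S, True); last first.
  exists (cst 0%E); split=> //; first by rewrite integral0 lee_fin powR_ge0.
  by apply: aeW => x; case: S0; exists x.
have La x : LrT mu r (beta_arg x) by exact: arg_LrT.
have [B [g [mg g0 gB hg]]] : exists (B : nat -> set S) (g : nat -> S -> \bar R),
  [/\ forall n, measurable_fun setT (g n), forall n x, (0 <= g n x)%E,
    forall n, (\int[mu]_x g n x <= (weighted_const `^ P)%:E)%E &
    {ae mu, forall x, forall a : R, 0 <= a < `|T (beta_arg x) x| ->
      \forall n \near \oo, ((a `^ P * w x)%:E <= g n x)%E}].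
  have dilT B : BB B -> star B = [set: S] -> forall n, dil n.+1 B = [set: S].
    move=> bB sT n; apply/seteqP; split=> // y _.
    by apply: (dil_sub hBB bB (isT : (1 <= n.+1)%N)); rewrite /= sT.
  have [[B [bB sT]]|[B [bB cov]]] := exhausting_balls hBB x0.
    have [g [mg g0 gB hg]] := local_bound bB.
    exists (fun=> B), (fun=> g); split=> //; move: hg; apply: filterS => x hx a /andP[a0 lt].
    exists 0%N => // n _; apply: le_trans (hx _); last by rewrite (dilT B bB sT 4).
    rewrite lee_fin ler_wpM2r ?(ltW (w0 x))// ge0_ler_powR ?nnegrE ?(ltW P0)//.
    rewrite (dilT B bB sT 5) (_ : restr _ setT = beta_arg x) ?(ltW lt)//.
    by apply/funext => i; apply/funext => y; rewrite /restr indicT mulr1.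
  have /choice[g hg] n := local_bound (proj1 (bB n)).
  exists B, g; split.
  - by move=> n; case: (hg n).
  - by move=> n; case: (hg n).
  - by move=> n; case: (hg n).
  have : {ae mu, forall x, forall n, dil 5 (B n) x ->
      ((`|T (restr (beta_arg x) (dil 6 (B n))) x| `^ P * w x)%:E <= g n x)%E}.
    by apply/ae_foralln => n; case: (hg n).
  apply: filterS => x hx a /andP[a0 lt].
  have [N0 hN0] := cov x; pose c := (C2 + 2 * (@lev R C0 m `^ (m%:R / r) * Wk)) *
    \prod_i nrm mu r (beta_arg x i).
  have c0 : 0 <= c.
    rewrite mulr_ge0 ?addr_ge0 ?mulr_ge0 ?powR_ge0 ?(ltW Wk0)//.
    by apply: prodr_ge0 => i _; exact: nrm_ge0.
  pose del := `|T (beta_arg x) x| - a; have del0 : 0 < del by rewrite subr_gt0.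
  pose X := (c / del) `^ r + 1.
  exists (maxn N0 (Num.truncn X).+1) => // n /= hn.
  have nN : (N0 <= n)%N by apply: leq_trans hn; exact: leq_maxl.
  have [bn vn] := bB n; have b5 := dil_ball hBB 5 bn.
  have x5 : dil 5 (B n) x by apply: (dil_sub hBB bn (isT : (1 <= 5)%N)); exact: hN0.
  apply: le_trans (hx n x5); rewrite lee_fin ler_wpM2r ?(ltW (w0 x))//.
  rewrite ge0_ler_powR ?nnegrE ?(ltW P0)//.
  have := truncation_error hBB m0 r1 C2_ge0 Wk0 mesT wkT T2 (La x) b5 x5.
  rewrite -/(dil 6 (B n)) => err.
  have vX : X <= vol (dil 5 (B n)).
    apply: le_trans (le_vol_dil hBB 5 bn); apply: ltW; apply: lt_trans vn.
    apply: lt_le_trans (truncnS_gt _) _; rewrite ler_nat.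
    by apply: leq_trans hn; exact: leq_maxr.
  set v5 := vol (dil 5 (B n)) in err vX.
  have X1 : 1 <= X by rewrite lerDr powR_ge0.
  have X0 : 0 <= X := le_trans ler01 X1.
  have ri0 : 0 <= r^-1 by rewrite invr_ge0 ltW.
  have V1 : 1 <= v5 `^ r^-1.
    rewrite -[leLHS](congr1 (@^~ r^-1) (powR1 R)) ge0_ler_powR ?nnegrE//.
      exact: le_trans vX.
    exact: le_trans X1 vX.
  have Vc : c / del <= v5 `^ r^-1.
    have -> : c / del = ((c / del) `^ r) `^ r^-1.
      by rewrite -powRrM divff ?gt_eqF// powRr1// divr_ge0// ltW.
    rewrite ge0_ler_powR ?nnegrE ?powR_ge0//; first exact: le_trans vX.
    by apply: le_trans vX; rewrite lerDl.
  have V0 : 0 < v5 `^ r^-1 := lt_le_trans ltr01 V1.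
  have e_le : (C2 + 2 * (@lev R C0 m `^ (m%:R / r) * Wk)) *
      \prod_i (nrm mu r (beta_arg x i) / v5 `^ r^-1) <= del.
    have -> : (C2 + 2 * (@lev R C0 m `^ (m%:R / r) * Wk)) *
        \prod_i (nrm mu r (beta_arg x i) / v5 `^ r^-1) = c / (v5 `^ r^-1) ^+ m.
      by rewrite big_split/= prodr_const card_ord exprVn /c; ring.
    apply: (@le_trans _ _ (c / v5 `^ r^-1)).
      rewrite ler_wpM2l// lef_pV2 ?posrE ?exprn_gt0//.
      by rewrite -{1}(expr1 (v5 `^ r^-1)) ler_weXn2l.
    by rewrite ler_pdivrMr// mulrC -ler_pdivrMr.
  by move: err e_le; rewrite /del; lra.
exists (fun x => limn_einf (g ^~ x)); split.
- exact: measurable_limn_einf.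
- by move=> x; apply: limn_einf_ge; exists 0%N.
- by apply: (integral_le_liminf mg g0) => //; exact: aeW.
move: hg; apply: filterS => x hx.
have W0 : 0 <= `|T (beta_arg x) x| `^ P * w x by rewrite mulr_ge0 ?powR_ge0// ltW.
apply/lee_mul01Pr => // e /andP[e0 e1].
have [z|z] := eqVneq (`|T (beta_arg x) x|) 0.
  rewrite z powR0 ?gt_eqF// mul0r mule0; apply: limn_einf_ge; exists 0%N => // n _; exact: g0.
have z0 : 0 < `|T (beta_arg x) x| by rewrite lt0r z normr_ge0.
apply: limn_einf_ge.
have := hx (e `^ P^-1 * `|T (beta_arg x) x|).
rewrite [(e `^ P^-1 * _) `^ P]powRM ?powR_ge0// -[(e `^ P^-1) `^ P]powRrM mulVf ?gt_eqF//.
rewrite powRr1 ?(ltW e0)// -mulrA EFinM; apply.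
rewrite mulr_ge0 ?powR_ge0//= -[ltRHS]mul1r ltr_pM2r//.
rewrite -[ltRHS](congr1 (@^~ P^-1) (powR1 R)) gt0_ltr_powR ?nnegrE ?invr_gt0 ?(ltW e0)//.
Qed.

End sparse_tuples.

(** * Vector weights *)

(** A negative power of a weight in a dual tuple is a product of powers of the others,
    to which Hoelder's inequality applies. *)
Lemma dual_A_bound {R : realType} {d : measure_display} {S : measurableType d}
    (mu : {measure set S -> \bar R}) (BB : set (set S)) (star : set S -> set S) (C0 : R)
    (hBB : ball_basis mu BB star C0) (I : finType) (phi : I -> S -> R) (k : I -> R) (A : R)
    (j j' : I) :
  (forall i, pos_weight mu BB (phi i)) -> (forall i, 0 < k i) ->
  (forall x, \prod_i phi i x `^ k i = 1) ->
  (forall B, BB B -> \prod_i mean mu (phi i) B `^ k i <= A) -> j' != j ->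
  A_bound mu BB (phi j) (1 + (\sum_(l | l != j) k l) / k j) (A `^ (k j)^-1).
Proof.
move=> wphi k0 phi1 phiA jj'; set K := \sum_(l | l != j) k l.
have K0 : 0 < K.
  rewrite /K (bigD1 j')//=; apply: ltr_wpDr => //.
  by apply: sumr_ge0 => l _; exact: ltW.
set q := 1 + K / k j; have q1 : q - 1 = K / k j by rewrite /q; ring.
have q10 : 0 < q - 1 by rewrite q1 divr_gt0.
have p0 i x : 0 < phi i x by case: (wphi i).
have qE : 1 - conj_exp q = - (k j / K).
  have -> : k j / K = (q - 1)^-1 by rewrite q1 invf_div.
  by rewrite /conj_exp; field; rewrite gt_eqF.
pose th (l : {l | l \in predC1 j}) := k (val l) / K.
pose psi (l : {l | l \in predC1 j}) := phi (val l).
have th0 l : 0 < th l by rewrite divr_gt0.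
have bigS (op : Monoid.com_law (1 : R)) (F : I -> R) :
    \big[op/1]_(l : {l | l \in predC1 j}) F (val l) = \big[op/1]_(l | l != j) F l.
  by rewrite -big_sub; apply: eq_bigl => l; rewrite inE.
have th1 : \sum_l th l = 1.
  rewrite /th -mulr_suml (_ : \sum_l _ = K) ?divff ?gt_eqF//.
  by rewrite -(big_sub _ k); apply: eq_bigl => l; rewrite inE.
have phiE x : phi j x `^ (1 - conj_exp q) = \prod_l psi l x `^ th l.
  have -> : \prod_l psi l x `^ th l = \prod_(l | l != j) phi l x `^ (k l / K).
    by rewrite -(bigS _ (fun l => phi l x `^ (k l / K))).
  have h : phi j x `^ (k j / K) * \prod_(l | l != j) phi l x `^ (k l / K) = 1.
    rewrite -(bigD1 j (P := predT) (F := fun l => phi l x `^ (k l / K)))//=.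
    transitivity ((\prod_i phi i x `^ k i) `^ K^-1); last by rewrite phi1 powR1.
    rewrite powR_prod; last by move=> i; exact: powR_ge0.
    by apply: eq_bigr => l _; rewrite -powRrM.
  rewrite qE powRN; have a0 : 0 < phi j x `^ (k j / K) by exact: powR_gt0.
  by rewrite -[RHS](mulKf (lt0r_neq0 a0)) h mulr1.
have hold B : BB B ->
    (\int[mu]_(x in B) (phi j x `^ (1 - conj_exp q))%:E <=
      (\prod_l mass mu (psi l) B `^ th l)%:E)%E.
  move=> bB; under eq_integral do rewrite phiE.
  apply: holder_integral => //.
  - exact: (ball_measurable hBB).
  - by move=> l; case: (wphi (val l)).
  - by move=> l x; rewrite /psi ltW.
  - by move=> l; apply: mass_ge0 => x; rewrite /psi ltW.
  - by move=> l; rewrite (mass_ballE hBB (wphi _) bB).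
have wd : pos_weight mu BB (fun x => phi j x `^ (1 - conj_exp q)).
  have [md v0] := dual_pow_measurable (1 - conj_exp q) (wphi j).
  by split=> // B bB; apply: (le_lt_trans (hold B bB)); rewrite ltry.
split=> // B bB; have vB := vol_gt0 hBB bB.
have m0 i : 0 < mean mu (phi i) B by exact: (mean_gt0 hBB (wphi i)).
have le1 : mean mu (fun x => phi j x `^ (1 - conj_exp q)) B <=
    \prod_l mean mu (psi l) B `^ th l.
  have -> : \prod_l mean mu (psi l) B `^ th l =
      (\prod_l mass mu (psi l) B `^ th l) / vol mu B.
    have -> : (vol mu B)^-1 = \prod_l (vol mu B)^-1 `^ th l.
      rewrite -[LHS]powRr1 ?invr_ge0 ?(ltW vB)//.
      transitivity ((vol mu B)^-1 `^ (\sum_l th l)); first by rewrite th1.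
      elim: (index_enum _) => [|l s IH]; first by rewrite !big_nil powRr0.
      by rewrite !big_cons powRD ?IH// invr_eq0 (gt_eqF vB) implybT.
    rewrite -big_split/=; apply: eq_bigr => l _.
    rewrite -powRM ?invr_ge0 ?(ltW vB)//.
    by apply: mass_ge0 => x; rewrite /psi ltW.
  rewrite /mean ler_wpM2r ?invr_ge0 ?(ltW vB)//.
  by rewrite -lee_fin -(mass_ballE hBB wd bB); exact: hold.
have d0 : 0 < mean mu (fun x => phi j x `^ (1 - conj_exp q)) B by exact: (mean_gt0 hBB wd).
have le2 : mean mu (fun x => phi j x `^ (1 - conj_exp q)) B `^ (q - 1) <=
    \prod_(l | l != j) mean mu (phi l) B `^ (k l / k j).
  have -> : \prod_(l | l != j) mean mu (phi l) B `^ (k l / k j) =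
     (\prod_l mean mu (psi l) B `^ th l) `^ (q - 1).
    rewrite powR_prod; last by move=> l; exact: powR_ge0.
    rewrite -(bigS _ (fun l => mean mu (phi l) B `^ (k l / k j))); apply: eq_bigr => l _.
    rewrite -powRrM /th q1; congr (_ `^ _).
    by field; rewrite !gt_eqF.
  rewrite ge0_ler_powR ?nnegrE ?(ltW q10) ?(ltW d0)//.
  by apply: prodr_ge0 => l _; exact: powR_ge0.
apply: (le_trans (ler_wpM2l (ltW (m0 j)) le2)).
have -> : mean mu (phi j) B * \prod_(l | l != j) mean mu (phi l) B `^ (k l / k j) =
    (\prod_l mean mu (phi l) B `^ k l) `^ (k j)^-1.
  rewrite powR_prod; last by move=> l; exact: powR_ge0.
  rewrite [RHS](bigD1 j)//= -powRrM divff ?gt_eqF// powRr1 ?(ltW (m0 j))//.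
  by congr (_ * _); apply: eq_bigr => l _; rewrite -powRrM.
rewrite ge0_ler_powR ?nnegrE ?invr_ge0 ?(ltW (k0 j)) ?phiA//.
  by apply: prodr_ge0 => l _; exact: powR_ge0.
by apply: le_trans (phiA B bB); apply: prodr_ge0 => l _; exact: powR_ge0.
Qed.

Lemma mule_lty_pos {R : realType} (x y : \bar R) : (0 < x)%E -> (0 < y)%E ->
  (x * y < +oo)%E -> (x < +oo)%E /\ (y < +oo)%E.
Proof.
case: x => [x| |]; case: y => [y| |] // x0 y0; rewrite ?ltry//.
- by rewrite gt0_muley.
- by rewrite gt0_mulye.
Qed.

Lemma prode_lty_pos {R : realType} (I : eqType) (s : seq I) (f : I -> \bar R) :
  (forall i, 0 < f i)%E -> (\prod_(i <- s) f i < +oo)%E -> forall i, i \in s -> (f i < +oo)%E.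
Proof.
move=> f0; have pos (l : seq I) : (0 < \prod_(i <- l) f i)%E.
  by elim: l => [|i l IH]; rewrite ?big_nil// big_cons mule_gt0.
elim: s => [|i s IH] //; rewrite big_cons => /(mule_lty_pos (f0 i) (pos s))[h1 h2] j.
by rewrite inE => /orP[/eqP ->//|]; exact: IH.
Qed.

Lemma poweR_lty_inv {R : realType} (x : \bar R) (a : R) : 0 < a ->
  (x `^ a < +oo)%E -> (x < +oo)%E.
Proof. by case: x => [x| |] // a0; rewrite ?ltry//= gt_eqF. Qed.

Section vector_weights.
Context {R : realType} {d : measure_display} {S : measurableType d}.
Variable mu : {measure set S -> \bar R}.
Variables (BB : set (set S)) (star : set S -> set S) (C0 : R).
Hypothesis hBB : ball_basis mu BB star C0.
Local Notation vol := (vol mu).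
Local Notation mass := (mass mu).
Local Notation mean := (mean mu).
Local Notation pos_weight := (pos_weight mu BB).
Context {m : nat}.
Hypothesis m0 : (0 < m)%N.
Variables (r : R) (p : 'I_m -> R) (w : 'I_m -> S -> \bar R).
Hypothesis (r1 : 1 <= r) (rp : forall i, r < p i).
Let P : R := hexp p.
Let q i : R := p i / r.
Hypothesis hw : forall i, weight mu (w i).

Let r0 : 0 < r. Proof. exact: lt_le_trans ltr01 r1. Qed.
Let p0 i : 0 < p i. Proof. exact: lt_trans (rp i). Qed.

Lemma hexp_inv : P^-1 = \sum_i (p i)^-1. Proof. by rewrite /P /hexp invrK. Qed.

Lemma hexp_gt0 : 0 < P.
Proof.
rewrite -invr_gt0 hexp_inv (bigD1 (Ordinal m0))//=.
by apply: ltr_wpDr; [apply: sumr_ge0 => i _|]; rewrite ?invr_ge0 ?invr_gt0 ?ltW.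
Qed.

Lemma hexp_div : hexp q = P / r.
Proof.
rewrite /hexp /q; under eq_bigr do rewrite invf_div.
by rewrite -mulr_sumr -hexp_inv invfM invrK mulrC.
Qed.

Lemma prod_weight_div : prod_weight q w = prod_weight p w.
Proof.
apply/funext => x; rewrite /prod_weight; apply: eq_bigr => i _; congr (_ `^ _)%E.
by rewrite hexp_div /q -/P; field; rewrite !gt_eqF.
Qed.

Lemma dual_powE i : 1 - conj_exp (q i) = r / (r - p i).
Proof.
have h : p i - r != 0 by rewrite gt_eqF// subr_gt0.
have h' : r - p i != 0 by rewrite -opprB oppr_eq0.
have r_neq0 : r != 0 by rewrite gt_eqF.
rewrite /conj_exp /q (_ : p i / r - 1 = (p i - r) / r); last by field.
by field; rewrite h h' r_neq0.
Qed.

Lemma conj_exp_inv i : (conj_exp (q i))^-1 = 1 - r / p i.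
Proof. by rewrite /conj_exp /q invf_div; field; rewrite !gt_eqF. Qed.

(** A representative of the weight with values in the positive real numbers. *)
Definition wrep i x : R := if 0 < fine (w i x) then fine (w i x) else 1.
Definition wtarget x : R := \prod_i wrep i x `^ (P / p i).
Definition wdual i x : R := wrep i x `^ (r / (r - p i)).

Lemma wrep_gt0 i x : 0 < wrep i x.
Proof. by rewrite /wrep; case: ifP. Qed.

Lemma measurable_wrep i : measurable_fun setT (wrep i).
Proof.
have mf : measurable_fun setT (fun x => fine (w i x)).
  by apply: (measurableT_comp (fine_measurable measurableT)); case: (hw i).
apply: measurable_fun_ifT => //.
by apply: (@measurable_fun_ltr _ _ _ _ (cst 0)).
Qed.

Lemma ae_wrep : {ae mu, forall x, forall i, w i x = (wrep i x)%:E}.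
Proof.
have h i : {ae mu, forall x, w i x = (wrep i x)%:E}.
  have [_] := hw i; apply: filterS => x /andP[w0 woo].
  have fw : w i x \is a fin_num by rewrite ge0_fin_numE// ltW.
  have f0 : 0 < fine (w i x) by rewrite fine_gt0// w0.
  by rewrite /wrep f0 fineK.
exact: filter_forall.
Qed.

Lemma measurable_target : measurable_fun setT (prod_weight p w).
Proof.
rewrite /prod_weight; elim: (index_enum _) => [|i s IH].
  by rewrite (_ : (fun x => _) = cst 1%E)//; apply/funext => x; rewrite big_nil.
rewrite (_ : (fun x => _) = fun x => (w i x `^ (P / p i) *
    \prod_(j <- s) w j x `^ (P / p j))%E); last by apply/funext => x; rewrite big_cons.
apply: emeasurable_funM => //.
by apply: (measurableT_comp (measurable_poweR _)); case: (hw i).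
Qed.

Lemma ae_target : {ae mu, forall x, prod_weight p w x = (wtarget x)%:E}.
Proof.
have := ae_wrep; apply: filterS => x hx; rewrite /prod_weight /wtarget -prodEFin.
by apply: eq_bigr => i _; rewrite hx poweR_EFin.
Qed.

Lemma measurable_dual i : measurable_fun setT (sigma r p w i).
Proof. by apply: (measurableT_comp (measurable_poweR _)); case: (hw i). Qed.

Lemma ae_dual i : {ae mu, forall x, sigma r p w i x = (wdual i x)%:E}.
Proof.
by have := ae_wrep; apply: filterS => x hx; rewrite /sigma hx poweR_EFin.
Qed.

Lemma wtarget_gt0 x : 0 < wtarget x.
Proof. by apply: prodr_gt0 => i _; rewrite powR_gt0// wrep_gt0. Qed.

Lemma wdual_gt0 i x : 0 < wdual i x.
Proof. by rewrite powR_gt0// wrep_gt0. Qed.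

Lemma measurable_wtarget : measurable_fun setT wtarget.
Proof.
apply: measurable_prod => i _; apply: (measurableT_comp (measurable_powR _)).
exact: measurable_wrep.
Qed.

Lemma measurable_wdual i : measurable_fun setT (wdual i).
Proof. by apply: (measurableT_comp (measurable_powR _)); exact: measurable_wrep. Qed.

Lemma gap_gt0 i : 0 < 1 - r / p i.
Proof. by rewrite subr_gt0 ltr_pdivrMr// mul1r. Qed.

Let avg_ae g (v : S -> R) B : BB B -> measurable_fun setT g -> measurable_fun setT v ->
  {ae mu, forall x, g x = (v x)%:E} ->
  avg mu B g = ((vol B)^-1%:E * \int[mu]_(x in B) (v x)%:E)%E.
Proof.
move=> bB mg mv gv; rewrite /avg (volE hBB bB) inver gt_eqF ?(vol_gt0 hBB)//; congr (_ * _)%E.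
apply: ae_eq_integral => //.
- exact: (ball_measurable hBB).
- exact: measurable_funTS.
- by apply: measurable_funTS; exact/measurable_EFinP.
- by move: gv; apply: filterS.
Qed.

Let Xt B := ((vol B)^-1%:E * \int[mu]_(x in B) (wtarget x)%:E)%E.
Let Xd i B := ((vol B)^-1%:E * \int[mu]_(x in B) (wdual i x)%:E)%E.

Let value_le B : BB B ->
  (Xt B `^ (r / P) * \prod_i Xd i B `^ (1 - r / p i) <= Avec_const mu BB q w)%E.
Proof.
move=> bB; apply: ereal_sup_ubound; exists B => //.
rewrite prod_weight_div hexp_div invf_div.
rewrite (avg_ae bB measurable_target measurable_wtarget ae_target); congr (_ * _)%E.
apply: eq_bigr => i _; rewrite conj_exp_inv; congr (_ `^ _)%E.
rewrite /Xd -(avg_ae bB (measurable_dual i) (measurable_wdual i) (ae_dual i)).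
by congr avg; apply/funext => x; rewrite dual_powE.
Qed.

Hypothesis hA : (Avec_const mu BB q w < +oo)%E.

Let pos B (v : S -> R) : BB B -> measurable_fun setT v -> (forall x, 0 < v x) ->
  (0 < (vol B)^-1%:E * \int[mu]_(x in B) (v x)%:E)%E.
Proof.
move=> bB mv v0; apply: mule_gt0; first by rewrite lte_fin invr_gt0 (vol_gt0 hBB).
apply: positive_integral_gt0 => //; first exact: (ball_measurable hBB).
by have /andP[] := ball_measure hBB bB.
Qed.

Let fin B (v : S -> R) : BB B -> ((vol B)^-1%:E * \int[mu]_(x in B) (v x)%:E < +oo)%E ->
  (forall x, 0 < v x) -> measurable_fun setT v -> (\int[mu]_(x in B) (v x)%:E < +oo)%E.
Proof.
move=> bB lt v0 mv; have vB := vol_gt0 hBB bB.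
have [] // := mule_lty_pos _ _ lt; first by rewrite lte_fin invr_gt0.
apply: positive_integral_gt0 => //; first exact: (ball_measurable hBB).
by have /andP[] := ball_measure hBB bB.
Qed.

Let rP0 : 0 < r / P. Proof. by rewrite divr_gt0// hexp_gt0. Qed.

Let finite_means B : BB B -> (Xt B < +oo)%E /\ forall i, (Xd i B < +oo)%E.
Proof.
move=> bB; have t0 : (0 < Xt B)%E by apply: pos => //; [exact: measurable_wtarget|exact: wtarget_gt0].
have d0 i : (0 < Xd i B)%E by apply: pos => //; [exact: measurable_wdual|exact: wdual_gt0].
have lt := le_lt_trans (value_le bB) hA.
have [||h1 h2] := mule_lty_pos _ _ lt.
- exact: poweR_gt0.
- elim: (index_enum _) => [|i s IH]; first by rewrite big_nil.
  by rewrite big_cons mule_gt0// poweR_gt0.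
split; first exact: (poweR_lty_inv rP0).
move=> i; apply: (poweR_lty_inv (gap_gt0 i)).
by apply: (prode_lty_pos (fun j => poweR_gt0 _ (d0 j)) h2); rewrite mem_index_enum.
Qed.

(** The product of the means over a ball is finite and none of them is zero, so each is
    finite. *)
Lemma pos_wtarget : pos_weight wtarget.
Proof.
split; [exact: measurable_wtarget|exact: wtarget_gt0|move=> B bB].
by have [h _] := finite_means bB; apply: (fin bB h); [exact: wtarget_gt0|exact: measurable_wtarget].
Qed.

Lemma pos_wdual i : pos_weight (wdual i).
Proof.
split; [exact: measurable_wdual|exact: wdual_gt0|move=> B bB].
by have [_ h] := finite_means bB; apply: (fin bB (h i)); [exact: wdual_gt0|exact: measurable_wdual].
Qed.

Lemma mean_tuple_le B : BB B -> ((mean wtarget B `^ (r / P) *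
  \prod_i mean (wdual i) B `^ (1 - r / p i))%:E <= Avec_const mu BB q w)%E.
Proof.
move=> bB; have := value_le bB.
have mE v : pos_weight v -> ((vol B)^-1%:E * \int[mu]_(x in B) (v x)%:E)%E = (mean v B)%:E.
  by move=> wv; rewrite (mass_ballE hBB wv bB) -EFinM mulrC.
rewrite /Xt /Xd mE ?poweR_EFin; last exact: pos_wtarget.
rewrite (eq_bigr (fun i => (mean (wdual i) B `^ (1 - r / p i))%:E)).
  by rewrite prodEFin -EFinM.
by move=> i _; rewrite mE ?poweR_EFin//; exact: pos_wdual.
Qed.

Lemma weight_dual x : wtarget x `^ (r / P) * \prod_i wdual i x `^ (1 - r / p i) = 1.
Proof.
have P0 := hexp_gt0.
rewrite /wtarget powR_prod; last by move=> i; exact: powR_ge0.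
rewrite -big_split/= big1// => i _; have u0 := wrep_gt0 i x.
rewrite /wdual -!powRrM -powRD ?(gt_eqF u0) ?implybT//.
rewrite (_ : _ + _ = 0) ?powRr0//.
have h : r - p i != 0 by rewrite lt_eqF// subr_lt0.
by field; rewrite h !gt_eqF.
Qed.

End vector_weights.

(** * Operators of bounded oscillation *)

Section realization.
Context {R : realType} {d : measure_display} {S : measurableType d}.
Variable mu : {measure set S -> \bar R}.
Context {m : nat}.
Variable r : R.
Hypothesis r1 : 1 <= r.
Local Notation tuples := ('I_m -> S -> R).

Let r0 : 0 < r. Proof. exact: lt_le_trans ltr01 r1. Qed.

Lemma multilinear_normsub (V : normedModType R) (T : tuples -> S -> V) :
  multilinear mu r T -> normsub mu r T.
Proof.
move=> linT f i Lf; have [scal add] := linT f i Lf; split.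
- by move=> a x; rewrite scal normrZ.
- by move=> g Lg x; rewrite add// ler_normD.
Qed.

(** Both alternatives in the definition of bounded oscillation provide an operator with
    values in some normed space that has the same norm at each point. *)
Lemma oscillation_realization (BB : set (set S)) (star : set S -> set S)
    (V : completeNormedModType R) (T : tuples -> S -> R) (C1 C2 : R) :
  bounded_oscillation mu BB star r V T C1 C2 ->
  exists (V' : normedModType R) (T' : tuples -> S -> V'),
    [/\ normsub mu r T', forall f, LrT mu r f -> forall x, `|T f x| = `|T' f x|,
      oscT1 mu BB star r T' C1 & oscT2 mu BB star r T' C2].
Proof.
case=> _ _ [[T' [linT TT' o1 o2]]|[_ linT o1 o2]].
  exists V, T'; split=> //; first exact: multilinear_normsub.
  by move=> f Lf x; rewrite TT'// normr_id.
exists (R^o : normedModType R), T; split=> //.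
by case: linT => // linT; exact: (@multilinear_normsub R^o).
Qed.

Variables (T : tuples -> S -> R) (V' : normedModType R) (T' : tuples -> S -> V').
Hypothesis wT : weak_bounded mu r T.
Hypothesis TT' : forall f, LrT mu r f -> forall x, `|T f x| = `|T' f x|.

Lemma realization_measurable f : LrT mu r f -> measurable_fun setT (fun x => `|T' f x|).
Proof.
move=> Lf; have [mT _] := wT; rewrite (_ : (fun x => _) = fun x => `|T f x|).
  exact: (measurableT_comp (@normr_measurable R setT)) (mT f Lf).
by apply/funext => x; rewrite TT'.
Qed.

(** The constant [C] is added because the sparse domination needs a positive bound. *)
Lemma realization_weak C f a : 0 <= C -> LrT mu r f -> 0 < a ->
  (a%:E * mu [set x | a < `|T' f x|]%R `^ (r / m%:R)^-1 <=
     ((fine (weak_opnorm mu r T) + C) * \prod_i nrm mu r (f i))%:E)%E.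
Proof.
move=> C_ge0 Lf a0; have [_ Ny] := wT.
have nE : (\prod_(i < m) 'N[mu]_(r%:E)[EFin \o f i] = (\prod_i nrm mu r (f i))%:E)%E.
  by rewrite -prodEFin; apply: eq_bigr => i _; rewrite nrmK.
have n0 : 0 <= \prod_i nrm mu r (f i) by apply: prodr_ge0 => i _; exact: nrm_ge0.
have := opnorm_attained Lf _ Ny; rewrite nE => /(_ _)/le_trans H.
apply: (@le_trans _ _ (weakLnorm mu (r / m%:R) (T f))).
  apply: ereal_sup_ubound; exists a => //; congr (_ * mu _ `^ _)%E.
  by apply/seteqP; split=> x /=; rewrite TT'.
apply: H; first by rewrite lee_fin n0 ltry.
by rewrite -EFinM lee_fin ler_wpM2r// lerDl.
Qed.

(** The weak type bound of such a tuple is zero. *)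
Lemma null_entry (Wk : R) f i0 :
  (forall f a, LrT mu r f -> 0 < a ->
    (a%:E * mu [set x | a < `|T' f x|]%R `^ (r / m%:R)^-1 <= (Wk * \prod_i nrm mu r (f i))%:E)%E) ->
  LrT mu r f -> {ae mu, forall x, f i0 x = 0} -> {ae mu, forall x, T' f x = 0}.
Proof.
move=> wk Lf f0; have m0 : (0 < m)%N := leq_ltn_trans (leq0n i0) (ltn_ord i0).
have n0 : nrm mu r (f i0) = 0.
  apply/eqP; have := nrmX r1 (Lf i0); rewrite (_ : (\int[mu]_x _ = 0)%E).
    by move=> [] /esym/eqP; rewrite powR_eq0 => /andP[].
  have [mf _] := (LfunE mu r (f i0)).1 (Lf i0).
  rewrite (ae_eq_integral (cst 0%E))//; first by rewrite integral0.
  - apply/measurable_EFinP; apply: (measurableT_comp (measurable_powR _)).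
    exact: (measurableT_comp (@normr_measurable R setT)).
  - by move: f0; apply: filterS => x /= -> _; rewrite normr0 powR0// gt_eqF.
have small n : {ae mu, forall x, `|T' f x| <= n.+1%:R^-1}.
  have a0 : 0 < n.+1%:R^-1 :> R by rewrite invr_gt0.
  have := wk f _ Lf a0; rewrite (bigD1 i0)//= n0 mul0r mulr0 => le.
  set Z := [set x | _] in le; have mZ : measurable Z.
    rewrite -[Z]setTI (_ : Z = (fun x => `|T' f x|) @^-1` `]n.+1%:R^-1, +oo[%classic).
      by apply: realization_measurable.
    by apply/seteqP; split=> x /=; rewrite in_itv/= andbT.
  have Z0 : mu Z = 0%E.
    apply/eqP; rewrite eq_le measure_ge0 andbT leNgt; apply/negP => Z0.
    have := mule_gt0 (_ : (0 < (n.+1%:R^-1)%:E)%E) (poweR_gt0 (r / m%:R)^-1 Z0).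
    by rewrite lte_fin => /(_ a0); rewrite ltNge le.
  exists Z; split=> // x /= /negP; rewrite -ltNge; exact.
have : {ae mu, forall x, forall n, `|T' f x| <= n.+1%:R^-1} by exact/ae_foralln.
apply: filterS => x hx; apply/normr0_eq0/eqP; rewrite eq_le normr_ge0 andbT.
apply/ler_addgt0Pr => e e0; rewrite add0r; have := hx (Num.truncn e^-1).
move/le_trans; apply; rewrite invf_ple ?posrE ?ltr0n//.
exact/ltW/truncnS_gt.
Qed.

End realization.

(** * Symbols of bounded oscillation *)

Section oscillation_constants.
Context {R : realType} {d : measure_display} {S : measurableType d}.
Variable mu : {measure set S -> \bar R}.
Variables (BB : set (set S)) (star : set S -> set S) (C0 : R).
Hypothesis hBB : ball_basis mu BB star C0.
Local Notation vol := (vol mu).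
Variable b : S -> R.
Hypothesis mb : measurable_fun setT b.

Definition ball_mean Q : R := fine (avg mu Q (EFin \o b)).

Let mdev Q : measurable_fun setT (fun x => `|b x - ball_mean Q|).
Proof.
apply: (measurableT_comp (@normr_measurable R setT)).
exact: measurable_funB.
Qed.

Let mexp Q l : measurable_fun setT (fun x => expR (`|b x - ball_mean Q| / l)).
Proof. by apply: measurableT_comp => //; exact: measurable_funM. Qed.

Lemma osc_witness Q e : BB Q -> (osc_expL mu BB b < e%:E)%E -> exists l, [/\ 0 < l, l < e &
  (\int[mu]_(x in Q) (expR (`|b x - ball_mean Q| / l) - 1)%:E <= (vol Q)%:E)%E].
Proof.
move=> bQ lt; have vQ := vol_gt0 hBB bQ.
have h : (expL_norm mu Q (fun x => b x - ball_mean Q)%R < e%:E)%E.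
  by apply: le_lt_trans lt; apply: ereal_sup_ubound; exists Q.
have [_ [l [l0 hl] <-]] := ereal_inf_lt h; rewrite lte_fin => le'.
exists l; split=> //; move: hl; rewrite /avg (volE hBB bQ) inver gt_eqF//.
move=> /(lee_wpmul2l (_ : (0 <= (vol Q)%:E)%E)); rewrite lee_fin (ltW vQ) => /(_ isT).
by rewrite muleA -EFinM divff ?gt_eqF// mul1e mule1.
Qed.

(** The infimum that defines the norm need not be attained, hence the factor two. *)
Lemma osc_exponential Q : BB Q -> (0 < osc_expL mu BB b < +oo)%E ->
  (\int[mu]_(x in Q) (expR (`|b x - ball_mean Q| / (2 * fine (osc_expL mu BB b))))%:E <=
    (2 * vol Q)%:E)%E.
Proof.
move=> bQ /andP[b0 bfin]; have mQ := ball_measurable hBB bQ.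
have fo : osc_expL mu BB b \is a fin_num by rewrite ge0_fin_numE// ltW.
have f0 : 0 < fine (osc_expL mu BB b) by rewrite fine_gt0// b0.
have [|l [l0 ll hl]] := osc_witness (e := 2 * fine (osc_expL mu BB b)) bQ.
  by rewrite -{1}(fineK fo) lte_fin; lra.
set lam := 2 * _ in ll *; have lam0 : 0 < lam by rewrite mulr_gt0.
apply: (@le_trans _ _ (\int[mu]_(x in Q) (1 + (expR (`|b x - ball_mean Q| / l) - 1)%:E))%E).
  apply: ge0_le_integral => //.
  - by apply/measurable_EFinP; exact: measurable_funTS.
  - apply: emeasurable_funD => //; apply/measurable_EFinP; apply: measurable_funTS.
    exact: measurable_funB.
  - move=> x _; rewrite -EFinD lee_fin addrCA subrr addr0 ler_expR ler_wpM2l//.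
    by rewrite lef_pV2 ?posrE// ltW.
rewrite ge0_integralD//; last 2 first.
- move=> x _; rewrite lee_fin subr_ge0; apply: le_trans (expR_ge1Dx _).
  by rewrite lerDl divr_ge0// ltW.
- by apply/measurable_EFinP; apply: measurable_funTS; exact: measurable_funB.
rewrite integral_cst// mul1e (volE hBB bQ) mulr2n mulrDl !mul1r EFinD leeD2l//.
Qed.

Let zero_osc Q : BB Q -> (osc_expL mu BB b <= 0)%E ->
  {ae mu, forall x, Q x -> b x = ball_mean Q}.
Proof.
move=> bQ o0; have mQ := ball_measurable hBB bQ; have vQ := vol_gt0 hBB bQ.
have small e : 0 < e -> (\int[mu]_(x in Q) `|(b x - ball_mean Q)%:E| <= e%:E)%E.
  move=> e0; have [|l [l0 le hl]] := osc_witness (e := e / vol Q) bQ.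
    by apply: (le_lt_trans o0); rewrite lte_fin divr_gt0.
  apply: (@le_trans _ _ (\int[mu]_(x in Q) (l * (expR (`|b x - ball_mean Q| / l) - 1))%:E)%E).
    apply: ge0_le_integral => //.
    - apply: measurable_funTS; apply: measurableT_comp => //; apply/measurable_EFinP.
      exact: measurable_funB.
    - apply/measurable_EFinP; apply: measurable_funTS; apply: measurable_funM => //.
      exact: measurable_funB.
    - move=> x _; rewrite abse_EFin lee_fin mulrC -ler_pdivrMr// lerBrDl.
      exact: expR_ge1Dx.
  have m1 : measurable_fun setT (fun x => expR (`|b x - ball_mean Q| / l) - 1).
    exact: measurable_funB.
  have p1 x : 0 <= expR (`|b x - ball_mean Q| / l) - 1.
    rewrite subr_ge0; apply: le_trans (expR_ge1Dx _).
    by rewrite lerDl divr_ge0// ltW.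
  apply: (le_trans (integral_scale_le mQ m1 p1 (ltW l0) hl)).
  by rewrite lee_fin -ler_pdivlMr// ltW.
have z : (\int[mu]_(x in Q) `|(b x - ball_mean Q)%:E| = 0)%E.
  apply/eqP; rewrite eq_le integral_ge0// andbT.
  by apply/lee_addgt0Pr => e e0; rewrite add0e; exact: small.
have mbQ : measurable_fun Q (fun x => (b x - ball_mean Q)%:E).
  by apply: measurable_funTS; apply/measurable_EFinP; exact: measurable_funB.
have := (ae_eq_integral_abs mu mQ mbQ).1 z.
apply: filterS => x hx Qx; have [/eqP] := hx Qx.
by rewrite subr_eq0 => /eqP.
Qed.

(** On each ball the function equals its mean; the means of two balls agree because some
    ball contains both. *)
Lemma osc_zero_constant B0 : BB B0 -> (osc_expL mu BB b <= 0)%E ->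
  exists c, {ae mu, forall x, b x = c}.
Proof.
move=> bB0 o0.
have mono A Z : BB A -> BB Z -> A `<=` Z -> ball_mean A = ball_mean Z.
  move=> bA bZ AZ; have := filterI (zero_osc bA o0) (zero_osc bZ o0).
  move=> [N [mN N0 hN]]; apply/eqP; apply/negPn/negP => ne.
  suff : (mu A <= 0)%E by rewrite leNgt; have /andP[->] := ball_measure hBB bA.
  rewrite -N0; apply: le_measure; rewrite ?inE//; first exact: (ball_measurable hBB).
  move=> x Ax; apply: hN => /= -[h1 h2].
  by move/eqP: ne; apply; rewrite -(h1 Ax) -(h2 (AZ x Ax)).
have cE Q : BB Q -> ball_mean Q = ball_mean B0.
  move=> bQ; have [Z [bZ QZ BZ]] := common_ball hBB bQ bB0.
  by rewrite (mono Q Z)// (mono B0 Z).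
exists (ball_mean B0); have [x0 _] := ball_neq0 hBB bB0.
have [[B [bB sT]]|[B [bB cov]]] := exhausting_balls hBB x0.
  have bs := star_ball hBB bB; have := zero_osc bs o0; apply: filterS => x.
  by rewrite cE// sT; exact.
have : {ae mu, forall x, forall n, star (B n) x -> b x = ball_mean B0}.
  apply/ae_foralln => n; have [bn _] := bB n.
  by rewrite -(cE _ (star_ball hBB bn)); exact: zero_osc (star_ball hBB bn) o0.
by apply: filterS => x hx; have [N hN] := cov x; exact: (hx N (hN N (leqnn N))).
Qed.

End oscillation_constants.

(** * The norm of a commutator *)

(** The constant of the moment bound for the order [b * s], after taking the root of
    order [s]. *)
Definition moment_const {R : realType} (Kc rt b s : R) : R :=
  (16 * Kc) `^ s^-1 * (2 * (b * s) / rt) `^ b.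

Lemma powR_moment {R : realType} (X Y Z b s : R) : 0 <= X -> 0 <= Y -> 0 <= Z -> 0 < s ->
  (X `^ s^-1 * Y `^ b * Z `^ b) `^ s = X * Y `^ (b * s) * Z `^ (b * s).
Proof.
move=> X0 Y0 Z0 s0.
rewrite (powRM s (mulr_ge0 (powR_ge0 _ _) (powR_ge0 _ _)) (powR_ge0 _ _)).
rewrite (powRM s (powR_ge0 _ _) (powR_ge0 _ _)) -!powRrM mulVf ?gt_eqF// powRr1//.
Qed.

Section commutator_norm.
Context {R : realType} {d : measure_display} {S : measurableType d}.
Variable mu : {measure set S -> \bar R}.
Variables (BB : set (set S)) (star : set S -> set S) (C0 : R).
Hypothesis hBB : ball_basis mu BB star C0.
Local Notation vol := (vol mu).
Local Notation mass := (mass mu).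
Local Notation mean := (mean mu).
Local Notation pos_weight := (pos_weight mu BB).
Context {m : nat}.
Local Notation tuples := ('I_m -> S -> R).
Hypothesis m0 : (0 < m)%N.
Variables (r : R) (p : 'I_m -> R).
Hypothesis (r1 : 1 <= r) (rp : forall i, r < p i).
Let P : R := hexp p.
Let q i : R := p i / r.

(** The sparse bound has the power [1 / r + k] of the constant of the vector weight,
    which is this maximum for the following [k]. *)
Definition max_exp : R := \big[Num.max/hexp p]_(i < m) conj_exp (p i / r).
Let mx := max_exp.
Let k := mx - r^-1.

Let r0 : 0 < r. Proof. exact: lt_le_trans ltr01 r1. Qed.
Let p0 i : 0 < p i. Proof. exact: lt_trans (rp i). Qed.
Let P0 : 0 < P. Proof. exact: (hexp_gt0 m0 r1 rp). Qed.
Let hP : P^-1 = \sum_i (p i)^-1. Proof. exact: hexp_inv. Qed.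
Let gap0 i : 0 < 1 - r / p i. Proof. exact: gap_gt0. Qed.

Lemma hexp_le_max : P <= mx. Proof. exact: bigmax_ge_id. Qed.

Lemma conj_le_max i : (1 - r / p i)^-1 <= mx.
Proof.
rewrite -(conj_exp_inv r1 rp) invrK; exact: (le_bigmax _ (fun i => conj_exp (p i / r))).
Qed.

Lemma max_exp_ge1 : 1 <= mx.
Proof.
have g := gap0 (Ordinal m0); apply: le_trans (conj_le_max (Ordinal m0)).
by rewrite invf_ge1// gerBl; apply: divr_ge0; exact: ltW.
Qed.

Let rV1 : r^-1 <= 1. Proof. by rewrite invf_le1. Qed.

Lemma sparse_exp_ge0 : 0 <= k.
Proof. by rewrite subr_ge0; apply: le_trans rV1 max_exp_ge1. Qed.

Lemma sparse_exp_entry i : (p i)^-1 <= k * (1 - r / p i).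
Proof.
have g0 := gap0 i; have h : 1 <= mx * (1 - r / p i).
  by rewrite -ler_pdivrMr// div1r; exact: conj_le_max.
have e : r^-1 * (1 - r / p i) = r^-1 - (p i)^-1 by field; rewrite !gt_eqF.
by rewrite /k mulrBl e; move: rV1; lra.
Qed.

Lemma sparse_exp_target : 1 - P^-1 <= k * (r / P).
Proof.
have -> : k * (r / P) = mx / P * r - P^-1 by rewrite /k; field; rewrite !gt_eqF.
rewrite lerD2r; apply: (@le_trans _ _ (mx / P)); first by rewrite ler_pdivlMr// mul1r hexp_le_max.
by rewrite ler_peMr// divr_ge0 ?(ltW P0)// (le_trans ler01)// max_exp_ge1.
Qed.

Variables (w : 'I_m -> S -> \bar R).
Hypothesis hw : Avec mu BB (fun i => p i / r) w.
Variable B1 : set S.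
Hypothesis bB1 : BB B1.

Let ww i : weight mu (w i). Proof. by case: hw. Qed.
Let Afin : (Avec_const mu BB q w < +oo)%E. Proof. by case: hw. Qed.
Let wt := wtarget p w.
Let wd := wdual r p w.
Let pwt : pos_weight wt. Proof. exact: (pos_wtarget hBB m0 r1 rp ww Afin). Qed.
Let pwd i : pos_weight (wd i). Proof. exact: (pos_wdual hBB m0 r1 rp ww Afin). Qed.
Let dual x : wt x `^ (r / P) * \prod_i wd i x `^ (1 - r / p i) = 1.
Proof. exact: weight_dual. Qed.

Definition Aconst : R := fine (Avec_const mu BB q w).
Let A := Aconst.

Lemma AconstE : Avec_const mu BB q w = A%:E.
Proof.
rewrite /A /Aconst fineK// fin_numElt Afin andbT.
by apply: lt_le_trans (mean_tuple_le hBB m0 r1 rp ww Afin bB1); rewrite ltNyr.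
Qed.

Let hA B : BB B -> mean wt B `^ (r / P) * \prod_i mean (wd i) B `^ (1 - r / p i) <= A.
Proof.
by move=> bB; rewrite -lee_fin -AconstE; exact: (mean_tuple_le hBB m0 r1 rp ww Afin bB).
Qed.

Lemma Aconst_ge1 : 1 <= A.
Proof. exact: (A_ge1 hBB r1 m0 rp hP pwt pwd dual hA bB1). Qed.

Let phi := dual_fun wt wd.
Let kap := dual_exp r P p.

Lemma dual_exp_inv_le j : (kap j)^-1 <= mx.
Proof.
case: j => [i|]; first exact: conj_le_max.
rewrite /kap /= invf_div; apply: le_trans hexp_le_max.
by rewrite ler_pdivrMr// ler_peMr// ltW.
Qed.

(** The exponent [kap j] of a weight in the dual tuple is at least the inverse of the
    maximum. *)
Lemma tuple_A_bound j : exists2 t : R, 1 < t & A_bound mu BB (phi j) t (A `^ mx).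
Proof.
have [j' jj'] : exists j' : option 'I_m, j' != j.
  by case: j => [i|]; [exists None|exists (Some (Ordinal m0))].
have k0 := dual_exp_gt0 r1 m0 rp hP.
have [wq hq] := dual_A_bound hBB (dual_fun_pos pwt pwd) k0 (dual_funE dual)
  (fun B bB => dual_meanE hA bB) jj'.
exists (1 + (\sum_(l | l != j) kap l) / kap j).
  rewrite ltrDl; apply: divr_gt0; last exact: k0.
  rewrite (bigD1 j')//=; apply: ltr_wpDr; last exact: k0.
  by apply: sumr_ge0 => l _; exact/ltW/k0.
split=> // B bB; apply: (le_trans (hq B bB)).
by apply: ler_powR; [exact: Aconst_ge1|exact: dual_exp_inv_le].
Qed.

Lemma tuple_moments l0 c0 Kc j : 1 <= l0 -> 0 < c0 -> Kc = C0 ^+ 4 * l0 ->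
  (forall B, BB B -> star B <> setT ->
    exists B', [/\ BB B', B' `&` B !=set0, ~ B' `<=` star B & vol B' <= l0 * vol B]) ->
  (forall v, Ainfty mu BB v ->
    (RH_const mu BB v (1 + c0 * (fine (Ainfty_const mu BB v))^-1) < +oo)%E) ->
  moments mu BB star (moment_const Kc (rate c0 Kc)) (A `^ mx) (phi j).
Proof.
move=> l01 c00 KcE reg RH Q t b s bQ mt t0 b0 s0 ht.
have [e e1 hM] := tuple_A_bound j.
have M1 : 1 <= A `^ mx.
  by rewrite -[leLHS](congr1 (@^~ mx) (powR1 R)) ge0_ler_powR ?nnegrE
    ?(le_trans ler01 Aconst_ge1) ?(le_trans ler01 max_exp_ge1) ?Aconst_ge1.
have rt0 := rate_gt0 hBB l01 c00 KcE.
have Kc0 : 0 < Kc by rewrite KcE mulr_gt0 ?(C0X_gt0 hBB)// (lt_le_trans ltr01).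
have := moment_bound hBB l01 c00 KcE reg RH e1 (dual_fun_pos pwt pwd j) M1 hM bQ mt t0
  (mulr_gt0 b0 s0) ht.
under eq_integral do rewrite powRrM.
move=> le; apply: (le_trans le).
rewrite /moment_const -/(phi j).
by rewrite powR_moment ?mulr_ge0 ?powR_ge0 ?invr_ge0 ?(ltW Kc0) ?(ltW b0) ?(ltW s0) ?(ltW rt0).
Qed.

Lemma entry_norm_ge1 i a : 0 < a -> (1 <= wmaximal_norm mu BB (sigma r p w i) a)%E.
Proof.
move=> a0; apply: (wmaximal_norm_ge1 hBB a0 (pwd i) _ _ bB1).
- exact: measurable_dual.
- exact: ae_dual.
Qed.

Lemma target_norm_ge1 a : 0 < a -> (1 <= wmaximal_norm mu BB (prod_weight p w) a)%E.
Proof.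
move=> a0; apply: (wmaximal_norm_ge1 hBB a0 pwt _ _ bB1).
- exact: (measurable_target p ww).
- exact: ae_target.
Qed.

Variables (T : tuples -> S -> R) (V : normedModType R) (T' : tuples -> S -> V) (C1 C2 Wk : R).
Hypothesis (C1_ge0 : 0 <= C1) (C2_ge0 : 0 <= C2) (Wk0 : 0 < Wk).
Hypothesis subT : normsub mu r T'.
Hypothesis TT' : forall f, LrT mu r f -> forall x, `|T f x| = `|T' f x|.
Hypothesis mesT : forall f, LrT mu r f -> measurable_fun setT (fun x => `|T' f x|).
Hypothesis wkT : forall f (a : R), LrT mu r f -> 0 < a ->
  (a%:E * mu [set x | a < `|T' f x|]%R `^ (r / m%:R)^-1 <= (Wk * \prod_i nrm mu r (f i))%:E)%E.
Hypothesis T1 : oscT1 mu BB star r T' C1.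
Hypothesis T2 : oscT2 mu BB star r T' C2.

Variables (tau : {set 'I_m}) (sj : 'I_m -> R) (s : R) (mc : R -> R -> R) (Km : R).
Hypothesis (sj1 : forall i, 1 <= sj i <= p i / r).
Hypothesis (s1 : 1 < P -> 1 <= s < conj_exp P).
Hypothesis (tau_sj : forall i, i \in tau -> 1 < sj i) (tau_s : forall i, i \in tau -> 1 < P -> 1 < s).
Hypothesis mc0 : forall a b, 0 <= mc a b.
Hypothesis Km1 : 1 <= Km.
Hypothesis mom : forall i j, i \in tau -> moments mu BB star mc (A `^ mx) (phi j).
Hypothesis hKm : forall i, i \in tau -> mc r (conj_exp (sj i)) `^ r^-1 <= Km.
Let N := #|tau|.

Variables (b : tuples) (alpha : 'I_m -> nat).
Hypothesis mb : forall i, measurable_fun setT (b i).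
Hypothesis alphaE : forall i, alpha i = (i \in tau).
Hypothesis osc_pos : forall i, i \in tau -> (0 < osc_expL mu BB (b i) < +oo)%E.

(** With all exponents [s] and [sj i] equal to one this is the quantity [N1]; the
    commutators require exponents larger than one for the entries with a symbol. *)
Definition maximal_factors : \bar R :=
  ((\prod_(i < m) wmaximal_norm mu BB (sigma r p w i) (p i / (r * sj i)) `^ (r * sj i)^-1) *
  (if (1 < hexp p)%R then wmaximal_norm mu BB (prod_weight p w) (conj_exp (hexp p) / s) `^ s^-1
   else 1))%E.

(** The summand one makes the constant positive. *)
Definition space_const : R :=
  @local_const R C0 m r * (C0 ^+ m * 2 ^+ N * 2 ^+ N) * (sparse_const C0 r P k p tau s mc * Km ^+ N) + 1.

Definition osc_product : R := \prod_(i in tau) fine (osc_expL mu BB (b i)).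

Let sj0 i : 0 < sj i. Proof. by apply: lt_le_trans ltr01 _; case/andP: (sj1 i). Qed.
Let s0 : 1 < P -> 0 < s.
Proof. by move=> P1; have /andP[h _] := s1 P1; exact: lt_le_trans ltr01 h. Qed.
Let mwe : measurable_fun setT (prod_weight p w). Proof. exact: (measurable_target p ww). Qed.
Let lam i : R := if i \in tau then 2 * fine (osc_expL mu BB (b i)) else 1.
Let lam0 i : 0 < lam i.
Proof.
rewrite /lam; case: ifPn => // /osc_pos /andP[b0 bfin].
by rewrite mulr_gt0// fine_gt0// b0.
Qed.

Let cs0 : 1 < P -> 0 < conj_exp P.
Proof. by move=> P1; rewrite divr_gt0// subr_gt0. Qed.

Let factor_gt0 i :
  (0 < wmaximal_norm mu BB (sigma r p w i) (p i / (r * sj i)) `^ (r * sj i)^-1)%E.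
Proof.
apply: poweR_gt0; apply: lt_le_trans (entry_norm_ge1 i _); first by rewrite lte_fin.
by rewrite divr_gt0// mulr_gt0.
Qed.

Let target_gt0 : (0 < if (1 < hexp p)%R then
  wmaximal_norm mu BB (prod_weight p w) (conj_exp (hexp p) / s) `^ s^-1 else 1)%E.
Proof.
case: ifP => [P1|_]; last by rewrite lte_fin.
apply: poweR_gt0; apply: lt_le_trans (target_norm_ge1 _); first by rewrite lte_fin.
by rewrite divr_gt0 ?cs0 ?s0.
Qed.

Let factors_gt0 : (0 < \prod_(i < m)
  wmaximal_norm mu BB (sigma r p w i) (p i / (r * sj i)) `^ (r * sj i)^-1)%E.
Proof.
elim: (index_enum _) => [|i l IH]; first by rewrite big_nil.
by rewrite big_cons mule_gt0.
Qed.

Lemma maximal_factors_gt0 : (0 < maximal_factors)%E.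
Proof. exact: mule_gt0 factors_gt0 target_gt0. Qed.

Let comm_argE f x : comm_arg b alpha f x =
  arg (fun x i => b i x) (slope tau f) (offset tau f b) x.
Proof.
apply/funext => i; apply/funext => y; rewrite /comm_arg /arg /slope /offset alphaE.
by case: (i \in tau) => /=; rewrite ?expr1 ?expr0 ?mul1r ?mulr0 ?add0r//; ring.
Qed.

(** The weighted bound is applied to [h i], the quotient of [|f i| ^ r] and the dual
    weight, and to the deviations of the symbols from their means, divided by twice the
    oscillation norm. *)
Lemma commutator_bound f : (maximal_factors < +oo)%E ->
  (forall i, wL mu (w i) (p i) (f i)) -> LrT mu r (slope tau f) -> LrT mu r (offset tau f b) ->
  (wLnorm mu (prod_weight p w) (hexp p) (EFin \o commutator T b alpha f) <=
    (space_const * (C1 + C2 + Wk) * osc_product * A `^ (N.+1%:R * mx))%:E * maximal_factors *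
    \prod_(i < m) wLnorm mu (w i) (p i) (EFin \o f i))%E.
Proof.
move=> Yfin wf Lslope Loffset.
have [prod_fin tgt_fin] := mule_lty_pos factors_gt0 target_gt0 Yfin.
have finN i : (entry_norm mu BB r p sj (sigma r p w) i < +oo)%E.
  refine (poweR_lty_inv (_ : 0 < (r * sj i)^-1) _); first by rewrite invr_gt0 mulr_gt0.
  by apply: (prode_lty_pos factor_gt0 prod_fin); rewrite mem_index_enum.
have finW : 1 < P -> (target_norm mu BB P s (prod_weight p w) < +oo)%E.
  move=> P1; refine (poweR_lty_inv (_ : 0 < s^-1) _); first by rewrite invr_gt0 s0.
  by move: tgt_fin; rewrite P1.
have mf i : measurable_fun setT (f i) by case: (wf i).
have wd0 i x : 0 < wd i x by exact: wdual_gt0.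
have u0 i x : 0 < wrep w i x by exact: wrep_gt0.
(* The norm of [h i] in [L^(p i / r)] of the dual weight is that of [f i] in the space
   of the original weight. *)
pose h i x := `|f i x| `^ r * wd i x `^ (-1).
have mh i : measurable_fun setT (h i).
  apply: measurable_funM.
    apply: (measurableT_comp (measurable_powR _)).
    exact: (measurableT_comp (@normr_measurable R setT)).
  by apply: (measurableT_comp (measurable_powR _)); case: (pwd i).
have h0 i x : 0 <= h i x by rewrite mulr_ge0 ?powR_ge0.
have fh i x : `|f i x| `^ r = h i x * wd i x.
  by rewrite /h -mulrA powR_inv1 ?(ltW (wd0 _ _))// mulVf ?mulr1// gt_eqF.
have hp i x : h i x `^ (p i / r) * wd i x = `|f i x| `^ p i * wrep w i x.
  rewrite /h powRM ?powR_ge0// -powRrM mulrC [r * _]mulrC divfK ?gt_eqF// mulrCA; congr (_ * _).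
  rewrite /wd /wdual -!powRrM -powRD ?(gt_eqF (u0 _ _)) ?implybT//.
  rewrite -[RHS]powRr1 ?(ltW (u0 _ _))//; congr (_ `^ _).
  have h1 : r - p i != 0 by rewrite lt_eqF// subr_lt0.
  by field; rewrite h1 gt_eqF.
pose J i := (\int[mu]_x (h i x `^ (p i / r) * wd i x)%:E)%E.
have J0 i : (0 <= J i)%E.
  by apply: integral_ge0 => x _; rewrite lee_fin mulr_ge0 ?powR_ge0// ltW.
have wJ i : wLnorm mu (w i) (p i) (EFin \o f i) = (J i `^ (p i)^-1)%E.
  rewrite /wLnorm /J; congr (_ `^ _)%E; apply: ae_eq_integral => //.
  - apply: emeasurable_funM; last by case: (ww i).
    apply: (measurableT_comp (measurable_poweR _)); apply: measurableT_comp => //.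
    exact/measurable_EFinP.
  - apply/measurable_EFinP; apply: measurable_funM; last by case: (pwd i).
    exact: (measurableT_comp (measurable_powR _)).
  - have := ae_wrep ww; apply: filterS => x hx _.
    by rewrite hp hx abse_EFin poweR_EFin -EFinM.
have Jfin i : (J i < +oo)%E.
  refine (poweR_lty_inv (_ : 0 < (p i)^-1) _); first by rewrite invr_gt0.
  by rewrite -wJ; case: (wf i).
pose G i := fine (wLnorm mu (w i) (p i) (EFin \o f i)).
have G0 i : 0 <= G i by rewrite fine_ge0// wJ poweR_ge0.
have JE i : J i = (fine (J i))%:E by rewrite fineK// ge0_fin_numE.
have GE i : wLnorm mu (w i) (p i) (EFin \o f i) = (G i)%:E.
  by rewrite /G wJ JE poweR_EFin.
have GJ i : J i = (G i `^ p i)%:E.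
  rewrite /G wJ JE poweR_EFin /= -powRrM mulVf ?gt_eqF// powRr1//.
  exact: fine_ge0.
have hG i : (\int[mu]_x (h i x `^ (p i / r) * wd i x)%:E <= (G i `^ p i)%:E)%E.
  by rewrite -GJ.
pose t Q i x := `|b i x - ball_mean mu (b i) Q| / lam i.
have mt Q i : measurable_fun setT (t Q i).
  apply: measurable_funM => //; apply: (measurableT_comp (@normr_measurable R setT)).
  exact: measurable_funB.
have t0 Q i x : 0 <= t Q i x by rewrite divr_ge0// ltW.
have t_exp Q i : BB Q -> i \in tau ->
    (\int[mu]_(x in Q) (expR (t Q i x))%:E <= (2 * vol Q)%:E)%E.
  by move=> bQ it; rewrite /t /lam it; exact: (osc_exponential hBB (mb i) bQ (osc_pos it)).
have bt Q i x : i \in tau -> `|b i x - ball_mean mu (b i) Q| = lam i * t Q i x.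
  by move=> _; rewrite /t mulrC divfK// gt_eqF.
have lam_ge0 i : 0 <= lam i by exact: ltW.
have A0 : 0 <= A by exact: le_trans ler01 Aconst_ge1.
have M1 : 1 <= A `^ mx.
  by rewrite -[leLHS](congr1 (@^~ mx) (powR1 R)) ge0_ler_powR ?nnegrE
    ?A0 ?(le_trans ler01 max_exp_ge1) ?Aconst_ge1.
have [g [mg g0 gB hg]] := weighted_bound hBB r1 m0 rp hP pwt pwd dual hA sparse_exp_ge0
  sparse_exp_entry sparse_exp_target sj1 s1 tau_sj tau_s mc0 M1 Km1
  (fun i it => mom None it) (fun i it => mom (Some i) it) hKm mwe (ae_target p ww)
  (fun i => measurable_dual r p ww i) (fun i => ae_dual r p ww i) finN finW mh h0 G0 hG mt t0 t_exp C1_ge0 C2_ge0 Wk0 subT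
  mesT wkT T1 T2 fh lam_ge0 bt Lslope Loffset.
set wc := weighted_const _ _ _ _ _ _ _ _ _ _ _ _ _ _ _ _ _ _ _ _ _ in gB.
have oc0 : 0 <= osc_product.
  by apply: prodr_ge0 => i it; apply: fine_ge0; have /andP[/ltW] := osc_pos it.
have tf0 : 0 <= target_factor mu BB P s (prod_weight p w).
  by rewrite /target_factor; case: ifP => _; rewrite ?powR_ge0.
have ef0 i : 0 <= entry_factor mu BB r p sj (sigma r p w) i by exact: powR_ge0.
have big0 : 0 <= @big R C0 m ^+ m by rewrite exprn_ge0// (le_trans ler01)// (big_ge1 hBB m0).
have con0 : 0 <= @local_const R C0 m r by apply: le_trans big0 _; case: (local_const_ge hBB r m0).
have spc0 : 0 <= sparse_const C0 r P k p tau s mc.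
  rewrite !mulr_ge0 ?powR_ge0 ?exprn_ge0//.
  by rewrite /osc_const; case: ifP => _; rewrite ?powR_ge0// mulr_ge0// addr_ge0// mulr_ge0.
have C0p := C0_ge0 hBB.
have Ap : A `^ (N.+1%:R * mx) = A `^ (r^-1 + k) * (A `^ mx) ^+ N.
  have -> : r^-1 + k = mx by rewrite /k; ring.
  rewrite -powR_mulrn ?powR_ge0// -powRrM -powRD; last first.
    by rewrite (gt_eqF (lt_le_trans ltr01 Aconst_ge1)) implybT.
  by congr (_ `^ _); rewrite -natr1; ring.
have wcE : wc = (@local_const R C0 m r * (C0 ^+ m * 2 ^+ N * 2 ^+ N) *
    (sparse_const C0 r P k p tau s mc * Km ^+ N)) * ((C1 + C2 + Wk) * osc_product *
    A `^ (N.+1%:R * mx) * (\prod_i entry_factor mu BB r p sj (sigma r p w) i *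
      target_factor mu BB P s (prod_weight p w)) * \prod_i G i).
  rewrite /wc /weighted_const /operator_const Ap exprMn big_split/=.
  have -> : \prod_(i in tau) lam i = 2 ^+ N * osc_product.
    rewrite /osc_product -prodr_const -big_split/=; apply: eq_bigr => i it.
    by rewrite /lam it.
  by rewrite -/N; ring.
have YE : maximal_factors = (\prod_i entry_factor mu BB r p sj (sigma r p w) i *
      target_factor mu BB P s (prod_weight p w))%:E.
  rewrite EFinM -prodEFin /maximal_factors; congr (_ * _)%E.
    apply: eq_bigr => i _; rewrite /entry_factor -poweR_EFin fineK//.
    rewrite ge0_fin_numE//; exact: opnorm_ge0.
  rewrite /target_factor; case: ifP => // P1; rewrite -poweR_EFin fineK//.
  by rewrite ge0_fin_numE ?finW//; exact: opnorm_ge0.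
have GP : (\prod_(i < m) wLnorm mu (w i) (p i) (EFin \o f i) = (\prod_i G i)%:E)%E.
  by rewrite -prodEFin; apply: eq_bigr => i _.
have Xge0 : 0 <= (C1 + C2 + Wk) * osc_product *
    A `^ (N.+1%:R * mx) * (\prod_i entry_factor mu BB r p sj (sigma r p w) i *
      target_factor mu BB P s (prod_weight p w)) * \prod_i G i.
  have pe0 : 0 <= \prod_i entry_factor mu BB r p sj (sigma r p w) i by exact: prodr_ge0.
  have pG0 : 0 <= \prod_i G i by exact: prodr_ge0.
  by rewrite !mulr_ge0 ?powR_ge0// !addr_ge0// ltW.
have Km0 : 0 <= Km by exact: le_trans ler01 Km1.
have c_ge0 : 0 <= @local_const R C0 m r * (C0 ^+ m * 2 ^+ N * 2 ^+ N) *
    (sparse_const C0 r P k p tau s mc * Km ^+ N).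
  apply: mulr_ge0; apply: mulr_ge0 => //; last exact: exprn_ge0.
  by rewrite !mulr_ge0 ?exprn_ge0.
have wc_ge0 : 0 <= wc by rewrite wcE; exact: mulr_ge0.
apply: (@le_trans _ _ wc%:E); last first.
  rewrite YE GP -!EFinM lee_fin wcE /space_const.
  set c := _ * (sparse_const _ _ _ _ _ _ _ _ * _).
  set X := (C1 + C2 + Wk) * _ * _ * _ * _ in Xge0 *.
  apply: (@le_trans _ _ ((c + 1) * X)); first by rewrite ler_wpM2r// lerDl.
  by rewrite le_eqVlt; apply/orP; left; apply/eqP; rewrite /X; ring.
have -> : wc%:E = ((wc `^ P)%:E `^ P^-1)%E.
  by rewrite poweR_EFin -powRrM divff ?gt_eqF// powRr1.
rewrite /wLnorm -/P; apply: gt0_ler_poweR.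
- by rewrite invr_ge0 ltW.
- rewrite in_itv/= leey andbT; apply: integral_ge0 => x _.
  by rewrite mule_ge0 ?poweR_ge0// prode_ge0// => i _; exact: poweR_ge0.
- by rewrite in_itv/= lee_fin powR_ge0 leey.
apply: le_trans gB; apply: integral_le_ae => //.
move: hg (ae_target p ww); apply: filterS2 => x hgx htx.
apply: le_trans hgx; rewrite htx abse_EFin poweR_EFin -EFinM lee_fin.
have La : LrT mu r (arg (fun x i => b i x) (slope tau f) (offset tau f b) x).
  exact: arg_LrT.
by rewrite /commutator comm_argE TT'.
Qed.

Lemma space_const_gt0 : 0 < space_const.
Proof.
rewrite ltr_wpDl//.
have big0 : 0 <= @big R C0 m ^+ m by rewrite exprn_ge0// (le_trans ler01)// (big_ge1 hBB m0).
have con0 : 0 <= @local_const R C0 m r by apply: le_trans big0 _; case: (local_const_ge hBB r m0).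
have spc0 : 0 <= sparse_const C0 r P k p tau s mc.
  rewrite !mulr_ge0 ?powR_ge0 ?exprn_ge0//.
  by rewrite /osc_const; case: ifP => _; rewrite ?powR_ge0// mulr_ge0// addr_ge0// mulr_ge0.
have C0p := C0_ge0 hBB.
have Km0 : 0 <= Km by exact: le_trans ler01 Km1.
apply: mulr_ge0; apply: mulr_ge0 => //; last exact: exprn_ge0.
by rewrite !mulr_ge0 ?exprn_ge0.
Qed.

(** If a maximal operator is unbounded, then so is the right-hand side, because all its
    factors are positive. *)
Theorem commutator_wopnorm (D : set tuples) :
  (forall f, D f -> (forall i, wL mu (w i) (p i) (f i)) ->
    LrT mu r (slope tau f) /\ LrT mu r (offset tau f b)) ->
  (wopnorm mu D p w (commutator T b alpha) <=
    (space_const * (C1 + C2 + Wk) * osc_product * A `^ (N.+1%:R * mx))%:E * maximal_factors)%E.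
Proof.
move=> hD; have C_gt0 := space_const_gt0.
have CW : 0 < C1 + C2 + Wk by rewrite ltr_wpDl// addr_ge0.
have osc0 : 0 < osc_product.
  apply: prodr_gt0 => i it; have /andP[b0 bfin] := osc_pos it.
  by rewrite fine_gt0// b0.
have Ap0 : 0 < A `^ (N.+1%:R * mx) by rewrite powR_gt0// (lt_le_trans ltr01 Aconst_ge1).
set c := space_const * _ * _ * _; have c0 : 0 < c by rewrite !mulr_gt0.
have [Yfin|] := boolP (maximal_factors < +oo)%E; last first.
  rewrite -leNgt leye_eq => /eqP ->; rewrite gt0_muley ?lte_fin//.
  exact: leey.
have Y0 := maximal_factors_gt0.
have fY : maximal_factors \is a fin_num by rewrite ge0_fin_numE// ltW.
rewrite -(fineK fY) -EFinM; apply: ereal_inf_lbound; exists (c * fine maximal_factors) => //.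
split; first by rewrite mulr_ge0 ?(ltW c0)// fine_ge0// ltW.
move=> f [Df wf]; have [Ls Lo] := hD f Df wf.
by rewrite EFinM fineK//; exact: commutator_bound.
Qed.

End commutator_norm.

(** * Tuples on which a commutator is defined *)

Section degenerate_symbols.
Context {R : realType} {d : measure_display} {S : measurableType d}.
Variable mu : {measure set S -> \bar R}.
Context {m : nat}.
Local Notation tuples := ('I_m -> S -> R).
Variables (r : R) (b : tuples) (alpha : 'I_m -> nat) (tau : {set 'I_m}) (f : tuples).
Hypothesis r1 : 1 <= r.
Hypothesis alphaE : forall i, alpha i = (i \in tau).
Hypothesis Lcomm : {ae mu, forall x, LrT mu r (comm_arg b alpha f x)}.
Hypothesis muT : (0 < mu setT)%E.

Definition ae_constant i := exists c, {ae mu, forall x, b i x = c}.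

Lemma ae_inhabited (Q : S -> Prop) : {ae mu, forall x, Q x} -> exists x, Q x.
Proof.
move=> [Z [mZ Z0 sub]]; apply/not_existsP => nQ.
suff : (mu setT <= 0)%E by rewrite leNgt muT.
rewrite -Z0; apply: le_measure; rewrite ?inE// => x _; apply: sub => /= h.
exact: nQ h.
Qed.

Lemma entry_integrable i : i \notin tau -> f i \in Lfun mu r%:E.
Proof.
move=> it; have [x /(_ i)] := ae_inhabited Lcomm.
rewrite /comm_arg alphaE (negbTE it) (_ : (fun y => _) = f i)//.
by apply/funext => y; rewrite expr0 mul1r.
Qed.

(** Two points at which the symbol differs recover both the entry and its product with
    the symbol. *)
Lemma symbol_dichotomy i : i \in tau -> ae_constant i \/
  (f i \in Lfun mu r%:E /\ (fun y => b i y * f i y) \in Lfun mu r%:E).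
Proof.
move=> it; have [x0 Lx0] := ae_inhabited Lcomm.
have [[x [Lx ne]]|no] := pselect (exists x, LrT mu r (comm_arg b alpha f x) /\ b i x <> b i x0).
  right; have argE z y : comm_arg b alpha f z i y = (b i z - b i y) * f i y.
    by rewrite /comm_arg alphaE it expr1.
  have bx : b i x - b i x0 != 0 by rewrite subr_eq0; exact/eqP.
  have h1 := Lfun_scale1 r1 (-1) (Lx0 i).
  have [h2 _] := Lfun_scaleD r1 1 (Lx i) h1.
  have Lf : f i \in Lfun mu r%:E.
    have := Lfun_scale1 r1 (b i x - b i x0)^-1 h2; rewrite (_ : (fun y => _) = f i)//.
    by apply/funext => y; rewrite !argE; field.
  split=> //; have [h3 _] := Lfun_scaleD r1 (b i x0) Lf h1.
  rewrite (_ : (fun y => b i y * f i y) = fun y => b i x0 * f i y + -1 * comm_arg b alpha f x0 i y)//.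
  by apply/funext => y; rewrite argE; ring.
left; exists (b i x0); move: Lcomm; apply: filterS => x Lx.
by apply/eqP/negPn/negP => /eqP ne; apply: no; exists x.
Qed.

Variables (T : tuples -> S -> R) (V : normedModType R) (T' : tuples -> S -> V) (Wk : R).
Hypothesis subT : normsub mu r T'.
Hypothesis wT : weak_bounded mu r T.
Hypothesis TT' : forall f, LrT mu r f -> forall x, `|T f x| = `|T' f x|.
Hypothesis wkT : forall f (a : R), LrT mu r f -> 0 < a ->
  (a%:E * mu [set x | a < `|T' f x|]%R `^ (r / m%:R)^-1 <= (Wk * \prod_i nrm mu r (f i))%:E)%E.

Let r0 : 0 < r. Proof. exact: lt_le_trans ltr01 r1. Qed.

Let L0 : cst 0 \in Lfun mu r%:E.
Proof.
apply/LfunE; split=> //; rewrite (_ : EFin \o cst 0 = cst 0%E)//.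
by rewrite Lnorm0// ?lt0r_neq0// ltry.
Qed.

(** A constant symbol makes one entry zero for almost every point. The exceptional
    points form a null set, but the argument of the operator varies with the point;
    expanding in the entries leaves finitely many fixed tuples with an entry that is
    zero almost everywhere. *)
Lemma constant_symbol i0 : i0 \in tau -> ae_constant i0 ->
  {ae mu, forall x, commutator T b alpha f x = 0}.
Proof.
move=> i0t c0.
have /choice[uv huv] i : exists uv : (S -> R) * (S -> R), [/\ uv.1 \in Lfun mu r%:E,
    uv.2 \in Lfun mu r%:E,
    {ae mu, forall x y, comm_arg b alpha f x i y = b i x * uv.1 y + uv.2 y} &
    i = i0 -> {ae mu, forall y, uv.1 y = 0} /\ {ae mu, forall y, uv.2 y = 0}].
  have [it|it] := boolP (i \in tau); last first.
    exists (cst 0, f i); split=> //=; first exact: entry_integrable.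
      apply: aeW => x y; rewrite /comm_arg alphaE (negbTE it) expr0; ring.
    by move=> ii0; move: it; rewrite ii0 i0t.
  have [[c hc]|nc] := pselect (ae_constant i).
    exists (cst 0, fun y => (c - b i y) * f i y); split=> //=.
    - have [x [Lx bx]] := ae_inhabited (filterI Lcomm hc).
      have := Lx i; rewrite (_ : comm_arg b alpha f x i = fun y => (c - b i y) * f i y)//.
      by apply/funext => y; rewrite /comm_arg alphaE it expr1 bx.
    - move: hc; apply: filterS => x bx y; rewrite /comm_arg alphaE it expr1 bx; ring.
    - move=> _; split; first exact: aeW.
      by move: hc; apply: filterS => y ->; rewrite subrr mul0r.
  have [//|[Lf Lbf]] := symbol_dichotomy it.
  exists (f i, fun y => -1 * (b i y * f i y)); split=> //=.
  - exact: Lfun_scale1.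
  - apply: aeW => x y; rewrite /comm_arg alphaE it expr1; ring.
  - by move=> ii0; case: nc; rewrite ii0.
pose u i := (uv i).1; pose v i := (uv i).2.
have Lu : LrT mu r u by move=> i; case: (huv i).
have Lv : LrT mu r v by move=> i; case: (huv i).
have zero : {ae mu, forall x, forall e : {ffun 'I_m -> bool},
    T' (fun i => if e i then u i else v i) x = 0}.
  apply: filter_forall => e; apply: (null_entry r1 wT TT' (i0 := i0) wkT).
    by move=> i; case: (e i).
  have [_ _ _ /(_ erefl)[h1 h2]] := huv i0.
  by case: (e i0).
have args : {ae mu, forall x, forall i, forall y, comm_arg b alpha f x i y = b i x * u i y + v i y}.
  by apply: filter_forall => i; case: (huv i).
move: zero args Lcomm; apply: filterS3 => x z a Lx.
apply/normr0_eq0/eqP; rewrite eq_le normr_ge0 andbT /commutator TT'//.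
have -> : comm_arg b alpha f x = fun i y => b i x * u i y + v i y.
  by apply/funext => i; apply/funext => y; exact: a.
apply: le_trans (sublinear_product r1 subT (b ^~ x) (U := cst 0) (W := cst 0) (K := 0) Lu Lv _ _ _) _ => //.
- by move=> e; rewrite z normr0 mul0r.
- by rewrite mul0r.
Qed.

End degenerate_symbols.

(** * The two bounds *)

Lemma poweR_ge1 {R : realType} (x : \bar R) (a : R) : 0 <= a -> (1 <= x)%E -> (1 <= x `^ a)%E.
Proof.
move=> a0; case: x => [x| |] //.
  rewrite !lee_fin => x1; rewrite -[leLHS](congr1 (@^~ a) (powR1 R)).
  by rewrite ge0_ler_powR ?nnegrE// (le_trans ler01).
by rewrite /=; case: ifP => // _; rewrite leey.
Qed.

Section main.
Context {R : realType} {d : measure_display} {S : measurableType d}.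
Variable mu : {measure set S -> \bar R}.
Variables (BB : set (set S)) (star : set S -> set S) (C0 : R).
Hypothesis hBB : ball_basis mu BB star C0.
Context {m : nat}.
Hypothesis m0 : (0 < m)%N.
Variables (r : R) (p : 'I_m -> R).
Hypothesis (r1 : 1 <= r) (rp : forall i, r < p i).
Let q i : R := p i / r.

Let r0 : 0 < r. Proof. exact: lt_le_trans ltr01 r1. Qed.
Let p0 i : 0 < p i. Proof. exact: lt_trans (rp i). Qed.
Let P0 : 0 < hexp p. Proof. exact: (hexp_gt0 m0 r1 rp). Qed.
Let cs0 : 1 < hexp p -> 0 < conj_exp (hexp p).
Proof. by move=> P1; rewrite divr_gt0// subr_gt0. Qed.

Lemma N1_ge0 w : (0 <= N1 mu BB r p w)%E.
Proof.
rewrite mule_ge0 ?prode_ge0//; first by move=> i _; exact: poweR_ge0.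
by case: ifP => // _; exact: opnorm_ge0.
Qed.

Lemma N2_ge0 t2 s sj w : (0 <= N2 mu BB t2 s sj r p w)%E.
Proof.
rewrite mule_ge0 ?prode_ge0//; first by move=> i _; exact: poweR_ge0.
by case: ifP => // _; exact: poweR_ge0.
Qed.

Section without_balls.
Hypothesis noB : BB = set0.

Lemma Avec_const_no_balls w (a : R) : a != 0 -> (Avec_const mu BB q w `^ a = 0)%E.
Proof. by move=> a0; rewrite /Avec_const noB image_set0 ereal_sup0 /= (negbTE a0). Qed.

(** Any two points lie in a ball, so without balls there are no points. *)
Lemma wopnorm_no_balls D w U : (wopnorm mu D p w U <= 0)%E.
Proof.
have eS (x : S) : False by have [B []] := ball_pair hBB x x; rewrite noB.
apply: ereal_inf_lbound; exists 0 => //; split=> // f _; rewrite mul0e.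
rewrite /wLnorm (_ : (fun x => _) = cst 0%E); last by apply/funext => x; case: (eS x).
by rewrite integral0 poweR_EFin powR0// invr_eq0 gt_eqF.
Qed.

End without_balls.

Variables (w : 'I_m -> S -> \bar R).
Hypothesis hw : Avec mu BB q w.
Variable B1 : set S.
Hypothesis bB1 : BB B1.

Lemma maximal_factors_N1 : maximal_factors mu BB r p w (fun=> 1) 1 = N1 mu BB r p w.
Proof.
rewrite /maximal_factors /N1; congr (_ * _)%E.
  by apply: eq_bigr => i _; rewrite mulr1.
case: ifP => // _; rewrite divr1 invr1 poweRe1//; exact: opnorm_ge0.
Qed.

(** All the maximal operators have norm at least one, so each factor can be replaced by
    the product of its two versions. *)
Lemma maximal_factors_le (tau : {set 'I_m}) s sj :
  (1 < hexp p -> 1 < s < conj_exp (hexp p)) -> (forall j, 1 < sj j < p j / r) ->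
  (maximal_factors mu BB r p w (fun i => if i \in tau then sj i else 1%R)
     (if tau == finset.set0 then 1%R else s) <= N1 mu BB r p w * N2 mu BB tau s sj r p w)%E.
Proof.
move=> hs hsj; have sj0 i : 0 < sj i by have /andP[/(lt_trans ltr01)] := hsj i.
have E1 i : (1 <= wmaximal_norm mu BB (sigma r p w i) (p i / r) `^ r^-1)%E.
  apply: poweR_ge1; first by rewrite invr_ge0 ltW.
  by apply: (entry_norm_ge1 hBB m0 r1 rp hw bB1); rewrite divr_gt0.
have E2 i : (1 <= wmaximal_norm mu BB (sigma r p w i) (p i / (r * sj i)) `^ (r * sj i)^-1)%E.
  have rs : 0 < r * sj i by rewrite mulr_gt0.
  apply: poweR_ge1; first by rewrite invr_ge0 ltW.
  by apply: (entry_norm_ge1 hBB m0 r1 rp hw bB1); rewrite divr_gt0.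
have ge0 (x : \bar R) : (1 <= x)%E -> (0 <= x)%E by apply: le_trans; exact: lee01.
have leMl (x y : \bar R) : (1 <= x)%E -> (1 <= y)%E -> (y <= x * y)%E.
  by move=> x1 y1; rewrite -{1}(mul1e y) lee_wpmul2r// ge0.
rewrite /N1 /N2 muleACA; apply: lee_pmul.
- by apply: prode_ge0 => i _; exact: poweR_ge0.
- by case: ifP => // _; exact: poweR_ge0.
- rewrite [X in (_ * X)%E]big_mkcond/= -big_split/=; apply: le_prode => i.
    exact: poweR_ge0.
  by case: ifP => _; rewrite ?mulr1 ?mule1//; exact: leMl.
- case: (boolP (1 < hexp p)) => P1; last by rewrite mule1.
  have /andP[s1 s2] := hs P1; have s0 : 0 < s := lt_trans ltr01 s1.
  have W1 : (1 <= wmaximal_norm mu BB (prod_weight p w) (conj_exp (hexp p)))%E.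
    by apply: (target_norm_ge1 hBB m0 r1 rp hw bB1); exact: cs0.
  have W2 : (1 <= wmaximal_norm mu BB (prod_weight p w) (conj_exp (hexp p) / s) `^ s^-1)%E.
    apply: poweR_ge1; first by rewrite invr_ge0 ltW.
    by apply: (target_norm_ge1 hBB m0 r1 rp hw bB1); rewrite divr_gt0// cs0.
  case: ifP => _; last exact: leMl.
  by rewrite divr1 invr1 poweRe1 ?ge0// muleC; exact: leMl.
Qed.

End main.

Theorem theorem1p8 (R : realType) (d : measure_display) (S : measurableType d)
    (mu : {measure set S -> \bar R}) (BB : set (set S))
    (star : set S -> set S) (C0 : R) (hBB : ball_basis mu BB star C0)
    (m : nat) (hm : (0 < m)%N) (r : R) (hr : 1 <= r)
    (p : 'I_m -> R) (hp : forall i, r < p i) :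
  let q : 'I_m -> R := fun i => p i / r in
  let mx : R := \big[Num.max/hexp p]_(i < m) conj_exp (q i) in
  (exists2 C : R, 0 < C &
     forall (V : completeNormedModType R) (T : ('I_m -> S -> R) -> S -> R)
       (C1 C2 : R) (w : 'I_m -> S -> \bar R),
       bounded_oscillation mu BB star r V T C1 C2 ->
       weak_bounded mu r T ->
       Avec mu BB q w ->
       (T_norm mu r p w T
          <= C%:E * ((C1 + C2)%:E + weak_opnorm mu r T)
             * N1 mu BB r p w * Avec_const mu BB q w `^ mx)%E)
  /\
  (sharp_reverse_Holder mu BB ->
   forall alpha : 'I_m -> nat, (forall i, (alpha i <= 1)%N) ->
   forall (s : R) (sj : 'I_m -> R),
     (1 < hexp p -> 1 < s < conj_exp (hexp p)) ->
     (forall j, 1 < sj j < p j / r) ->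
   exists2 C : R, 0 < C &
     forall (V : completeNormedModType R) (T : ('I_m -> S -> R) -> S -> R)
       (C1 C2 : R) (w : 'I_m -> S -> \bar R) (b : 'I_m -> S -> R),
       bounded_oscillation mu BB star r V T C1 C2 ->
       weak_bounded mu r T ->
       Avec mu BB q w ->
       (forall i, measurable_fun setT (b i)) ->
       (comm_norm mu r p w T b alpha
          <= C%:E * ((C1 + C2)%:E + weak_opnorm mu r T) * N1 mu BB r p w
             * \sum_(t2 : {set 'I_m} | t2 \subset supp alpha)
                 (N2 mu BB t2 s sj r p w
                  * \prod_(i in supp alpha) osc_expL mu BB (b i)
                  * Avec_const mu BB q w `^ (#|supp alpha|.+1%:R * mx)))%E).
Proof.
move=> q mx; have mx1 : 1 <= mx := max_exp_ge1 hm hr hp.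
have mx0 : 0 < mx := lt_le_trans ltr01 mx1.
have r0 : 0 < r := lt_le_trans ltr01 hr.
have pr i : 1 < p i / r by rewrite ltr_pdivlMr// mul1r.
have conj_gt1 : 1 < hexp p -> 1 < conj_exp (hexp p).
  by move=> P1; rewrite /conj_exp ltr_pdivlMr ?subr_gt0// mul1r gtrBl.
(* Without balls the supremum in the definition of the constant of the vector weight is
   not positive, but the space is empty. *)
have [[B1 bB1]|/set0P/negP/negPn/eqP noB] := pselect (BB !=set0); last first.
  split; first exists 1 => // V T C1 C2 w _ _ _.
    apply: (le_trans (wopnorm_no_balls hBB hm hr hp noB _ _ _)).
    by rewrite Avec_const_no_balls ?mule0// gt_eqF.
  move=> _ alpha _ s sj _ _; exists 1 => // V T C1 C2 w b _ _ _ _.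
  apply: (le_trans (wopnorm_no_balls hBB hm hr hp noB _ _ _)).
  rewrite big1 ?mule0// => t2 _.
  by rewrite Avec_const_no_balls ?mule0// gt_eqF// mulr_gt0.
have muT : (0 < mu setT)%E.
  apply: (@lt_le_trans _ _ (mu B1)); first by have /andP[] := ball_measure hBB bB1.
  by apply: le_measure; rewrite ?inE//; exact: (ball_measurable hBB).
(* The weak norm of the operator may be zero, and the sparse domination needs a positive
   bound: [C1] is added to it, and the factor two accounts for that. *)
have real_bound (K Cs W0 O a : R) (Y : \bar R) : 0 <= K -> 0 <= Cs -> 0 <= W0 -> 0 <= O ->
    0 <= a -> (0 <= Y)%E -> forall C1, 0 <= C1 -> C1 <= Cs ->
    ((K * (Cs + (W0 + C1)) * O * a)%:E * Y <=
      (2 * K)%:E * (Cs%:E + W0%:E) * (Y * (O%:E * a%:E)))%E.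
  move=> K0 Cs0 W00 O0 a0 Y0 C1 C10 C1s.
  have -> : ((2 * K)%:E * (Cs%:E + W0%:E) * (Y * (O%:E * a%:E)) =
     (2 * K * (Cs + W0) * (O * a))%:E * Y)%E.
    by rewrite -EFinD -!EFinM [(Y * _)%E]muleC muleA -EFinM; congr (_%:E * _)%E; ring.
  rewrite lee_wpmul2r// lee_fin.
  have -> : K * (Cs + (W0 + C1)) * O * a = (Cs + (W0 + C1)) * (K * O * a) by ring.
  have -> : 2 * K * (Cs + W0) * (O * a) = 2 * (Cs + W0) * (K * O * a) by ring.
  rewrite ler_wpM2r ?mulr_ge0//; lra.
split.
  exists (2 * space_const C0 r p finset.set0 1 (fun _ _ => 0) 1).
    by rewrite mulr_gt0// (space_const_gt0 hBB hm).
  move=> V T C1 C2 w hT wT hw; have [C1p C2p _] := hT.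
  have [V' [T' [subT TT' o1 o2]]] := oscillation_realization hT.
  pose W0 := fine (weak_opnorm mu r T).
  have W0_ge0 : 0 <= W0 by apply: fine_ge0; exact: opnorm_ge0.
  have WE : weak_opnorm mu r T = W0%:E.
    by rewrite fineK// ge0_fin_numE ?opnorm_ge0//; case: wT.
  have Wk0 : 0 < W0 + C1 by rewrite ltr_wpDl.
  have AE := AconstE hBB hm hr hp hw bB1.
  have A1 := Aconst_ge1 hBB hm hr hp hw bB1.
  have mom0 (i : 'I_m) (j : option 'I_m) : i \in (finset.set0 : {set 'I_m}) -> moments mu BB star
    (fun _ _ => 0) (Aconst mu BB r p w `^ max_exp r p) (dual_fun (wtarget p w) (wdual r p w) j).
    by rewrite inE.
  have sj1 (i : 'I_m) : 1 <= (1 : R) <= p i / r by rewrite lexx ltW.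
  have s1 : 1 < hexp p -> 1 <= (1 : R) < conj_exp (hexp p).
    by move=> P1; rewrite lexx conj_gt1.
  (* The operator is its own commutator for the exponent [alpha = 0]. *)
  have core := commutator_wopnorm hBB hm hr hp hw bB1 (ltW C1p) (ltW C2p) Wk0 subT TT'
    (realization_measurable wT TT') (fun f a Lf a0 => realization_weak wT TT' (ltW C1p) Lf a0)
    o1 o2 (tau := finset.set0) (sj := fun=> 1) (s := 1) (mc := fun _ _ => 0) (Km := 1) sj1 s1 _ _
    (fun _ _ => lexx _) (lexx _) mom0 _ (b := fun=> cst 0) (alpha := fun=> 0%N) _ _ _
    (D := LrT mu r) _.
  have commE : commutator T (fun=> cst 0) (fun=> 0%N) = T.
    apply/funext => f; apply/funext => x; rewrite /commutator; congr (T _ x).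
    by apply/funext => i; apply/funext => y; rewrite /comm_arg expr0 mul1r.
  rewrite commE in core; apply: (le_trans (core _ _ _ _ _ _ _)).
  - by move=> i; rewrite inE.
  - by move=> i; rewrite inE.
  - by move=> i; rewrite inE.
  - by move=> i.
  - by move=> i; rewrite inE.
  - by move=> i; rewrite inE.
  - move=> f Lf _; split=> i.
      have := Lfun_scale1 hr 0 (Lf i); rewrite (_ : (fun x => _) = slope finset.set0 f i)//.
      by apply/funext => x; rewrite /slope inE mul0r.
    rewrite (_ : offset _ _ _ i = f i)//.
    by apply/funext => x; rewrite /offset inE.
  rewrite maximal_factors_N1 /osc_product big_set0 cards0 mul1r.
  rewrite AE WE poweR_EFin -muleA.
  have := real_bound (space_const C0 r p finset.set0 1 (fun _ _ => 0) 1) (C1 + C2) W0 1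
    (Aconst mu BB r p w `^ mx) (N1 mu BB r p w).
  rewrite !mul1e; apply => //.
  - by rewrite ltW// (space_const_gt0 hBB hm).
  - by rewrite addr_ge0 ?ltW.
  - exact: powR_ge0.
  - exact: N1_ge0.
  - exact: ltW.
  - by rewrite lerDl ltW.
move=> [c0 c00 RH] alpha alpha1 s sj hs hsj.
pose tau := supp alpha.
have [l0 [l01 reg]] := regular_balls hBB (ex_intro _ B1 bB1) c00 RH.
pose Kc := C0 ^+ 4 * l0.
pose mc := moment_const Kc (rate c0 Kc).
(* Maximal operators with a larger exponent are used for entries with a symbol only. *)
pose sjm i := if i \in tau then sj i else 1.
pose sm := if tau == finset.set0 then 1 else s.
pose Km := 1 + \sum_(i in tau) mc r (conj_exp (sjm i)) `^ r^-1.
have Kc0 : 0 < Kc by rewrite mulr_gt0 ?(C0X_gt0 hBB)// (lt_le_trans ltr01).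
have rt0 : 0 < rate c0 Kc := rate_gt0 hBB l01 c00 erefl.
have mc0 a a' : 0 <= mc a a' by rewrite mulr_ge0 ?powR_ge0.
have Km1 : 1 <= Km by rewrite lerDl; apply: sumr_ge0 => i _; exact: powR_ge0.
have hKm i : i \in tau -> mc r (conj_exp (sjm i)) `^ r^-1 <= Km.
  move=> it; rewrite /Km (bigD1 i)//=.
  have : 0 <= \sum_(j in tau | j != i) mc r (conj_exp (sjm j)) `^ r^-1.
    by apply: sumr_ge0 => j _; exact: powR_ge0.
  lra.
have sjm1 i : 1 <= sjm i <= p i / r.
  rewrite /sjm; case: ifP => _; last by rewrite lexx ltW.
  by have /andP[/ltW -> /ltW ->] := hsj i.
have sm1 : 1 < hexp p -> 1 <= sm < conj_exp (hexp p).
  move=> P1; rewrite /sm; case: ifP => _; first by rewrite lexx conj_gt1.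
  by have /andP[/ltW -> ->] := hs P1.
have tau_sj i : i \in tau -> 1 < sjm i.
  by move=> it; rewrite /sjm it; have /andP[] := hsj i.
have tau_s i : i \in tau -> 1 < hexp p -> 1 < sm.
  move=> it P1; rewrite /sm; case: eqP => [t0|_]; first by rewrite t0 inE in it.
  by have /andP[] := hs P1.
have alphaE i : alpha i = (i \in tau).
  by rewrite inE; move: (alpha1 i); case: (alpha i) => [|[]].
exists (2 * space_const C0 r p tau sm mc Km).
  by rewrite mulr_gt0// (space_const_gt0 hBB hm).
move=> V T C1 C2 w b hT wT hw mb; have [C1p C2p _] := hT.
have [V' [T' [subT TT' o1 o2]]] := oscillation_realization hT.
pose W0 := fine (weak_opnorm mu r T).
have W0_ge0 : 0 <= W0 by apply: fine_ge0; exact: opnorm_ge0.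
have WE : weak_opnorm mu r T = W0%:E.
  by rewrite fineK// ge0_fin_numE ?opnorm_ge0//; case: wT.
have Wk0 : 0 < W0 + C1 by rewrite ltr_wpDl.
have AE := AconstE hBB hm hr hp hw bB1.
have A1 := Aconst_ge1 hBB hm hr hp hw bB1.
have weak := fun f a Lf a0 => realization_weak wT TT' (ltW C1p) (f := f) (a := a) Lf a0.
have sp0 : 0 < space_const C0 r p tau sm mc Km := space_const_gt0 hBB hm _ _ _ _ mc0 Km1.
set K := space_const _ _ _ _ _ _ _ in sp0 *.
have osc0 i : (0 <= osc_expL mu BB (b i))%E.
  apply: (@le_trans _ _ (expL_norm mu B1 (fun x => b i x - fine (avg mu B1 (EFin \o b i)))%R)).
    by apply: le_ereal_inf_tmp => _ [l [l_gt0 _] <-]; rewrite lee_fin ltW.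
  by apply: ereal_sup_ubound; exists B1.
have N10 := N1_ge0 mu BB r p w.
have prod_osc0 : (0 <= \prod_(i in tau) osc_expL mu BB (b i))%E.
  by apply: prode_ge0 => i _.
have term0 t2 : (0 <= N2 mu BB t2 s sj r p w * \prod_(i in tau) osc_expL mu BB (b i) *
    Avec_const mu BB q w `^ (#|tau|.+1%:R * mx))%E.
  apply: mule_ge0; last exact: poweR_ge0.
  by apply: mule_ge0 => //; exact: N2_ge0.
have CW0 : (0 <= (2 * K)%:E * ((C1 + C2)%:E + weak_opnorm mu r T))%E.
  have K2 : 0 <= 2 * K by apply: mulr_ge0 => //; exact: ltW.
  have C12 : 0 <= C1 + C2 + W0 by move: C1p C2p W0_ge0; lra.
  by rewrite WE -EFinD -EFinM lee_fin; exact: mulr_ge0.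
(* If a symbol is constant the left-hand side is zero. *)
have [[i [it ci]]|nconst] := pselect (exists i, i \in tau /\ ae_constant mu b i).
  apply: (@le_trans _ _ 0%E); last first.
    by rewrite mule_ge0 ?sume_ge0// mule_ge0.
  apply: ereal_inf_lbound; exists 0 => //; split=> // f [Lf _]; rewrite mul0e.
  have z := constant_symbol hr alphaE Lf muT subT wT TT' weak it ci.
  have P0 : 0 < hexp p := hexp_gt0 hm hr hp.
  have i0 : (\int[mu]_x (`|(EFin \o commutator T b alpha f) x| `^ hexp p *
      prod_weight p w x) <= 0)%E.
    rewrite -[leRHS](integral0 mu setT); apply: integral_le_ae => //.
    move: z; apply: filterS => x /= ->.
    by rewrite normr0 powR0 ?gt_eqF// mul0e.
  rewrite /wLnorm; set I := (\int[mu]_x _)%E in i0 *.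
  have -> : I = 0%E.
    apply/eqP; rewrite eq_le i0/=; apply: integral_ge0 => x _.
    by rewrite mule_ge0 ?poweR_ge0// prode_ge0// => j _; exact: poweR_ge0.
  by rewrite poweR_EFin powR0// invr_eq0 gt_eqF.
have osc_gt0 i : i \in tau -> (0 < osc_expL mu BB (b i))%E.
  move=> it; rewrite ltNge; apply/negP => le0; apply: nconst; exists i; split=> //.
  exact: (osc_zero_constant hBB (mb i) bB1 le0).
set RHS := (X in (_ <= X)%E).
(* The bound is by the term of the sum with [t2 = tau]; the other terms are not
   negative. *)
have RHS_ge : ((2 * K)%:E * ((C1 + C2)%:E + W0%:E) * (N1 mu BB r p w * N2 mu BB tau s sj r p w *
    (\prod_(i in tau) osc_expL mu BB (b i) * (Aconst mu BB r p w `^ (#|tau|.+1%:R * mx))%:E))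
    <= RHS)%E.
  rewrite /RHS (bigD1 tau)//= AE poweR_EFin -WE -[leRHS]muleA.
  apply: lee_wpmul2l => //; rewrite -[leLHS]muleA; apply: lee_wpmul2l => //.
  rewrite muleA leeDl// sume_ge0// => t2 _.
  by have := term0 t2; rewrite AE poweR_EFin.
apply: le_trans RHS_ge; have sjs := maximal_factors_le hBB hm hr hp hw bB1 tau hs hsj.
have Y0 : (0 < maximal_factors mu BB r p w sjm sm)%E.
  by apply: (maximal_factors_gt0 hBB hm hr hp hw bB1).
have NN0 : (0 < N1 mu BB r p w * N2 mu BB tau s sj r p w)%E by exact: lt_le_trans Y0 sjs.
have CW_gt0 : (0 < (2 * K)%:E * ((C1 + C2)%:E + W0%:E))%E.
  have K2 : 0 < 2 * K by exact: mulr_gt0.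
  have C12 : 0 < C1 + C2 + W0 by rewrite ltr_pwDl// addr_gt0.
  by rewrite -EFinD -EFinM lte_fin; exact: mulr_gt0.
have Ap0 : (0 < (Aconst mu BB r p w `^ (#|tau|.+1%:R * mx))%:E)%E.
  by rewrite lte_fin powR_gt0// (lt_le_trans ltr01).
(* If a symbol has infinite oscillation the right-hand side is infinite, as all other
   factors are positive. *)
have [osc_fin|/existsNP[i /not_implyP[it /negP]]] :=
  pselect (forall i, i \in tau -> (osc_expL mu BB (b i) < +oo)%E); last first.
  rewrite -leNgt leye_eq => /eqP oi.
  have -> : (\prod_(i in tau) osc_expL mu BB (b i) = +oo)%E.
    rewrite (bigD1 i)//= oi gt0_mulye//.
    apply: (big_ind (fun x => 0 < x)%E) => [|x y|j /andP[jt _]]; first by rewrite lte_fin.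
      exact: mule_gt0.
    exact: osc_gt0.
  by rewrite gt0_mulye// gt0_muley// gt0_muley// leey.
have osc_pos i : i \in tau -> (0 < osc_expL mu BB (b i) < +oo)%E.
  by move=> it; rewrite osc_gt0// osc_fin.
have OE : (\prod_(i in tau) osc_expL mu BB (b i) = (osc_product mu BB tau b)%:E)%E.
  rewrite /osc_product -prodEFin; apply: eq_bigr => i it.
  by rewrite fineK// ge0_fin_numE// osc_fin.
have mom i j : i \in tau -> moments mu BB star mc (Aconst mu BB r p w `^ max_exp r p)
    (dual_fun (wtarget p w) (wdual r p w) j).
  by move=> _; exact: (tuple_moments hBB hm hr hp hw bB1 j l01 c00 erefl reg RH).
have core := commutator_wopnorm hBB hm hr hp hw bB1 (ltW C1p) (ltW C2p) Wk0 subT TT'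
  (realization_measurable wT TT') weak o1 o2 sjm1 sm1 tau_sj tau_s mc0 Km1 mom hKm mb alphaE
  osc_pos (D := [set f | {ae mu, forall x, LrT mu r (comm_arg b alpha f x)}]) _.
apply: (le_trans (core _)).
  move=> f Lf _; split=> i; have [it|it] := boolP (i \in tau).
  - rewrite /slope it.
    by case: (symbol_dichotomy hr alphaE Lf muT it) => [ci|[]//]; case: nconst; exists i.
  - have := Lfun_scale1 hr 0 (entry_integrable alphaE Lf muT it).
    rewrite (_ : (fun x => _) = slope tau f i)//.
    by apply/funext => x; rewrite /slope (negbTE it) mul0r.
  - case: (symbol_dichotomy hr alphaE Lf muT it) => [ci|[_ Lbf]]; first by case: nconst; exists i.
    have := Lfun_scale1 hr (-1) Lbf; rewrite (_ : (fun x => _) = offset tau f b i)//.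
    by apply/funext => x; rewrite /offset it mulN1r.
  - rewrite (_ : offset tau f b i = f i); first exact: (entry_integrable alphaE Lf muT it).
    by apply/funext => x; rewrite /offset (negbTE it).
rewrite OE; apply: le_trans (lee_wpmul2l (ltW CW_gt0) (lee_wpmul2r _ sjs)); last first.
  rewrite -EFinM lee_fin mulr_ge0 ?powR_ge0//.
  by apply: prodr_ge0 => i it; exact: fine_ge0.
apply: (real_bound K (C1 + C2) W0 (osc_product mu BB tau b) _
  (maximal_factors mu BB r p w sjm sm)); rewrite ?(ltW sp0) ?(ltW Y0) ?powR_ge0//.
- by rewrite addr_ge0 ?ltW.
- by apply: prodr_ge0 => i it; exact: fine_ge0.
- exact: ltW.
- by rewrite lerDl ltW.
Qed.
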